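(* Let $K\subset\mathbb{R}^n$ be a symmetric convex body, $1<p<\infty$, and $\frac1p+\frac1{p'}=1$. (i) $T^p(K)$ is a dual space: it is the dual of the Banach space $U^{p'}(K)$ (with pairing $\langle f,g\rangle=\int_{\mathbb{R}^{n+1}_+}f(x,t)g(x,t)\,dx\,dt$, $f\in U^{p'}(K)$, $g\in T^p(K)$). (ii) $U^{p'}(K)$ consists of the functions $f\in L^{p'}_{\mathrm{loc}}(\mathbb{R}^{n+1}_+)$ admitting an atomic decomposition $$f=\sum_{i=1}^\infty\lambda_i f_i,\qquad \|f\|_{U^{p'}(K)}\simeq\sum_{i=1}^\infty|\lambda_i|,$$ $$f_i(x,t)=a_i(x,t)\int_{B(x,t)}g_i(y)\,dy,\qquad \|g_i\|_{L^1(\mathbb{R}^n)}=1,\qquad \|a_i\|_{L^{p'}(\mathbb{R}^{n+1}_+)}\le1,\qquad i\ge1,$$ where the convergence of the series is in the norm of $U^{p'}(K)$, and therefore in $L^{p'}_{\mathrm{loc}}(\mathbb{R}^{n+1}_+)$. (iii) The analogous decomposition holds for functions in $S^1_0(K)$, the predual of $T^1(K)$: every $f\in S_0^1(K)$ can be written as $f=\sum_{i=1}^\infty\lambda_i f_i$, with convergence in the norm of $S^1(K)$ and $\|f\|_{S^1(K)}\simeq\sum_{i=1}^\infty|\lambda_i|$, where $f_i(x,t)=a_i(x,t)\int_{B(x,t)}g_i(y)\,dy$, $\|g_i\|_{L^1(\mathbb{R}^n)}=1$, and $a_i\in C_c(\mathbb{R}^{n+1}_+)$ with $|a_i(x,t)|\le1$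 for all $(x,t)\in\mathbb{R}^{n+1}_+$.
   Context: A symmetric convex body $K\subset\mathbb{R}^n$ is a compact convex set with nonempty interior such that $-x\in K$ whenever $x\in K$; $\|\cdot\|_K$ is the norm whose closed unit ball is $K$. For $x\in\mathbb{R}^n$, $t>0$, $B(x,t)=\{y:\|y-x\|_K\le t\}$; such sets are called $K$-balls. $\mathbb{R}^{n+1}_+=\mathbb{R}^n\times(0,\infty)$ with Lebesgue measure $dx\,dt$. A point $(x,t)\in\mathbb{R}^{n+1}_+$ is identified with the $K$-ball $B=B(x,t)$, and $f_B=f(x,t)$. $C_c(\mathbb{R}^{n+1}_+)$ is the space of compactly supported continuous functions on $\mathbb{R}^{n+1}_+$. For $x\in\mathbb{R}^n$, $\Gamma_x=\{(y,t)\in\mathbb{R}^{n+1}_+:\|x-y\|_K\le t\}$. For $1<p<\infty$, $T^p(K)$ is the space of all locally integrable functions $g$ on $\mathbb{R}^{n+1}_+$ with $\|g\|_{T^p(K)}:=\|A_p(g)\|_{L^\infty(\mathbb{R}^n)}<\infty$, $A_p(g)(x):=\|g\|_{L^p(\Gamma_x)}$. $T^1(K)$ is the space of (signed) Radon measures $\mu$ on $\mathbb{R}^{n+1}_+$ with $\|\mu\|_{T^1(K)}:=\operatorname{ess\,sup}_{x\in\mathbb{R}^n}|\mu|(\Gamma_x)<\infty$. $V^{p'}(K)$ is the space of all $f\in L^{p'}_{\mathrm{loc}}(\mathbb{R}^{n+1}_+)$ with $$\|f\|_{V^{p'}(K)}:=\sup_{\|g\|_{T^p(K)}\le1}\int_{\mathbb{R}^{n+1}_+}|f(x,t)g(x,t)|\,dx\,dt<\infty,$$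 and $U^{p'}(K)$ is the closure of $C_c(\mathbb{R}^{n+1}_+)$ in $V^{p'}(K)$, with the norm inherited from $V^{p'}(K)$. $S^1(K)$ is the space of all continuous functions $f$ on $\mathbb{R}^{n+1}_+$ with $\|f\|_{S^1(K)}:=\sup_{\mathcal{C}}\sum_{B\in\mathcal{C}}|f_B|<\infty$, the supremum being over all finite collections $\mathcal{C}$ of pairwise disjoint $K$-balls; $S^1_0(K)$ is the closure of $C_c(\mathbb{R}^{n+1}_+)$ in $S^1(K)$. ''$\simeq$'' means equality up to multiplicative constants depending only on $n$. ''Is the dual of'' is understood with equivalent norms. *)

(* Defs.v *)
From HB Require Import structures.
From mathcomp Require Import all_boot all_order all_algebra finmap.
From mathcomp Require Import all_classical all_reals all_analysis ess_sup_inf.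

Set Implicit Arguments.
Unset Strict Implicit.
Unset Printing Implicit Defensive.
Import Order.TTheory GRing.Theory Num.Theory.
Import numFieldNormedType.Exports.
Local Open Scope classical_set_scope.
Local Open Scope ring_scope.

Section rV_measurable.
Context (R : realType) (n : nat).

Let coord (i : 'I_n) (x : 'rV[R]_n) : R := x ord0 i.

Let measurable_rV0 : g_sigma_preimage coord set0.
Proof. exact: sigma_algebra0. Qed.

Let measurable_rVC A : g_sigma_preimage coord A -> g_sigma_preimage coord (~` A).
Proof. exact: sigma_algebraC. Qed.

Let measurable_rV_bigcup (F : (set 'rV[R]_n)^nat) :
  (forall i, g_sigma_preimage coord (F i)) ->
  g_sigma_preimage coord (\bigcup_i (F i)).
Proof. exact: sigma_algebra_bigcup. Qed.

(* The product sigma-algebra, as for tuples in the library; since [R] is second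
   countable, it is the Borel sigma-algebra of the topology of ['rV[R]_n]. *)
HB.instance Definition _ := @isMeasurable.Build default_measure_display
  'rV[R]_n (g_sigma_preimage coord) measurable_rV0 measurable_rVC
  measurable_rV_bigcup.

End rV_measurable.

Lemma measurable_coord_rV (R : realType) n (i : 'I_n) :
  measurable_fun [set: 'rV[R]_n] (fun x : 'rV[R]_n => x ord0 i).
Proof.
move=> _ A mA; rewrite setTI; apply: sub_sigma_algebra.
rewrite -bigcup_seq/=; exists i => /=; first by rewrite mem_index_enum.
by exists A => //; rewrite setTI.
Qed.

Lemma measurable_fun_rV d (T : measurableType d) (R : realType) n
    (f : T -> 'rV[R]_n) :
  (forall i, measurable_fun [set: T] (fun z => f z ord0 i)) ->
  measurable_fun [set: T] f.
Proof.
move=> mf; apply: (@measurability _ _ T 'rV[R]_n setT f _ (erefl _)) => A [B].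
rewrite -bigcup_seq/= => -[i _ [C mC <-]] <-.
by rewrite !setTI; have := mf i measurableT C mC; rewrite setTI.
Qed.

Section lebesgue_measure_rV.
Local Open Scope ereal_scope.
Context (R : realType).

Definition rV_cons n (z : 'rV[R]_n * R) : 'rV[R]_n.+1 :=
  row_mx (const_mx z.2 : 'rV[R]_1) z.1.

Lemma measurable_rV_cons n : measurable_fun [set: 'rV[R]_n * R] (@rV_cons n).
Proof.
apply: measurable_fun_rV => i.
rewrite (_ : (fun z => _) = (fun z : 'rV[R]_n * R =>
  match fintype.split (i : 'I_(1 + n)) with inl _ => z.2 | inr j => z.1 ord0 j end)).
  case: fintype.split => [_|j]; first exact: measurable_snd.
  exact: (measurableT_comp (measurable_coord_rV j) measurable_fst).
by apply/funext => z; rewrite !mxE; case: fintype.split => // j; rewrite mxE.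
Qed.

Fixpoint lebesgue_measure_rV n : {measure set 'rV[R]_n -> \bar R} :=
  match n with
  | 0 => \d_(0%R : 'rV[R]_0)
  | m.+1 => measure_function_pushforward__canonical__measure_function_Measure
      (lebesgue_measure_rV m \x @lebesgue_measure R) (@measurable_rV_cons m)
  end.

Lemma lebesgue_measure_rVS n A : lebesgue_measure_rV n.+1 A =
  (lebesgue_measure_rV n \x @lebesgue_measure R) (@rV_cons n @^-1` A).
Proof. by []. Qed.

End lebesgue_measure_rV.

Section function_spaces.
Context (R : realType) (X Y : Type).
Implicit Types (E : set (X -> R)) (N : (X -> R) -> \bar R) (f h : X -> R).
Local Open Scope ereal_scope.

Definition equivalent_up_to (C : R) (a b : \bar R) :=
  C^-1%:E * a <= b /\ b <= C%:E * a.

Definition norm_closure E N (D : set (X -> R)) : set (X -> R) :=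
  [set f | E f /\
    forall e : R, (0 < e)%R -> exists2 h, D h & N (f \- h)%R < e%:E].

(* Elements of [E] are representatives; [null f] says that [f] represents the
   zero element of the quotient space normed by [N]. *)
Definition banach_space E N (null : (X -> R) -> Prop) :=
  [/\ [/\ E (cst 0%R),
          forall f h, E f -> E h -> E (f \+ h)%R
        & forall (c : R) f, E f -> E (c \*o f)%R],
      [/\ forall f, E f -> 0 <= N f < +oo,
          forall f, E f -> N f = 0 <-> null f,
          forall f h, E f -> E h -> N (f \+ h)%R <= N f + N h
        & forall (c : R) f, E f -> N (c \*o f)%R = `|c|%:E * N f]
    & forall u : (X -> R)^nat, (forall k, E (u k)) ->
        (forall e : R, (0 < e)%R -> exists k0, forall j k,
          (k0 <= j)%N -> (k0 <= k)%N -> N (u j \- u k)%R < e%:E) ->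
        exists2 f, E f & N (u k \- f)%R @[k --> \oo] --> 0].

Definition linear_on E (L : (X -> R) -> R) :=
  forall (c : R) f h, E f -> E h -> L ((c \*o f) \+ h)%R = (c * L f + L h)%R.

Definition bounded_on E N (L : (X -> R) -> R) :=
  exists c : R, forall f, E f -> `|L f|%:E <= c%:E * N f.

Definition dual_norm E N (L : (X -> R) -> R) : \bar R :=
  ereal_sup [set `|L f|%:E | f in [set f | E f /\ N f <= 1]].

(* [(G, M)] is the dual of [(E, N)] for the pairing [pair], with norms
   equivalent up to [C]; [eqG] is equality in [G], and [pairable f g] says that
   the integral defining [pair f g] converges absolutely. *)
Definition is_dual E N (G : set Y) (M : Y -> \bar R) (eqG : Y -> Y -> Prop)
    (pairable : (X -> R) -> Y -> Prop) (pair : (X -> R) -> Y -> R) (C : R) :=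
  [/\ forall f g, E f -> G g -> pairable f g,
      forall g, G g ->
        [/\ linear_on E (pair ^~ g), bounded_on E N (pair ^~ g)
          & equivalent_up_to C (M g) (dual_norm E N (pair ^~ g))],
      forall L, linear_on E L -> bounded_on E N L ->
        exists2 g, G g & forall f, E f -> L f = pair f g
    & forall g1 g2, G g1 -> G g2 ->
        (forall f, E f -> pair f g1 = pair f g2) <-> eqG g1 g2].

End function_spaces.

Section spaces.
Context (R : realType) (n : nat).
Local Notation H := ('rV[R]_n * R)%type.
Implicit Types (K : set 'rV[R]_n) (p q : R) (x y : 'rV[R]_n) (z : H).
Implicit Types (f g h a : H -> R).

Definition dx : {measure set 'rV[R]_n -> \bar R} := lebesgue_measure_rV R n.
(* [H] as a measurable space, on which [lebesgue_measure] is defined. *)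
Local Notation mH := ('rV[R]_n * measurableTypeR R)%type.
Definition dxdt : {measure set mH -> \bar R} := (dx \x @lebesgue_measure R)%E.

Definition symmetric_convex_body K :=
  [/\ compact K, convex_set (M := 'rV[R]_n) K, K^° !=set0
    & forall x, K x -> K (- x)].

(* The Minkowski functional of [K]. *)
Definition Knorm K x : R :=
  inf [set r : R | 0 < r /\ exists2 y, K y & x = r *: y].

Definition Kball K x (t : R) : set 'rV[R]_n := [set y | Knorm K (y - x) <= t].

Definition half_space : set H := [set z | 0 < z.2].

Definition cone K x : set H :=
  [set z | half_space z /\ Knorm K (x - z.1) <= z.2].

(* Functions on the half-space are total functions, whose values outside of
   [half_space] are irrelevant. *)
Definition Lp_norm_on p (D : set H) f : \bar R :=
  'N[dxdt]_(p%:E)[EFin \o (f \_ D)].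

Definition Lp_loc p : set (H -> R) :=
  [set f | measurable_fun half_space f /\
    forall Q, compact Q -> Q `<=` half_space -> (Lp_norm_on p Q f < +oo)%E].

Definition Cc : set (H -> R) :=
  [set f | {within half_space, continuous f} /\
    exists Q, [/\ compact Q, Q `<=` half_space &
      forall z, half_space z -> ~ Q z -> f z = 0]].

Definition null_ae f := {ae dxdt, forall z, half_space z -> f z = 0}.

Definition eq_ae f g := null_ae (f \- g).

Definition null_everywhere f := forall z, half_space z -> f z = 0.

Definition T_area K p g x : \bar R := Lp_norm_on p (cone K x) g.

Definition T_norm K p g : \bar R := ess_sup dx (T_area K p g).

Definition T_space K p : set (H -> R) :=
  [set g | Lp_loc 1 g /\ (T_norm K p g < +oo)%E].

(* In [V_norm], [V_space] and [U_space], [p] is the exponent of the space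
   [T_space K p] and [q] is its conjugate exponent. *)
Definition V_norm K p f : \bar R :=
  ereal_sup [set (\int[dxdt]_(z in half_space) `|f z * g z|%:E)%E |
    g in [set g | T_space K p g /\ (T_norm K p g <= 1)%E]].

Definition V_space K p q : set (H -> R) :=
  [set f | Lp_loc q f /\ (V_norm K p f < +oo)%E].

Definition U_space K p q : set (H -> R) :=
  norm_closure (V_space K p q) (V_norm K p) Cc.

Definition integral_pairing f g : R := \int[dxdt]_(z in half_space) (f z * g z).

Definition integral_pairable f g : Prop :=
  dxdt.-integrable half_space (EFin \o (f \* g)).

(* A signed Radon measure on the half-space, possibly of infinite total
   variation, given by its Jordan decomposition. *)
Record signed_radon := SignedRadon {
  radon_pos : {measure set mH -> \bar R};
  radon_neg : {measure set mH -> \bar R};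
  radon_pos_half_space : radon_pos (~` half_space) = 0%E;
  radon_neg_half_space : radon_neg (~` half_space) = 0%E;
  radon_pos_fin : forall Q, compact Q -> Q `<=` half_space ->
    (radon_pos Q < +oo)%E;
  radon_neg_fin : forall Q, compact Q -> Q `<=` half_space ->
    (radon_neg Q < +oo)%E;
  radon_singular : exists P : set H, [/\ measurable P,
    radon_pos (~` P) = 0%E & radon_neg P = 0%E]
}.

Implicit Types mu nu : signed_radon.

Definition total_variation mu (A : set H) : \bar R :=
  (radon_pos mu A + radon_neg mu A)%E.

Definition radon_eq mu nu := forall A, measurable A ->
  radon_pos mu A = radon_pos nu A /\ radon_neg mu A = radon_neg nu A.

Definition T1_norm K mu : \bar R :=
  ess_sup dx (fun x => total_variation mu (cone K x)).

Definition T1_space K : set signed_radon :=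
  [set mu | (T1_norm K mu < +oo)%E].

Definition radon_integrable f mu :=
  (radon_pos mu).-integrable half_space (EFin \o f) /\
  (radon_neg mu).-integrable half_space (EFin \o f).

Definition radon_pairing f mu : R :=
  \int[radon_pos mu]_(z in half_space) f z -
  \int[radon_neg mu]_(z in half_space) f z.

(* [(x, t)] stands for the ball [Kball K x t]. *)
Definition disjoint_balls K (C : {fset H}) :=
  [set` C] `<=` half_space /\ trivIset [set` C] (fun z => Kball K z.1 z.2).

Definition S1_norm K f : \bar R :=
  ereal_sup [set (\sum_(z <- C) `|f z|)%:E | C in [set C | disjoint_balls K C]].

Definition S1_space K : set (H -> R) :=
  [set f | {within half_space, continuous f} /\ (S1_norm K f < +oo)%E].

Definition S10_space K : set (H -> R) :=
  norm_closure (S1_space K) (S1_norm K) Cc.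

Definition unit_L1 (g : 'rV[R]_n -> R) :=
  measurable_fun [set: 'rV[R]_n] g /\ ('N[dx]_1[EFin \o g] = 1)%E.

Definition unit_ball_Lp q a :=
  measurable_fun half_space a /\ (Lp_norm_on q half_space a <= 1)%E.

Definition unit_ball_Cc a := Cc a /\ forall z, half_space z -> `|a z| <= 1.

Definition atom K a (g : 'rV[R]_n -> R) : H -> R :=
  fun z => a z * \int[dx]_(y in Kball K z.1 z.2) g y.

Definition atomic_sum K (lam : R^nat) (a : (H -> R)^nat)
    (g : ('rV[R]_n -> R)^nat) (k : nat) : H -> R :=
  fun z => \sum_(i < k) lam i * atom K (a i) (g i) z.

Definition abs_coef_sum (lam : R^nat) : \bar R := (\sum_(i <oo) `|lam i|%:E)%E.

Definition atomic_decomposition K (N : (H -> R) -> \bar R)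
    (coefficient : (H -> R) -> Prop) f (lam : R^nat) (a : (H -> R)^nat)
    (g : ('rV[R]_n -> R)^nat) :=
  [/\ forall i, coefficient (a i), forall i, unit_L1 (g i),
      (abs_coef_sum lam < +oo)%E
    & (N (f \- atomic_sum K lam a g k)%R @[k --> \oo] --> 0)%E].

Definition cvg_Lp_loc p (u : (H -> R)^nat) f :=
  forall Q, compact Q -> Q `<=` half_space ->
    (Lp_norm_on p Q (f \- u k)%R @[k --> \oo] --> 0)%E.

End spaces.

(* Main.v *)
Require Import Defs.
From HB Require Import structures.
From mathcomp Require Import all_boot all_order all_algebra finmap.
From mathcomp Require Import all_classical all_reals all_analysis ess_sup_inf measurable_realfun.
From mathcomp Require Import ring lra.
Import Order.TTheory GRing.Theory Num.Theory.
Import numFieldNormedType.Exports.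
Local Open Scope classical_set_scope.
Local Open Scope ring_scope.
Set Implicit Arguments.
Unset Strict Implicit.
Unset Printing Implicit Defensive.

(** Write [H_g z] for the integral of [g] over the ball [z]. A ball [z] belongs to the cone
    at [x] exactly when [x] belongs to [z], so that by Tonelli the integral of
    [g x * nu (cone K x)] over [x] is that of [H_g] for [nu]. Hence a bound on almost every
    cone is a bound on all the integrals of [H_g], for [g >= 0] of mass at most 1
    ([tent_le_ess_sup]). With Hoelder this shows that atoms have norm at most 1, in V
    ([V_norm_weight]); in S^1 it holds because disjoint balls carry disjoint parts of the mass
    of [g] ([S1_norm_weight]). Conversely, if [g] is the normalized indicator of the ball of
    center [x] and radius [r], then [H_g] is at least [2 ^- n] on the part of the cone at [x]
    above the height [r]; so the area function, or the mass of a cone, is recovered at every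
    point by testing against atoms ([T_area_le], [cone_mass_le]). The norm of T^p and T^1 is
    thus equivalent to the supremum of the pairings with atoms.

    A bounded functional on U is integration against a function: choose [w > 0] of the form
    [a * H_g]; the values of the functional at the functions [w] times an indicator form a
    finite charge, absolutely continuous for Lebesgue measure, and its Radon-Nikodym density
    divided by [w] is the function sought ([U_representation]).

    In S^1 the bound for the pairing with a measure [nu] is where the combinatorics of
    disjoint balls enters. After discretization, the local ratio method sorts the balls by
    radius and selects disjoint ones whose values of [f] carry a fixed part of the integral; the balls that meet a given one and are not smaller have bounded total mass,
    because all of them contribute to the average over one ball with four times its radius
    ([key_inequality]). A bounded functional on S^1_0 is split into its positive and negative
    parts on compactly supported functions, each of which is a measure by the construction of
    Riesz ([riesz_positive]); the two measures are mutually singular ([signed_representation])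
    and are bounded on cones by testing against atoms.

    The atomic decompositions are formal consequences. A functional that is at most 1 on atoms
    has norm at most a constant [c], so by Hahn-Banach the gauge of the atoms is at most [c]
    times the norm, up to an arbitrarily small error in norm; expanding the successive errors
    gives a series with coefficients of total size at most [2 c] times the norm
    ([atomic_expansion]). *)

(** * Borel sets of the half-space *)

(** The same product, once with its topology and once with its sigma-algebra: [R]
    and [measurableTypeR R] carry different structures. *)
Notation half R n := ('rV[R]_n * R)%type.
Notation mhalf R n := ('rV[R]_n * measurableTypeR R)%type.

Section sigma_algebra_of_coordinates.
Context (R : realType).

Lemma measurable_fun_rays d (T : measurableType d) (D : set T) (f : T -> R) :
  (forall c, measurable (D `&` [set x | c < f x])) -> measurable_fun D f.
Proof.
move=> mf; apply: (measurability _ (RGenOInfty.measurableE R)) => A [B].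
move=> [c ->] <-.
by rewrite (_ : _ @^-1` _ = [set x | c < f x])//; apply/seteqP; split => x/=;
  rewrite in_itv/= andbT.
Qed.

Context (n : nat).

(** Properties that define a sigma-algebra need only be checked on coordinate
    half-spaces. This serves for approximability by continuous functions and for
    Caratheodory measurability. *)
Lemma measurable_half_ind (D : set (set (mhalf R n))) :
  sigma_algebra setT D ->
  (forall i c, D [set z : mhalf R n | c < z.1 ord0 i]) ->
  (forall c, D [set z : mhalf R n | c < z.2]) ->
  forall A, measurable A -> D A.
Proof.
move=> sD D1 D2 A mA.
have mid : measurable_fun [set: g_sigma_algebraType D]
    (fun z : mhalf R n => (z.1, z.2)).
  apply: measurable_fun_pair.
    apply: measurable_fun_rV => i; apply: measurable_fun_rays => c; rewrite setTI.
    by apply: sub_sigma_algebra; exact: D1.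
  apply: measurable_fun_rays => c; rewrite setTI; by apply: sub_sigma_algebra; exact: D2.
have := mid measurableT A mA; rewrite setTI.
rewrite (_ : _ @^-1` _ = A); last by apply/seteqP; split => -[].
by rewrite /measurable/= sigma_algebra_id.
Qed.

Lemma bigcup_count_measurable d (T : measurableType d) (I : countType)
    (F : I -> set T) : (forall i, measurable (F i)) ->
  measurable (\bigcup_i F i).
Proof.
move=> mF; pose G k := if @choice.unpickle I k is Some i then F i else set0.
rewrite (_ : \bigcup_i F i = \bigcup_k G k).
  apply: bigcup_measurable => k _; rewrite /G; case: choice.unpickle => //.
apply/seteqP; split => [x [i _ Fi]|x [k _]].
  by exists (choice.pickle i) => //; rewrite /G choice.pickleK.
by rewrite /G; case: choice.unpickle => // i Fi; exists i.
Qed.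

(** An open set is the countable union of the rational boxes that it contains. *)
Lemma open_measurable_half (U : set (half R n)) : open U ->
  measurable (U : set (mhalf R n)).
Proof.
move=> oU.
pose box (q : 'rV[rat]_n * rat * nat) : set (mhalf R n) :=
  [set z : mhalf R n | (forall i, `|ratr (q.1.1 ord0 i) - z.1 ord0 i| < q.2.+1%:R^-1) /\
     `|ratr q.1.2 - z.2| < q.2.+1%:R^-1].
pose F q := if `[< box q `<=` U >] then box q else set0.
have -> : U = \bigcup_q F q.
  apply/seteqP; split => [z Uz|z [q _]]; last first.
    by rewrite /F; case: asboolP => // + bz; exact.
  have /nbhs_ballP[e /= e0 eU] : nbhs z U by exact: open_nbhs_nbhs.
  have [k ke] : exists k, (k.+1%:R)^-1 < e / 2.
    have [k _ /(_ _ (leqnn _)) ke] := near_infty_natSinv_lt (PosNum (divr_gt0 e0 (ltr0n _ 2))).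
    by exists k.
  have rr (x : R) : {q : rat | `|ratr q - x| < k.+1%:R^-1}.
    apply: cid.
    have k0 : 0 < k.+1%:R^-1 :> R by rewrite invr_gt0.
    have /rat_in_itvoo[q] : x - k.+1%:R^-1 < x + k.+1%:R^-1.
      by rewrite ltrBlDr -addrA ltrDl addr_gt0.
    by rewrite in_itv/= => xq; exists q; rewrite ltr_distl.
  pose q : 'rV[rat]_n * rat * nat :=
    (\row_i sval (rr (z.1 ord0 i)), sval (rr z.2), k).
  have bz : box q z.
    split => /= [i|]; first by rewrite mxE; exact: svalP (rr _).
    exact: svalP (rr _).
  exists q => //; rewrite /F; case: asboolP => // -[] y [by1 by2].
  apply: eU; case: bz => bz1 bz2.
  have E2 : k.+1%:R^-1 + k.+1%:R^-1 < e by rewrite (splitr e) ltrD.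
  have tri (a b c : R) : `|c - a| < k.+1%:R^-1 -> `|c - b| < k.+1%:R^-1 -> ball a e b.
    move=> ca cb; rewrite -ball_normE/=; apply: lt_trans E2.
    rewrite (_ : a - b = (c - b) - (c - a)); last by ring.
    by rewrite (le_lt_trans (ler_normB _ _))// ltrD.
  split=> /=; last exact: tri bz2 by2.
  split => // i j; rewrite (ord1 i); exact: tri (bz1 j) (by1 j).
apply: bigcup_count_measurable => q; rewrite /F; case: asboolP => // _.
rewrite (_ : box q = (\bigcap_(i in [set: 'I_n]) [set z : mhalf R n | `|ratr (q.1.1 ord0 i) - z.1 ord0 i| < q.2.+1%:R^-1])
  `&` [set z : mhalf R n | `|ratr q.1.2 - z.2| < q.2.+1%:R^-1]); last first.
  by apply/seteqP; split => [z [z1 z2]|z [z1 z2]]; split => // i; have := z1 i; exact.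
have mlt (f : mhalf R n -> R) (c r : R) : measurable_fun setT f ->
    measurable [set z : mhalf R n | `|c - f z| < r].
  move=> mf; have mg : measurable_fun setT (fun z => `|c - f z|).
    by apply: measurableT_comp => //; exact: measurable_funB.
  rewrite -[X in measurable X]setTI (_ : [set _ | _] =
    (fun z : mhalf R n => `|c - f z|) @^-1` `]-oo, r[%classic); first exact: mg.
  by apply/seteqP; split => x/=; rewrite in_itv/=.
apply: measurableI.
  apply: fin_bigcap_measurable => // i _; apply: mlt.
  apply: (measurableT_comp (measurable_coord_rV i) measurable_fst) => //.
apply: mlt; exact: measurable_snd.
Qed.

Lemma closed_measurable_half (U : set (half R n)) : closed U ->
  measurable (U : set (mhalf R n)).
Proof.
by move=> cU; rewrite -[U]setCK; apply: measurableC; apply: open_measurable_half; exact: closed_openC.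
Qed.

Lemma compact_measurable_half (U : set (half R n)) : compact U ->
  measurable (U : set (mhalf R n)).
Proof.
by move=> /compact_closed/closed_measurable_half; apply; exact: norm_hausdorff.
Qed.

Lemma open_measurable_rV (U : set 'rV[R]_n) : open U -> measurable U.
Proof.
move=> oU; have mU : measurable (fst @^-1` U : set (mhalf R n)).
  apply: open_measurable_half; apply: open_comp => // z _; exact: cvg_fst.
have mf : measurable_fun setT (fun x : 'rV[R]_n => (x, 0) : mhalf R n).
  by apply: measurable_fun_pair => //; exact: measurable_id.
by have := mf measurableT _ mU; rewrite setTI.
Qed.

Lemma continuous_measurable_half (D : set (half R n)) (f : half R n -> R) :
  open D -> {within D, continuous f} ->
  measurable_fun (D : set (mhalf R n)) f.
Proof.
move=> oD cf; apply: measurable_fun_rays => c.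
apply: open_measurable_half; rewrite openE => z [Dz fz].
rewrite continuous_open_subspace// in cf.
have := cf z; rewrite inE => /(_ Dz) cz.
rewrite /interior; near=> y; split; first by near: y; exact: open_nbhs_nbhs.
by near: y; apply: (cz [set x | c < x]); apply: open_nbhs_nbhs; split => //; exact: open_gt.
Unshelve. all: by end_near. Qed.

Lemma continuous_measurable_rV (f : 'rV[R]_n -> R) :
  continuous f -> measurable_fun setT f.
Proof.
move=> cf; apply: measurable_fun_rays => c; rewrite setTI; apply: open_measurable_rV.
by apply: (open_comp (f := f) (D := [set x | c < x])); [move=> ? _; exact: cf|exact: open_gt].
Qed.

Lemma half_space_open : open (@half_space R n).
Proof.
by apply: (open_comp (f := snd) (D := [set x : R | 0 < x])); [move=> ? _; exact: cvg_snd|exact: open_gt].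
Qed.

Lemma measurable_half_space : measurable (@half_space R n : set (mhalf R n)).
Proof. apply: open_measurable_half; exact: half_space_open. Qed.

End sigma_algebra_of_coordinates.

(** * The gauge of a symmetric convex body *)

Section gauge.
Context (R : realType) (n : nat) (K : set 'rV[R]_n).
Hypothesis hK : symmetric_convex_body K.
Implicit Types (x y : 'rV[R]_n) (r s t c : R).

Let gauge x := [set r : R | 0 < r /\ exists2 y, K y & x = r *: y].

Lemma body_convex x y s : 0 <= s -> s <= 1 -> K x -> K y ->
  K (s *: x + (1 - s) *: y).
Proof.
move=> s0 s1 Kx Ky; have [_ cK _ _] := hK.
have s01 : (0 <= s <= 1)%R by rewrite s0.
have := cK x y (Itv01 s0 s1) (mem_set Kx) (mem_set Ky).
by rewrite inE.
Qed.

Lemma body_opp x : K x -> K (- x). Proof. by case: hK => _ _ _; exact. Qed.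

(** By symmetry, averaging an interior ball with the opposite of its center moves it
    to the origin. *)
Lemma body_interior0 : exists2 e, 0 < e & forall x, `|x| < e -> K x.
Proof.
have [_ _ [x Kx] _] := hK.
have /nbhs_ballP[e /= e0 eK] := Kx.
exists (e / 2) => [|y ye]; first by rewrite divr_gt0.
have h1 : 0 <= 2^-1 :> R by rewrite invr_ge0.
have h2 : 2^-1 <= 1 :> R by rewrite invf_le1 ?ler1n.
have := @body_convex (x + 2 *: y) (- x) 2^-1 h1 h2.
rewrite (_ : 1 - 2^-1 = 2^-1 :> R); last by field.
rewrite -scalerDr addrAC addrN add0r scalerA mulVf// scale1r; apply.
  apply: eK; rewrite -ball_normE/= opprD addrA addrN add0r normrN normrZ.
  by rewrite ger0_norm// mulrC -ltr_pdivlMr.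
by apply: body_opp; exact: nbhs_singleton Kx.
Qed.

Lemma body0 : K 0.
Proof. by have [e e0] := body_interior0; apply; rewrite normr0. Qed.

Let gauge_up x r s : gauge x r -> r <= s -> gauge x s.
Proof.
move=> [r0 [y Ky ->]] rs; have s0 := lt_le_trans r0 rs.
split => //; exists ((r / s) *: y); last first.
  by rewrite scalerA mulrCA divff ?gt_eqF// mulr1.
have := @body_convex y 0 (r / s) _ _ Ky body0.
rewrite scaler0 addr0; apply; first by rewrite divr_ge0// ltW.
by rewrite ler_pdivrMr// mul1r.
Qed.

Let gauge_lb x : has_lbound (gauge x).
Proof. by exists 0 => r [/ltW]. Qed.

Let gauge_nonempty x : gauge x !=set0.
Proof.
have [e e0 eK] := body_interior0.
exists ((`|x| + 1) / e * 2); split.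
  by rewrite mulr_gt0// divr_gt0// ltr_wpDl.
have p0 : 0 < (`|x| + 1) / e * 2 by rewrite mulr_gt0// divr_gt0// ltr_wpDl.
exists (((`|x| + 1) / e * 2)^-1 *: x); last by rewrite scalerA divff ?scale1r ?gt_eqF.
apply: eK; rewrite normrZ gtr0_norm ?invr_gt0// mulrC ltr_pdivrMr//.
rewrite mulrA mulrCA divff ?gt_eqF//; have := normr_ge0 x; lra.
Qed.

Let gauge_lt x r : Knorm K x < r -> gauge x r.
Proof.
by move=> /inf_lt[|s gs /ltW]; [exact: gauge_nonempty|exact: gauge_up].
Qed.

Let gauge_le x r : gauge x r -> Knorm K x <= r.
Proof. by move=> gr; apply: ge_inf => //; exact: gauge_lb. Qed.

Lemma Knorm_ge0 x : 0 <= Knorm K x.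
Proof. by apply: lb_le_inf; [exact: gauge_nonempty|move=> r [/ltW]]. Qed.

Lemma Knorm_triangle x y : Knorm K (x + y) <= Knorm K x + Knorm K y.
Proof.
apply/ler_addgt0Pr => e e0.
have e2 : 0 < e / 2 by rewrite divr_gt0.
have [r0 [x' Kx xE]] : gauge x (Knorm K x + e / 2) by apply: gauge_lt; rewrite ltrDl.
have [s0 [y' Ky yE]] : gauge y (Knorm K y + e / 2) by apply: gauge_lt; rewrite ltrDl.
rewrite [leRHS](_ : _ = (Knorm K x + e / 2) + (Knorm K y + e / 2)); last by field.
move: r0 s0 xE yE; set r := _ + e / 2; set s := _ + e / 2 => r0 s0 -> ->.
have rs : 0 < r + s by rewrite addr_gt0.
apply: gauge_le; split => //; exists ((r / (r + s)) *: x' + (1 - r / (r + s)) *: y').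
  apply: body_convex => //; first by rewrite divr_ge0// ltW.
  by rewrite ler_pdivrMr// mul1r lerDl ltW.
by rewrite scalerDr !scalerA; congr (_ *: _ + _ *: _); field; rewrite gt_eqF.
Qed.

Lemma KnormN x : Knorm K (- x) = Knorm K x.
Proof.
congr (inf _); apply/seteqP; split => r [r0 [y Ky xE]]; split => //;
  exists (- y); rewrite ?scalerN -?xE ?opprK//; exact: body_opp.
Qed.

Lemma KnormB x y : Knorm K (x - y) = Knorm K (y - x).
Proof. by rewrite -KnormN opprB. Qed.

Lemma Knorm0 : Knorm K 0 = 0.
Proof.
apply/eqP; rewrite eq_le Knorm_ge0 andbT; apply/ler_addgt0Pr => e e0.
rewrite add0r; apply: gauge_le; split => //; exists 0; last by rewrite scaler0.
exact: body0.
Qed.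

Lemma KnormZ c x : 0 <= c -> Knorm K (c *: x) = c * Knorm K x.
Proof.
have le d z : 0 < d -> Knorm K (d *: z) <= d * Knorm K z.
  move=> d0; apply/ler_addgt0Pr => e e0.
  have [r0 [y Ky yE]] : gauge z (Knorm K z + e / d).
    by apply: gauge_lt; rewrite ltrDl divr_gt0.
  rewrite [leRHS](_ : _ = d * (Knorm K z + e / d)); last first.
    by rewrite mulrDr mulrCA divff ?mulr1 ?gt_eqF.
  apply: gauge_le; split; first by rewrite mulr_gt0.
  by exists y => //; rewrite -scalerA -yE.
rewrite le_eqVlt => /predU1P[<-|c0].
  by rewrite scale0r mul0r Knorm0.
apply/eqP; rewrite eq_le le//=.
rewrite -[X in c * Knorm K X]scale1r -(@mulVf _ c) ?gt_eqF// -scalerA.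
by rewrite -ler_pdivlMl// le// invr_gt0.
Qed.

(** This estimate and [norm_le_Knorm] express that [K] has the origin in its
    interior and that it is bounded: the gauge defines the usual topology. *)
Lemma Knorm_le_norm : exists2 c, 0 < c & forall x, Knorm K x <= c * `|x|.
Proof.
have [e e0 eK] := body_interior0.
exists (2 / e) => [|x]; first by rewrite divr_gt0.
have [->|x0] := eqVneq x 0; first by rewrite Knorm0 normr0 mulr0.
have nx0 : 0 < `|x| by rewrite normr_gt0.
have c0 : 0 < 2 / e * `|x| by rewrite mulr_gt0 ?divr_gt0.
apply: gauge_le; split => //.
exists ((2 / e * `|x|)^-1 *: x); last by rewrite scalerA divff ?scale1r ?gt_eqF.
apply: eK; rewrite normrZ gtr0_norm ?invr_gt0// mulrC ltr_pdivrMr//.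
rewrite mulrA mulrCA divff ?gt_eqF//; lra.
Qed.

Lemma norm_le_Knorm : exists2 c, 0 < c & forall x, `|x| <= c * Knorm K x.
Proof.
have [cK _ _ _] := hK; have [M [_ KM]] := compact_bounded cK.
exists (`|M| + 1) => [|x]; first by rewrite ltr_wpDl.
have {}KM y : K y -> `|y| <= `|M| + 1.
  by apply: KM; rewrite (le_lt_trans (ler_norm _))// ltrDl.
have M0 : 0 < `|M| + 1 by rewrite ltr_wpDl.
rewrite -ler_pdivrMl//; apply: lb_le_inf; first exact: gauge_nonempty.
move=> r [r0 [y Ky ->]]; rewrite ler_pdivrMl// normrZ gtr0_norm// mulrC.
by rewrite ler_wpM2r ?KM// ltW.
Qed.

Lemma Knorm_lipschitz x y : `|Knorm K x - Knorm K y| <= Knorm K (x - y).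
Proof.
rewrite ler_norml; apply/andP; split.
  rewrite lerNl opprB lerBlDr KnormB -[leLHS]/(Knorm K y).
  by rewrite -[X in Knorm K X <= _](subrK x) Knorm_triangle.
by rewrite lerBlDr -[X in Knorm K X <= _](subrK y) Knorm_triangle.
Qed.

Lemma Knorm_continuous : continuous (Knorm K).
Proof.
move=> x; have [c c0 cn] := Knorm_le_norm.
apply/(@cvgrPdist_lt _ _ _ _ (nbhs_filter x)) => e e0.
rewrite near_simpl; apply/nbhs_ballP.
exists (e / c) => [|y]; first by rewrite /= divr_gt0.
rewrite -ball_normE/= => xy; apply: le_lt_trans (Knorm_lipschitz _ _) _.
by apply: le_lt_trans (cn _) _; rewrite mulrC -ltr_pdivlMr.
Qed.

Lemma measurable_Knorm : measurable_fun setT (Knorm K).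
Proof. by apply: continuous_measurable_rV; exact: Knorm_continuous. Qed.

Lemma measurable_rVB d (T : measurableType d) (f g : T -> 'rV[R]_n) :
  measurable_fun setT f -> measurable_fun setT g ->
  measurable_fun setT (fun z => f z - g z).
Proof.
move=> mf mg; apply: measurable_fun_rV => i.
rewrite (_ : (fun z => _) = (fun z => f z ord0 i - g z ord0 i)); last first.
  by apply/funext => z; rewrite !mxE.
by apply: measurable_funB;
  [exact: (measurableT_comp (measurable_coord_rV i) mf)|
   exact: (measurableT_comp (measurable_coord_rV i) mg)].
Qed.

Lemma Kball_sub x r y s : Knorm K (y - x) + s <= r -> Kball K y s `<=` Kball K x r.
Proof.
move=> h z; rewrite /Kball/= => zy; apply: le_trans h.
by rewrite -[z - x](subrKA y) addrC (le_trans (Knorm_triangle _ _))// lerD2l.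
Qed.

Lemma Kball_center x r : 0 <= r -> Kball K x r x.
Proof. by move=> r0; rewrite /Kball/= subrr Knorm0. Qed.

(** The center of the common ball lies on the segment between the two centers. *)
Lemma Kball_common x r y t s : s <= r -> s <= t ->
  Knorm K (y - x) <= (t - s) + (r - s) ->
  exists w, Kball K w s `<=` Kball K x r /\ Kball K w s `<=` Kball K y t.
Proof.
move=> sr st d_le; set d := Knorm K (y - x) in d_le.
have [dr|rd] := leP d (r - s).
  exists y; split; apply: Kball_sub; first by rewrite -/d; lra.
  by rewrite subrr Knorm0; lra.
have d0 : 0 < d by lra.
exists (x + ((r - s) / d) *: (y - x)); split; apply: Kball_sub.
  rewrite [x + _]addrC addrK KnormZ; last by rewrite divr_ge0 ?(ltW d0)// subr_ge0.
  by rewrite -/d divfK ?gt_eqF//; lra.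
rewrite KnormB (_ : y - _ = (1 - (r - s) / d) *: (y - x)); last first.
  by rewrite scalerBl scale1r opprD addrA.
rewrite KnormZ; last by rewrite subr_ge0 ler_pdivrMr// mul1r ltW.
by rewrite -/d mulrBl divfK ?gt_eqF//; lra.
Qed.

Lemma measurable_Kball x r : measurable (Kball K x r).
Proof.
rewrite /Kball -[X in measurable X]setTI (_ : [set _ | _] =
  (fun y => Knorm K (y - x)) @^-1` `]-oo, r]%classic); last first.
  by apply/seteqP; split => z/=; rewrite in_itv.
apply: (measurableT_comp measurable_Knorm) => //.
by apply: measurable_rVB => //; exact: measurable_id.
Qed.

End gauge.

(** * Lebesgue measure of balls *)

(** Makes a sigma-finiteness proof visible to unification, so that Tonelli's
    theorem applies to a measure that only carries the plain structure. *)
Definition sfm d (T : measurableType d) (R : realType)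
  (m : {measure set T -> \bar R}) (h : sigma_finite setT m) :
  set T -> \bar R := m.
HB.instance Definition _ d (T : measurableType d) (R : realType)
  (m : {measure set T -> \bar R}) (h : sigma_finite setT m) :=
  Measure.on (sfm h).
HB.instance Definition _ d (T : measurableType d) (R : realType)
  (m : {measure set T -> \bar R}) (h : sigma_finite setT m) :=
  Measure_isSigmaFinite.Build _ _ _ (sfm h) h.

Local Notation push m mf :=
  (measure_function_pushforward__canonical__measure_function_Measure m mf).

Section lebesgue_rV.
Context (R : realType).
Local Open Scope ereal_scope.
Let lam := @lebesgue_measure R.

Lemma lebesgue_affine (a r : R) (A : set (measurableTypeR R)) : (0 < r)%R ->
  measurable A ->
  lam [set s | A (a + r * s)%R] = (r^-1)%:E * lam A.
Proof.
move=> r0 mA.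
have mphi : measurable_fun setT (fun s : measurableTypeR R => (a + r * s)%R : measurableTypeR R).
  by apply: measurable_funD => //; exact: measurable_funM.
pose nu := mscale (NngNum (ltW r0)) (push lam mphi).
suff -> : lam A = nu A.
  by rewrite /nu /mscale/= /pushforward muleA -EFinM mulVf ?mul1e// gt_eqF.
apply: lebesgue_measure_unique mA => X [[x y]/= _ <-].
rewrite /nu /mscale/= /pushforward.
rewrite (_ : _ @^-1` _ = `](x - a) / r, (y - a) / r]%classic)%R; last first.
  apply/seteqP; split => s/=; rewrite !in_itv/= ltr_pdivrMr// ler_pdivlMr//;
    by rewrite ltrBlDl lerBrDl mulrC.
rewrite !lebesgue_measure_itv/= !lte_fin ltr_pM2r ?invr_gt0// ltrD2r.
case: ifPn => _; rewrite ?mule0// -!EFinB -EFinM; congr _%:E.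
by field; rewrite gt_eqF.
Qed.

Lemma lebesgue_centered_itv (M : R) : (0 <= M)%R ->
  lam `[(- M)%R, M]%classic = (2 * M)%:E.
Proof.
move=> M0; rewrite /lam lebesgue_measure_itv/= lte_fin.
case: ifPn => [_|]; first by rewrite -EFinB; congr (_%:E); ring.
by rewrite -leNgt => Mle; congr (_%:E); lra.
Qed.

(** By induction on the dimension, one coordinate at a time. *)
Lemma dx_affine n (a : 'rV[R]_n) (r : R) (A : set 'rV[R]_n) : (0 < r)%R ->
  measurable A ->
  dx R n [set x | A (a + r *: x)%R] = (r ^- n)%:E * dx R n A.
Proof.
move=> r0; rewrite /dx; elim: n a A => [|n IH] a A mA.
  rewrite expr0 invr1 mul1e; congr (dirac _ _).
  by apply/seteqP; split => x /=; rewrite [(_ + _)%R]thinmx0 [x]thinmx0.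
rewrite !lebesgue_measure_rVS.
pose a0 := lsubmx (a : 'rV_(1 + n)) ord0 ord0; pose a' := rsubmx (a : 'rV_(1 + n)).
pose phi x := lam (xsection (@rV_cons R n @^-1` A) x).
have mcA : measurable (@rV_cons R n @^-1` A).
  by rewrite -[X in measurable X]setTI; exact: measurable_rV_cons.
have mphi : measurable_fun setT phi by exact: measurable_fun_xsection.
have mT : measurable_fun setT (fun x : 'rV[R]_n => a' + r *: x)%R.
  apply: measurable_fun_rV => i.
  rewrite (_ : (fun z => _) = (fun z : 'rV[R]_n => a' ord0 i + r * z ord0 i))%R.
    apply: measurable_funD => //; apply: measurable_funM => //.
    exact: measurable_coord_rV.
  by apply/funext => z; rewrite !mxE.
rewrite /product_measure1.
transitivity (\int[lebesgue_measure_rV R n]_x ((r^-1)%:E * phi (a' + r *: x)%R)).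
  apply: eq_integral => x _ /=.
  rewrite /phi -(lebesgue_affine a0)//; last exact: measurable_xsection.
  have aff s : (a + r *: rV_cons (x, s))%R = rV_cons (a' + r *: x, a0 + r * s)%R.
    apply/rowP => i; rewrite !mxE.
    case: (split_ordP (i : 'I_(1 + n))) => j ->.
      by rewrite !mxE /a0 mxE (ord1 j).
    by rewrite !mxE.
  rewrite /lam; congr (lebesgue_measure _); apply/seteqP; split => s;
    by rewrite /xsection/= !inE/= aff.
rewrite ge0_integralZl//; last 2 first.
- exact: (measurableT_comp mphi mT).
- by rewrite lee_fin invr_ge0 ltW.
rewrite (_ : (fun x => phi _) = phi \o (fun x => a' + r *: x)%R)//.
have := @ge0_integral_pushforward _ _ _ _ R _ mT (lebesgue_measure_rV R n) setT phi measurableT mphi.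
rewrite preimage_setT => <-; last by move=> x _; exact: measure_ge0.
have rn0 : (0 <= r ^- n)%R by rewrite invr_ge0 exprn_ge0// ltW.
rewrite (eq_measure_integral (mscale (NngNum rn0) (lebesgue_measure_rV R n))).
  rewrite ge0_integral_mscale//= /phi.
  by rewrite muleA -EFinM -invfM -exprS.
by move=> B mB _; rewrite /= /pushforward IH.
Qed.

Definition cube (n : nat) (M : R) : set 'rV[R]_n :=
  [set x : 'rV[R]_n | forall i, (`|x ord0 i| <= M)%R].

Lemma measurable_cube n M : measurable (@cube n M).
Proof.
rewrite (_ : @cube n M = \bigcap_(i in [set: 'I_n]) [set x : 'rV[R]_n | (`|x ord0 i| <= M)%R]).
  apply: fin_bigcap_measurable => // i _.
  rewrite -[X in measurable X]setTI (_ : [set _ | _] =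
    (fun x : 'rV[R]_n => `|x ord0 i|)%R @^-1` `]-oo, M]%classic).
    have mf : measurable_fun setT (fun x : 'rV[R]_n => `|x ord0 i|)%R.
      by apply: (measurableT_comp _ (measurable_coord_rV i)) => //; exact: measurable_normr.
    exact: mf.
  by apply/seteqP; split => z/=; rewrite in_itv.
by apply/seteqP; split => [x h i _|x h i]; [exact: h|exact: h].
Qed.

Lemma dx_cube n M : (0 <= M)%R -> dx R n (@cube n M) = ((2 * M) ^+ n)%:E.
Proof.
move=> M0; rewrite /dx; elim: n => [|n IH].
  rewrite /= diracE expr0 mem_set//.
  by move=> -[].
rewrite lebesgue_measure_rVS.
rewrite (_ : _ @^-1` _ = @cube n M `*` `[(- M)%R, M]%classic).
  rewrite product_measure1E//; last exact: measurable_cube.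
  rewrite exprSr EFinM; congr (_ * _); [exact: IH|exact: lebesgue_centered_itv].
apply/seteqP; split => [[x s]/= h|[x s]/= [h1 h2]].
  split => /=.
    move=> i; have := h (rshift 1 i); rewrite /rV_cons/=.
    by rewrite (row_mxEr (const_mx s : 'rV_1) x).
  have := h (@lshift 1 n ord0); rewrite /rV_cons/=.
  by rewrite (row_mxEl (const_mx s : 'rV_1) x) mxE in_itv/= ler_norml.
rewrite /cube/= /rV_cons => i; have [j ->|j ->] := split_ordP (i : 'I_(1 + n)).
  rewrite (row_mxEl (const_mx s : 'rV_1) x) mxE ler_norml.
  by move: h2; rewrite in_itv.
rewrite (row_mxEr (const_mx s : 'rV_1) x); exact: h1.
Qed.

Lemma norm_rV_lt n (x : 'rV[R]_n) (e : R) : (0 < e)%R ->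
  (forall i, `|x ord0 i| < e)%R -> (`|x| < e)%R.
Proof.
move=> e0 h; rewrite -[x]opprK normrN -[(- _)%R]sub0r.
have : ball (0%R : 'rV[R]_n) e x.
  split => // i j; rewrite (ord1 i) mxE -ball_normE/= sub0r normrN; exact: h.
by rewrite -ball_normE/= !sub0r.
Qed.

Lemma coord_le_norm n (x : 'rV[R]_n) i : (`|x ord0 i| <= `|x|)%R.
Proof.
apply/ler_addgt0Pr => e e0.
have : ball (0%R : 'rV[R]_n) (`|x| + e)%R x.
  by rewrite -ball_normE/= sub0r normrN ltrDl.
move=> [_ /(_ ord0 i)]; rewrite mxE -ball_normE/= sub0r normrN; exact: ltW.
Qed.

Lemma sigma_finite_dx n : sigma_finite [set: 'rV[R]_n] (dx R n).
Proof.
exists (fun k => @cube n k%:R).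
  apply/esym/seteqP; split => // x _.
  exists (Num.bound `|x|) => // i /=.
  by rewrite (le_trans (coord_le_norm _ _))// ltW// archi_boundP.
by move=> k; split; [exact: measurable_cube|rewrite dx_cube// ltry].
Qed.

Lemma sigma_finite_dxdt n : sigma_finite [set: mhalf R n] (dxdt R n).
Proof.
exists (fun k => @cube n k%:R `*` `[(- k%:R)%R, k%:R]%classic).
  apply/esym/seteqP; split => // -[x t] _.
  exists (Num.bound (`|x| + `|t|)) => //; split => /= [i|].
    rewrite (le_trans (coord_le_norm _ _))// (@le_trans _ _ (`|x| + `|t|))%R ?lerDl//.
    by rewrite ltW// archi_boundP// addr_ge0.
  rewrite in_itv/= -ler_norml (@le_trans _ _ (`|x| + `|t|))%R ?lerDr//.
  by rewrite ltW// archi_boundP// addr_ge0.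
move=> k; split; first by apply: measurableX => //; exact: measurable_cube.
have -> : dxdt R n (@cube n k%:R `*` `[(- k%:R)%R, k%:R]%classic) =
    dx R n (@cube n k%:R) * lam `[(- k%:R)%R, k%:R]%classic.
  by apply: product_measure1E => //; exact: measurable_cube.
by rewrite dx_cube// lebesgue_centered_itv// -EFinM ltry.
Qed.

Section ball.
Context (n : nat) (K : set 'rV[R]_n).
Hypothesis hK : symmetric_convex_body K.

Definition unit_vol : R := fine (dx R n (Kball K 0%R 1%R)).

Lemma unit_volE : dx R n (Kball K 0%R 1%R) = unit_vol%:E /\ (0 < unit_vol)%R.
Proof.
have [c c0 hc] := norm_le_Knorm hK; have [d d0 hd] := Knorm_le_norm hK.
have m1 : measurable (Kball K 0%R 1%R) by exact: measurable_Kball.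
have fin : dx R n (Kball K 0%R 1%R) \is a fin_num.
  rewrite ge0_fin_numE ?measure_ge0//.
  apply: (@le_lt_trans _ _ (dx R n (@cube n c))); last by rewrite dx_cube ?ltry ?ltW.
  apply: le_measure; rewrite ?inE//; first exact: measurable_cube.
  move=> x; rewrite /Kball/= subr0 => x1 i.
  by rewrite (le_trans (coord_le_norm _ _))// (le_trans (hc _))// ger_pMr.
rewrite /unit_vol fineK//; split => //.
rewrite -lte_fin fineK//.
have e0 : (0 < d^-1 / 2)%R by rewrite divr_gt0// invr_gt0.
apply: (@lt_le_trans _ _ (dx R n (@cube n (d^-1 / 2)))).
  by rewrite dx_cube ?(ltW e0)// lte_fin exprn_gt0// mulr_gt0.
apply: le_measure; rewrite ?inE//; first exact: measurable_cube.
move=> x h; rewrite /Kball/= subr0 (le_trans (hd _))// mulrC -ler_pdivlMr// div1r ltW//.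
apply: norm_rV_lt; first by rewrite invr_gt0.
move=> i; apply: le_lt_trans (h i) _; rewrite ltr_pdivrMr// ltr_pMr ?invr_gt0//.
by rewrite ltr1n.
Qed.

Lemma dx_Kball x r : (0 < r)%R ->
  dx R n (Kball K x r) = (r ^+ n * unit_vol)%:E.
Proof.
move=> r0; rewrite EFinM -unit_volE.1.
have mB : measurable (Kball K 0%R 1%R) by exact: measurable_Kball.
have ri0 : (0 < r^-1)%R by rewrite invr_gt0.
have := dx_affine (- (r^-1 *: x))%R ri0 mB; rewrite exprVn invrK => <-.
congr (dx R n _); apply/seteqP; split => y; rewrite /Kball/= subr0;
  rewrite [X in (Knorm K X <= 1)%R]addrC -scalerBr (KnormZ hK) ?(ltW ri0)//;
  by rewrite mulrC ler_pdivrMr// mul1r.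
Qed.

End ball.
End lebesgue_rV.

(** * Averages of integrals over cones *)

Section tents.
Context (R : realType) (n : nat) (K : set 'rV[R]_n).
Hypothesis hK : symmetric_convex_body K.
Local Open Scope ereal_scope.
Implicit Types (g : 'rV[R]_n -> \bar R) (w : half R n -> \bar R).

(** Dual to integration over cones, see [tent_tonelli]. *)
Definition ball_integral g (z : half R n) : \bar R :=
  \int[dx R n]_(y in Kball K z.1 z.2) g y.

Let incid : set ('rV[R]_n * mhalf R n) := [set u | (Knorm K (u.1 - u.2.1) <= u.2.2)%R].

Let measurable_incid : measurable incid.
Proof.
rewrite -[X in measurable X]setTI (_ : incid =
  (fun u => u.2.2 - Knorm K (u.1 - u.2.1))%R @^-1` `[0%R, +oo[%classic); last first.
  by apply/seteqP; split => u; rewrite /incid/= in_itv/= andbT subr_ge0.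
have mf : measurable_fun setT
    (fun u : 'rV[R]_n * mhalf R n => u.2.2 - Knorm K (u.1 - u.2.1))%R.
  apply: measurable_funB.
    exact: (measurableT_comp measurable_snd measurable_snd).
  apply: (measurableT_comp (measurable_Knorm hK)).
  apply: measurable_rVB; first exact: measurable_fst.
  exact: (measurableT_comp measurable_fst measurable_snd).
exact: mf.
Qed.

Lemma measurable_cone x : measurable (cone K x : set (mhalf R n)).
Proof.
rewrite (_ : cone K x = @half_space R n `&` xsection incid x).
  apply: measurableI; first exact: measurable_half_space.
  exact: measurable_xsection.
by apply/seteqP; split => z; rewrite /cone/xsection/= inE.
Qed.

Lemma cone_half x : cone K x `<=` @half_space R n.
Proof. by move=> z []. Qed.

Lemma measurable_cone_slab x (r : R) :
  measurable (cone K x `&` [set z | (r <= z.2)%R] : set (mhalf R n)).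
Proof.
apply: measurableI; first exact: measurable_cone.
rewrite -[X in measurable X]setTI (_ : [set _ | _] =
  (@snd 'rV[R]_n (measurableTypeR R)) @^-1` `[r, +oo[%classic)%R.
  exact: measurable_snd.
by apply/seteqP; split => z; rewrite /= in_itv/= andbT.
Qed.

Section tonelli.
Variable nu : {measure set (mhalf R n) -> \bar R}.
Hypothesis sf : sigma_finite setT nu.
Variable w : half R n -> \bar R.
Hypothesis mw : measurable_fun (@half_space R n : set (mhalf R n)) w.
Hypothesis w0 : forall z, half_space z -> 0 <= w z.
Variable g : 'rV[R]_n -> \bar R.
Hypothesis mg : measurable_fun setT g.
Hypothesis g0 : forall x, 0 <= g x.

Let w' : mhalf R n -> \bar R := w \_ (@half_space R n).
Let w'0 z : 0 <= w' z. Proof. by rewrite /w' patchE; case: ifPn => //; rewrite inE; exact: w0. Qed.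
Let mw' : measurable_fun setT w'.
Proof. by apply/(measurable_restrictT _ _).1 => //; exact: measurable_half_space. Qed.

Let F (u : 'rV[R]_n * mhalf R n) := g u.1 * w' u.2 * (\1_incid u)%:E.
Let F0 u : 0 <= F u.
Proof. by rewrite /F !mule_ge0// lee_fin. Qed.
Let mF : measurable_fun setT F.
Proof.
apply: emeasurable_funM.
  apply: emeasurable_funM.
    by apply: measurableT_comp => //; exact: measurable_fst.
  by apply: measurableT_comp => //; exact: measurable_snd.
by apply/measurable_EFinP; exact: measurable_indic.
Qed.

Let F1 x : \int[nu]_z F (x, z) = g x * \int[nu]_(z in cone K x) w z.
Proof.
rewrite /F /=; under eq_integral do rewrite -muleA.
rewrite ge0_integralZl//; last 2 first.
- apply: emeasurable_funM => //.
  apply/measurable_EFinP; have := @measurable_indic _ _ R setT _ measurable_incid.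
  exact: measurable_fun_pair2.
- by move=> z _; rewrite mule_ge0// lee_fin.
congr (_ * _); rewrite [RHS]integral_mkcond; apply: eq_integral => z _.
rewrite patchE /w' patchE indicE.
have [zh|zh] := boolP (z \in half_space (n := n)); last first.
  by rewrite mul0e ifF//; apply/negbTE; apply: contra zh; rewrite !inE => -[].
rewrite /cone/=; have [xz|xz] := boolP ((x, z) \in incid).
  by rewrite mule1 mem_set//; split; [exact/set_mem|move: xz; rewrite inE].
rewrite mule0 ifF//; apply/negbTE; apply: contra xz; rewrite !inE => -[].
by rewrite /incid.
Qed.

Let F2 z : \int[dx R n]_x F (x, z) = w' z * ball_integral g z.
Proof.
rewrite /F /=; under eq_integral do rewrite (muleC (g _)) -muleA.
rewrite ge0_integralZl//; last 2 first.
- apply: emeasurable_funM => //.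
  apply/measurable_EFinP; have := @measurable_indic _ _ R setT _ measurable_incid.
  exact: measurable_fun_pair1.
- by move=> x _; rewrite mule_ge0// lee_fin.
congr (_ * _); rewrite /ball_integral [RHS]integral_mkcond; apply: eq_integral => x _.
rewrite patchE indicE; have [xz|xz] := boolP ((x, z) \in incid).
  by rewrite mule1 mem_set//; move: xz; rewrite inE.
by rewrite mule0 ifF//; apply/negbTE; apply: contra xz; rewrite !inE.
Qed.

(** A ball [z] belongs to the cone at [x] exactly when the point [x] belongs to the
    ball [z]. *)
Lemma tent_tonelli :
  \int[dx R n]_x (g x * \int[nu]_(z in cone K x) w z) =
  \int[nu]_(z in @half_space R n) (w z * ball_integral g z).
Proof.
under eq_integral do rewrite -F1.
have := @fubini_tonelli _ _ _ _ R (sfm (sigma_finite_dx R n)) (sfm sf) F mF F0.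
rewrite /sfm => ->; under eq_integral do rewrite F2.
rewrite [RHS]integral_mkcond; apply: eq_integral => z _.
by rewrite /w' !patchE; case: ifPn => //; rewrite mul0e.
Qed.

End tonelli.

Lemma measurable_area (nu : {measure set (mhalf R n) -> \bar R}) w :
  sigma_finite setT nu ->
  measurable_fun (@half_space R n : set (mhalf R n)) w ->
  (forall z, half_space z -> 0 <= w z) ->
  measurable_fun setT (fun x => \int[nu]_(z in cone K x) w z).
Proof.
move=> sf mw w0.
pose w' : mhalf R n -> \bar R := w \_ (@half_space R n).
pose F (u : 'rV[R]_n * mhalf R n) := w' u.2 * (\1_incid u)%:E.
have w'0 z : 0 <= w' z by rewrite /w' patchE; case: ifPn => //; rewrite inE; exact: w0.
have mw' : measurable_fun setT w'.
  by apply/(measurable_restrictT _ _).1 => //; exact: measurable_half_space.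
have mF : measurable_fun setT F.
  apply: emeasurable_funM; last by apply/measurable_EFinP; exact: measurable_indic.
  by apply: measurableT_comp => //; exact: measurable_snd.
have F0 u : 0 <= F u by rewrite mule_ge0// lee_fin.
have := @measurable_fun_fubini_tonelli_F _ _ _ _ R (sfm sf) F mF F0.
rewrite (_ : fubini_F _ _ = (fun x => \int[nu]_(z in cone K x) w z))//.
apply/funext => x; rewrite /fubini_F [RHS]integral_mkcond; apply: eq_integral => z _.
rewrite /F /= patchE /w' patchE indicE.
have [zh|zh] := boolP (z \in half_space (n := n)); last first.
  by rewrite mul0e ifF//; apply/negbTE; apply: contra zh; rewrite !inE => -[].
rewrite /cone/=; have [xz|xz] := boolP ((x, z) \in incid).
  by rewrite mule1 mem_set//; split; [exact/set_mem|move: xz; rewrite inE].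
rewrite mule0 ifF//; apply/negbTE; apply: contra xz; rewrite !inE => -[].
by rewrite /incid.
Qed.

Lemma measurable_ball_integral g : measurable_fun setT g -> (forall x, 0 <= g x) ->
  measurable_fun (setT : set (mhalf R n)) (ball_integral g).
Proof.
move=> mg g0.
pose F (u : 'rV[R]_n * mhalf R n) := g u.1 * (\1_incid u)%:E.
have mF : measurable_fun setT F.
  apply: emeasurable_funM; last by apply/measurable_EFinP; exact: measurable_indic.
  by apply: measurableT_comp => //; exact: measurable_fst.
have F0 u : 0 <= F u by rewrite mule_ge0// lee_fin.
have := @measurable_fun_fubini_tonelli_G _ _ _ _ R (sfm (sigma_finite_dx R n)) F mF F0.
rewrite [X in measurable_fun _ X](_ : _ = ball_integral g)//.
apply/funext => z; rewrite /fubini_G /ball_integral [RHS]integral_mkcond.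
apply: eq_integral => x _; rewrite patchE /F/= indicE.
have [xz|xz] := boolP ((x, z) \in incid).
  by rewrite mule1 mem_set//; move: xz; rewrite inE.
by rewrite mule0 ifF//; apply/negbTE; apply: contra xz; rewrite !inE.
Qed.

Lemma ball_integral_ge0 g z : (forall x, 0 <= g x) -> 0 <= ball_integral g z.
Proof. by move=> g0; exact: integral_ge0. Qed.

Lemma ball_integral_le g z : measurable_fun setT g -> (forall x, 0 <= g x) ->
  ball_integral g z <= \int[dx R n]_x g x.
Proof.
by move=> mg g0; apply: ge0_subset_integral => //; exact: measurable_Kball.
Qed.

(** Tonelli turns a bound on almost every cone into a bound on the average. *)
Lemma tent_le_ess_sup (nu : {measure set (mhalf R n) -> \bar R}) w g (m : \bar R) :
  sigma_finite setT nu ->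
  measurable_fun (@half_space R n : set (mhalf R n)) w ->
  (forall z, half_space z -> 0 <= w z) ->
  measurable_fun setT g -> (forall x, 0 <= g x) -> \int[dx R n]_x g x <= 1 ->
  0 <= m -> {ae dx R n, forall x, \int[nu]_(z in cone K x) w z <= m} ->
  \int[nu]_(z in @half_space R n) (w z * ball_integral g z) <= m.
Proof.
move=> sf mw w0 mg g0 g1 m0 hm; rewrite -tent_tonelli//.
have mA := measurable_area sf mw w0.
have A0 x : 0 <= \int[nu]_(z in cone K x) w z.
  by apply: integral_ge0 => z /cone_half; exact: w0.
apply: (@le_trans _ _ (\int[dx R n]_x (g x * m))).
  apply: ae_ge0_le_integral => //.
  - by move=> x _; rewrite mule_ge0.
  - exact: emeasurable_funM.
  - by move=> x _; rewrite mule_ge0.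
  - exact: emeasurable_funM.
  - by apply: filterS hm => x hx _; rewrite lee_wpmul2l.
rewrite ge0_integralZr//.
by rewrite -[leRHS]mul1e lee_wpmul2r.
Qed.

Definition avg (x0 : 'rV[R]_n) (r : R) : 'rV[R]_n -> R :=
  fun y => ((r ^+ n * unit_vol K)^-1 * \1_(Kball K x0 r) y)%R.

Lemma measurable_avg x0 r : measurable_fun setT (avg x0 r).
Proof.
apply: measurable_funM => //; apply: measurable_indic; exact: measurable_Kball.
Qed.

Lemma avg_ge0 x0 r y : (0 < r)%R -> (0 <= avg x0 r y)%R.
Proof.
move=> r0; rewrite /avg mulr_ge0// invr_ge0 mulr_ge0 ?exprn_ge0 ?ltW//.
exact: (unit_volE hK).2.
Qed.

Lemma ball_integral_avg x0 r z : (0 < r)%R ->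
  ball_integral (EFin \o avg x0 r) z =
  ((r ^+ n * unit_vol K)^-1)%:E * dx R n (Kball K x0 r `&` Kball K z.1 z.2).
Proof.
move=> r0; have mB := measurable_Kball hK.
have c0 : (0 <= (r ^+ n * unit_vol K)^-1)%R.
  by rewrite invr_ge0 mulr_ge0 ?exprn_ge0 ?ltW//; exact: (unit_volE hK).2.
rewrite /ball_integral; under eq_integral do rewrite /= /avg EFinM.
rewrite ge0_integralZl//; last by apply/measurable_EFinP; exact: measurable_indic.
by rewrite integral_indic.
Qed.

Lemma integral_avg x0 r : (0 < r)%R -> \int[dx R n]_x (avg x0 r x)%:E = 1.
Proof.
move=> r0; have mB := measurable_Kball hK.
have v0 : (0 < r ^+ n * unit_vol K)%R.
  by rewrite mulr_gt0 ?exprn_gt0//; exact: (unit_volE hK).2.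
under eq_integral do rewrite /= /avg EFinM.
rewrite ge0_integralZl//; last 2 first.
- by apply/measurable_EFinP; exact: measurable_indic.
- by rewrite lee_fin invr_ge0 ltW.
by rewrite integral_indic// setIT dx_Kball// -EFinM mulVf ?gt_eqF.
Qed.

(** The two balls share a ball of radius [s], whose volume is [(s / r) ^+ n] times
    that of [Kball K x0 r]. *)
Lemma avg_lower x0 r y t s : (0 < s)%R -> (s <= r)%R -> (s <= t)%R ->
  (Knorm K (y - x0) <= (t - s) + (r - s))%R ->
  ((s / r) ^+ n)%:E <= ball_integral (EFin \o avg x0 r) (y, t).
Proof.
move=> s0 sr st h; have r0 := lt_le_trans s0 sr; have mB := measurable_Kball hK.
have [u [u1 u2]] := Kball_common hK sr st h.
rewrite ball_integral_avg//=.
have v0 : (0 < unit_vol K)%R := (unit_volE hK).2.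
rewrite (_ : (s / r) ^+ n = (r ^+ n * unit_vol K)^-1 * (s ^+ n * unit_vol K))%R; last first.
  by rewrite expr_div_n; field; rewrite !gt_eqF// exprn_gt0.
rewrite EFinM lee_wpmul2l//.
  by rewrite lee_fin invr_ge0 mulr_ge0 ?exprn_ge0 ?ltW.
rewrite -(dx_Kball hK u)//; apply: le_measure; rewrite ?inE//.
  exact: measurableI.
by move=> q uq; split; [exact: u1|exact: u2].
Qed.

(** The ball [z] contains [x0], so that it shares a ball of radius [r / 2] with
    [Kball K x0 r]; hence the constants [2 ^+ n] of the duality estimates. *)
Lemma avg_lower_cone x0 r z : (0 < r)%R -> cone K x0 z -> (r <= z.2)%R ->
  ((2^-1) ^+ n)%:E <= ball_integral (EFin \o avg x0 r) z.
Proof.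
move=> r0 [z0 xz] rz; case: z z0 xz rz => y t /= t0 xz rz.
have -> : (2^-1 = (r / 2) / r :> R)%R by field; rewrite gt_eqF.
apply: avg_lower.
- by rewrite divr_gt0.
- by rewrite ler_pdivrMr// ler_pMr// ler1n.
- apply: le_trans rz; by rewrite ler_pdivrMr// ler_pMr// ler1n.
- by rewrite KnormB// (le_trans xz)//; lra.
Qed.

Lemma ball_integral_fin g z : measurable_fun setT g -> (forall x, 0 <= g x) ->
  \int[dx R n]_x g x <= 1 -> ball_integral g z = (fine (ball_integral g z))%:E /\
  (0 <= fine (ball_integral g z) <= 1)%R.
Proof.
move=> mg g0 g1.
have h1 : ball_integral g z <= 1 := le_trans (ball_integral_le z mg g0) g1.
have h0 := ball_integral_ge0 z g0.
have fin : ball_integral g z \is a fin_num by rewrite ge0_fin_numE// (le_lt_trans h1)// ltry.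
by rewrite fineK// fine_ge0//= -lee_fin fineK.
Qed.

End tents.

(** * Exhaustion of the half-space *)

Section exhaustion.
Context (R : realType) (n : nat).

(** Cubes in the first variable, so that these sets do not depend on [K]. *)
Definition exh (k : nat) : set (half R n) :=
  [set z | cube k%:R z.1 /\ z.2 \in `[k.+1%:R^-1, k.+1%:R]].

Lemma exh_compact k : compact (exh k).
Proof.
have cc : compact (@cube R n k%:R).
  have -> : @cube R n k%:R = [set v : 'rV[R]_n | forall i,
      `[(- k%:R), k%:R]%classic (v ord0 i)].
    by apply/seteqP; split => v h i; have := h i; rewrite /= in_itv/= ler_norml.
  have := @rV_compact R n (fun _ => `[(- k%:R), k%:R]%classic).
  by apply => i; exact: segment_compact.
rewrite (_ : exh k = @cube R n k%:R `*` `[k.+1%:R^-1, k.+1%:R]%classic).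
  apply: compact_setX; [exact: cc|exact: segment_compact].
by apply/seteqP; split.
Qed.

Lemma exh_half k : exh k `<=` @half_space R n.
Proof.
move=> [x t] [_] /=; rewrite in_itv/= => /andP[+ _]; apply: lt_le_trans.
by rewrite invr_gt0.
Qed.

Lemma exh_nd j k : (j <= k)%N -> exh j `<=` exh k.
Proof.
move=> jk [x t] [/= xj]; rewrite !in_itv/= => /andP[t1 t2]; split => /=.
  by move=> i; rewrite (le_trans (xj i))// ler_nat.
rewrite in_itv/= (le_trans _ t1)/=; first by rewrite (le_trans t2)// ler_nat.
by rewrite lef_pV2 ?posrE// ler_nat.
Qed.

Lemma exh_bigcup : \bigcup_k exh k = @half_space R n.
Proof.
apply/seteqP; split => [z [k _]|[x t] t0]; first exact: exh_half.
rewrite /half_space/= in t0.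
exists (Num.bound (`|x| + t + t^-1)) => //.
set k := Num.bound _.
have hk : `|x| + t + t^-1 < k%:R.
  by apply: archi_boundP; rewrite !addr_ge0// ?ltW// invr_gt0.
have ti0 : 0 < t^-1 by rewrite invr_gt0.
have kS : k%:R <= k.+1%:R :> R by rewrite ler_nat.
split => /= [i|]; first by have := coord_le_norm x i; lra.
rewrite in_itv/=; apply/andP; split; last by have := normr_ge0 x; lra.
by rewrite -[leRHS]invrK lef_pV2 ?posrE//; have := normr_ge0 x; lra.
Qed.

Lemma measurable_exh k : measurable (exh k : set (mhalf R n)).
Proof. by apply: compact_measurable_half; exact: exh_compact. Qed.

Implicit Types (f : half R n -> R).

(** Truncation to these sets makes a function bounded with compact support, hence
    admissible in all the tests below. *)
Definition sublevel (f : half R n -> R) (k : nat) : set (mhalf R n) :=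
  exh k `&` [set z | (`|f z| <= k%:R)%R].

Lemma sublevel_half f k : sublevel f k `<=` @half_space R n.
Proof. by move=> z [/exh_half]. Qed.

Lemma measurable_sublevel f k : measurable_fun (@half_space R n : set (mhalf R n)) f -> measurable (sublevel f k).
Proof.
move=> mf; rewrite (_ : sublevel f k =
    exh k `&` (@half_space R n `&` (fun z => `|f z|)%R @^-1` `]-oo, k%:R]%classic)).
  apply: measurableI; first exact: measurable_exh.
  have mna : measurable_fun (@half_space R n : set (mhalf R n)) (fun z => `|f z|)%R by exact: measurableT_comp.
  exact: (mna (@measurable_half_space R n)).
apply/seteqP; split => z [ze]; rewrite /= in_itv/=.
  by split => //; split => //; exact: exh_half ze.
by case.
Qed.

Lemma sublevel_nd f : nondecreasing_seq (sublevel f).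
Proof.
move=> i j ij; apply/subsetPset => z [/= zi ai]; split; first exact: exh_nd zi.
by rewrite /= (le_trans ai)// ler_nat.
Qed.

Lemma sublevel_bigcup f : \bigcup_k sublevel f k = @half_space R n.
Proof.
apply/seteqP; split => [z [k _ /sublevel_half]//|z hz].
have : (\bigcup_k exh k) z by rewrite exh_bigcup.
move=> [k _ zk]; exists (maxn k (Num.bound `|f z|%R)) => //; split.
  by apply: exh_nd zk; exact: leq_maxl.
by rewrite /= ltW// (lt_le_trans (archi_boundP _))// ler_nat leq_maxr.
Qed.

Lemma compact_half_bounds (K : set 'rV[R]_n) (Q : set (half R n)) :
  symmetric_convex_body K -> compact Q -> Q `<=` @half_space R n ->
  exists2 rt : R * R, 0 <= rt.1 /\ 0 < rt.2 &
    forall z, Q z -> Knorm K z.1 <= rt.1 /\ rt.2 <= z.2.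
Proof.
move=> hK cQ Qh; have [->|/set0P Q0] := eqVneq Q set0; first by exists (0, 1).
have c2 : {within Q, continuous (@snd 'rV[R]_n R)}.
  by apply: continuous_subspaceT => z; exact: cvg_snd.
have [c cQ' hc] := compact_EVT_min Q0 cQ c2.
have [M [_ QM]] := compact_bounded cQ.
have [d d0 hd] := Knorm_le_norm hK.
exists (d * (`|M| + 1), c.2) => /=.
  split; first by rewrite mulr_ge0 ?addr_ge0// ltW.
  by apply: Qh; rewrite inE in cQ'.
move=> z Qz; split; last by apply: hc; rewrite inE.
rewrite (le_trans (hd _))// ler_pM2l//.
apply: le_trans (QM (`|M| + 1) _ z Qz); first by rewrite prod_normE le_max lexx.
by rewrite (le_lt_trans (ler_norm _))// ltrDl.
Qed.

(** Every ball of a compact set of balls shares a ball of a fixed radius with one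
    wide ball around the origin. *)
Lemma compact_avg_lower (K : set 'rV[R]_n) (Q : set (half R n)) :
  symmetric_convex_body K -> compact Q -> Q `<=` @half_space R n ->
  exists2 rc : R * R, 0 < rc.1 /\ 0 < rc.2 &
    forall z, Q z -> (rc.2%:E <= ball_integral K (EFin \o avg K 0 rc.1) z)%E.
Proof.
move=> hK cQ Qh; have [[rho tau]/= [rho0 tau0] h] := compact_half_bounds hK cQ Qh.
have r0 : 0 < rho + tau by rewrite ltr_wpDl.
exists (rho + tau, (tau / (rho + tau)) ^+ n) => /=.
  by rewrite exprn_gt0// divr_gt0.
move=> [y t] /h/= [yr tt]; apply: avg_lower => //; first by rewrite lerDr.
by rewrite subr0; lra.
Qed.

End exhaustion.

(** * The norms of T^p and V *)

Section power_integrals.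
Context d (T : measurableType d) (R : realType) (mu : {measure set T -> \bar R}).
Local Open Scope ereal_scope.
Implicit Types (D : set T) (f g : T -> R) (p q : R).

(** The [p]-th power of the L^p norm, which unlike the norm is an integral: it is
    additive in the domain and obeys monotone convergence. *)
Definition pint p D f : \bar R := \int[mu]_(z in D) (`|f z| `^ p)%:E.

Lemma pint_ge0 p D f : 0 <= pint p D f.
Proof. by apply: integral_ge0 => z _; rewrite lee_fin powR_ge0. Qed.

Lemma measurable_pow D f p : measurable_fun D f ->
  measurable_fun D (fun z => (`|f z| `^ p)%:E).
Proof.
move=> mf; apply/measurable_EFinP.
apply: (measurableT_comp (measurable_powR p)).
exact: measurableT_comp.
Qed.

Lemma Lnorm_pint p D f : p != 0%R ->
  'N[mu]_(p%:E)[EFin \o (f \_ D)] = pint p D f `^ p^-1.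
Proof.
move=> p0; rewrite unlock /pint [in RHS]integral_mkcond; congr (_ `^ _).
apply: eq_integral => z _ /=; rewrite !patchE; case: ifPn => // _.
by rewrite normr0 powR0.
Qed.

Lemma le_pint p D E f : measurable D -> measurable E -> D `<=` E ->
  measurable_fun E f -> pint p D f <= pint p E f.
Proof.
move=> mD mE DE mf; by apply: ge0_subset_integral => //; exact: measurable_pow.
Qed.

Lemma hoelder_on D f g p q : measurable D -> measurable_fun D f ->
  measurable_fun D g -> (0 < p)%R -> (0 < q)%R -> (p^-1 + q^-1 = 1)%R ->
  \int[mu]_(z in D) `|f z * g z|%:E <= pint p D f `^ p^-1 * pint q D g `^ q^-1.
Proof.
move=> mD mf mg p0 q0 pq.
rewrite -!Lnorm_pint ?gt_eqF//.
apply: le_trans (hoelder mu _ _ p0 q0 pq); last 2 first.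
  exact/(measurable_restrictT _ _).1.
  exact/(measurable_restrictT _ _).1.
rewrite Lnorm1 [leLHS]integral_mkcond le_eqVlt; apply/orP; left; apply/eqP.
apply: eq_integral => z _ /=; rewrite !patchE; case: ifPn => //= _.
by rewrite mul0r normr0.
Qed.

Lemma poweR_le (x y : \bar R) p : (0 <= p)%R -> 0 <= x -> x <= y -> x `^ p <= y `^ p.
Proof.
move=> p0 x0 xy; apply: gt0_ler_poweR => //; rewrite in_itv/= leey andbT//.
exact: le_trans xy.
Qed.

Lemma poweRVK (x : \bar R) p : p != 0%R -> 0 <= x -> (x `^ p^-1) `^ p = x.
Proof. by move=> p0 x0; rewrite -poweRrM mulVf// poweRe1. Qed.

Lemma poweRK (x : \bar R) p : p != 0%R -> 0 <= x -> (x `^ p) `^ p^-1 = x.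
Proof. by move=> p0 x0; rewrite -poweRrM mulfV// poweRe1. Qed.

Lemma conjugate_exponents p q : (1 < p)%R -> (p^-1 + q^-1 = 1)%R ->
  [/\ (1 < q)%R, ((q - 1) * p = q)%R & ((p - 1) * q = p)%R].
Proof.
move=> p1 pq; have p0 : (0 < p)%R by rewrite (lt_trans _ p1).
have qE : (q^-1 = (p - 1) / p)%R by rewrite mulrBl divff ?gt_eqF// mul1r -pq addrAC subrr add0r.
have {}qE : (q = p / (p - 1))%R by rewrite -[LHS]invrK qE invf_div.
have p10 : (0 < p - 1)%R by rewrite subr_gt0.
rewrite qE; split; first by rewrite ltr_pdivlMr// mul1r ltrBlDr ltrDl.
  by field; rewrite gt_eqF.
by field; rewrite gt_eqF.
Qed.

Lemma norm_le1_pow (x p : R) : (1 <= p)%R -> (`|x| <= 1 + `|x| `^ p)%R.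
Proof.
move=> p1; have [x1|x1] := leP `|x|%R 1%R; first by rewrite (le_trans x1)// lerDl powR_ge0.
by rewrite (le_trans (le1r_powR (ltW x1) p1))// lerDr.
Qed.

End power_integrals.
Arguments pint {d T R} mu p D f.

Section tent_spaces.
Context (R : realType) (n : nat) (K : set 'rV[R]_n).
Hypothesis hK : symmetric_convex_body K.
Local Open Scope ereal_scope.
Local Notation hs := (@half_space R n : set (mhalf R n)).
Local Notation mu := (dxdt R n).
Local Notation dx := (dx R n).
Implicit Types (f g h k a : half R n -> R) (p q : R).

Let mhs : measurable hs := @measurable_half_space R n.

Lemma dxdt_compact_fin (Q : set (half R n)) : compact Q -> mu Q < +oo.
Proof.
move=> cQ; have [M [_ QM]] := compact_bounded cQ.
pose m := (`|M| + 1)%R; have m0 : (0 <= m)%R by rewrite addr_ge0.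
have {}QM z : Q z -> (`|z| <= m)%R.
  by apply: QM; rewrite (le_lt_trans (ler_norm _))// ltrDl.
apply: (@le_lt_trans _ _ (mu (@cube R n m `*` `[(- m)%R, m]%classic))).
  apply: le_measure; rewrite ?inE//; first exact: compact_measurable_half.
    by apply: measurableX => //; exact: measurable_cube.
  move=> [x t] /QM; rewrite prod_normE ge_max/= => /andP[xm tm]; split => /=.
    by move=> i; rewrite (le_trans (coord_le_norm _ _)).
  by rewrite in_itv/= -ler_norml.
have -> : mu (@cube R n m `*` `[(- m)%R, m]%classic) =
    dx (@cube R n m) * @lebesgue_measure R `[(- m)%R, m]%classic.
  by apply: product_measure1E => //; exact: measurable_cube.
by rewrite dx_cube// lebesgue_centered_itv// -EFinM ltry.
Qed.

Lemma T_areaE p k x : p != 0%R -> T_area K p k x = pint mu p (cone K x) k `^ p^-1.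
Proof. by move=> p0; rewrite /T_area /Lp_norm_on Lnorm_pint. Qed.

Lemma Lp_norm_onE p D f : p != 0%R -> Lp_norm_on p D f = pint mu p D f `^ p^-1.
Proof. by move=> p0; rewrite /Lp_norm_on Lnorm_pint. Qed.

Lemma T_norm_ge0 p k : 0 <= T_norm K p k.
Proof.
apply: ess_sup_gee; last by apply: nearW => x; exact: Lnorm_ge0.
apply: (@lt_le_trans _ _ (dx (@cube R n 1))).
  by rewrite dx_cube// lte_fin exprn_gt0// mulr_gt0.
by apply: le_measure; rewrite ?inE//; exact: measurable_cube.
Qed.

(** The weights with which the cones are averaged. Domination instead of equality
    admits signed densities and indicators of compact sets. *)
Definition tent_weight h := measurable_fun hs h /\
  exists g : 'rV[R]_n -> \bar R, [/\ measurable_fun setT g, forall x, 0 <= g x,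
    \int[dx]_x g x <= 1 & forall z, half_space z -> `|h z|%:E <= ball_integral K g z].

Lemma tent_weight_le1 h z : tent_weight h -> half_space z -> (`|h z| <= 1)%R.
Proof.
move=> [_ [g [mg g0 g1 hg]]] /hg; rewrite -lee_fin => /le_trans; apply.
exact: le_trans (ball_integral_le hK z mg g0) g1.
Qed.

(** The [p]-th power of the area function is an integral over a cone, to which
    [tent_le_ess_sup] applies. *)
Lemma tent_weight_pint p k h : (1 <= p)%R -> measurable_fun hs k -> tent_weight h ->
  \int[mu]_(z in hs) ((`|k z| `^ p)%:E * `|h z|%:E) <= T_norm K p k `^ p.
Proof.
move=> p1 mk [mh [g [mg g0 g1 hg]]]; have p0 : (0 < p)%R by rewrite (lt_le_trans _ p1).
apply: (@le_trans _ _ (\int[mu]_(z in hs) ((`|k z| `^ p)%:E * ball_integral K g z))).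
  apply: ge0_le_integral => //.
  - apply: emeasurable_funM; first exact: measurable_pow.
    by apply/measurable_EFinP; exact: measurableT_comp.
  - apply: emeasurable_funM; first exact: measurable_pow.
    by apply: measurable_funTS; exact: measurable_ball_integral.
  - by move=> z hz; rewrite lee_wpmul2l ?lee_fin ?powR_ge0//; exact: hg.
apply: (tent_le_ess_sup hK (sigma_finite_dxdt R n)) => //.
- exact: measurable_pow.
- exact: poweR_ge0.
have := ess_sup_ge dx (T_area K p k); apply: filterS => x.
rewrite T_areaE ?gt_eqF// => hx.
rewrite -[leLHS](@poweRVK _ _ p) ?gt_eqF ?pint_ge0//.
by apply: poweR_le; [exact: ltW|exact: poweR_ge0|exact: hx].
Qed.

(** Hoelder, with [h `^ p <= h] because a weight is at most 1. *)
Lemma tent_weight_hoelder p q a h k : (1 < p)%R -> (p^-1 + q^-1 = 1)%R ->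
  measurable_fun hs a -> tent_weight h -> measurable_fun hs k ->
  \int[mu]_(z in hs) `|a z * h z * k z|%:E <= Lp_norm_on q hs a * T_norm K p k.
Proof.
move=> p1 pq ma th mk; have [q1 _ _] := conjugate_exponents p1 pq.
have p0 : (0 < p)%R by rewrite (lt_trans _ p1).
have q0 : (0 < q)%R by rewrite (lt_trans _ q1).
have mh : measurable_fun hs h by case: th.
under eq_integral do rewrite -mulrA.
apply: le_trans (hoelder_on mu mhs ma (measurable_funM mh mk) q0 p0 _) _.
  by rewrite addrC.
rewrite Lp_norm_onE ?gt_eqF// lee_wpmul2l ?poweR_ge0//.
rewrite -[leRHS](@poweRK _ _ p) ?gt_eqF ?T_norm_ge0//.
apply: poweR_le; rewrite ?invr_ge0 ?(ltW p0) ?pint_ge0//.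
apply: le_trans (tent_weight_pint (ltW p1) mk th).
apply: ge0_le_integral => //.
- by apply: measurable_pow; exact: measurable_funM.
- apply: emeasurable_funM; first exact: measurable_pow.
  by apply/measurable_EFinP; exact: measurableT_comp.
- move=> z hz; rewrite -EFinM lee_fin normrM powRM// mulrC ler_wpM2l ?powR_ge0//.
  have [->|h0] := eqVneq (h z) 0%R; first by rewrite normr0 powR0 ?gt_eqF.
  by apply: ge1r_powR (ltW p1); rewrite normr_gt0 h0 (tent_weight_le1 th).
Qed.

Lemma V_norm_le p f (m : \bar R) :
  (forall k, T_space K p k -> T_norm K p k <= 1 ->
    \int[mu]_(z in hs) `|f z * k z|%:E <= m) -> V_norm K p f <= m.
Proof. by move=> h; apply: ge_ereal_sup => _ [k [Tk k1] <-]; exact: h. Qed.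

Lemma le_V_norm p f k : T_space K p k -> T_norm K p k <= 1 ->
  \int[mu]_(z in hs) `|f z * k z|%:E <= V_norm K p f.
Proof. by move=> Tk k1; apply: ereal_sup_ubound; exists k. Qed.

Lemma V_norm_ge0 p f : (1 < p)%R -> 0 <= V_norm K p f.
Proof.
move=> p1; have p0 : p != 0%R by rewrite gt_eqF// (lt_trans _ p1).
have E D r : r != 0%R -> @Lp_norm_on R n r D (cst 0%R) = 0.
  move=> r0; rewrite Lp_norm_onE// /pint.
  under eq_integral do rewrite /= normr0 powR0//.
  by rewrite integral0 poweR0r// invr_eq0.
have N0 : T_norm K p (cst 0%R) <= 0.
  by apply/ess_supP; apply: nearW => x; rewrite /T_area E.
apply: le_trans (@le_V_norm p f (cst 0%R) _ _).
- exact: integral_ge0.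
- split; last by rewrite (le_lt_trans N0)// ltry.
  by split => [|Q _ _]; [exact: measurable_cst|rewrite E ?oner_eq0].
- exact: le_trans N0 _.
Qed.

Lemma V_norm_weight p q a h : (1 < p)%R -> (p^-1 + q^-1 = 1)%R ->
  measurable_fun hs a -> tent_weight h ->
  V_norm K p (fun z => a z * h z)%R <= Lp_norm_on q hs a.
Proof.
move=> p1 pq ma th; apply: V_norm_le => k [[mk _] _] k1.
apply: le_trans (tent_weight_hoelder p1 pq ma th mk) _.
by rewrite -[leRHS]mule1 lee_wpmul2l// /Lp_norm_on Lnorm_ge0.
Qed.

Lemma T_norm_le_Lp p k : (1 < p)%R -> measurable_fun hs k ->
  T_norm K p k <= Lp_norm_on p hs k.
Proof.
move=> p1 mk; have p0 : (0 < p)%R by rewrite (lt_trans _ p1).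
apply/ess_supP; apply: nearW => x.
rewrite T_areaE ?gt_eqF// Lp_norm_onE ?gt_eqF//.
apply: poweR_le; rewrite ?invr_ge0 ?(ltW p0) ?pint_ge0//.
by apply: le_pint => //; [exact: measurable_cone|exact: cone_half].
Qed.

Lemma Lp_loc1_of p k : (1 < p)%R -> measurable_fun hs k ->
  (forall Q, compact Q -> Q `<=` @half_space R n -> pint mu p Q k < +oo) ->
  Lp_loc 1 k.
Proof.
move=> p1 mk hk; split => // Q cQ Qh.
have mQ : measurable (Q : set (mhalf R n)) by exact: compact_measurable_half.
have mkQ : measurable_fun (Q : set (mhalf R n)) k by exact: measurable_funS mk.
rewrite Lp_norm_onE ?oner_eq0// invr1 poweRe1 ?pint_ge0//.
apply: (@le_lt_trans _ _ (\int[mu]_(z in Q) (1 + (`|k z| `^ p)%:E))).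
  apply: ge0_le_integral => //.
  - exact: measurable_pow.
  - by apply: emeasurable_funD => //; exact: measurable_pow.
  - by move=> z _; rewrite -EFinD lee_fin powRr1// norm_le1_pow// ltW.
rewrite ge0_integralD//.
- by rewrite integral_cst// mul1e lte_add_pinfty//; [exact: dxdt_compact_fin|exact: hk].
- exact: measurable_pow.
Qed.

(** By duality in L^p, because the unit ball of L^p lies in that of T^p. The test
    functions are the normalized powers [|f| `^ (q - 1)], cut to sets where [f] is
    bounded. *)
Lemma Lp_le_V_norm p q f : (1 < p)%R -> (p^-1 + q^-1 = 1)%R ->
  measurable_fun hs f -> Lp_norm_on q hs f <= V_norm K p f.
Proof.
move=> p1 pq mf; have [q1 qp _] := conjugate_exponents p1 pq.
have p0 : (0 < p)%R by rewrite (lt_trans _ p1).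
have q0 : (0 < q)%R by rewrite (lt_trans _ q1).
have mS (k : nat) : measurable (sublevel f k) by exact: measurable_sublevel.
have mfe (k : nat) : measurable_fun (sublevel f k) f.
  by apply: measurable_funS mf => //; exact: sublevel_half.
have fin (k : nat) : pint mu q (sublevel f k) f < +oo.
  apply: (@le_lt_trans _ _ (\int[mu]_(z in sublevel f k) (k%:R `^ q)%:E)).
    apply: ge0_le_integral => //; first exact: measurable_pow.
    by move=> z [_ fk]; rewrite lee_fin ge0_ler_powR// ?nnegrE// ltW.
  rewrite integral_cst// lte_mul_pinfty ?lee_fin ?powR_ge0//.
  apply: le_lt_trans (dxdt_compact_fin (@exh_compact R n k)).
  by apply: le_measure; rewrite ?inE//; [exact: measurable_exh|move=> z []].
have main (k : nat) : pint mu q (sublevel f k) f `^ q^-1 <= V_norm K p f.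
  have [->|F0] := eqVneq (pint mu q (sublevel f k) f) 0.
    by rewrite poweR0r ?invr_eq0 ?gt_eqF// V_norm_ge0.
  have [F FE] : exists F, pint mu q (sublevel f k) f = F%:E.
    by exists (fine (pint mu q (sublevel f k) f)); rewrite fineK// ge0_fin_numE// pint_ge0.
  have {}F0 : (0 < F)%R by rewrite -lte_fin -FE lt0e F0 pint_ge0.
  pose c := (F `^ p^-1)%R; have c0 : (0 < c)%R by rewrite powR_gt0.
  pose G := (fun z => c^-1 * `|f z| `^ (q - 1))%R.
  pose g := (G \_ (sublevel f k))%R.
  have mG : measurable_fun (sublevel f k) G.
    apply: measurable_funM => //; apply: (measurableT_comp (measurable_powR _)).
    exact: measurableT_comp.
  have mg : measurable_fun hs g.
    apply: measurable_funTS; apply/(measurable_restrictT _ _).1 => //.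
  have G0 z : (0 <= G z)%R by rewrite mulr_ge0 ?powR_ge0// invr_ge0 ltW.
  have gp D : measurable D -> pint mu p D g <= 1.
    move=> mD.
    have -> : 1 = pint mu p (sublevel f k) G :> \bar R.
      rewrite /pint; under eq_integral do
        rewrite ger0_norm// powRM ?powR_ge0 ?invr_ge0 ?(ltW c0)// -powRrM qp EFinM.
      rewrite ge0_integralZl//; last 2 first.
      - exact: measurable_pow.
      - by rewrite lee_fin powR_ge0.
      rewrite -/(pint mu q (sublevel f k) f) FE -EFinM -powR_inv1 ?(ltW c0)//.
      rewrite (powRAC c (-1)%R p) /c -(powRrM F) mulVf ?gt_eqF// powRr1 ?(ltW F0)//.
      by rewrite powR_inv1 ?(ltW F0)// mulVf ?gt_eqF.
    rewrite /pint integral_mkcond [leRHS]integral_mkcond; apply: ge0_le_integral => //.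
    - by move=> z _; rewrite patchE; case: ifP => // _; rewrite lee_fin powR_ge0.
    - apply/(measurable_restrictT _ _).1 => //; apply: measurable_pow.
      apply: measurable_funTS; apply/(measurable_restrictT _ _).1 => //.
    - apply/(measurable_restrictT _ _).1 => //; exact: measurable_pow.
    - move=> z _; rewrite !patchE; case: ifP => _; last first.
        by case: ifP => // _; rewrite lee_fin powR_ge0.
      rewrite /g patchE; case: ifP => //=.
      by rewrite normr0 powR0// gt_eqF.
  have Tg : T_norm K p g <= 1.
    apply: le_trans (T_norm_le_Lp p1 mg) _.
    rewrite Lp_norm_onE ?gt_eqF// -[leRHS](poweR1r p^-1).
    by apply: poweR_le; rewrite ?invr_ge0 ?(ltW p0) ?pint_ge0 ?gp.
  have Tsg : T_space K p g.
    split; last by rewrite (le_lt_trans Tg) ?ltry.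
    apply: (Lp_loc1_of p1 mg) => Q cQ _.
    by rewrite (le_lt_trans (gp _ (compact_measurable_half cQ))) ?ltry.
  apply: le_trans (le_V_norm f Tsg Tg).
  have -> : \int[mu]_(z in hs) `|f z * g z|%:E = (c^-1)%:E * pint mu q (sublevel f k) f.
    rewrite /pint -ge0_integralZl//; last 2 first.
    - exact: measurable_pow.
    - by rewrite lee_fin invr_ge0 ltW.
    rewrite [LHS]integral_mkcond [RHS]integral_mkcond; apply: eq_integral => z _.
    rewrite !patchE /g patchE; have [ze|ze] := boolP (z \in sublevel f k).
      rewrite mem_set; last by apply: (@sublevel_half _ _ f k); exact/set_mem.
      rewrite -EFinM normrM (ger0_norm (G0 z)) /G mulrCA; congr (_ * _)%:E.
      by rewrite mulr_powRB1.
    by case: ifP => // _; rewrite mulr0 normr0.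
  rewrite FE -EFinM lee_fin /c -powRN -[X in (_ <= _ * X)%R]powRr1 ?(ltW F0)// -powRD; last first.
    by apply/implyP => _; rewrite gt_eqF.
  by rewrite (_ : q^-1 = - p^-1 + 1)%R// -pq; ring.
rewrite Lp_norm_onE ?gt_eqF// -[leRHS](@poweRK _ _ q) ?gt_eqF ?V_norm_ge0//.
apply: poweR_le; rewrite ?invr_ge0 ?(ltW q0) ?pint_ge0//.
have cv : pint mu q (sublevel f k) f @[k --> \oo] --> pint mu q hs f.
  have -> : pint mu q hs f = pint mu q (\bigcup_k sublevel f k) f by rewrite sublevel_bigcup.
  apply: ge0_nondecreasing_set_cvg_integral.
  - exact: sublevel_nd.
  - exact: mS.
  - by move=> i; exact: measurable_pow.
  - by move=> i z _; rewrite lee_fin powR_ge0.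
rewrite -(cvg_lim _ cv)//; apply: lime_le; first by apply: cvgP cv.
apply: nearW => k; rewrite -[leLHS](@poweRVK _ _ q) ?gt_eqF ?pint_ge0//.
by apply: poweR_le; rewrite ?poweR_ge0 ?main// ltW.
Qed.

End tent_spaces.

Section V_norm_theory.
Context (R : realType) (n : nat) (K : set 'rV[R]_n).
Hypothesis hK : symmetric_convex_body K.
Local Open Scope ereal_scope.
Local Notation hs := (@half_space R n : set (mhalf R n)).
Local Notation mu := (dxdt R n).
Local Notation dx := (dx R n).
Implicit Types (f g h k a : half R n -> R) (p q : R).

Let mhs : measurable hs := @measurable_half_space R n.

Let mabs f : measurable_fun hs f -> measurable_fun hs (fun z => `|f z|%:E).
Proof. by move=> mf; apply/measurable_EFinP; exact: measurableT_comp. Qed.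

Lemma eq_V_norm p f h : (forall z, half_space z -> f z = h z) ->
  V_norm K p f = V_norm K p h.
Proof.
move=> fh; congr ereal_sup; apply/seteqP; split => _ [k Tk <-]; exists k => //;
  by apply: eq_integral => z; rewrite inE => /fh ->.
Qed.

Lemma V_normD p f h : measurable_fun hs f -> measurable_fun hs h ->
  V_norm K p (f \+ h)%R <= V_norm K p f + V_norm K p h.
Proof.
move=> mf mh; apply: V_norm_le => k Tk k1.
have mk : measurable_fun hs k by case: Tk => -[].
apply: le_trans (leeD (le_V_norm f Tk k1) (le_V_norm h Tk k1)).
rewrite -ge0_integralD//; last 2 first.
- by apply: mabs; exact: measurable_funM.
- by apply: mabs; exact: measurable_funM.
apply: ge0_le_integral => //.
- by apply: mabs; apply: measurable_funM => //; exact: measurable_funD.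
- by apply: emeasurable_funD; apply: mabs; exact: measurable_funM.
- by move=> z _; rewrite -EFinD lee_fin /= mulrDl ler_normD.
Qed.

Lemma V_normZ p (c : R) f : (1 < p)%R -> measurable_fun hs f ->
  V_norm K p (c \*o f)%R = `|c|%:E * V_norm K p f.
Proof.
move=> p1.
have le (d : R) g : measurable_fun hs g -> V_norm K p (d \*o g)%R <= `|d|%:E * V_norm K p g.
  move=> mg; apply: V_norm_le => k Tk k1.
  have mk : measurable_fun hs k by case: Tk => -[].
  rewrite (_ : (fun z => _) = (fun z => `|d|%:E * `|g z * k z|%:E)); last first.
    by apply/funext => z; rewrite /= -mulrA normrM EFinM.
  rewrite ge0_integralZl//; last by apply: mabs; exact: measurable_funM.
  by rewrite lee_wpmul2l// le_V_norm.
move=> mf; apply/eqP; rewrite eq_le le//=.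
have [->|c0] := eqVneq c 0%R; first by rewrite normr0 mul0e V_norm_ge0.
have c'0 : (0 < `|c|)%R by rewrite normr_gt0.
rewrite -lee_pdivlMl//.
have -> : V_norm K p f = V_norm K p (c^-1 \*o (c \*o f))%R.
  by apply: eq_V_norm => z _ /=; rewrite mulrA mulVf// mul1r.
by rewrite -normfV; apply: le; exact: measurable_funM.
Qed.

Lemma V_normN p f : V_norm K p (\- f)%R = V_norm K p f.
Proof.
congr ereal_sup; apply/seteqP; split => _ [k Tk <-]; exists k => //;
  by apply: eq_integral => z _; rewrite mulNr normrN.
Qed.

Lemma V_normB p f h : V_norm K p (f \- h)%R = V_norm K p (h \- f)%R.
Proof. by rewrite -V_normN; apply: eq_V_norm => z _ /=; rewrite opprB. Qed.

Lemma T_normZ p (c : R) k : (1 < p)%R -> measurable_fun hs k ->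
  T_norm K p (fun z => c * k z)%R = `|c|%:E * T_norm K p k.
Proof.
move=> p1; have p0 : (0 < p)%R by rewrite (lt_trans _ p1).
have le (d : R) g : measurable_fun hs g ->
    T_norm K p (fun z => d * g z)%R <= `|d|%:E * T_norm K p g.
  move=> mg; apply/ess_supP; have := ess_sup_ge dx (T_area K p g).
  apply: filterS => x hx.
  rewrite T_areaE ?gt_eqF//; rewrite T_areaE ?gt_eqF// in hx.
  rewrite /pint; under eq_integral do rewrite normrM powRM// EFinM.
  rewrite ge0_integralZl//; last 2 first.
  - exact: measurable_cone.
  - apply: measurable_pow; apply: measurable_funS mg => //; exact: cone_half.
  rewrite poweRM ?pint_ge0 ?lee_fin ?powR_ge0// poweR_EFin -powRrM mulfV ?gt_eqF//.
  by rewrite powRr1// lee_wpmul2l.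
move=> mk; apply/eqP; rewrite eq_le le//=.
have [->|c0] := eqVneq c 0%R; first by rewrite normr0 mul0e T_norm_ge0.
have c'0 : (0 < `|c|)%R by rewrite normr_gt0.
rewrite -lee_pdivlMl//.
rewrite {1}(_ : k = (fun z => c^-1 * (c * k z))%R); last first.
  by apply/funext => z /=; rewrite mulrA mulVf// mul1r.
by rewrite -normfV; apply: (le _ (fun z => c * k z)%R); exact: measurable_funM.
Qed.

Lemma T_spaceZ p (c : R) k : (1 < p)%R -> T_space K p k ->
  T_space K p (fun z => c * k z)%R.
Proof.
move=> p1 [[mk lk] kfin]; split; last first.
  rewrite T_normZ//; move: kfin; case: (T_norm K p k) (T_norm_ge0 K p k) => //= r _ _.
  by rewrite -EFinM ltry.
split => [|Q cQ Qh]; first exact: measurable_funM.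
have E (f : half R n -> R) : Lp_norm_on 1 Q f = pint mu 1 Q f.
  by rewrite Lp_norm_onE ?oner_eq0// invr1 poweRe1 ?pint_ge0.
have := lk Q cQ Qh; rewrite !E {E}/pint.
under [X in _ -> X < _]eq_integral do rewrite normrM powRM// EFinM.
rewrite ge0_integralZl//; last 2 first.
- exact: compact_measurable_half.
- by apply: measurable_pow; apply: measurable_funS mk.
have := pint_ge0 mu 1 Q k; rewrite /pint; case: (\int[_]_(x in _) _) => //= r _ _.
by rewrite -EFinM ltry.
Qed.

(** By homogeneity in the second factor. If [T_norm K p k] vanishes, all multiples
    of [k] are admissible, and the integral vanishes as well. *)
Lemma V_pair p f k : (1 < p)%R -> measurable_fun hs f -> V_norm K p f < +oo ->
  T_space K p k ->
  \int[mu]_(z in hs) `|f z * k z|%:E <= V_norm K p f * T_norm K p k.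
Proof.
move=> p1 mf Vf Tk; have mk : measurable_fun hs k by case: Tk => -[].
have [v vE] : exists v, V_norm K p f = v%:E.
  by exists (fine (V_norm K p f)); rewrite fineK// ge0_fin_numE// V_norm_ge0.
have [t tE] : exists t, T_norm K p k = t%:E.
  by exists (fine (T_norm K p k)); rewrite fineK// ge0_fin_numE ?T_norm_ge0//; case: Tk.
have t0 : (0 <= t)%R by rewrite -lee_fin -tE T_norm_ge0.
have v0 : (0 <= v)%R by rewrite -lee_fin -vE V_norm_ge0.
have scale (c : R) : (0 < c)%R -> (c * t <= 1)%R ->
    c%:E * \int[mu]_(z in hs) `|f z * k z|%:E <= v%:E.
  move=> c0 ct; rewrite -vE.
  have Tc := T_spaceZ c p1 Tk.
  apply: le_trans (le_V_norm f Tc _); last first.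
    by rewrite T_normZ// tE gtr0_norm// -EFinM lee_fin.
  rewrite -ge0_integralZl//; last 2 first.
  - by apply: mabs; exact: measurable_funM.
  - by rewrite lee_fin ltW.
  rewrite le_eqVlt; apply/orP; left; apply/eqP; apply: eq_integral => z _.
  by rewrite mulrCA [in RHS]normrM gtr0_norm.
rewrite vE tE; have [tp|] := ltP 0%R t.
  rewrite muleC -lee_pdivrMl//; apply: scale; rewrite ?invr_gt0// mulVf ?gt_eqF//.
move=> tn; have {tn tE}t0' : t = 0%R by apply/eqP; rewrite eq_le tn t0.
rewrite t0' mule0; rewrite leNgt; apply/negP => I0.
have [i iE] : exists i, \int[mu]_(z in hs) `|f z * k z|%:E = i%:E.
  exists (fine (\int[mu]_(z in hs) `|f z * k z|%:E)); rewrite fineK//.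
  rewrite ge0_fin_numE ?ltW//; have := @scale 1%R ltr01; rewrite mul1e t0' mulr0.
  by move=> /(_ ler01) /le_lt_trans; apply; rewrite ltry.
rewrite iE lte_fin in I0.
have := @scale ((v + 1) / i)%R; rewrite t0' mulr0 ler01 iE -EFinM lee_fin.
rewrite divfK ?gt_eqF// divr_gt0 ?ltr_wpDl// => /(_ isT isT).
by move=> ?; lra.
Qed.

Lemma V_norm_sum p (F : (half R n -> R)^nat) f : measurable_fun hs f ->
  (forall i, measurable_fun hs (F i)) ->
  (forall z, half_space z -> `|f z|%:E <= \sum_(i <oo) `|F i z|%:E) ->
  V_norm K p f <= \sum_(i <oo) V_norm K p (F i).
Proof.
move=> mf mF fF; apply: V_norm_le => k Tk k1.
have mk : measurable_fun hs k by case: Tk => -[].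
apply: (@le_trans _ _ (\int[mu]_(z in hs) \sum_(i <oo) `|F i z * k z|%:E)).
  apply: ge0_le_integral => //.
  - by apply: mabs; exact: measurable_funM.
  - apply: ge0_emeasurable_sum => // i _; apply: mabs; exact: measurable_funM.
  - move=> z hz; rewrite normrM EFinM.
    under eq_eseriesr do rewrite normrM EFinM muleC.
    rewrite nneseriesZl//.
    by rewrite muleC lee_wpmul2l// fF.
rewrite integral_nneseries//; last by move=> i; apply: mabs; exact: measurable_funM.
by apply: lee_nneseries => *; [exact: integral_ge0|exact: le_V_norm].
Qed.

(** By [compact_avg_lower]. This weight compares the norms of V and T^p with those
    of L^q and L^p on functions supported in a compact set. *)
Lemma compact_weight (Q : set (half R n)) : compact Q -> Q `<=` @half_space R n ->
  exists2 c : R, (0 < c)%R & tent_weight K (fun z => c * \1_Q z)%R.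
Proof.
move=> cQ Qh; have [[r c]/= [r0 c0] h] := compact_avg_lower hK cQ Qh.
have mQ := compact_measurable_half cQ.
exists c => //; split.
  by apply: measurable_funM => //; exact: measurable_indic.
exists (EFin \o avg K 0 r); split.
- by apply/measurable_EFinP; exact: measurable_avg.
- by move=> x; rewrite lee_fin; exact: avg_ge0.
- by rewrite integral_avg.
- move=> z _; have [zQ|zQ] := pselect (Q z).
    by rewrite indicE mem_set// mulr1 gtr0_norm//; exact: h.
  rewrite indicE memNset// mulr0 normr0.
  by apply: ball_integral_ge0 => x; rewrite lee_fin; exact: avg_ge0.
Qed.

Lemma V_norm_compact (Q : set (half R n)) : compact Q -> Q `<=` @half_space R n ->
  exists2 c : R, (0 < c)%R & forall p q f, (1 < p)%R -> (p^-1 + q^-1 = 1)%R ->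
    measurable_fun hs f -> (forall z, half_space z -> ~ Q z -> f z = 0%R) ->
    V_norm K p f <= c%:E * Lp_norm_on q hs f.
Proof.
move=> cQ Qh; have [c c0 tc] := compact_weight cQ Qh.
exists c^-1%R; first by rewrite invr_gt0.
move=> p q f p1 pq mf f0; rewrite lee_pdivlMl//.
rewrite -[X in X%:E * _](gtr0_norm c0) -V_normZ//.
rewrite (@eq_V_norm _ _ (fun z => f z * (c * \1_Q z))%R).
  exact: V_norm_weight.
move=> z hz /=; rewrite indicE; have [zQ|zQ] := pselect (Q z).
  by rewrite mem_set// mulr1 mulrC.
by rewrite f0// mul0r mulr0.
Qed.

Lemma T_norm_compact (Q : set (half R n)) : compact Q -> Q `<=` @half_space R n ->
  exists2 c : R, (0 < c)%R & forall p k, (1 <= p)%R -> measurable_fun hs k ->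
    pint mu p Q k <= c%:E * T_norm K p k `^ p.
Proof.
move=> cQ Qh; have [c c0 tc] := compact_weight cQ Qh.
have mQ := compact_measurable_half cQ.
exists c^-1%R; first by rewrite invr_gt0.
move=> p k p1 mk; rewrite lee_pdivlMl//.
apply: le_trans (tent_weight_pint hK p1 mk tc).
rewrite /pint -ge0_integralZl//; last 2 first.
- by apply: measurable_pow; exact: measurable_funS mk.
- by rewrite lee_fin ltW.
rewrite integral_mkcond [leRHS]integral_mkcond le_eqVlt; apply/orP; left; apply/eqP.
apply: eq_integral => z _; rewrite !patchE indicE.
have [zQ|zQ] := boolP (z \in Q).
  rewrite mem_set; last by apply: Qh; exact/set_mem.
  by rewrite mulr1 (gtr0_norm c0) muleC.
by case: ifP => // _; rewrite /= mulr0 normr0 mule0.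
Qed.

(** Dominated by the ball integral of the absolute value of [g]. *)
Lemma unit_L1_weight (g : 'rV[R]_n -> R) : unit_L1 g ->
  tent_weight K (fun z => \int[dx]_(y in Kball K z.1 z.2) g y)%R.
Proof.
move=> [mg g1]; rewrite Lnorm1 in g1.
have meg : measurable_fun setT (EFin \o g) by exact/measurable_EFinP.
split.
  rewrite (_ : (fun z => _) = fine \o
     (fun z => ball_integral K (EFin \o g)^\+ z - ball_integral K (EFin \o g)^\- z)).
    apply: measurable_funTS; apply: measurableT_comp; first exact: fine_measurable.
    apply: emeasurable_funB; apply: measurable_ball_integral => //.
    - exact: measurable_funepos.
    - exact: measurable_funeneg.
  by apply/funext => z; rewrite /Rintegral/= integralE.
exists (fun y => `|g y|%:E); split => //.
- by apply/measurable_EFinP; exact: measurableT_comp.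
- by rewrite -g1.
- move=> z _; rewrite /Rintegral.
  have le : `|\int[dx]_(y in Kball K z.1 z.2) (g y)%:E| <=
      ball_integral K (fun y => `|g y|%:E) z.
    apply: le_abse_integral; first exact: measurable_Kball.
    exact: measurable_funTS.
  apply: le_trans le.
  by case: (\int[_]_(_ in _) _) => //= *; rewrite ?leey// normr0 lee_fin.
Qed.

End V_norm_theory.

(** * Approximation by continuous functions *)

Lemma cvge0P (R : realType) (u : (\bar R)^nat) : (forall k, 0 <= u k)%E ->
  (u k @[k --> \oo] --> 0)%E <->
  forall e : R, 0 < e -> exists N, forall k, (N <= k)%N -> (u k < e%:E)%E.
Proof.
move=> u0; split=> [/fine_cvgP[fin cv] e e0|h].
  have : \forall k \near \oo, (u k < e%:E)%E.
    have lt : \forall k \near \oo, `|(fine \o u) k| < e by exact: cvgr0_norm_lt.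
    near=> k; have uk : u k \is a fin_num by near: k.
    rewrite -[ltLHS]fineK// lte_fin -[ltLHS]ger0_norm ?fine_ge0//.
    by near: k.
  by move=> [N _ hN]; exists N => k; exact: hN.
apply/fine_cvgP; split.
  have [N hN] := h 1 ltr01; exists N => // k /hN uk.
  by rewrite ge0_fin_numE// (lt_trans uk)// ltry.
apply/cvgr0Pnorm_lt => e e0; have [N hN] := h e e0; exists N => // k /hN uk /=.
have fin : u k \is a fin_num by rewrite ge0_fin_numE// (lt_trans uk)// ltry.
by rewrite ger0_norm ?fine_ge0// -lte_fin fineK.
Unshelve. all: by end_near. Qed.

Section cutoffs.
Context (R : realType) (n : nat).
Implicit Types (z : half R n) (f g : half R n -> R).

Definition clamp (u : R) : R := Num.min 1 (Num.max 0 u).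

Lemma clamp_itv u : 0 <= clamp u <= 1.
Proof.
by rewrite /clamp le_min ler01 le_max lexx/= ge_min lexx.
Qed.

Lemma clamp_ge1 u : 1 <= u -> clamp u = 1.
Proof.
move=> u1; rewrite /clamp min_l// le_max u1 orbT//.
Qed.

Lemma clamp_le0 u : u <= 0 -> clamp u = 0.
Proof. by move=> u0; rewrite /clamp max_l// min_r// ler01. Qed.

Lemma continuous_clamp (T : topologicalType) (u : T -> R) : continuous u ->
  continuous (fun x => clamp (u x)).
Proof.
move=> cu x; apply: (@continuous_min _ _ (cst 1) (fun x => Num.max 0 (u x))).
  exact: cst_continuous.
by apply: (@continuous_max _ _ (cst 0) u); [exact: cst_continuous|exact: cu].
Qed.

Definition cutoff (k : nat) z : R :=
  clamp (k.+1%:R - `|z.1|) * (clamp (k.+2%:R - z.2) *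
  clamp ((z.2 - k.+2%:R^-1) * (k.+1%:R * k.+2%:R))).

Lemma cutoff_itv k z : 0 <= cutoff k z <= 1.
Proof.
have /andP[a0 a1] := clamp_itv (k.+1%:R - `|z.1|).
have /andP[b0 b1] := clamp_itv (k.+2%:R - z.2).
have /andP[c0 c1] := clamp_itv ((z.2 - k.+2%:R^-1) * (k.+1%:R * k.+2%:R)).
by rewrite /cutoff !mulr_ge0//= !mulr_ile1// mulr_ge0.
Qed.

Lemma cutoff1 k z : exh k z -> cutoff k z = 1.
Proof.
case: z => x t [/= xk]; rewrite in_itv/= => /andP[t1 t2]; rewrite /cutoff/=.
rewrite !clamp_ge1 ?mulr1//.
- rewrite -ler_pdivrMr ?mulr_gt0// lerBrDr; apply: le_trans t1.
  rewrite le_eqVlt; apply/orP; left; apply/eqP.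
  have -> : k.+2%:R = k.+1%:R + 1 :> R by rewrite natr1.
  have : 0 < k.+1%:R :> R by [].
  by move: (k.+1%:R) => a a0; field; rewrite !gt_eqF ?addr_gt0.
- have -> : k.+2%:R = k.+1%:R + 1 :> R by rewrite natr1.
  lra.
- rewrite lerBrDr -lerBrDl -natr1 addrK.
  apply/ler_addgt0Pr => e e0; rewrite ltW//; apply: norm_rV_lt.
    by rewrite ltr_wpDl.
  by move=> i; rewrite (le_lt_trans (xk i))// ltrDl.
Qed.

Lemma cutoff0 k z : ~ exh k.+1 z -> cutoff k z = 0.
Proof.
case: z => x t zk; rewrite /cutoff/=.
have [xk|xk] := leP k.+1%:R `|x|.
  by rewrite clamp_le0 ?mul0r// subr_le0.
have [tk|tk] := leP k.+2%:R t.
  by rewrite (@clamp_le0 (k.+2%:R - t)) ?mul0r ?mulr0// subr_le0.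
have [tl|tl] := leP t (k.+2%:R^-1).
  rewrite (@clamp_le0 (_ * (_ * _))) ?mulr0// mulr_le0_ge0 ?subr_le0//.
exfalso; apply: zk; split => /=; last by rewrite in_itv/= !ltW.
by move=> i; rewrite (le_trans (coord_le_norm _ _))// ltW.
Qed.

Lemma continuous_cutoff k : continuous (cutoff k).
Proof.
have A : continuous (fun z : half R n => clamp (k.+1%:R - `|z.1|)).
  have h : continuous (fun z : half R n => `|z.1|).
    move=> y; apply: (@continuous_comp _ _ _ fst (fun x : 'rV[R]_n => `|x|)); first exact: cvg_fst.
    exact: norm_continuous.
  by apply: continuous_clamp => y; exact: (cvgB (cvg_cst _) (h y)).
have B : continuous (fun z : half R n => clamp (k.+2%:R - z.2)).
  by apply: continuous_clamp => y; exact: (cvgB (cvg_cst _) cvg_snd).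
have C : continuous (fun z : half R n =>
    clamp ((z.2 - k.+2%:R^-1) * (k.+1%:R * k.+2%:R))).
  apply: continuous_clamp => y.
  exact: (cvgM (cvgB cvg_snd (cvg_cst _)) (cvg_cst _)).
move=> z; exact: (continuousM (A z) (continuousM (B z) (C z))).
Qed.

Lemma compact_sub_exh (K : set 'rV[R]_n) (Q : set (half R n)) : symmetric_convex_body K -> compact Q ->
  Q `<=` @half_space R n -> exists k, Q `<=` exh k.
Proof.
move=> hK cQ Qh; have [[rho tau]/= [_ tau0] h] := compact_half_bounds hK cQ Qh.
have [M [_ QM]] := compact_bounded cQ.
have {}QM z : Q z -> `|z| <= `|M| + 1.
  by apply: QM; rewrite (le_lt_trans (ler_norm _))// ltrDl.
exists (Num.bound (`|M| + 1 + tau^-1)); set k := Num.bound _.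
have ti : 0 < tau^-1 by rewrite invr_gt0.
have hk : `|M| + 1 + tau^-1 < k%:R.
  by apply: archi_boundP; rewrite !addr_ge0// ltW.
have kS : k%:R <= k.+1%:R :> R by rewrite ler_nat.
have M0 := normr_ge0 M.
move=> [x t] Qz; have /= [_ tt] := h _ Qz.
have := QM _ Qz; rewrite prod_normE ge_max/= => /andP[xM tM].
split => /= [i|]; first by have := coord_le_norm x i; lra.
rewrite in_itv/=; apply/andP; split; last by have := ler_norm t; lra.
apply: le_trans tt; rewrite -[leRHS]invrK lef_pV2 ?posrE//; lra.
Qed.

Lemma Cc_cutoff k f : continuous f -> Cc (fun z => f z * cutoff k z).
Proof.
move=> cf; split.
  apply: continuous_subspaceT => z; apply: continuousM; first exact: cf.
  exact: continuous_cutoff.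
exists (exh k.+1); split; [exact: exh_compact|exact: exh_half|].
by move=> z _ zk; rewrite cutoff0// mulr0.
Qed.

End cutoffs.

(** The sum counts the integers from 1 to [N.+1] that are at most [u * N.+1]: it
    rounds that number down. *)
Lemma layer_approx (R : realType) (u : R) (N : nat) : (0 <= u <= 1)%R ->
  (`|u - N.+1%:R^-1 * \sum_(j < N.+1) (j.+1%:R <= u * N.+1%:R)%R%:R| <= N.+1%:R^-1)%R.
Proof.
move=> /andP[u0 u1]; have N0 : (0 < N.+1%:R :> R)%R by [].
pose m := Num.truncn (u * N.+1%:R)%R.
have uN0 : (0 <= u * N.+1%:R)%R by rewrite mulr_ge0.
have /andP[m1 m2] := truncn_itv uN0; rewrite -/m in m1 m2.
have mN : (m <= N.+1)%N.
  by rewrite -(ler_nat R) (le_trans m1)// ler_piMl.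
have -> : (\sum_(j < N.+1) (j.+1%:R <= u * N.+1%:R)%R%:R = m%:R :> R)%R.
  transitivity ((\sum_(j < N.+1) (j < m)%N)%:R : R)%R.
    by rewrite natr_sum; apply: eq_bigr => j _; rewrite -truncn_ge_nat.
  congr (_%:R)%R; rewrite -(big_mkord xpredT (fun j => (j < m)%N : nat)).
  rewrite (big_cat_nat (leq0n m) mN)//= [X in (X + _)%N](eq_big_nat _ _ (F2 := fun=> 1%N)); last first.
    by move=> i /andP[_ ->].
  rewrite [X in (_ + X)%N](eq_big_nat _ _ (F2 := fun=> 0%N)); last first.
    by move=> i /andP[mi _]; rewrite ltnNge mi.
  by rewrite !sum_nat_const_nat muln1 muln0 addn0 subn0.
rewrite -[u in (u - _)%R](mulfK (lt0r_neq0 N0)) -(mulrC (N.+1%:R^-1)%R) -mulrBr.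
rewrite normrM gtr0_norm ?invr_gt0// ger_pMr ?invr_gt0//.
by rewrite ger0_norm ?subr_ge0// lerBlDr addrC natr1 ltW.
Qed.

Section density.
Context (R : realType) (n : nat).
Local Open Scope ereal_scope.
Local Notation hs := (@half_space R n : set (mhalf R n)).
Variable nu : {measure set (mhalf R n) -> \bar R}.
Variable Q : set (mhalf R n).
Hypothesis mQ : measurable Q.
Hypothesis finQ : nu Q < +oo.
Implicit Types (A B : set (mhalf R n)) (phi : half R n -> R).

Let dist A phi := \int[nu]_(z in Q) `|\1_A z - phi z|%:E.

(** These sets form a sigma-algebra that contains the coordinate half-spaces. *)
Let approx : set (set (mhalf R n)) := [set A | measurable A /\
  forall e : R, (0 < e)%R -> exists phi : half R n -> R,
    [/\ continuous phi, forall z, (0 <= phi z <= 1)%R & dist A phi <= e%:E]].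

Let mcont phi : continuous phi -> measurable_fun (setT : set (mhalf R n)) phi.
Proof.
move=> cphi; apply: continuous_measurable_half; first exact: openT.
exact: continuous_subspaceT.
Qed.

Let mdist A phi D : measurable A -> continuous phi ->
  measurable_fun (D : set (mhalf R n)) (fun z => `|\1_A z - phi z|%:E).
Proof.
move=> mA cphi; apply: measurable_funTS; apply/measurable_EFinP.
apply: measurableT_comp => //; apply: measurable_funB.
  exact: measurable_indic.
exact: mcont.
Qed.

Let approx_split A B C phi (psi chi : half R n -> R) : measurable A -> measurable B -> measurable C ->
  continuous phi -> continuous psi -> continuous chi ->
  (forall z, `|\1_A z - phi z| <= `|\1_B z - psi z| + `|\1_C z - chi z|)%R ->
  dist A phi <= dist B psi + dist C chi.
Proof.
move=> mA mB mC c1 c2 c3 h; rewrite /dist -ge0_integralD//; last 2 first.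
- exact: mdist.
- exact: mdist.
apply: ge0_le_integral => //.
- exact: mdist.
- by apply: emeasurable_funD; exact: mdist.
- by move=> z _; rewrite -EFinD lee_fin.
Qed.

Let approxC A : approx A -> approx (~` A).
Proof.
move=> [mA hA]; split; first exact: measurableC.
move=> e /hA[phi [cphi phi01 dphi]]; exists (fun z => 1 - phi z)%R; split.
- by move=> z; apply: continuousB; [exact: cst_continuous|exact: cphi].
- by move=> z; have /andP[] := phi01 z; rewrite subr_ge0 lerBlDr lerDl => -> ->.
rewrite (_ : dist _ _ = dist A phi)//; apply: eq_integral => z _.
rewrite !indicE in_setC; case: (z \in A) => /=; first by rewrite sub0r normrN.
by rewrite sub0r normrN opprB addrC subrK.
Qed.

Let approxU A B : approx A -> approx B -> approx (A `|` B).
Proof.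
move=> [mA hA] [mB hB]; split; first exact: measurableU.
move=> e e0; have e2 : (0 < e / 2)%R by rewrite divr_gt0.
have [phi [c1 p1 d1]] := hA _ e2; have [psi [c2 p2 d2]] := hB _ e2.
exists (fun z => Num.max (phi z) (psi z)); split.
- by move=> z; apply: continuous_max; [exact: c1|exact: c2].
- move=> z; have /andP[a b] := p1 z; have /andP[c d] := p2 z.
  by rewrite le_max a ge_max b d.
rewrite [e]splitr EFinD; apply: le_trans (leeD d1 d2).
apply: approx_split => //; first exact: measurableU.
  by move=> z; apply: continuous_max; [exact: c1|exact: c2].
move=> z; have /andP[a b] := p1 z; have /andP[c d] := p2 z.
rewrite !indicE in_setU; case: (z \in A); case: (z \in B) => /=;
  rewrite ?sub0r ?normrN; have [h|h] := leP (phi z) (psi z);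
  rewrite ?(@ger0_norm _ (1 - _)%R) ?subr_ge0// ?ger0_norm//; lra.
Qed.

Let approx0 : approx set0.
Proof.
split => // e e0; exists (cst 0%R); split; first exact: cst_continuous.
  by move=> z; rewrite lexx ler01.
rewrite /dist; under eq_integral do rewrite indic0 subr0 normr0.
by rewrite integral0 lee_fin ltW.
Qed.

Let approx_lim A (B : (set (mhalf R n))^nat) : measurable A ->
  (forall N, approx (B N)) -> (forall N, B N `<=` A) ->
  nondecreasing_seq B -> A = \bigcup_N B N -> approx A.
Proof.
move=> mA hB BA ndB AE; split => // e e0; have e2 : (0 < e / 2)%R by rewrite divr_gt0.
have mB N : measurable (B N) by case: (hB N).
have mD N : measurable (Q `&` (A `\` B N)).
  by apply: measurableI => //; exact: measurableD.
have cap0 : \bigcap_N (Q `&` (A `\` B N)) = set0.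
  apply/seteqP; split => // z zN; have [_ [Az _]] := zN 0%N I.
  by move: Az; rewrite AE => -[N _ BNz]; have [_ [_]] := zN N I.
have : nu (Q `&` (A `\` B N)) @[N --> \oo] --> 0.
  rewrite -(measure0 nu) -cap0; apply: nonincreasing_cvg_mu => //.
  - by rewrite (le_lt_trans _ finQ)// le_measure ?inE//; exact: subIsetl.
  - by rewrite cap0.
  - move=> i j ij; apply/subsetPset => z [Qz [Az Bz]]; split => //; split => //.
    by move=> /(subsetPset _ _ (ndB _ _ ij)).
move=> /cvge0P -/(_ (fun k => measure_ge0 _ _) _ e2)[N /(_ N (leqnn _)) hN].
have [phi [cphi phi01 dphi]] := (hB N).2 _ e2.
exists phi; split => //; rewrite [e]splitr EFinD.
apply: le_trans (leeD (ltW hN) dphi).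
rewrite [X in nu X + _]setIC -(@integral_indic _ _ _ nu Q mQ); last exact: measurableD.
rewrite /dist -ge0_integralD//; last 2 first.
- by apply/measurable_EFinP; apply: measurable_indic; exact: measurableD.
- exact: mdist.
apply: ge0_le_integral => //.
- exact: mdist.
- apply: emeasurable_funD; last exact: mdist.
  by apply/measurable_EFinP; apply: measurable_indic; exact: measurableD.
move=> z _; rewrite -EFinD lee_fin.
have -> : (\1_A z = \1_(A `\` B N) z + \1_(B N) z :> R)%R.
  rewrite !indicE in_setD; have [zB|zB] := boolP (z \in B N).
    by rewrite mem_set ?add0r//; apply: (BA N); exact/set_mem.
  by case: (z \in A); rewrite addr0.
by rewrite -addrA (le_trans (ler_normD _ _))// ger0_norm ?indicE// lerD2r.
Qed.

Let approx_sigma : sigma_algebra setT approx.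
Proof.
split => [|A aA|F hF]; first exact: approx0.
  by rewrite setTD; exact: approxC.
apply: (@approx_lim _ (fun N => \big[setU/set0]_(i < N) F i)).
- by apply: bigcup_measurable => k _; case: (hF k).
- elim=> [|N IH]; first by rewrite big_ord0; exact: approx0.
  by rewrite big_ord_recr/=; exact: approxU.
- by move=> N; rewrite -bigcup_mkord => z [k _ Fk]; exists k.
- by move=> i j ij; apply/subsetPset; apply: subset_bigsetU.
- apply/seteqP; split => z [k _].
    by move=> Fk; exists k.+1 => //; rewrite -bigcup_mkord; exists k => //=.
  by rewrite -bigcup_mkord => -[j _ Fj]; exists j.
Qed.

Let approx_ray (u : half R n -> R) (c : R) : continuous u ->
  approx [set z | (c < u z)%R].
Proof.
move=> cu; set A := [set z | _].
have mA : measurable A.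
  apply: open_measurable_half.
  by apply: (open_comp (f := u) (D := [set x | c < x]%R)); [move=> ? _; exact: cu|exact: open_gt].
split => // e e0; have e2 : (0 < e / 2)%R by rewrite divr_gt0.
pose B (N : nat) := Q `&` (A `&` [set z | (N%:R * (u z - c) < 1)%R]).
have mB N : measurable (B N).
  apply: measurableI => //; apply: measurableI => //; apply: open_measurable_half.
  apply: (open_comp (f := (fun z => N%:R * (u z - c))%R) (D := [set x | x < 1]%R)).
    by move=> z _; exact: (cvgM (cvg_cst _) (cvgB (cu z) (cvg_cst _))).
  exact: open_lt.
have cap0 : \bigcap_N B N = set0.
  apply/seteqP; split => // z zN; have [_ [Az _]] := zN 0%N I.
  have uc : (0 < u z - c)%R by rewrite subr_gt0.
  have [_ [_ /=]] := zN (Num.bound (u z - c)^-1) I; rewrite -ltr_pdivlMr// mul1r.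
  have ui : (0 <= (u z - c)^-1)%R by rewrite invr_ge0 ltW.
  by move=> /lt_trans/(_ (archi_boundP ui)); rewrite ltxx.
have : nu (B N) @[N --> \oo] --> 0.
  rewrite -(measure0 nu) -cap0; apply: nonincreasing_cvg_mu => //.
  - by rewrite (le_lt_trans _ finQ)// le_measure ?inE//; exact: subIsetl.
  - by rewrite cap0.
  - move=> i j ij; apply/subsetPset => z [Qz [Az Bz]]; split => //; split => //.
    move: Bz => /=; apply: le_lt_trans; rewrite ler_wpM2r ?ler_nat//.
    by rewrite subr_ge0 ltW.
move=> /cvge0P -/(_ (fun k => measure_ge0 _ _) _ e0)[N /(_ N (leqnn _)) hN].
have cphi : continuous (fun z => clamp (N%:R * (u z - c)))%R.
  apply: continuous_clamp => z.
  exact: (cvgM (cvg_cst _) (cvgB (cu z) (cvg_cst _))).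
exists (fun z => clamp (N%:R * (u z - c)))%R; split => //.
  by move=> z; exact: clamp_itv.
apply: le_trans (ltW hN).
rewrite (_ : nu (B N) = \int[nu]_(z in Q) (\1_(B N) z)%:E); last first.
  by rewrite integral_indic//; congr (nu _); rewrite setIidl//; exact: subIsetl.
apply: ge0_le_integral => //.
- exact: mdist.
- by apply/measurable_EFinP; exact: measurable_indic.
move=> z Qz; rewrite lee_fin; have [Az|Az] := pselect (A z); last first.
  rewrite (indicE _ A) memNset// clamp_le0 ?subr0 ?normr0 ?indicE//.
  by rewrite mulr_ge0_le0// subr_le0 leNgt; exact/negP.
rewrite (indicE _ A) mem_set//.
have /andP[c0 c1] := clamp_itv (N%:R * (u z - c))%R.
have [Nz|Nz] := ltP (N%:R * (u z - c))%R 1%R.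
  rewrite indicE mem_set; last by split.
  by rewrite ger0_norm ?subr_ge0// gerBl.
by rewrite clamp_ge1// subrr normr0 indicE.
Qed.

Lemma approx_indic A (e : R) : measurable A -> (0 < e)%R ->
  exists phi : half R n -> R, [/\ continuous phi, forall z, (0 <= phi z <= 1)%R &
    \int[nu]_(z in Q) `|\1_A z - phi z|%:E <= e%:E].
Proof.
move=> mA e0; suff [_ h] : approx A by exact: h.
move: A mA; apply: measurable_half_ind; first exact: approx_sigma.
  move=> i c; apply: (approx_ray (u := fun z => z.1 ord0 i)) => z.
  apply: (@continuous_comp _ _ _ fst (fun x : 'rV[R]_n => x ord0 i)); first exact: cvg_fst.
  exact: coord_continuous.
move=> c; apply: (approx_ray (u := snd)) => z; exact: cvg_snd.
Qed.

(** From indicators to bounded functions by [layer_approx]. That the bound is kept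
    turns L^1 closeness into L^q closeness. *)
Lemma approx_bounded (f : half R n -> R) (M e : R) :
  measurable_fun setT (f : mhalf R n -> R) ->
  (0 < M)%R -> (forall z, `|f z| <= M)%R -> (0 < e)%R ->
  exists phi : half R n -> R, [/\ continuous phi, forall z, (`|phi z| <= M)%R &
    \int[nu]_(z in Q) `|f z - phi z|%:E <= e%:E].
Proof.
move=> mf M0 fM e0.
pose v := fine (nu Q); have vE : nu Q = v%:E by rewrite /v fineK// ge0_fin_numE.
have v0 : (0 <= v)%R by exact: fine_ge0.
pose N := Num.bound (2 * M * v / (e / 2))%R.
have hN : (2 * M * v / N.+1%:R <= e / 2)%R.
  rewrite ler_pdivrMr// -ler_pdivrMl ?divr_gt0// mulrC ltW//.
  apply: (@lt_trans _ _ N%:R%R); last by rewrite ltr_nat.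
  by apply: archi_boundP; rewrite divr_ge0 ?mulr_ge0// ltW// divr_gt0.
pose u z := ((f z / M + 1) / 2)%R.
have u01 z : (0 <= u z <= 1)%R.
  have := fM z; rewrite ler_norml => /andP[f1 f2].
  rewrite /u divr_ge0//=; last by rewrite -lerBlDr sub0r ler_pdivlMr// mulN1r.
  rewrite ler_pdivrMr// mul1r -lerBrDr ler_pdivrMr//.
  by rewrite (_ : 2 - 1 = 1)%R ?mul1r//; ring.
have fE z : f z = (M * (2 * u z - 1))%R.
  by rewrite /u; field; rewrite gt_eqF.
have mu' : measurable_fun setT (u : mhalf R n -> R).
  by apply: measurable_funM => //; apply: measurable_funD => //; exact: measurable_funM.
pose A (j : 'I_N.+1) : set (mhalf R n) := [set z | (j.+1%:R <= u z * N.+1%:R)%R].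
have mA j : measurable (A j).
  rewrite -[X in measurable X]setTI (_ : A j =
    (fun z => u z * N.+1%:R)%R @^-1` `[j.+1%:R, +oo[%classic); last first.
    by apply/seteqP; split => z; rewrite /A/= in_itv/= andbT.
  have mg : measurable_fun setT ((fun z => u z * N.+1%:R)%R : mhalf R n -> R).
    exact: measurable_funM.
  exact: mg.
have e4 : (0 < e / (4 * M))%R by rewrite divr_gt0 ?mulr_gt0.
have /choice[phi hphi] : forall j, exists phi : half R n -> R,
    [/\ continuous phi, forall z, (0 <= phi z <= 1)%R & dist (A j) phi <= (e / (4 * M))%:E].
  by move=> j; exact: approx_indic.
pose psi z := (N.+1%:R^-1 * \sum_(j < N.+1) phi j z)%R.
have csum (r : seq 'I_N.+1) : continuous (fun z => \sum_(j <- r) phi j z)%R.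
  elim: r => [|j r IH].
    rewrite (_ : (fun z => _) = cst 0%R); first exact: cst_continuous.
    by apply/funext => z; rewrite big_nil.
  rewrite (_ : (fun z => _) = (fun z => phi j z + \sum_(i <- r) phi i z)%R).
    by move=> z; have [c _ _] := hphi j; exact: (cvgD (c z) (IH z)).
  by apply/funext => z; rewrite big_cons.
have cpsi : continuous psi by move=> z; exact: (cvgM (cvg_cst _) (csum _ z)).
have psi01 z : (0 <= psi z <= 1)%R.
  rewrite /psi mulr_ge0 ?sumr_ge0//=; last first.
    by move=> j _; have [_ /(_ z)/andP[]] := hphi j.
  rewrite ler_pdivrMl// mulr1 (@le_trans _ _ (\sum_(j < N.+1) 1)%R)//.
    by apply: ler_sum => j _; have [_ /(_ z)/andP[]] := hphi j.
  by rewrite sumr_const card_ord.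
exists (fun z => M * (2 * psi z - 1))%R; split.
- move=> z; apply: cvgM; first exact: cvg_cst.
  by apply: cvgB; [apply: cvgM; [exact: cvg_cst|exact: cpsi]|exact: cvg_cst].
- move=> z; rewrite normrM gtr0_norm// ger_pMr// ler_norml.
  have /andP[? ?] := psi01 z; lra.
have pw z : (`|f z - M * (2 * psi z - 1)| <= 2 * M / N.+1%:R +
    2 * M / N.+1%:R * \sum_(j < N.+1) `|\1_(A j) z - phi j z|)%R.
  rewrite fE (_ : (_ - _) = 2 * M * (u z - psi z))%R; last by ring.
  have M2 : (0 < 2 * M)%R by rewrite mulr_gt0.
  rewrite normrM gtr0_norm// -!mulrA -!mulrDr !ler_pM2l//.
  have := layer_approx N (u01 z); set s := (N.+1%:R^-1 * _)%R => us.
  rewrite -[(u z - psi z)%R](subrKA s) (le_trans (ler_normD _ _))// lerD//.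
  rewrite /s /psi -mulrBr normrM ger0_norm ?invr_ge0// ler_wpM2l ?invr_ge0//.
  rewrite -sumrB (le_trans (ler_norm_sum _ _ _))//; apply: ler_sum => j _.
  rewrite indicE (_ : (z \in A j) = (j.+1%:R <= u z * N.+1%:R)%R)//.
  by apply/idP/idP; rewrite inE.
apply: (@le_trans _ _ (\int[nu]_(z in Q) ((2 * M / N.+1%:R)%:E +
   (2 * M / N.+1%:R)%:E * \sum_(j < N.+1) `|\1_(A j) z - phi j z|%:E))).
  have mS : measurable_fun Q (fun z => \sum_(j < N.+1) `|\1_(A j) z - phi j z|%:E).
    by apply: emeasurable_sum => j; have [c _ _] := hphi j; exact: mdist.
  apply: ge0_le_integral => //.
  - apply: measurable_funTS; apply/measurable_EFinP; apply: measurableT_comp => //.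
    apply: measurable_funB => //; apply: measurable_funM => //.
    apply: measurable_funB => //; apply: measurable_funM => //; exact: mcont.
  - by apply: emeasurable_funD => //; exact: emeasurable_funM.
  - by move=> z _; rewrite sumEFin -EFinM -EFinD lee_fin.
have c0 : (0 <= 2 * M / N.+1%:R)%R by rewrite divr_ge0// mulr_ge0// ltW.
have S0 z : 0 <= \sum_(j < N.+1) `|\1_(A j) z - phi j z|%:E by exact: sume_ge0.
have mS : measurable_fun Q (fun z => \sum_(j < N.+1) `|\1_(A j) z - phi j z|%:E).
  by apply: emeasurable_sum => j; have [c _ _] := hphi j; exact: mdist.
rewrite ge0_integralD//; last 2 first.
- by move=> z _; rewrite mule_ge0.
- exact: emeasurable_funM.
rewrite integral_cst// ge0_integralZl//.
rewrite ge0_integral_sum//; last by move=> j; have [c _ _] := hphi j; exact: mdist.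
rewrite vE -EFinM [e]splitr EFinD; apply: leeD.
  by rewrite lee_fin (le_trans _ hN)// mulrAC.
apply: (@le_trans _ _ ((2 * M / N.+1%:R)%:E * \sum_(j < N.+1) (e / (4 * M))%:E)).
  rewrite lee_wpmul2l//; apply: lee_sum => j _; by have [_ _] := hphi j.
rewrite sumEFin sumr_const card_ord -EFinM lee_fin -mulr_natr.
rewrite le_eqVlt; apply/orP; left; apply/eqP; field.
by rewrite gt_eqF//= -natr1 natr1 pnatr_eq0.
Qed.

End density.

(** * The space U *)

Section integral_tools.
Context d (T : measurableType d) (R : realType) (mu : {measure set T -> \bar R}).
Local Open Scope ereal_scope.

Lemma integral_supp (D E : set T) (F : T -> \bar R) : D `<=` E ->
  (forall z, E z -> ~ D z -> F z = 0) ->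
  \int[mu]_(z in E) F z = \int[mu]_(z in D) F z.
Proof.
move=> DE F0; rewrite [LHS]integral_mkcond [RHS]integral_mkcond.
apply: eq_integral => z _; rewrite !patchE.
have [zD|zD] := pselect (D z); first by rewrite !mem_set//; exact: DE.
rewrite (memNset zD); case: ifPn => // /set_mem zE; exact: F0.
Qed.

Lemma integral_tail (E : set T) (S : (set T)^nat) (F : T -> \bar R) (e : R) :
  measurable E -> measurable_fun E F -> (forall z, E z -> 0 <= F z) ->
  \int[mu]_(z in E) F z < +oo ->
  (forall k, measurable (S k)) -> nondecreasing_seq S -> \bigcup_k S k = E ->
  (0 < e)%R -> exists k, \int[mu]_(z in E `\` S k) F z < e%:E.
Proof.
move=> mE mF F0 fin mS ndS SE e0.
have SkE k : S k `<=` E by rewrite -SE; exact: bigcup_sup.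
have mFk k : measurable_fun (S k) F by exact: measurable_funS mF.
have mFd k : measurable_fun (E `\` S k) F by apply: measurable_funS mF => // z [].
have split k : \int[mu]_(z in E) F z =
    \int[mu]_(z in S k) F z + \int[mu]_(z in E `\` S k) F z.
  rewrite -ge0_integral_setU//; first by rewrite setDUK.
  - exact: measurableD.
  - by rewrite setDUK.
  - by rewrite setDUK.
  - by apply/disj_setPS => z [? []].
have cv : \int[mu]_(z in S k) F z @[k --> \oo] --> \int[mu]_(z in E) F z.
  rewrite -SE; apply: ge0_nondecreasing_set_cvg_integral => //.
  by move=> k z /SkE; exact: F0.
pose I := fine (\int[mu]_(z in E) F z).
have IE : \int[mu]_(z in E) F z = I%:E.
  by rewrite /I fineK// ge0_fin_numE// integral_ge0.
rewrite IE in cv; have : \forall k \near \oo, (I - e)%:E < \int[mu]_(z in S k) F z.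
  move/fine_cvgP : cv => [fin' cv].
  have gt : \forall k \near \oo, (I - e < fine (\int[mu]_(z in S k) F z))%R.
    by apply: (cvgr_gt _ cv); rewrite ltrBlDr ltrDl.
  by near=> k; rewrite -[ltRHS]fineK ?lte_fin; near: k.
move=> [k _ /(_ k (leqnn _)) hk]; exists k.
have Sk0 : 0 <= \int[mu]_(z in S k) F z by apply: integral_ge0 => z /SkE; exact: F0.
have Dk0 : 0 <= \int[mu]_(z in E `\` S k) F z by apply: integral_ge0 => z [/F0].
have := split k; rewrite IE.
move: hk Sk0 Dk0; move: (\int[mu]_(z in S k) F z) (\int[mu]_(z in E `\` S k) F z).
move=> [s| |] [t| |]//=; rewrite ?lte_fin ?lee_fin ?ltry// => h s0 t0.
by rewrite -EFinD => -[] H; move: h; rewrite H; lra.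
Unshelve. all: by end_near. Qed.

End integral_tools.

Section U_space_theory.
Context (R : realType) (n : nat) (K : set 'rV[R]_n).
Hypothesis hK : symmetric_convex_body K.
Variables p q : R.
Hypothesis p1 : 1 < p.
Hypothesis pq : p^-1 + q^-1 = 1.
Local Open Scope ereal_scope.
Local Notation hs := (@half_space R n : set (mhalf R n)).
Local Notation mu := (dxdt R n).
Local Notation V := (V_norm K p).
Local Notation U := (U_space K p q).
Implicit Types (f g h k a : half R n -> R).

Let mhs : measurable hs := @measurable_half_space R n.
Let q1 : (1 < q)%R. Proof. by have [] := conjugate_exponents p1 pq. Qed.
Let q0 : (0 < q)%R. Proof. exact: lt_trans q1. Qed.

Lemma Lp_norm_onD r (D : set (mhalf R n)) f g : (1 <= r)%R -> measurable D ->
  measurable_fun D f -> measurable_fun D g ->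
  Lp_norm_on r D (f \+ g)%R <= Lp_norm_on r D f + Lp_norm_on r D g.
Proof.
move=> r1 mD mf mg; rewrite /Lp_norm_on.
rewrite (_ : ((f \+ g) \_ D = (f \_ D) \+ (g \_ D))%R).
  by apply: minkowski_EFin => //; exact/(measurable_restrictT _ _).1.
by apply/funext => z; rewrite /= !patchE; case: ifP => // _; rewrite addr0.
Qed.

Lemma Lp_norm_onZ r (D : set (mhalf R n)) (c : R) f : (0 < r)%R -> measurable D ->
  measurable_fun D f ->
  Lp_norm_on r D (c \*o f)%R = `|c|%:E * Lp_norm_on r D f.
Proof.
move=> r0 mD mf; rewrite !(Lp_norm_onE D) ?gt_eqF// /pint.
under eq_integral do rewrite normrM powRM// EFinM.
rewrite ge0_integralZl//; last exact: measurable_pow.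
rewrite poweRM ?lee_fin ?powR_ge0 ?pint_ge0// poweR_EFin -powRrM mulfV ?gt_eqF//.
by rewrite powRr1.
Qed.

Lemma Lp_locD f g : Lp_loc q f -> Lp_loc q g -> Lp_loc q (f \+ g)%R.
Proof.
move=> [mf lf] [mg lg]; split; first exact: measurable_funD.
move=> Q cQ Qh; have mQ := compact_measurable_half cQ.
apply: le_lt_trans (Lp_norm_onD (ltW q1) mQ _ _) _.
- exact: measurable_funS mf.
- exact: measurable_funS mg.
- by rewrite lte_add_pinfty//; [exact: lf|exact: lg].
Qed.

Lemma Lp_locZ (c : R) f : Lp_loc q f -> Lp_loc q (c \*o f)%R.
Proof.
move=> [mf lf]; split; first exact: measurable_funM.
move=> Q cQ Qh; have mQ := compact_measurable_half cQ.
rewrite Lp_norm_onZ//; last exact: measurable_funS mf.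
have := lf Q cQ Qh; have : 0 <= Lp_norm_on q Q f by exact: Lnorm_ge0.
by case: (Lp_norm_on q Q f) => //= r _ _; rewrite -EFinM ltry.
Qed.

Lemma Lp_loc_of_fin f : measurable_fun hs f -> Lp_norm_on q hs f < +oo -> Lp_loc q f.
Proof.
move=> mf fin; split => // Q cQ Qh; apply: le_lt_trans fin.
rewrite !Lp_norm_onE ?gt_eqF//; apply: poweR_le; rewrite ?invr_ge0 ?(ltW q0) ?pint_ge0//.
by apply: le_pint => //; exact: compact_measurable_half.
Qed.

Lemma Cc_measurable f : Cc f -> measurable_fun hs f.
Proof.
by move=> [cf _]; apply: continuous_measurable_half cf; exact: half_space_open.
Qed.

Lemma CcD f g : Cc f -> Cc g -> Cc (f \+ g)%R.
Proof.
move=> [cf [Q [cQ Qh f0]]] [cg [P [cP Ph g0]]]; split.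
  move: cf cg; rewrite !continuous_open_subspace; [|exact: half_space_open..].
  by move=> cf cg z zh; apply: continuousD; [exact: cf|exact: cg].
exists (Q `|` P); split; [exact: compactU|by move=> z [/Qh|/Ph]|].
by move=> z hz /not_orP[zQ zP] /=; rewrite f0// g0// addr0.
Qed.

Lemma CcZ (c : R) f : Cc f -> Cc (c \*o f)%R.
Proof.
move=> [cf [Q [cQ Qh f0]]]; split.
  move: cf; rewrite !continuous_open_subspace; [|exact: half_space_open..].
  by move=> cf z zh; apply: continuousM; [exact: cst_continuous|exact: cf].
by exists Q; split => // z hz zQ /=; rewrite f0// mulr0.
Qed.

Lemma Cc_bounded f : Cc f -> exists2 M : R, (0 < M)%R &
  forall z, half_space z -> (`|f z| <= M)%R.
Proof.
move=> [cf [Q [cQ Qh f0]]].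
have cfQ : {within Q, continuous f} by exact: continuous_subspaceW cf.
have [M [_ hM]] := compact_bounded (continuous_compact cfQ cQ).
exists (`|M| + 1)%R => [|z hz]; first by rewrite ltr_wpDl.
have [zQ|zQ] := pselect (Q z); last by rewrite f0// normr0 addr_ge0.
apply: (hM (`|M| + 1)%R); last by exists z.
by rewrite (le_lt_trans (ler_norm _))// ltrDl.
Qed.

Lemma bounded_compact_pint r f (M : R) (Q : set (half R n)) : (0 < r)%R ->
  measurable_fun hs f ->
  (forall z, half_space z -> (`|f z| <= M)%R) -> compact Q -> Q `<=` @half_space R n ->
  (forall z, half_space z -> ~ Q z -> f z = 0%R) -> pint mu r hs f < +oo.
Proof.
move=> r0 mf fM cQ Qh f0; have mQ := compact_measurable_half cQ.
rewrite /pint (@integral_supp _ _ _ mu (Q : set (mhalf R n)) hs _ Qh); last first.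
  by move=> z hz zQ; rewrite f0// normr0 powR0// gt_eqF.
apply: (@le_lt_trans _ _ (\int[mu]_(z in Q) (M `^ r)%:E)).
  apply: ge0_le_integral => //.
  - by apply: measurable_pow; exact: measurable_funS mf.
  - move=> z /Qh hz; rewrite lee_fin; apply: ge0_ler_powR => //; rewrite ?nnegrE ?(ltW r0)//.
      exact: le_trans (fM z hz).
    exact: fM.
by rewrite integral_cst// lte_mul_pinfty ?dxdt_compact_fin// lee_fin powR_ge0.
Qed.

Lemma V_space_bounded_compact f (M : R) (Q : set (half R n)) :
  measurable_fun hs f ->
  (forall z, half_space z -> (`|f z| <= M)%R) -> compact Q -> Q `<=` @half_space R n ->
  (forall z, half_space z -> ~ Q z -> f z = 0%R) -> V_space K p q f.
Proof.
move=> mf fM cQ Qh f0.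
have fin : Lp_norm_on q hs f < +oo.
  rewrite Lp_norm_onE ?gt_eqF//; apply: poweR_lty.
  exact: bounded_compact_pint fM cQ Qh f0.
split; first exact: Lp_loc_of_fin.
have [c c0 hc] := V_norm_compact hK cQ Qh.
apply: le_lt_trans (hc p q f p1 pq mf f0) _.
have : 0 <= Lp_norm_on q hs f by exact: Lnorm_ge0.
by move: fin; case: (Lp_norm_on q hs f) => //= r _ _; rewrite -EFinM ltry.
Qed.

Lemma Cc_V_space f : Cc f -> V_space K p q f.
Proof.
move=> cf; have [M M0 fM] := Cc_bounded cf; have mf := Cc_measurable cf.
case: cf => cf [Q [cQ Qh f0]]; exact: (V_space_bounded_compact mf fM cQ Qh f0).
Qed.

Lemma V_spaceD f g : V_space K p q f -> V_space K p q g -> V_space K p q (f \+ g)%R.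
Proof.
move=> [lf Vf] [lg Vg]; split; first exact: Lp_locD.
by apply: le_lt_trans (V_normD _ _ lf.1 lg.1) _; rewrite lte_add_pinfty.
Qed.

Lemma V_spaceZ (c : R) f : V_space K p q f -> V_space K p q (c \*o f)%R.
Proof.
move=> [lf Vf]; split; first exact: Lp_locZ.
rewrite (V_normZ K _ p1 lf.1); have := V_norm_ge0 K f p1.
by move: Vf; case: (V f) => //= r _ _; rewrite -EFinM ltry.
Qed.

Lemma U_measurable f : U f -> measurable_fun hs f.
Proof. by case=> -[[]]. Qed.

Lemma U_space_closed f : Lp_loc q f ->
  (forall e : R, (0 < e)%R -> exists2 h, U h & V (f \- h)%R < e%:E) -> U f.
Proof.
move=> lf hf; have [h Uh h1] := hf 1%R ltr01; split; first split => //.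
  have mh := U_measurable Uh.
  rewrite (_ : f = (f \- h) \+ h)%R; last by apply/funext => z /=; rewrite subrK.
  apply: le_lt_trans (V_normD _ _ _ mh) _; first exact: measurable_funB lf.1 mh.
  by rewrite lte_add_pinfty ?(lt_trans h1) ?ltry//; case: Uh => -[].
move=> e e0; have e2 : (0 < e / 2)%R by rewrite divr_gt0.
have [u Uu ue] := hf _ e2; have [v Cv ve] := Uu.2 _ e2.
exists v => //; rewrite (_ : f \- v = (f \- u) \+ (u \- v))%R; last first.
  by apply/funext => z /=; rewrite subrKA.
have mu' := U_measurable Uu; have mv := Cc_measurable Cv.
apply: le_lt_trans (V_normD _ _ (measurable_funB lf.1 mu') (measurable_funB mu' mv)) _.
by rewrite [e]splitr EFinD lteD.
Qed.

Lemma U_spaceD f g : U f -> U g -> U (f \+ g)%R.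
Proof.
move=> Uf Ug; split; first by apply: V_spaceD; [case: Uf|case: Ug].
move=> e e0; have e2 : (0 < e / 2)%R by rewrite divr_gt0.
have [u Cu ue] := Uf.2 _ e2; have [v Cv ve] := Ug.2 _ e2.
exists (u \+ v)%R; first exact: CcD.
rewrite (_ : (f \+ g) \- (u \+ v) = (f \- u) \+ (g \- v))%R; last first.
  by apply/funext => z /=; rewrite opprD addrACA.
apply: le_lt_trans (V_normD _ _ _ _) _.
- by apply: measurable_funB; [exact: U_measurable|exact: Cc_measurable].
- by apply: measurable_funB; [exact: U_measurable|exact: Cc_measurable].
- by rewrite [e]splitr EFinD lteD.
Qed.

Lemma U_space0 : U (cst 0%R).
Proof.
have C0 : Cc (cst 0%R : half R n -> R).
  split; first by apply: continuous_subspaceT => z; exact: cst_continuous.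
  by exists set0; split => //; exact: compact0.
split; first exact: Cc_V_space.
move=> e e0; exists (cst 0%R) => //.
apply: (@le_lt_trans _ _ 0); last by rewrite lte_fin.
apply: V_norm_le => k _ _; rewrite integral0_eq// => z _ /=.
by rewrite subr0 mul0r normr0.
Qed.

Lemma U_spaceZ (c : R) f : U f -> U (c \*o f)%R.
Proof.
move=> Uf; split; first by apply: V_spaceZ; case: Uf.
move=> e e0; have c0 : (0 < `|c| + 1)%R by rewrite ltr_wpDl.
have [u Cu ue] := Uf.2 _ (divr_gt0 e0 c0).
have mfu : measurable_fun hs (f \- u)%R.
  by apply: measurable_funB; [exact: U_measurable|exact: Cc_measurable].
exists (c \*o u)%R; first exact: CcZ.
rewrite (_ : (c \*o f) \- (c \*o u) = c \*o (f \- u))%R; last first.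
  by apply/funext => z /=; rewrite mulrBr.
rewrite (V_normZ K _ p1 mfu).
apply: (@le_lt_trans _ _ ((`|c| + 1)%:E * V (f \- u)%R)).
  by rewrite lee_wpmul2r ?V_norm_ge0// lee_fin lerDl.
by rewrite muleC -lte_pdivlMr.
Qed.

Lemma U_spaceB f g : U f -> U g -> U (f \- g)%R.
Proof.
move=> Uf /(U_spaceZ (-1)%R) Ug; have := U_spaceD Uf Ug.
by congr U; apply/funext => z /=; rewrite mulN1r.
Qed.

(** Bounded functions with compact support are L^1 limits, hence by boundedness
    L^q limits, of continuous ones with a common support; there the norm of
    [U] is dominated by that of L^q. *)
Lemma U_space_bounded_compact f (M : R) (Q : set (half R n)) :
  measurable_fun hs f ->
  (forall z, half_space z -> (`|f z| <= M)%R) -> compact Q -> Q `<=` @half_space R n ->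
  (forall z, half_space z -> ~ Q z -> f z = 0%R) -> U f.
Proof.
move=> mf fM cQ Qh f0; split; first exact: V_space_bounded_compact fM cQ Qh f0.
move=> e e0; have [k Qk] := compact_sub_exh hK cQ Qh.
have mE := @measurable_exh R n k.+1.
have [c c0 hc] := V_norm_compact hK (@exh_compact R n k.+1) (@exh_half R n k.+1).
pose M' := (`|M| + 1)%R; have M0 : (0 < M')%R by rewrite ltr_wpDl.
have {}fM z : half_space z -> (`|f z| <= M')%R.
  by move=> /fM /le_trans; apply; rewrite (le_trans (ler_norm _))// lerDl.
pose f' : half R n -> R := f \_ (@half_space R n).
have mf' : measurable_fun setT (f' : mhalf R n -> R) by exact/(measurable_restrictT _ _).1.
have f'M z : (`|f' z| <= M')%R.
  rewrite /f' patchE; case: ifPn => [/set_mem/fM//|_].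
  by rewrite normr0 ltW.
pose del := (((e / (2 * c)) `^ q) / ((2 * M') `^ (q - 1)))%R.
have M2 : (0 < 2 * M')%R by rewrite mulr_gt0.
have ec0 : (0 < e / (2 * c))%R by rewrite divr_gt0 ?mulr_gt0.
have del0 : (0 < del)%R by rewrite divr_gt0// powR_gt0.
have [phi [cphi phiM dphi]] :=
  approx_bounded mE (dxdt_compact_fin (@exh_compact R n k.+1)) mf' M0 f'M del0.
pose h z := (phi z * cutoff k z)%R.
have Ch : Cc h by exact: Cc_cutoff.
have mh := Cc_measurable Ch.
exists h => //; have mfh : measurable_fun hs (f \- h)%R by exact: measurable_funB.
have h0 z : half_space z -> ~ exh k.+1 z -> (f \- h)%R z = 0%R.
  move=> hz zk; rewrite /= /h cutoff0// mulr0 subr0 f0// => /Qk zQ.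
  by apply: zk; exact: exh_nd zQ.
apply: le_lt_trans (hc p q _ p1 pq mfh h0) _.
rewrite -lte_pdivlMl//; apply: (@le_lt_trans _ _ (e / (2 * c))%:E); last first.
  rewrite -EFinM lte_fin (_ : c^-1 * e = 2 * (e / (2 * c)))%R; first by lra.
  by field; rewrite gt_eqF.
rewrite Lp_norm_onE ?gt_eqF// -[leRHS](@poweRK _ _ q) ?gt_eqF ?lee_fin ?(ltW ec0)//.
apply: poweR_le; rewrite ?invr_ge0 ?(ltW q0) ?pint_ge0// poweR_EFin.
rewrite /pint (@integral_supp _ _ _ mu (exh k.+1 : set (mhalf R n)) hs _ (@exh_half R n k.+1)); last first.
  by move=> z hz zk; rewrite h0// normr0 powR0// gt_eqF.
apply: (@le_trans _ _ (\int[mu]_(z in exh k.+1)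
    (((2 * M') `^ (q - 1))%:E * `|f' z - phi z|%:E))).
  have mphi : measurable_fun (setT : set (mhalf R n)) phi.
    apply: continuous_measurable_half; first exact: openT.
    exact: continuous_subspaceT.
  apply: ge0_le_integral => //.
  - by apply: measurable_pow; apply: measurable_funS mfh => //; exact: exh_half.
  - apply: emeasurable_funM => //; apply/measurable_EFinP; apply: measurableT_comp => //.
    by apply: measurable_funTS; exact: measurable_funB.
  move=> z ze; have hz := exh_half ze.
  rewrite -EFinM lee_fin.
  have f'E : f' z = f z by rewrite /f' patchE mem_set.
  have dle : (`|f z - h z| <= `|f' z - phi z|)%R.
    have /andP[c1 c2] := cutoff_itv k z.
    have -> : (f z - h z = (f' z - phi z) * cutoff k z)%R.
      rewrite f'E /h mulrBl; congr (_ - _)%R.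
      have [zQ|zQ] := pselect (Q z); first by rewrite cutoff1 ?mulr1//; exact: Qk.
      by rewrite f0// mul0r.
    by rewrite normrM (ger0_norm c1) ler_piMr.
  have d2M : (`|f' z - phi z| <= 2 * M')%R.
    rewrite (le_trans (ler_normB _ _))// mulrDl !mul1r lerD//.
  have -> : (`|(f \- h)%R z| `^ q = `|f z - h z| * `|f z - h z| `^ (q - 1))%R.
    by rewrite mulr_powRB1.
  rewrite mulrC ler_pM ?powR_ge0//.
  apply: ge0_ler_powR; rewrite ?nnegrE ?subr_ge0 ?(ltW q1) ?(ltW M2)//.
  exact: le_trans d2M.
rewrite ge0_integralZl//; last 2 first.
- apply/measurable_EFinP; apply: measurableT_comp => //.
  apply: measurable_funTS; apply: measurable_funB => //.
  apply: continuous_measurable_half; first exact: openT.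
  exact: continuous_subspaceT.
- by rewrite lee_fin powR_ge0.
rewrite -lee_pdivlMl ?powR_gt0//; apply: le_trans dphi _.
by rewrite -EFinM lee_fin mulrC.
Qed.

(** Cutting [a] to a sublevel set costs its L^q norm off that set, the tail of a
    convergent integral. *)
Lemma U_space_weight a h : measurable_fun hs a -> Lp_norm_on q hs a < +oo ->
  tent_weight K h -> U (fun z => a z * h z)%R.
Proof.
move=> ma fa th; have mh : measurable_fun hs h by case: th.
have mah : measurable_fun hs (fun z => a z * h z)%R by exact: measurable_funM.
pose S := sublevel a; have mS (k : nat) : measurable (S k) by exact: measurable_sublevel.
have pfin : pint mu q hs a < +oo.
  by move: fa; rewrite Lp_norm_onE ?gt_eqF// => /lty_poweRy; apply; rewrite invr_eq0 gt_eqF.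
have tail (e : R) : (0 < e)%R -> exists k : nat, pint mu q (hs `\` S k) a < e%:E.
  apply: integral_tail => //.
  - exact: measurable_pow.
  - exact: sublevel_nd.
  - exact: sublevel_bigcup.
apply: U_space_closed.
  apply: Lp_loc_of_fin => //; apply: le_lt_trans fa.
  rewrite !(Lp_norm_onE hs _ (lt0r_neq0 q0)); apply: poweR_le; rewrite ?invr_ge0 ?(ltW q0) ?pint_ge0//.
  apply: ge0_le_integral => //; [exact: measurable_pow|exact: measurable_pow|].
  move=> z hz; rewrite lee_fin; apply: ge0_ler_powR; rewrite ?nnegrE ?(ltW q0)//.
  by rewrite normrM ler_piMr// (tent_weight_le1 hK th).
move=> e e0; have eq0 : (0 < e `^ q)%R by rewrite powR_gt0.
have [k hk] := tail _ eq0.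
have maS : measurable_fun hs (fun z => a z * \1_(S k) z)%R.
  by apply: measurable_funM => //; exact: measurable_indic.
exists (fun z => a z * \1_(S k) z * h z)%R.
  apply: (@U_space_bounded_compact _ k%:R (exh k)) => //.
  - exact: measurable_funM.
  - move=> z hz; rewrite !normrM; have [zS|zS] := pselect (S k z).
      rewrite indicE mem_set// normr1 mulr1 -[leRHS]mulr1 ler_pM//.
        by case: zS.
      exact: (tent_weight_le1 hK th).
    by rewrite indicE memNset// normr0 mulr0 mul0r.
  - exact: exh_compact.
  - exact: exh_half.
  - move=> z hz zk; rewrite indicE memNset ?mulr0 ?mul0r//.
    by move=> -[].
rewrite (@eq_V_norm _ _ _ _ _ (fun z => (a z * \1_(hs `\` S k) z) * h z)%R); last first.
  move=> z hz /=; rewrite -mulrBl; congr (_ * _)%R.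
  have [zS|zS] := pselect (S k z).
    by rewrite !indicE (mem_set zS) memNset ?mulr1 ?mulr0 ?subrr// => -[].
  by rewrite !indicE (memNset zS) mem_set ?mulr0 ?mulr1 ?subr0.
have maD : measurable_fun hs (fun z => a z * \1_(hs `\` S k) z)%R.
  by apply: measurable_funM => //; apply: measurable_indic; exact: measurableD.
apply: le_lt_trans (V_norm_weight hK p1 pq maD th) _.
rewrite Lp_norm_onE ?gt_eqF// /pint (@integral_supp _ _ _ _ (hs `\` S k)); last 2 first.
- by move=> z [].
- by move=> z hz zS; rewrite indicE memNset// mulr0 normr0 powR0// gt_eqF.
rewrite (_ : \int[mu]_(z in hs `\` S k) _ = pint mu q (hs `\` S k) a); last first.
  by apply: eq_integral => z zS; rewrite indicE zS mulr1.
move: hk; have := pint_ge0 mu q (hs `\` S k) a.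
case: (pint mu q (hs `\` S k) a) => //= r; rewrite lee_fin !lte_fin => r0 re.
rewrite -[e]powRr1 ?(ltW e0)// -(mulfV (lt0r_neq0 q0)) powRrM.
by apply: gt0_ltr_powR; rewrite ?invr_gt0// ?nnegrE ?powR_ge0.
Qed.

End U_space_theory.

(** * Completeness of U *)

Section series_tools.
Context (R : realType).

(** For pointwise limits along a fast subsequence: the bound by the tail needs no
    dominating function. *)
Lemma telescope_tail (x : R^nat) :
  (\sum_(i <oo) `|x i.+1 - x i|%:E < +oo)%E ->
  cvgn x /\ forall j, (`|limn x - x j|%:E <= \sum_(i <oo) `|x (i + j).+1 - x (i + j)%N|%:E)%E.
Proof.
move=> fin; pose d (i : nat) : R := `|x i.+1 - x i|.
have d0 i : (0 <= (d i)%:E)%E by rewrite lee_fin normr_ge0.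
have part j l : (`|x (l + j)%N - x j|%:E <= \sum_(i < l) (d (i + j)%N)%:E)%E.
  rewrite sumEFin lee_fin; elim: l => [|l IH]; first by rewrite big_ord0 add0n subrr normr0.
  rewrite big_ord_recr/= -[x (l.+1 + j)%N](subrK (x (l + j)%N)) -addrA addrC.
  by rewrite (le_trans (ler_normD _ _))// lerD.
have le_tail j l : (`|x (l + j)%N - x j|%:E <= \sum_(i <oo) (d (i + j)%N)%:E)%E.
  apply: le_trans (part j l) _.
  rewrite -(big_mkord xpredT (fun i => (d (i + j)%N)%:E)).
  by apply: nneseries_lim_ge => i _ _; exact: d0.
have cx : cvgn x.
  apply/cauchy_cvgP/cauchy_exP => e e0.
  have cv := @nneseries_tail_cvg R (fun i => (d i)%:E) xpredT fin (fun i _ => d0 i).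
  have tail0 N : (0 <= \sum_(N <= k <oo) (d k)%:E)%E by exact: nneseries_ge0.
  have [N /(_ N (leqnn _)) hN] := (cvge0P tail0).1 cv _ e0.
  rewrite -nneseries_addn// in hN.
  exists (x N); exists N => // l /= /subnK <-.
  rewrite -ball_normE/= distrC -lte_fin; exact: le_lt_trans (le_tail N _) hN.
split => // j; have cxj : (x (l + j)%N - x j) @[l --> \oo] --> limn x - x j.
  apply: cvgB; last exact: cvg_cst.
  by rewrite (cvg_shiftn j x).
have cn : (`|x (l + j)%N - x j|%:E)%E @[l --> \oo] --> (`|limn x - x j|%:E)%E.
  by apply/fine_cvgP; split; [exact: nearW|exact: cvg_norm cxj].
rewrite -(cvg_lim _ cn)//; apply: lime_le; first exact: cvgP cn.
by apply: nearW => l; exact: le_tail.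
Unshelve. all: by end_near. Qed.

Lemma half_series_le (j : nat) :
  (\sum_(i <oo) ((2^-1 : R) ^+ (i + j))%:E <= (2 * 2^-1 ^+ j)%:E)%E.
Proof.
have c0 : 0 <= 2 * 2^-1 ^+ j :> R by rewrite mulr_ge0// exprn_ge0// invr_ge0.
apply: le_trans (epsilon_trick0 xpredT c0).
apply: lee_nneseries => [i _ _|i _]; first by rewrite lee_fin exprn_ge0// invr_ge0.
rewrite lee_fin natrX exprS exprD invfM -exprVn le_eqVlt; apply/orP; left; apply/eqP.
by rewrite mulrACA mulfV// mul1r mulrC.
Qed.

(** [P e j k] stands for closeness up to [e] in any norm. The indices are partial
    sums of the moduli, which makes them monotone. *)
Lemma fast_subsequence (P : R -> nat -> nat -> Prop) :
  (forall e, 0 < e -> exists k0, forall j k, (k0 <= j)%N -> (k0 <= k)%N -> P e j k) ->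
  exists2 m : nat -> nat, (forall j, (m j <= m j.+1)%N) &
    forall i j k, (m i <= j)%N -> (m i <= k)%N -> P (2^-1 ^+ i) j k.
Proof.
move=> h.
have /choice[N hN] : forall i : nat, exists k0, forall j k,
    (k0 <= j)%N -> (k0 <= k)%N -> P (2^-1 ^+ i) j k.
  by move=> i; apply: h; rewrite exprn_gt0// invr_gt0.
exists (fun j => \sum_(i < j.+1) N i)%N => [j|i j k ij ik].
  by rewrite [leqRHS]big_ord_recr leq_addr.
have Ni : (N i <= \sum_(i < i.+1) N i)%N by rewrite big_ord_recr/= leq_addl.
by apply: hN; exact: leq_trans Ni _.
Qed.

End series_tools.

Section U_banach.
Context (R : realType) (n : nat) (K : set 'rV[R]_n).
Hypothesis hK : symmetric_convex_body K.
Variables p q : R.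
Hypothesis p1 : 1 < p.
Hypothesis pq : p^-1 + q^-1 = 1.
Local Open Scope ereal_scope.
Local Notation hs := (@half_space R n : set (mhalf R n)).
Local Notation mu := (dxdt R n).
Local Notation V := (V_norm K p).
Local Notation U := (U_space K p q).
Implicit Types (f g h a : half R n -> R).

Let mhs : measurable hs := @measurable_half_space R n.
Let q1 : (1 < q)%R. Proof. by have [] := conjugate_exponents p1 pq. Qed.
Let q0 : (0 < q)%R. Proof. exact: lt_trans q1. Qed.

Lemma V_norm_Lp_loc f : measurable_fun hs f -> V f < +oo -> Lp_loc q f.
Proof.
move=> mf Vf; apply: (Lp_loc_of_fin p1 pq mf).
exact: le_lt_trans (Lp_le_V_norm hK p1 pq mf) Vf.
Qed.

Lemma V_norm_eq0 f : measurable_fun hs f -> V f = 0 <-> null_ae f.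
Proof.
move=> mf; split => [V0|f0].
  have : pint mu q hs f = 0.
    apply/eqP; rewrite eq_le pint_ge0 andbT.
    rewrite -[leLHS](@poweRVK _ _ q) ?gt_eqF ?pint_ge0// -Lp_norm_onE ?gt_eqF//.
    have -> : Lp_norm_on q hs f = 0.
      by apply/eqP; rewrite eq_le Lnorm_ge0 andbT -V0 (Lp_le_V_norm hK p1 pq).
    by rewrite poweR0r// gt_eqF.
  rewrite /pint => I0.
  have : \int[mu]_(z in hs) `|(`|f z| `^ q)%:E| = 0.
    by rewrite -[RHS]I0; apply: eq_integral => z _; rewrite gee0_abs// lee_fin powR_ge0.
  move=> /(ae_eq_integral_abs mu mhs (measurable_pow q mf)).
  apply: filterS => z hz zh; apply/eqP; rewrite -normr_eq0.
  have /= := hz zh; move=> [] /eqP; rewrite powR_eq0 => /andP[/eqP -> _] //.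
apply/eqP; rewrite eq_le V_norm_ge0// andbT; apply: V_norm_le => k [[mk _] _] _.
rewrite (ae_eq_integral (cst 0)) ?integral0//.
  by apply/measurable_EFinP; apply: measurableT_comp => //; exact: measurable_funM.
move: f0 => [N [mN N0 fN]]; exists N; split => // z hz; apply: fN => /= fz.
by apply: hz => zh /=; rewrite fz// mul0r normr0.
Qed.

(** Along a fast subsequence the increments have summable norms, so their tails,
    which bound the distance to the pointwise limit, have small norms. *)
Lemma U_complete (u : nat -> half R n -> R) : (forall k, U (u k)) ->
  (forall e : R, (0 < e)%R -> exists k0, forall j k, (k0 <= j)%N -> (k0 <= k)%N ->
    V (u j \- u k)%R < e%:E) ->
  exists2 f, U f & V (u k \- f)%R @[k --> \oo] --> 0.
Proof.
move=> Uu cau; have mu' k : measurable_fun hs (u k) by exact: U_measurable (Uu k).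
have [m m_nd hm] := fast_subsequence cau.
pose x (z : half R n) (j : nat) : R := u (m j) z.
pose F z := \sum_(i <oo) `|x z i.+1 - x z i|%:E.
pose f z := if F z < +oo then limn (x z) else 0%R.
have d0 z j : 0 <= \sum_(i <oo) `|x z (i + j).+1 - x z (i + j)%N|%:E.
  by apply: nneseries_ge0 => i _ _; rewrite lee_fin.
have key z j : `|f z - x z j|%:E <= \sum_(i <oo) `|x z (i + j).+1 - x z (i + j)%N|%:E.
  rewrite /f; case: ifPn => Fz; first by have [_] := telescope_tail Fz; exact.
  have nn i : 0 <= `|x z i.+1 - x z i|%:E by rewrite lee_fin.
  rewrite (@nneseries_addn _ (fun i => `|x z i.+1 - x z i|%:E) j)//.
  have : F z = +oo by apply/eqP; rewrite -leye_eq leNgt.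
  rewrite /F (@nneseries_split _ _ 0%N j)// add0n sumEFin.
  have := @nneseries_ge0 R (fun i => `|x z i.+1 - x z i|%:E) xpredT j (fun i _ _ => nn i).
  by case: (\sum_(j <= i <oo) _) => //= *; rewrite leey.
have mF : measurable_fun hs F.
  apply: ge0_emeasurable_sum => // i _; apply/measurable_EFinP.
  by apply: measurableT_comp => //; exact: (measurable_funB (mu' _) (mu' _)).
have mf : measurable_fun hs f.
  pose G : set (mhalf R n) := hs `&` [set z | F z < +oo].
  have mG : measurable G.
    have := emeasurable_fun_infty_o mhs mF +oo; exact.
  apply: (@measurable_fun_cvg _ _ _ hs (fun j z => (x z j * \1_G z)%R)).
    by move=> j; apply: (measurable_funM (mu' _)); exact: measurable_indic.
  move=> z hz; rewrite /f; case: ifPn => Fz.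
    rewrite (_ : (fun j => _) = x z); first by have [] := telescope_tail Fz.
    by apply/funext => j; rewrite indicE mem_set ?mulr1.
  rewrite (_ : (fun j => _) = cst 0%R); first exact: cvg_cst.
  apply/funext => j; rewrite indicE memNset ?mulr0// => -[_].
  by apply/negP.
have Vj j : V (f \- u (m j))%R <= (2 * 2^-1 ^+ j)%:E.
  apply: le_trans (half_series_le R j).
  apply: le_trans (@V_norm_sum _ _ K p (fun i => u (m (i + j).+1) \- u (m (i + j)%N))%R _ _ _ _) _.
  - exact: measurable_funB.
  - by move=> i; exact: measurable_funB.
  - by move=> z _; exact: key.
  apply: lee_nneseries => i *; first exact: V_norm_ge0.
  by apply: ltW; apply: hm => //; exact: m_nd.
have pow0 (e : R) : (0 < e)%R -> exists j : nat, (2 * 2^-1 ^+ j < e)%R.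
  move=> e0; have : (2 * 2^-1 ^+ j)%R @[j --> \oo] --> (0 : R)%R.
    by apply: cvg_geometric; rewrite ger0_norm ?invr_ge0// invf_lt1// ltr1n.
  move=> /cvgr0_norm_lt /(_ _ e0)[j _ /(_ j (leqnn _))/= hj]; exists j.
  by apply: le_lt_trans hj; exact: ler_norm.
have lf : Lp_loc q f.
  have lu : Lp_loc q (u (m 0%N)) by case: (Uu (m 0%N)) => -[].
  rewrite (_ : f = (f \- u (m 0%N)) \+ u (m 0%N))%R; last first.
    by apply/funext => z /=; rewrite subrK.
  apply: (Lp_locD p1 pq) => //; apply: V_norm_Lp_loc; first exact: measurable_funB.
  by rewrite (le_lt_trans (Vj 0%N))// ltry.
exists f.
  apply: (U_space_closed lf) => e /pow0[j je]; exists (u (m j)) => //.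
  by rewrite (le_lt_trans (Vj j))// lte_fin.
apply/cvge0P => [k|e e0]; first exact: V_norm_ge0.
have e2 : (0 < e / 2)%R by rewrite divr_gt0.
have [j je] := pow0 _ e2; exists (m j) => k jk.
rewrite (_ : u k \- f = (u k \- u (m j)) \+ (u (m j) \- f))%R; last first.
  by apply/funext => z /=; rewrite subrKA.
apply: le_lt_trans (V_normD _ _ _ _) _.
- exact: measurable_funB.
- exact: measurable_funB.
rewrite [e]splitr EFinD; apply: lteD.
  apply: lt_le_trans (hm j k (m j) jk (leqnn _)) _; rewrite lee_fin.
  rewrite ltW// (le_lt_trans _ je)// ler_peMl ?ler1n// exprn_ge0// invr_ge0//.
by rewrite V_normB (le_lt_trans (Vj j))// lte_fin.
Qed.

Lemma U_banach : banach_space U V (@null_ae R n).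
Proof.
split.
- split; first exact: U_space0.
  + by move=> f h; exact: U_spaceD.
  + by move=> c f; exact: U_spaceZ.
- split.
  + by move=> f Uf; rewrite V_norm_ge0//=; case: Uf => -[].
  + by move=> f Uf; apply: V_norm_eq0; exact: U_measurable Uf.
  + by move=> f h Uf Uh; apply: V_normD; [exact: U_measurable Uf|exact: U_measurable Uh].
  + by move=> c f Uf; apply: V_normZ => //; exact: U_measurable Uf.
- exact: U_complete.
Qed.

End U_banach.

(** * Recovering the area function from atoms *)

Section positive_functions.
Local Open Scope ereal_scope.

(** A weighted sum of the indicators of sets of finite measure that cover the space. *)
Lemma positive_integrable d (T : measurableType d) (R : realType)
    (m : {measure set T -> \bar R}) : sigma_finite setT m ->
  exists g : T -> R, [/\ measurable_fun setT g, forall x, (0 < g x <= 1)%R &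
    \int[m]_x (g x)%:E <= 1].
Proof.
move=> [F FT mF].
pose c (k : nat) : R := (1 / (2 ^ k.+1)%:R / (1 + fine (m (F k))))%R.
have p0 (k : nat) : (0 < 1 / (2 ^ k.+1)%:R :> R)%R by rewrite divr_gt0// ltr0n expn_gt0.
have f1 k : (1 <= 1 + fine (m (F k)))%R by rewrite lerDl fine_ge0.
have f0 k : (0 < 1 + fine (m (F k)))%R by rewrite (lt_le_trans _ (f1 k)).
have c0 k : (0 < c k)%R by rewrite divr_gt0.
have c_le k : (c k <= 1 / (2 ^ k.+1)%:R)%R by rewrite ler_pdivrMr// ler_peMr// ltW.
pose G x := \sum_(k <oo) (c k * \1_(F k) x)%:E.
have t0 k x : 0 <= (c k * \1_(F k) x)%:E by rewrite lee_fin mulr_ge0// ltW.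
have G0 x : 0 <= G x by apply: nneseries_ge0 => k _ _; exact: t0.
have G1 x : G x <= 1.
  apply: le_trans (epsilon_trick0 xpredT (@ler01 R)); apply: lee_nneseries => k *.
    exact: t0.
  by rewrite lee_fin (le_trans _ (c_le k))// ler_piMr ?(ltW (c0 k)).
have mG : measurable_fun setT G.
  apply: ge0_emeasurable_sum => // k _; apply/measurable_EFinP.
  by apply: measurable_funM => //; apply: measurable_indic; case: (mF k).
have Gf x : G x = (fine (G x))%:E.
  by rewrite fineK// ge0_fin_numE// (le_lt_trans (G1 x))// ltry.
exists (fine \o G); split.
- by apply: measurableT_comp => //; exact: fine_measurable.
- move=> x; rewrite /= -!lee_fin -!lte_fin -Gf G1 andbT.
  have : [set: T] x by []; rewrite FT => -[k _ Fk].
  apply: (@lt_le_trans _ _ (\sum_(0 <= i < k.+1) (c i * \1_(F i) x)%:E)); last first.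
    by apply: nneseries_lim_ge => i _ _; exact: t0.
  rewrite big_nat_recr//= indicE mem_set// mulr1 -[ltLHS]add0e.
  by rewrite lee_ltD// ?lte_fin// sume_ge0.
- under eq_integral do rewrite /= -Gf.
  rewrite integral_nneseries//; last first.
    move=> k; apply/measurable_EFinP.
    by apply: measurable_funM => //; apply: measurable_indic; case: (mF k).
  apply: le_trans (epsilon_trick0 xpredT (@ler01 R)); apply: lee_nneseries => k *.
    by apply: integral_ge0 => x _; exact: t0.
  have [mFk fin] := mF k.
  under eq_integral do rewrite EFinM.
  rewrite ge0_integralZl//; last 2 first.
  - by apply/measurable_EFinP; exact: measurable_indic.
  - by rewrite lee_fin ltW.
  rewrite integral_indic// setIT -[X in _ * X]fineK ?ge0_fin_numE// -EFinM lee_fin.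
  by rewrite /c mulrAC ler_pdivrMr// ler_wpM2l ?(ltW (p0 k))// lerDr.
Qed.

Lemma measurable_sg (R : realType) :
  measurable_fun [set: measurableTypeR R] (@Num.sg R).
Proof.
apply: measurable_fun_ifT => //.
  exact: measurable_fun_eqr.
apply: measurable_fun_ifT => //.
exact: measurable_fun_ltr.
Qed.

(** Monotone convergence as the height [r] decreases to 0. *)
Lemma cone_truncation (R : realType) (n : nat) (K : set 'rV[R]_n)
    (nu : {measure set (mhalf R n) -> \bar R}) (w : half R n -> \bar R) x (m : \bar R) :
  symmetric_convex_body K ->
  measurable_fun (@half_space R n : set (mhalf R n)) w ->
  (forall z, half_space z -> 0 <= w z) ->
  (forall r : R, (0 < r)%R ->
    \int[nu]_(z in cone K x `&` [set z | (r <= z.2)%R]) w z <= m) ->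
  \int[nu]_(z in cone K x) w z <= m.
Proof.
move=> hK mw w0 h.
pose S (k : nat) : set (mhalf R n) := cone K x `&` [set z | (k.+1%:R^-1 <= z.2)%R].
have mS k : measurable (S k) by exact: measurable_cone_slab.
have SE : \bigcup_k S k = cone K x.
  apply/seteqP; split => [z [k _ []]//|z zc].
  have z0 : (0 < z.2)%R by case: zc.
  have [k hk] : exists k : nat, (k.+1%:R^-1 <= z.2)%R.
    exists (Num.bound z.2^-1).
    rewrite -[leRHS]invrK lef_pV2 ?posrE ?invr_gt0// ltW//.
    apply: (@lt_trans _ _ (Num.bound z.2^-1)%:R); last by rewrite ltr_nat.
    by apply: archi_boundP; rewrite invr_ge0 ltW.
  by exists k.
have cv : \int[nu]_(z in S k) w z @[k --> \oo] --> \int[nu]_(z in cone K x) w z.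
  rewrite -SE; apply: ge0_nondecreasing_set_cvg_integral => //.
  - move=> i j ij; apply/subsetPset => z [zc zi]; split => //=.
    by rewrite (le_trans _ zi)// lef_pV2 ?posrE// ler_nat.
  - move=> i; apply: measurable_funS mw; first exact: measurable_half_space.
    by move=> z [/cone_half].
  - by move=> i z [/cone_half /w0].
rewrite -(cvg_lim _ cv)//; apply: lime_le; first exact: cvgP cv.
by apply: nearW => k; apply: h; rewrite invr_gt0.
Qed.

(** The ball integral of a strictly positive density, because balls have positive
    volume. *)
Lemma positive_weight (R : realType) (n : nat) (K : set 'rV[R]_n) :
  symmetric_convex_body K ->
  exists2 h : half R n -> R, tent_weight K h & forall z, half_space z -> (0 < h z)%R.
Proof.
move=> hK; have [g [mg g01 ig]] := positive_integrable (sigma_finite_dx R n).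
have meg : measurable_fun setT (EFin \o g) by exact/measurable_EFinP.
have eg0 x : 0 <= (EFin \o g) x by rewrite lee_fin; have /andP[/ltW] := g01 x.
have fin z := ball_integral_fin hK z meg eg0 ig.
exists (fun z => fine (ball_integral K (EFin \o g) z)).
  split.
    apply: measurable_funTS; apply: measurableT_comp; first exact: fine_measurable.
    exact: measurable_ball_integral.
  exists (EFin \o g); split => // z _.
  by have [gE /andP[h0 _]] := fin z; rewrite ger0_norm// -gE.
move=> z hz; have [gE /andP[h0 _]] := fin z.
rewrite lt_neqAle h0 andbT eq_sym; apply/eqP => e0.
have mB : measurable (Kball K z.1 z.2) by exact: measurable_Kball.
have : \int[dx R n]_(y in Kball K z.1 z.2) `|(EFin \o g) y| = 0.
  rewrite (_ : 0 = ball_integral K (EFin \o g) z); last by rewrite gE e0.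
  by apply: eq_integral => y _; rewrite gee0_abs.
move=> /(ae_eq_integral_abs _ mB (measurable_funTS meg)) [N [mN N0 BN]].
have : dx R n (Kball K z.1 z.2) = 0.
  apply/eqP; rewrite eq_le measure_ge0 andbT -N0; apply: le_measure; rewrite ?inE//.
  move=> y yB; apply: BN => /= /(_ yB) [] gy0.
  by have := g01 y; rewrite gy0 ltxx.
rewrite dx_Kball//; apply/eqP; rewrite eqe mulf_neq0//.
  by rewrite expf_neq0// gt_eqF.
by rewrite gt_eqF//; exact: (unit_volE hK).2.
Qed.

End positive_functions.

Lemma unit_L1_avg (R : realType) (n : nat) (K : set 'rV[R]_n) x r :
  symmetric_convex_body K -> 0 < r -> unit_L1 (avg K x r).
Proof.
move=> hK r0; split; first exact: measurable_avg.
rewrite Lnorm1 -[RHS](integral_avg hK x r0); apply: eq_integral => y _.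
by rewrite /= ger0_norm// avg_ge0.
Qed.

Section area_bound.
Context (R : realType) (n : nat) (K : set 'rV[R]_n).
Hypothesis hK : symmetric_convex_body K.
Variables p q : R.
Hypothesis p1 : 1 < p.
Hypothesis pq : p^-1 + q^-1 = 1.
Local Open Scope ereal_scope.
Local Notation hs := (@half_space R n : set (mhalf R n)).
Local Notation mu := (dxdt R n).
Implicit Types (f g h a b : half R n -> R).

Let mhs : measurable hs := @measurable_half_space R n.
Let p0 : (0 < p)%R. Proof. exact: lt_trans p1. Qed.
Let q1 : (1 < q)%R. Proof. by have [] := conjugate_exponents p1 pq. Qed.
Let q0 : (0 < q)%R. Proof. exact: lt_trans q1. Qed.
Let pqp : ((p - 1) * q = p)%R. Proof. by have [] := conjugate_exponents p1 pq. Qed.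

(** Testing against atoms bounds the area function everywhere: with [b = sgn k |k|
    `^ (p - 1) H `^ (p - 1)], cut to [S N], the pairing of [b H] with [k] is the
    integral of [(|k| H) `^ p] over [S N], which is also [|b|_q `^ q]. The sets [S
    N] make this integral finite, so that it can be cancelled. *)
Lemma T_area_le (k : half R n -> R) (c : R) (S : (set (mhalf R n))^nat) :
  measurable_fun hs k -> (0 <= c)%R ->
  (forall N, measurable (S N)) -> nondecreasing_seq S -> \bigcup_N S N = hs ->
  (forall N, S N `<=` exh N) -> (forall N z, S N z -> (`|k z| <= N%:R)%R) ->
  (forall (b : half R n -> R) (g : 'rV[R]_n -> R) (N : nat) (M : R), measurable_fun hs b ->
    (forall z, half_space z -> (`|b z| <= M)%R) ->
    (forall z, half_space z -> ~ S N z -> b z = 0%R) -> unit_L1 g ->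
    (`|\int[mu]_(z in hs) (atom K b g z * k z)|%R)%:E <= c%:E * Lp_norm_on q hs b) ->
  forall x, T_area K p k x <= (2 ^+ n * c)%:E.
Proof.
move=> mk c0 mS ndS SE Sexh kS test x.
have Shs N : S N `<=` hs by rewrite -SE; exact: bigcup_sup.
have p10 : (0 < p - 1)%R by rewrite subr_gt0.
have main (r : R) : (0 < r)%R ->
    \int[mu]_(z in cone K x `&` [set z | (r <= z.2)%R]) (`|k z| `^ p)%:E
    <= ((2 ^+ n * c) `^ p)%:E.
  move=> r0; pose g := avg K x r.
  have mg : measurable_fun setT (EFin \o g).
    by apply/measurable_EFinP; exact: measurable_avg.
  have g0 y : 0 <= (EFin \o g) y by rewrite lee_fin; exact: avg_ge0.
  have g1 : \int[dx R n]_y (EFin \o g) y <= 1 by rewrite integral_avg.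
  have fin z := ball_integral_fin hK z mg g0 g1.
  pose H z := fine (ball_integral K (EFin \o g) z).
  have H0 z : (0 <= H z)%R by have [_ /andP[]] := fin z.
  have H1 z : (H z <= 1)%R by have [_ /andP[]] := fin z.
  have tH : tent_weight K H.
    split.
      apply: measurable_funTS; apply: measurableT_comp; first exact: fine_measurable.
      exact: measurable_ball_integral.
    exists (EFin \o g); split => // z _; rewrite ger0_norm// /H.
    by have [<-] := fin z.
  have mH : measurable_fun hs H by case: tH.
  pose W z : R := (`|k z| `^ p * H z `^ p)%R.
  have W0 z : (0 <= W z)%R by rewrite mulr_ge0 ?powR_ge0.
  have mW : measurable_fun hs W.
    apply: measurable_funM; first by apply/measurable_EFinP; exact: measurable_pow.
    exact: (measurableT_comp (measurable_powR p) mH).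
  pose u z : R := (`|k z| `^ (p - 1) * H z `^ (p - 1))%R.
  have u0 z : (0 <= u z)%R by rewrite mulr_ge0 ?powR_ge0.
  have mbnd N : \int[mu]_(z in S N) (W z)%:E <= (c `^ p)%:E.
    pose b z := (Num.sg (k z) * u z * \1_(S N) z)%R.
    have mb : measurable_fun hs b.
      apply: measurable_funM; last exact: measurable_indic.
      apply: measurable_funM.
        by apply: measurableT_comp => //; exact: measurable_sg.
      apply: measurable_funM; last exact: (measurableT_comp (measurable_powR _) mH).
      apply/measurable_EFinP; exact: measurable_pow.
    have sgu z : (`|Num.sg (k z) * u z| = u z)%R.
      rewrite normrM (ger0_norm (u0 z)); have [k0|k0] := eqVneq (k z) 0%R.
        by rewrite /u k0 normr0 powR0 ?gt_eqF// !mul0r mulr0.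
      by rewrite normr_sg k0 mul1r.
    have bM z : half_space z -> (`|b z| <= N%:R `^ (p - 1))%R.
      move=> hz; rewrite /b normrM sgu; have [zS|zS] := pselect (S N z); last first.
        by rewrite indicE memNset// normr0 mulr0 powR_ge0.
      rewrite indicE mem_set// normr1 mulr1 /u -[leRHS]mulr1 ler_pM ?powR_ge0//.
        by apply: ge0_ler_powR; rewrite ?nnegrE ?(ltW p10)// kS.
      have := @ge0_ler_powR R (p - 1)%R (ltW p10) (H z) 1%R; rewrite powR1.
      by apply; rewrite ?nnegrE.
    have b0 z : half_space z -> ~ S N z -> b z = 0%R.
      by move=> hz zS; rewrite /b indicE memNset// mulr0.
    have := test b g N _ mb bM b0 (unit_L1_avg x hK r0).
    rewrite -[atom K b g]/(fun z => b z * H z)%R.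
    have E1 z : (b z * H z * k z = W z * \1_(S N) z)%R.
      rewrite /b /W /u -(mulr_powRB1 (normr_ge0 (k z)) p0) -(mulr_powRB1 (H0 z) p0).
      by rewrite {2}(normrEsg (k z)); ring.
    have E2 : \int[mu]_(z in hs) (b z * H z * k z)%:E = \int[mu]_(z in S N) (W z)%:E.
      rewrite (@integral_supp _ _ _ mu (S N) hs) ?Shs//.
        by apply: eq_integral => z zS; rewrite E1 indicE zS mulr1.
      by move=> z hz zS; rewrite E1 indicE memNset// mulr0.
    have E3 : pint mu q hs b = \int[mu]_(z in S N) (W z)%:E.
      rewrite /pint (@integral_supp _ _ _ mu (S N) hs) ?Shs//.
        apply: eq_integral => z zS; rewrite /b indicE zS mulr1 sgu /u powRM ?powR_ge0//.
        by rewrite -!powRrM pqp.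
      by move=> z hz zS; rewrite b0// normr0 powR0// gt_eqF.
    rewrite /Rintegral E2 (Lp_norm_onE hs b (lt0r_neq0 q0)) E3.
    have I0 : 0 <= \int[mu]_(z in S N) (W z)%:E.
      by apply: integral_ge0 => z _; rewrite lee_fin.
    have Ifin : \int[mu]_(z in S N) (W z)%:E < +oo.
      rewrite -E3; apply: (bounded_compact_pint q0 mb bM (@exh_compact R n N)).
        exact: exh_half.
      by move=> z hz zN; apply: b0 => // /Sexh.
    have [i iE] : exists i, \int[mu]_(z in S N) (W z)%:E = i%:E.
      by exists (fine (\int[mu]_(z in S N) (W z)%:E)); rewrite fineK// ge0_fin_numE.
    rewrite iE in I0 *; rewrite lee_fin in I0; rewrite /= ger0_norm// -EFinM !lee_fin.
    move=> ic; have [->|i0] := eqVneq i 0%R; first exact: powR_ge0.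
    have {}i0 : (0 < i)%R by rewrite lt_neqAle eq_sym i0.
    have {}ic : (i `^ p^-1 <= c)%R.
      have := ic; rewrite -ler_pdivrMr ?powR_gt0// -powRN -[X in (X * _)%R]powRr1//.
      rewrite -powRD; last by apply/implyP => _; rewrite gt_eqF.
      by rewrite (_ : 1 - q^-1 = p^-1)%R// -pq addrK.
    rewrite -[leLHS]powRr1// -(mulVf (lt0r_neq0 p0)) powRrM.
    by apply: ge0_ler_powR; rewrite ?nnegrE ?powR_ge0 ?(ltW p0).
  have Wle : \int[mu]_(z in hs) (W z)%:E <= (c `^ p)%:E.
    have cv : \int[mu]_(z in S N) (W z)%:E @[N --> \oo] --> \int[mu]_(z in hs) (W z)%:E.
      rewrite -SE; apply: ge0_nondecreasing_set_cvg_integral => //.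
      - by move=> N; apply/measurable_EFinP; apply: measurable_funS mW.
      - by move=> N z _; rewrite lee_fin.
    rewrite -(cvg_lim _ cv)//; apply: lime_le; first exact: cvgP cv.
    by apply: nearW => N.
  pose C : set (mhalf R n) := cone K x `&` [set z | (r <= z.2)%R].
  have mC : measurable C by exact: measurable_cone_slab.
  have Chs : C `<=` hs by move=> z [/cone_half].
  have k2 : (0 < (2^-1 ^+ n) `^ p :> R)%R by rewrite powR_gt0// exprn_gt0// invr_gt0.
  rewrite powRM ?exprn_ge0// EFinM -lee_pdivrMl ?powR_gt0 ?exprn_gt0//.
  rewrite (_ : ((2 ^+ n) `^ p)^-1 = (2^-1 ^+ n) `^ p)%R; last first.
    by rewrite exprVn -powRN -mulN1r powRrM powR_inv1// exprn_ge0.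
  apply: le_trans Wle; rewrite -/C -ge0_integralZl//; last first.
    by apply: measurable_pow; exact: measurable_funS mk.
  apply: (@le_trans _ _ (\int[mu]_(z in C) (W z)%:E)); last first.
    apply: ge0_subset_integral => //; first exact/measurable_EFinP.
    by move=> z _; rewrite lee_fin.
  apply: ge0_le_integral => //.
  - apply: emeasurable_funM => //; apply: measurable_pow; exact: measurable_funS mk.
  - by apply/measurable_EFinP; exact: measurable_funS mW.
  - move=> z [zc rz]; rewrite -EFinM lee_fin mulrC ler_wpM2l ?powR_ge0//.
    apply: ge0_ler_powR; rewrite ?nnegrE ?(ltW p0) ?exprn_ge0 ?invr_ge0//.
    have [HE _] := fin z; rewrite -lee_fin /H -HE; exact: avg_lower_cone.
rewrite T_areaE ?gt_eqF// -[leRHS](@poweRK _ _ p) ?gt_eqF ?lee_fin ?mulr_ge0 ?exprn_ge0//.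
apply: poweR_le; rewrite ?invr_ge0 ?(ltW p0) ?pint_ge0// poweR_EFin.
by apply: cone_truncation => //; exact: measurable_pow.
Qed.

End area_bound.

(** * Bounded functionals and densities *)

Section linear_functionals.
Context (R : realType) (X : Type).
Variables (E : set (X -> R)) (N : (X -> R) -> \bar R) (null : (X -> R) -> Prop).
Hypothesis E0 : E (cst 0).
Hypothesis ED : forall f h, E f -> E h -> E (f \+ h).
Hypothesis EZ : forall (c : R) f, E f -> E (c \*o f).
Variable L : (X -> R) -> R.
Hypothesis linL : linear_on E L.
Implicit Types f h : X -> R.

Lemma linear_on0 : L (cst 0) = 0.
Proof.
have := linL 1 E0 E0; rewrite mul1r (_ : _ \+ _ = cst 0).
  by move=> /eqP; rewrite -subr_eq0 opprD addNKr oppr_eq0 => /eqP.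
by apply/funext => x /=; rewrite mulr0 addr0.
Qed.

Lemma linear_onZ c f : E f -> L (c \*o f) = c * L f.
Proof.
move=> Ef; have := linL c Ef E0; rewrite linear_on0 addr0 => <-.
by congr L; apply/funext => x /=; rewrite addr0.
Qed.

Lemma linear_onD f h : E f -> E h -> L (f \+ h) = L f + L h.
Proof.
move=> Ef Eh; have := linL 1 Ef Eh; rewrite mul1r => <-.
by congr L; apply/funext => x /=; rewrite mul1r.
Qed.

Lemma linear_space_sum (I : Type) (s : seq I) (F : I -> X -> R) :
  (forall i, E (F i)) -> E (fun x => \sum_(i <- s) F i x).
Proof.
move=> EF; elim: s => [|i s ih].
  by rewrite (_ : (fun _ => _) = cst 0)//; apply/funext => x; rewrite big_nil.
rewrite (_ : (fun _ => _) = F i \+ (fun x => \sum_(i <- s) F i x)); last first.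
  by apply/funext => x; rewrite big_cons.
exact: ED.
Qed.

Lemma linear_on_sum (I : Type) (s : seq I) (F : I -> X -> R) :
  (forall i, E (F i)) -> L (fun x => \sum_(i <- s) F i x) = \sum_(i <- s) L (F i).
Proof.
move=> EF; elim: s => [|i s ih].
  rewrite big_nil (_ : (fun _ => _) = cst 0) ?linear_on0//.
  by apply/funext => x; rewrite big_nil.
rewrite (_ : (fun _ => _) = F i \+ (fun x => \sum_(i <- s) F i x)); last first.
  by apply/funext => x; rewrite big_cons.
rewrite linear_onD// ?ih ?big_cons//; exact: linear_space_sum.
Qed.

Lemma linear_space_sub f h : E f -> E h -> E (f \- h).
Proof.
move=> Ef Eh; rewrite (_ : f \- h = f \+ ((-1) \*o h)).
  by apply: ED => //; exact: EZ.
by apply/funext => x /=; rewrite mulN1r.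
Qed.

Lemma linear_onB f h : E f -> E h -> L (f \- h) = L f - L h.
Proof.
move=> Ef Eh; rewrite (_ : f \- h = f \+ ((-1) \*o h)).
  by rewrite linear_onD ?linear_onZ ?mulN1r//; exact: EZ.
by apply/funext => x /=; rewrite mulN1r.
Qed.

Local Open Scope ereal_scope.

Lemma dual_norm_ge0 : N (cst 0%R) <= 1 -> 0 <= dual_norm E N L.
Proof.
move=> N0; apply: ereal_sup_ubound; exists (cst 0%R) => //.
by rewrite linear_on0 normr0.
Qed.

Hypothesis Nfin : forall f, E f -> 0 <= N f < +oo.
Hypothesis NZ : forall (c : R) f, E f -> N (c \*o f)%R = `|c|%:E * N f.

(** The definition of the dual norm only sees the unit ball; homogeneity gives
    the usual estimate, boundedness being needed where [N] vanishes. *)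
Lemma le_dual_norm f : bounded_on E N L -> E f -> `|L f|%:E <= dual_norm E N L * N f.
Proof.
move=> [c Lc] Ef; have /andP[N0 Noo] := Nfin Ef.
have NE : N f = (fine (N f))%:E by rewrite fineK// ge0_fin_numE.
have [Nf0|Nf0] := eqVneq (N f) 0.
  by have := Lc _ Ef; rewrite Nf0 !mule0.
have nf0 : (0 < fine (N f))%R by rewrite fine_gt0// Noo andbT lt_neqAle eq_sym Nf0.
rewrite NE -lee_pdivrMr// -EFinM.
apply: ereal_sup_ubound; exists ((fine (N f))^-1 \*o f)%R.
  split; first exact: EZ.
  by rewrite NZ// gtr0_norm ?invr_gt0// NE/= -EFinM mulVf// gt_eqF.
by rewrite linear_onZ// normrM gtr0_norm ?invr_gt0// mulrC.
Qed.

Lemma dual_norm_lty : bounded_on E N L -> dual_norm E N L < +oo.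
Proof.
move=> [c Lc]; apply: (@le_lt_trans _ _ `|c|%:E); last exact: ltry.
apply: ge_ereal_sup => _ [f [Ef N1] <-]; apply: le_trans (Lc _ Ef) _.
have /andP[N0 Noo] := Nfin Ef.
rewrite -(@fineK _ (N f)) ?ge0_fin_numE// -EFinM lee_fin.
rewrite -(@fineK _ (N f)) ?ge0_fin_numE// lee_fin in N1.
rewrite (le_trans (ler_norm _))// normrM ler_piMr// ger0_norm// fine_ge0//.
Qed.

End linear_functionals.

Section bounded_functions.
Context d (T : measurableType d) (R : realType).

Definition bounded_mfun : set (T -> R) :=
  [set f : T -> R | measurable_fun setT f /\ exists M : R, forall z, `|f z| <= M].

Lemma bounded_mfun0 : bounded_mfun (cst 0).
Proof. by split; [exact: measurable_cst|exists 0 => z; rewrite normr0]. Qed.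

Lemma bounded_mfunD f g : bounded_mfun f -> bounded_mfun g -> bounded_mfun (f \+ g).
Proof.
move=> [mf [M fM]] [mg [M' gM]]; split; first exact: measurable_funD.
by exists (M + M') => z; rewrite (le_trans (ler_normD _ _))// lerD.
Qed.

Lemma bounded_mfunZ (c : R) f : bounded_mfun f -> bounded_mfun (c \*o f).
Proof.
move=> [mf [M fM]]; split; first exact: measurable_funM.
by exists (`|c| * M) => z; rewrite normrM ler_wpM2l.
Qed.

Lemma bounded_mfun_indic A : measurable A -> bounded_mfun (\1_A).
Proof.
move=> mA; split; first exact: measurable_indic.
by exists 1 => z; rewrite indicE; case: (_ \in _); rewrite ?normr1 ?normr0.
Qed.

(** Bounded measurable functions are uniform limits of step functions. *)
Lemma bounded_functional_eq0 (D : (T -> R) -> R) (C : R) :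
  linear_on bounded_mfun D ->
  (forall f M, bounded_mfun f -> (forall z, `|f z| <= M) -> `|D f| <= C * M) ->
  (forall A, measurable A -> D (\1_A) = 0) ->
  forall f, bounded_mfun f -> D f = 0.
Proof.
move=> linD DC D0.
have b0 := bounded_mfun0; have bD := bounded_mfunD; have bZ := bounded_mfunZ.
have unit f : bounded_mfun f -> (forall z, 0 <= f z <= 1) -> D f = 0.
  move=> bf f01; apply/eqP; rewrite -normr_eq0 eq_le normr_ge0 andbT.
  have C0 : 0 <= C.
    have := DC (\1_setT) 1 (bounded_mfun_indic measurableT).
    rewrite D0// normr0 mulr1; apply => z.
    by rewrite indicE; case: (_ \in _); rewrite ?normr1 ?normr0.
  apply/ler_addgt0Pr => e e0; rewrite add0r.
  have [N hN] : exists N : nat, C * N.+1%:R^-1 <= e.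
    exists (Num.bound (C / e)); rewrite ler_pdivrMr// mulrC -ler_pdivrMr// ltW//.
    apply: (@lt_trans _ _ (Num.bound (C / e))%:R); last by rewrite ltr_nat.
    by apply: archi_boundP; rewrite divr_ge0// ltW.
  pose A (j : 'I_N.+1) : set T := [set z | j.+1%:R <= f z * N.+1%:R].
  have mA j : measurable (A j).
    have mf : measurable_fun setT (fun z => f z * N.+1%:R).
      by apply: measurable_funM => //; case: bf.
    have := mf measurableT `[j.+1%:R, +oo[%classic (measurable_itv _).
    rewrite setTI (_ : _ @^-1` _ = A j)//.
    by apply/seteqP; split => z; rewrite /A /= in_itv/= andbT.
  have bA j : bounded_mfun (\1_(A j)) := bounded_mfun_indic (mA j).
  pose g : T -> R := N.+1%:R^-1 \*o (fun z => \sum_(j < N.+1) \1_(A j) z).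
  have bg : bounded_mfun g.
    by apply: bZ; exact: (linear_space_sum b0 bD _ bA).
  have Dg : D g = 0.
    rewrite (linear_onZ b0 linD); last exact: (linear_space_sum b0 bD _ bA).
    rewrite (linear_on_sum b0 bD linD _ bA) big1 ?mulr0// => j _.
    by rewrite D0.
  rewrite -[D f]subr0 -Dg -(linear_onB b0 bZ linD bf bg).
  apply: le_trans hN; apply: DC; first exact: (linear_space_sub bD bZ bf bg).
  move=> z; rewrite /g /=; have := layer_approx N (f01 z).
  rewrite (eq_bigr (fun j : 'I_N.+1 => \1_(A j) z))// => j _.
  rewrite indicE; have [h|h] := boolP (j.+1%:R <= f z * N.+1%:R).
    by rewrite mem_set.
  by rewrite memNset//; exact/negP.
move=> f bf; have [mf [M0 fM0]] := bf.
pose M := 1 + `|M0|.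
have M1 : 0 < M by rewrite ltr_pwDl.
have fM z : `|f z| <= M.
  by rewrite (le_trans (fM0 z))// (le_trans (ler_norm _))// lerDr.
have bT : bounded_mfun (\1_setT) := bounded_mfun_indic measurableT.
pose g := (2 * M)^-1 \*o f \+ 2^-1 \*o \1_setT.
have bg : bounded_mfun g by apply: bD; exact: bZ.
have Dg : D g = 0.
  apply: unit => // z; rewrite /g /= indicT mulr1.
  have := fM z; rewrite ler_norml => /andP[h1 h2].
  have -> : (2 * M)^-1 * f z + 2^-1 = (f z + M) / (2 * M).
    by field; rewrite gt_eqF.
  rewrite divr_ge0 ?mulr_ge0 ?(ltW M1)//=; last by rewrite -lerBlDr sub0r.
  by rewrite ler_pdivrMr ?mulr_gt0// mul1r mulr_natl mulr2n lerD2r.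
have := linear_onD linD (bZ (2 * M)^-1 _ bf) (bZ 2^-1 _ bT).
rewrite -/g Dg !(linear_onZ b0 linD)// D0// mulr0 addr0 => /esym/eqP.
by rewrite mulf_eq0 invr_eq0 mulf_eq0 pnatr_eq0/= (gt_eqF M1)/= => /eqP.
Qed.

End bounded_functions.

Section representation_by_density.
Local Open Scope ereal_scope.
Context d (T : measurableType d) (R : realType).
Variable m : {measure set T -> \bar R}.
Hypothesis sf : sigma_finite setT m.
Variable nu : set T -> R.
Hypothesis nuU : forall A B, measurable A -> measurable B -> A `&` B = set0 ->
  nu (A `|` B) = (nu A + nu B)%R.
Variables (F : T -> \bar R) (c : R) (r : R).
Hypothesis c0 : (0 <= c)%R.
Hypothesis r0 : (0 < r)%R.
Hypothesis mF : measurable_fun setT F.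
Hypothesis F0 : forall x, 0 <= F x.
Hypothesis intF : \int[m]_x F x < +oo.
Hypothesis nuF : forall A, measurable A ->
  `|nu A|%:E <= c%:E * (\int[m]_(x in A) F x) `^ r.

Let chg (A : set T) : \bar R := (nu A)%:E.

Let nu0 : nu set0 = 0%R.
Proof.
have := nuU measurable0 measurable0 (setI0 _); rewrite setU0 => /eqP.
by rewrite -subr_eq0 opprD addNKr oppr_eq0 => /eqP.
Qed.

Let chg0 : chg set0 = 0. Proof. by rewrite /chg nu0. Qed.

Let chg_fin A : measurable A -> chg A \is a fin_num. Proof. by []. Qed.

Let nu_null A : measurable A -> m A = 0 -> nu A = 0%R.
Proof.
move=> mA A0; have := nuF mA.
rewrite null_set_integral//; last exact: measurable_funTS.
  by rewrite poweR0r ?gt_eqF// mule0 lee_fin normr_le0 => /eqP.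
Qed.

Let nu_bigU (G : (set T)^nat) : (forall i, measurable (G i)) -> trivIset setT G ->
  forall k, nu (\bigcup_(i < k) G i) = (\sum_(0 <= i < k) nu (G i))%R.
Proof.
move=> mG tG; elim=> [|k ih].
  by rewrite bigcup_mkord big_ord0 big_geq// nu0.
rewrite big_nat_recr//= -ih -nuU//.
- by rewrite !bigcup_mkord big_ord_recr.
- by apply: bigcup_measurable.
- rewrite -subset0 => x [[i /= ik Gi] Gk].
  move/trivIsetP : tG => /(_ i k I I); rewrite (ltn_eqF ik) => /(_ isT) d0.
  by have : (G i `&` G k) x by []; rewrite d0.
Qed.

Let chg_sigma_additive : semi_sigma_additive chg.
Proof.
move=> G mG tG mUG.
have S k : measurable (\bigcup_(i < k) G i) by exact: bigcup_measurable.
have sub k : \bigcup_(i < k) G i `<=` \bigcup_i G i by move=> x [i _ Gi]; exists i.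
have tail k : nu (\bigcup_i G i) =
    (nu (\bigcup_(i < k) G i) + nu (\bigcup_i G i `\` \bigcup_(i < k) G i))%R.
  rewrite -nuU//; first by rewrite setDUK.
    exact: measurableD.
  by rewrite setDE setICA setICr setI0.
rewrite /chg -(_ : (fun k => (nu (\bigcup_(i < k) G i))%:E) = (fun k => _)); last first.
  by apply/funext => k; rewrite nu_bigU// sumEFin.
apply/fine_cvgP; split; first exact: nearW.
apply/cvgrPdist_le => e e0.
pose e' := ((e / (c + 1)) `^ r^-1)%R.
have c1 : (0 < c + 1)%R by rewrite ltr_wpDl.
have e'0 : (0 < e')%R by rewrite powR_gt0// divr_gt0.
have fU : \int[m]_(x in \bigcup_i G i) F x < +oo.
  by apply: le_lt_trans intF; exact: ge0_subset_integral.
have ndS : nondecreasing_seq (fun k => \bigcup_(i < k) G i).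
  by move=> i j ij; apply/subsetPset => x [a /= ai Ga]; exists a => //=; exact: leq_trans ij.
have SU : \bigcup_k (\bigcup_(i < k) G i) = \bigcup_i G i.
  apply/seteqP; split => [x [k _ [i _ Gi]]|x [i _ Gi]]; first by exists i.
  by exists i.+1 => //; exists i => /=.
have [k0 hk0] := integral_tail mUG (measurable_funTS mF) (fun x _ => F0 x) fU S ndS SU e'0.
near=> k.
rewrite /= (tail k) addrAC subrr add0r -lee_fin.
have mD j : measurable (\bigcup_i G i `\` \bigcup_(i < j) G i) by exact: measurableD.
apply: (le_trans (nuF (mD k))).
apply: (@le_trans _ _ (c%:E * (e'%:E `^ r))).
  apply: lee_wpmul2l => //; apply: poweR_le; first exact: ltW.
    by apply: integral_ge0 => x _; exact: F0.
  apply: ltW; apply: le_lt_trans hk0; apply: ge0_subset_integral => //.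
    exact: measurable_funTS.
  have k0k : (k0 <= k)%N by near: k; exact: nbhs_infty_ge.
  by move=> x [Ux nx]; split => // -[i /= ik Gi]; apply: nx; exists i => //=; exact: leq_trans k0k.
rewrite poweR_EFin /e' -powRrM mulVf ?gt_eqF// powRr1 ?divr_ge0 ?(ltW e0) ?(ltW c1)//.
rewrite -EFinM lee_fin mulrCA ler_piMr ?(ltW e0)// ler_pdivrMr// mul1r.
by rewrite lerDl.
Unshelve. all: by end_near. Qed.

HB.instance Definition _ := isCharge.Build _ _ _ chg chg0 chg_fin chg_sigma_additive.

(** The bound by a power of an integral makes [nu] countably additive and absolutely
    continuous, so that it has a Radon-Nikodym density. *)
Lemma functional_density : exists f : T -> R,
  m.-integrable setT (EFin \o f) /\
  forall A, measurable A -> (nu A)%:E = \int[m]_(x in A) (f x)%:E.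
Proof.
have dom : chg `<< sfm sf.
  by apply/null_content_dominatesP => A mA A0; rewrite /chg nu_null.
have fE x : (Radon_Nikodym chg (sfm sf)) x = (fine ((Radon_Nikodym chg (sfm sf)) x))%:E.
  by rewrite fineK//; exact: Radon_Nikodym_fin_num.
exists (fine \o Radon_Nikodym chg (sfm sf)); split.
  have := Radon_Nikodym_integrable dom.
  by apply: eq_integrable => // x _; rewrite /= -fE.
move=> A mA; rewrite -/(chg A) (Radon_Nikodym_integral dom mA).
by apply: eq_integral => x _; rewrite /= -fE.
Qed.

End representation_by_density.

(** * The dual of U *)

Section U_dual.
Context (R : realType) (n : nat) (K : set 'rV[R]_n).
Hypothesis hK : symmetric_convex_body K.
Variables p q : R.
Hypothesis p1 : 1 < p.
Hypothesis pq : p^-1 + q^-1 = 1.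
Local Open Scope ereal_scope.
Local Notation hs := (@half_space R n : set (mhalf R n)).
Local Notation mu := (dxdt R n).
Local Notation V := (V_norm K p).
Local Notation U := (U_space K p q).
Local Notation T := (T_space K p).
Local Notation pairing := (@integral_pairing R n).
Implicit Types (f g h a b : half R n -> R) (L : (half R n -> R) -> R).

Let mhs : measurable hs := @measurable_half_space R n.
Let p0 : (0 < p)%R. Proof. exact: lt_trans p1. Qed.
Let q1 : (1 < q)%R. Proof. by have [] := conjugate_exponents p1 pq. Qed.
Let q0 : (0 < q)%R. Proof. exact: lt_trans q1. Qed.
Let U0 : U (cst 0%R). Proof. exact: U_space0. Qed.
Let UZ (c : R) f : U f -> U (c \*o f)%R. Proof. exact: U_spaceZ. Qed.
Let UB f g : U f -> U g -> U (f \- g)%R. Proof. exact: U_spaceB. Qed.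
Let mU f : U f -> measurable_fun hs f. Proof. exact: U_measurable. Qed.
Let Ufin f : U f -> V f < +oo. Proof. by case=> -[]. Qed.
Let VZ (c : R) f : U f -> V (c \*o f)%R = `|c|%:E * V f.
Proof. by move=> Uf; apply: V_normZ => //; exact: mU. Qed.
Let Unonneg f : U f -> 0 <= V f < +oo.
Proof. by move=> Uf; rewrite V_norm_ge0//= Ufin. Qed.
Let mT g : T g -> measurable_fun hs g. Proof. by case=> -[]. Qed.
Let Tfin g : T g -> T_norm K p g = (fine (T_norm K p g))%:E.
Proof. by move=> Tg; rewrite fineK// ge0_fin_numE ?T_norm_ge0//; case: Tg. Qed.
Let Vfin f : U f -> V f = (fine (V f))%:E.
Proof. by move=> Uf; rewrite fineK// ge0_fin_numE ?V_norm_ge0// Ufin. Qed.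

Lemma pairing_integrable f g : U f -> T g -> integral_pairable f g.
Proof.
move=> Uf Tg; apply/integrableP; split.
  by apply/measurable_EFinP; apply: measurable_funM; [exact: mU|exact: mT].
apply: le_lt_trans (V_pair hK p1 (mU Uf) (Ufin Uf) Tg) _.
by rewrite (Vfin Uf) (Tfin Tg) -EFinM ltry.
Qed.

Lemma pairing_le f g : U f -> T g -> `|integral_pairing f g|%:E <= V f * T_norm K p g.
Proof.
move=> Uf Tg; have int := pairing_integrable Uf Tg.
rewrite EFin_normr_Rintegral//.
apply: le_trans (V_pair hK p1 (mU Uf) (Ufin Uf) Tg).
by apply: le_abse_integral => //; case/integrableP: int.
Qed.

Lemma pairing_linear g : T g -> linear_on U (pairing ^~ g).
Proof.
move=> Tg c f h Uf Uh; have [If Ih] := (pairing_integrable Uf Tg, pairing_integrable Uh Tg).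
have Icf := pairing_integrable (UZ c Uf) Tg.
rewrite /integral_pairing -RintegralZl// -RintegralD//.
  by apply: eq_Rintegral => z _ /=; rewrite mulrDl mulrA.
by apply: eq_integrable Icf => // z _; rewrite /= mulrA.
Qed.

Lemma pairing_bounded g : T g -> bounded_on U V (pairing ^~ g).
Proof.
move=> Tg; exists (fine (T_norm K p g)) => f Uf; rewrite muleC -Tfin//.
exact: pairing_le.
Qed.

Lemma dual_norm_le_T_norm g : T g -> dual_norm U V (pairing ^~ g) <= T_norm K p g.
Proof.
move=> Tg; apply: ge_ereal_sup => _ [f [Uf Vf1] <-].
apply: le_trans (pairing_le Uf Tg) _; rewrite (Tfin Tg).
by rewrite -[leRHS]mul1e lee_wpmul2r// -Tfin// T_norm_ge0.
Qed.

Lemma T_area_le_T_norm g (m : \bar R) : (forall x, T_area K p g x <= m) ->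
  T_norm K p g <= m.
Proof. by move=> h; apply/ess_supP; apply: nearW => x; exact: h. Qed.

(** [T_area_le], the dual norm being the bound on atoms. *)
Lemma T_norm_le_dual_norm g : T g ->
  T_norm K p g <= (2 ^+ n)%:E * dual_norm U V (pairing ^~ g).
Proof.
move=> Tg; have mg := mT Tg.
have linP := pairing_linear Tg; have bP := pairing_bounded Tg.
set D := dual_norm _ _ _.
have V0 : V (cst 0%R) <= 1.
  have := VZ 0%R U0; rewrite normr0 mul0e (_ : _ \*o _ = cst 0)%R => [->//|].
  by apply/funext => z /=; rewrite mul0r.
have D0 : 0 <= D by apply: dual_norm_ge0.
have DE : D = (fine D)%:E by rewrite fineK// ge0_fin_numE//; exact: dual_norm_lty Unonneg bP.
rewrite DE -EFinM; apply: T_area_le_T_norm => x.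
apply: (T_area_le hK p1 pq mg (fine_ge0 D0) (S := sublevel g)).
- by move=> N; exact: measurable_sublevel.
- exact: sublevel_nd.
- exact: sublevel_bigcup.
- by move=> N z [].
- by move=> N z [].
move=> b u N M mb bM b0 /(unit_L1_weight hK).
set h := fun z => (\int[_]_(y in _) u y)%R; move=> th.
have bfin : Lp_norm_on q hs b < +oo.
  rewrite (Lp_norm_onE hs b (lt0r_neq0 q0)).
  have hfin : pint mu q hs b < +oo.
    apply: (bounded_compact_pint q0 mb bM (@exh_compact R n N) (@exh_half R n N)).
    by move=> z hz zN; apply: b0 => // -[].
  rewrite -(@fineK _ (pint _ _ _ _)) ?poweR_EFin ?ltry//.
  by rewrite ge0_fin_numE// pint_ge0.
have Ubh : U (fun z => b z * h z)%R by exact: U_space_weight.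
apply: (le_trans (le_dual_norm U0 UZ linP Unonneg VZ bP Ubh)).
by rewrite -/D -DE lee_wpmul2l//; exact: V_norm_weight.
Qed.

(** Test with the sign of the difference, cut to its sublevel sets. *)
Lemma pairing_eq g1 g2 : T g1 -> T g2 ->
  (forall f, U f -> pairing f g1 = pairing f g2) <-> eq_ae g1 g2.
Proof.
move=> T1 T2; split => [h|[N [mN N0 sub]] f Uf].
- pose g := (g1 \- g2)%R.
  have mg : measurable_fun hs g by apply: measurable_funB; exact: mT.
  have z0 k : \int[mu]_(z in sublevel g k) `|g z|%:E = 0.
    pose f z := (Num.sg (g z) * \1_(sublevel g k) z)%R.
    have mf : measurable_fun hs f.
      apply: measurable_funM; last by apply: measurable_indic; exact: measurable_sublevel.
      exact: (measurableT_comp (@measurable_sg R) mg).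
    have Uf : U f.
      apply: (U_space_bounded_compact hK p1 pq mf (M := 1) _ (@exh_compact R n k)
        (@exh_half R n k)) => z hz.
        rewrite /f normrM indicE; case: (_ \in _); rewrite ?normr0 ?mulr0 ?ler01//.
        by rewrite normr1 mulr1 normr_sg; case: eqP.
      by move=> zk; rewrite /f indicE memNset ?mulr0// => -[].
    have := h f Uf.
    rewrite /integral_pairing => /eqP; rewrite -subr_eq0 -RintegralB//.
    - have fg z : (f z * g1 z - f z * g2 z = `|g z| * \1_(sublevel g k) z)%R.
        by rewrite -mulrBr -[(g1 z - g2 z)%R]/(g z) (normrEsg (g z)) /f; ring.
      under eq_Rintegral do rewrite fg.
      move=> /eqP e0.
      have int : mu.-integrable hs (EFin \o (fun z => `|g z| * \1_(sublevel g k) z)%R).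
        have := integrableB mhs (pairing_integrable Uf T1) (pairing_integrable Uf T2).
        apply: eq_integrable => // z _ /=; rewrite -EFinB; congr EFin; exact: fg.
      have := integrable_fin_num mhs int; move=> /fineK; rewrite -[fine _]/(Rintegral _ _ _) e0.
      rewrite (integral_supp _ (@sublevel_half _ _ g k)).
        move=> e1; rewrite [RHS]e1; apply: eq_integral => z zk /=; rewrite indicE zk mulr1//.
      by move=> z hz zk; rewrite /= indicE memNset// mulr0.
    - exact: pairing_integrable.
    - exact: pairing_integrable.
  have cv : \int[mu]_(z in sublevel g k) `|g z|%:E @[k --> \oo] -->
      \int[mu]_(z in hs) `|g z|%:E.
    rewrite -{1}(sublevel_bigcup g); apply: ge0_nondecreasing_set_cvg_integral => //.
    - exact: sublevel_nd.
    - by move=> k; exact: measurable_sublevel.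
    - move=> k; apply/measurable_EFinP; apply: measurableT_comp => //.
      by apply: measurable_funS mg => //; exact: sublevel_half.
  have i0 : \int[mu]_(z in hs) `|g z|%:E = 0.
    by rewrite -(cvg_lim _ cv)//; under eq_fun do rewrite z0; exact: lim_cst.
  have [N [mN N0 sub]] : ae_eq mu hs (EFin \o g) (cst 0).
    by apply/ae_eq_integral_abs => //; exact/measurable_EFinP.
  by exists N; split => // z hz; apply: sub => /= h2; apply: hz => hz; case: (h2 hz).
- congr fine; apply: ae_eq_integral => //.
  + by apply/measurable_EFinP; apply: measurable_funM; [exact: mU|exact: mT].
  + by apply/measurable_EFinP; apply: measurable_funM; [exact: mU|exact: mT].
  + exists N; split => // z hz; apply: sub => /= h2; apply: hz => hz.
    by move/eqP: (h2 hz); rewrite subr_eq0 => /eqP ->.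
Qed.

Lemma measurable_posV (w : half R n -> R) : measurable_fun hs w -> (forall z, half_space z -> (0 < w z)%R) ->
  measurable_fun hs (fun z => (w z)^-1)%R.
Proof.
move=> mw w0; apply: (eq_measurable_fun (fun z => w z `^ (-1))%R) => [z /set_mem hz|].
  by rewrite powR_inv1// ltW// w0.
exact: (measurableT_comp (measurable_powR _) mw).
Qed.

(** The functional is represented against a fixed strictly positive weight [w]
    of the space, where every bounded multiple of [w] is admissible; the density
    of the resulting finite charge is then divided by [w]. *)
Lemma functional_weight_density L c : linear_on U L -> (0 <= c)%R ->
  (forall f, U f -> `|L f|%:E <= c%:E * V f) ->
  exists w k : half R n -> R, [/\ measurable_fun hs w, forall z, half_space z -> (0 < w z)%R,
    measurable_fun hs k & forall phi, bounded_mfun (phi : mhalf R n -> R) ->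
      [/\ U (fun z => phi z * w z)%R,
          mu.-integrable hs (EFin \o (fun z => phi z * w z * k z)%R) &
          L (fun z => phi z * w z)%R = pairing (fun z => phi z * w z)%R k]].
Proof.
move=> linL c0 Lc.
have [a [ma a01 inta]] := positive_integrable (sigma_finite_dxdt R n).
have [h th hpos] := positive_weight hK.
have a0 z : (0 < a z)%R by case/andP: (a01 z).
have a1 z : (a z <= 1)%R by case/andP: (a01 z).
have mea : measurable_fun setT (EFin \o a) by exact/measurable_EFinP.
have ea0 z : 0 <= (EFin \o a) z by rewrite lee_fin ltW.
pose w z := (a z * h z)%R.
have mh : measurable_fun hs h by case: th.
have mw : measurable_fun hs w by apply: measurable_funM => //; exact: measurable_funTS.
have w0 z : half_space z -> (0 < w z)%R by move=> hz; rewrite mulr_gt0// hpos.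
have q10 : (0 < q^-1)%R by rewrite invr_gt0.
have powle M t : (0 <= M)%R -> (0 <= t <= 1)%R -> ((M * t) `^ q <= M `^ q * t)%R.
  move=> M0 /andP[t0 t1]; rewrite powRM// ler_wpM2l ?powR_ge0//.
  have [->|tn0] := eqVneq t 0%R; first by rewrite powR0 ?gt_eqF.
  apply: ge1r_powR; last exact: ltW.
  by rewrite lt_neqAle eq_sym tn0 t0 t1.
have Lpa (phi : mhalf R n -> R) (M : R) (D : set (mhalf R n)) : measurable D ->
    measurable_fun setT phi -> (forall z, (`|phi z| <= M)%R) ->
    (forall z, ~ D z -> phi z = 0%R) ->
    Lp_norm_on q hs (fun z => phi z * a z)%R <= M%:E * (\int[mu]_(z in D) (a z)%:E) `^ q^-1.
  move=> mD mphi phiM phi0.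
  have M0 : (0 <= M)%R by rewrite (le_trans _ (phiM (0%R, 0%R))).
  rewrite (Lp_norm_onE hs _ (lt0r_neq0 q0)).
  have I0 : 0 <= \int[mu]_(z in D) (a z)%:E by apply: integral_ge0 => z _; exact: ea0.
  have -> : M%:E * (\int[mu]_(z in D) (a z)%:E) `^ q^-1 =
      ((M `^ q)%:E * \int[mu]_(z in D) (a z)%:E) `^ q^-1.
    rewrite poweRM ?lee_fin ?powR_ge0//; congr (_ * _).
    by rewrite poweR_EFin -powRrM mulfV ?gt_eqF// powRr1.
  apply: poweR_le; [exact: ltW|exact: pint_ge0|].
  rewrite -ge0_integralZl ?lee_fin ?powR_ge0//; last 2 first.
  - exact: measurable_funTS.
  - by move=> z _; exact: ea0.
  have mpa : measurable_fun setT (fun z => phi z * a z)%R by exact: measurable_funM.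
  rewrite /pint (@integral_supp _ _ _ mu (hs `&` D)); last 2 first.
  - by move=> z [].
  - move=> z hz zD; rewrite phi0 ?mul0r ?normr0 ?powR0 ?gt_eqF// => Dz.
    by apply: zD.
  apply: (@le_trans _ _ (\int[mu]_(z in hs `&` D) ((M `^ q)%:E * (a z)%:E))).
    apply: ge0_le_integral => //.
    - exact: measurableI.
    - by apply: measurable_pow; exact: measurable_funTS.
    - by apply: emeasurable_funM => //; exact: measurable_funTS.
    - move=> z _; rewrite -EFinM lee_fin; apply: le_trans (powle M (a z) M0 _).
        apply: ge0_ler_powR; rewrite ?nnegrE ?(ltW q0) ?mulr_ge0 ?(ltW (a0 z))//.
        by rewrite normrM (gtr0_norm (a0 z)) ler_wpM2r// ltW.
      by rewrite (ltW (a0 z)) a1.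
  apply: ge0_subset_integral => //.
  - exact: measurableI.
  - by apply: emeasurable_funM => //; exact: measurable_funTS.
  - by move=> z _; rewrite mule_ge0 ?lee_fin ?powR_ge0// ltW.
have phiE (phi : mhalf R n -> R) z : (phi z * w z = (phi z * a z) * h z)%R.
  by rewrite mulrA.
have mphia (phi : mhalf R n -> R) : measurable_fun setT phi ->
    measurable_fun hs (fun z => phi z * a z)%R.
  by move=> mphi; apply: measurable_funTS; exact: measurable_funM.
have inta1 : (\int[mu]_(z in setT) (a z)%:E) `^ q^-1 <= 1.
  have -> : 1 = (1%E : \bar R) `^ q^-1 by rewrite poweR_EFin powR1.
  by apply: poweR_le => //; [exact: ltW|apply: integral_ge0 => z _; exact: ea0].
have Lpfin (phi : mhalf R n -> R) (M : R) : measurable_fun setT phi ->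
    (forall z, (`|phi z| <= M)%R) -> Lp_norm_on q hs (fun z => phi z * a z)%R <= M%:E.
  move=> mphi phiM; apply: le_trans (Lpa phi M setT measurableT mphi phiM _) _ => [z nz|].
    by exfalso; apply: nz.
  have M0 : (0 <= M)%R by rewrite (le_trans _ (phiM (0%R, 0%R))).
  by rewrite -[leRHS]mule1; apply: lee_wpmul2l.
have Uphi (phi : mhalf R n -> R) : bounded_mfun phi -> U (fun z => phi z * w z)%R.
  move=> [mphi [M phiM]].
  rewrite (_ : (fun z => phi z * w z)%R = fun z => (phi z * a z) * h z)%R; last first.
    by apply/funext => z; exact: phiE.
  apply: U_space_weight => //; first exact: mphia.
  by apply: le_lt_trans (Lpfin phi M mphi phiM) _; rewrite ltry.
have Lphi (phi : mhalf R n -> R) (M : R) (D : set (mhalf R n)) : measurable D ->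
    measurable_fun setT phi -> (forall z, (`|phi z| <= M)%R) ->
    (forall z, ~ D z -> phi z = 0%R) ->
    `|L (fun z => phi z * w z)%R|%:E <= (c * M)%:E * (\int[mu]_(z in D) (a z)%:E) `^ q^-1.
  move=> mD mphi phiM phi0.
  have Uw : U (fun z => phi z * w z)%R by apply: Uphi; split => //; exists M.
  apply: (le_trans (Lc _ Uw)); rewrite EFinM -muleA; apply: lee_wpmul2l; first by rewrite lee_fin.
  apply: le_trans (Lpa phi M D mD mphi phiM phi0).
  rewrite (_ : (fun z => phi z * w z)%R = fun z => (phi z * a z) * h z)%R; last first.
    by apply/funext => z; exact: phiE.
  by apply: V_norm_weight => //; exact: mphia.
pose nu (A : set (mhalf R n)) := L (fun z => \1_A z * w z)%R.
have ind1 (A : set (mhalf R n)) z : (`|\1_A z| <= 1 :> R)%R.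
  by rewrite indicE; case: (_ \in _); rewrite ?normr1 ?normr0.
have ind0 (A : set (mhalf R n)) z : ~ A z -> \1_A z = 0%R :> R.
  by move=> Az; rewrite indicE memNset.
have nuU A B : measurable A -> measurable B -> A `&` B = set0 ->
    nu (A `|` B) = (nu A + nu B)%R.
  move=> mA mB AB; rewrite /nu -(linear_onD linL); last 2 first.
  - by apply: Uphi; exact: bounded_mfun_indic.
  - by apply: Uphi; exact: bounded_mfun_indic.
  congr L; apply/funext => z /=; rewrite -mulrDl; congr (_ * _)%R.
  rewrite !indicE in_setU; case: (boolP (z \in A)) => [zA|]; last by rewrite add0r.
  rewrite (_ : z \in B = false) ?addr0//; apply/negP => zB.
  have : (A `&` B) z by split; exact: set_mem.
  by rewrite AB.
have nuF A : measurable A -> `|nu A|%:E <= c%:E * (\int[mu]_(z in A) (EFin \o a) z) `^ q^-1.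
  move=> mA; have := Lphi (\1_A) 1%R A mA (measurable_indic mA) (ind1 A) (@ind0 A).
  by rewrite mulr1.
have [|f [intf nuE]] := functional_density (sigma_finite_dxdt R n) nuU c0 q10 mea ea0 _ nuF.
  by apply: le_lt_trans inta _; rewrite ltry.
have mf : measurable_fun setT f by apply/measurable_EFinP; case/integrableP: intf.
have intphi (phi : mhalf R n -> R) : bounded_mfun phi ->
    mu.-integrable hs (EFin \o (fun z => phi z * f z)%R).
  move=> [mphi [M phiM]].
  have intf' := integrableS measurableT mhs (@subsetT _ _) intf.
  apply: (le_integrable mhs _ _ (integrableZl mhs M intf')).
    by apply/measurable_EFinP; apply: measurable_funTS; exact: measurable_funM.
  move=> z _; rewrite /= lee_fin !normrM ler_wpM2r//.
  by rewrite (le_trans (phiM z))// ler_norm.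
pose D (phi : mhalf R n -> R) :=
  (L (fun z => phi z * w z) - \int[mu]_(z in hs) (phi z * f z))%R.
have intZ (phi : mhalf R n -> R) e : bounded_mfun phi ->
    mu.-integrable hs (EFin \o (fun z => e * (phi z * f z))%R).
  move=> bphi; have := intphi _ (bounded_mfunZ e bphi).
  by apply: eq_integrable => // z _; rewrite /= mulrA.
have D_eq0 : forall phi, bounded_mfun phi -> D phi = 0%R.
  apply: (@bounded_functional_eq0 _ _ _ D
      (c + fine (\int[mu]_(z in hs) `|f z|%:E))%R).
  - move=> e phi psi bphi bpsi; rewrite /D.
    have -> : (fun z => (e \*o phi \+ psi) z * w z)%R =
        ((e \*o (fun z => phi z * w z)) \+ (fun z => psi z * w z))%R.
      by apply/funext => z /=; rewrite mulrDl mulrA.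
    rewrite linL; [|exact: Uphi|exact: Uphi].
    have -> : (\int[mu]_(z in hs) ((e \*o phi \+ psi) z * f z) =
        e * (\int[mu]_(z in hs) (phi z * f z)) + \int[mu]_(z in hs) (psi z * f z))%R.
      rewrite -RintegralZl//; last exact: intphi.
      rewrite -RintegralD//; last 2 first.
      - exact: intZ.
      - exact: intphi.
      by apply: eq_Rintegral => z _ /=; rewrite mulrDl mulrA.
    by ring.
  - move=> phi M [mphi _] phiM; rewrite /D.
    have bphi : bounded_mfun phi by split => //; exists M.
    rewrite (le_trans (ler_normB _ _))// mulrDl lerD//.
      have := Lphi phi M setT measurableT mphi phiM.
      have noT z : ~ [set: mhalf R n] z -> phi z = 0%R by move=> nz; exfalso; apply: nz.
      move=> /(_ noT); rewrite -lee_fin => /le_trans; apply.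
      have M0 : (0 <= M)%R by rewrite (le_trans _ (phiM (0%R, 0%R))).
      by rewrite -[leRHS]mule1; apply: lee_wpmul2l => //; rewrite lee_fin mulr_ge0.
    rewrite (le_trans (le_normr_Rintegral mhs (intphi _ bphi)))//.
    have intf' := integrable_norm (integrableS measurableT mhs (@subsetT _ _) intf).
    rewrite mulrC -[fine _]/(\int[mu]_(z in hs) `|f z|)%R -RintegralZl//.
    apply: le_Rintegral => //.
    + by have := integrable_norm (intphi _ bphi); apply: eq_integrable.
    + by have := integrableZl mhs M intf'; apply: eq_integrable.
    + by move=> z _; rewrite normrM ler_wpM2r.
  - move=> A mA; rewrite /D -/(nu A).
    have -> : nu A = nu (A `&` hs).
      apply/eqP; rewrite -subr_eq0 /nu -(linear_onB U0 UZ linL); last 2 first.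
      - by apply: Uphi; exact: bounded_mfun_indic.
      - by apply: Uphi; apply: bounded_mfun_indic; exact: measurableI.
      set F := (_ \- _)%R; have UF : U F.
        by apply: UB; apply: Uphi; apply: bounded_mfun_indic => //; exact: measurableI.
      have VF : V F = 0.
        apply: (V_norm_eq0 hK p1 pq (mU UF)).2; apply: aeW => z hz; rewrite /F /= !indicE in_setI.
        by rewrite (mem_set hz) andbT subrr.
      by have := Lc _ UF; rewrite VF mule0 lee_fin normr_le0.
    have := nuE _ (measurableI _ _ mA mhs); rewrite setIC => e1.
    rewrite -[X in (X - _)%R]/(fine (_)%:E) e1 -/(Rintegral _ _ _).
    rewrite Rintegral_mkcondr (@eq_Rintegral _ _ _ _ _ (fun z => \1_A z * f z)%R) ?subrr// => z _.
    by rewrite patchE indicE; case: ifP => _; rewrite ?mul1r ?mul0r.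
exists w, (fun z => f z / w z)%R; split => //.
  apply: measurable_funM; first exact: measurable_funTS.
  exact: measurable_posV.
move=> phi bphi.
have E z : hs z -> (phi z * w z * (f z / w z) = phi z * f z)%R.
  by move=> hz; field; rewrite gt_eqF// w0.
split; first exact: Uphi.
  by apply: eq_integrable (intphi _ bphi) => // z /set_mem hz /=; rewrite E.
have /eqP := D_eq0 _ bphi; rewrite /D subr_eq0 => /eqP ->.
by apply: eq_Rintegral => z /set_mem hz; rewrite E.
Qed.

(** Cut to such a set, [f / w] is bounded. *)
Let doubly_sub f w (N : nat) : set (mhalf R n) :=
  sublevel f N `&` sublevel (fun z => (w z)^-1)%R N.

Let doubly_sub_nd f w : nondecreasing_seq (doubly_sub f w).
Proof.
move=> i j ij; apply/subsetPset => z [zf zw].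
by split; [move: zf|move: zw]; apply/subsetPset; exact: sublevel_nd.
Qed.

Let doubly_sub_bigcup f w : \bigcup_N doubly_sub f w N = hs.
Proof.
apply/seteqP; split => [z [N _ [+ _]]|z hz]; first exact: sublevel_half.
have := hz; rewrite -(sublevel_bigcup f) => -[i _ iz].
have := hz; rewrite -(sublevel_bigcup (fun z => (w z)^-1)%R) => -[j _ jz].
exists (maxn i j) => //; split.
  by move: iz; apply/subsetPset; apply: sublevel_nd; rewrite leq_maxl.
by move: jz; apply/subsetPset; apply: sublevel_nd; rewrite leq_maxr.
Qed.

(** The area of the density is bounded by testing against truncated atoms. The
    representation extends by density from truncated functions to compactly
    supported ones, then to the whole space. *)
Lemma U_representation L : linear_on U L -> bounded_on U V L ->
  exists2 k, T k & forall f, U f -> L f = pairing f k.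
Proof.
move=> linL [c0 Lc0]; pose c := `|c0|%R.
have c_ge0 : (0 <= c)%R by exact: normr_ge0.
have Lc f : U f -> `|L f|%:E <= c%:E * V f.
  move=> Uf; apply: (le_trans (Lc0 f Uf)); rewrite (Vfin Uf) -!EFinM lee_fin.
  by rewrite ler_wpM2r ?fine_ge0 ?V_norm_ge0// ler_norm.
have [w [k [mw w0 mk rep]]] := functional_weight_density linL c_ge0 Lc.
have mwV := measurable_posV mw w0.
have mS f N : measurable_fun hs f -> measurable (doubly_sub f w N).
  by move=> mf; apply: measurableI; exact: measurable_sublevel.
have Shs f N : doubly_sub f w N `<=` hs by move=> z [/sublevel_half].
have bphi f (N : nat) (M : R) (S : set (mhalf R n)) : measurable_fun hs f ->
    measurable S -> S `<=` hs -> (forall z, S z -> (`|f z| <= M)%R /\ (`|(w z)^-1| <= N%:R)%R) ->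
    bounded_mfun ((fun z => f z / w z)%R \_ S).
  move=> mf mS' SH fM; split.
    apply/(measurable_restrictT _ mS'); apply: measurable_funS SH _ => //.
    exact: measurable_funM.
  exists (`|M| * N%:R)%R => z; rewrite patchE; case: ifPn => [/set_mem zS|_].
    have [h1 h2] := fM z zS; rewrite normrM ler_pM//.
    by rewrite (le_trans h1)// ler_norm.
  by rewrite normr0 mulr_ge0.
have Tk : T k.
  have area := T_area_le hK p1 pq mk c_ge0 (S := doubly_sub k w).
  have Tle : T_norm K p k <= (2 ^+ n * c)%:E.
    apply: T_area_le_T_norm => x; apply: area.
    - by move=> N; exact: mS.
    - exact: doubly_sub_nd.
    - exact: doubly_sub_bigcup.
    - by move=> N z [[]].
    - by move=> N z [[]].
    move=> b u N M mb bM b0 /(unit_L1_weight hK).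
    set h := fun z => (\int[_]_(y in _) u y)%R; move=> th.
    have mh : measurable_fun hs h by case: th.
    pose S := doubly_sub k w N.
    pose phi : mhalf R n -> R := ((fun z => b z * h z / w z)%R \_ S).
    have bp : bounded_mfun phi.
      apply: (bphi _ N M) => //; [exact: measurable_funM|exact: mS|exact: Shs|].
      move=> z [/[dup] /sublevel_half hz _ [_ ?]]; split => //.
      by rewrite normrM -[leRHS]mulr1 ler_pM// ?bM// (tent_weight_le1 hK th).
    have E z : half_space z -> (phi z * w z = b z * h z)%R.
      move=> hz; rewrite /phi patchE; case: ifPn => [_|/negP zS].
        by rewrite divfK// gt_eqF// w0.
      by rewrite mul0r b0 ?mul0r// => Sz; apply: zS; rewrite inE.
    have [Up ip Lp] := rep phi bp.
    have -> : (\int[mu]_(z in hs) (atom K b u z * k z))%R = L (fun z => phi z * w z)%R.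
      by rewrite Lp; apply: eq_Rintegral => z /set_mem hz; rewrite E.
    apply: (le_trans (Lc _ Up)); apply: lee_wpmul2l => //.
    by rewrite (eq_V_norm K p E); exact: V_norm_weight.
  have Tlty : T_norm K p k < +oo by apply: le_lt_trans Tle _; rewrite ltry.
  split => //; apply: (Lp_loc1_of p1 mk) => Q cQ QH.
  have [d d0 hd] := T_norm_compact hK cQ QH.
  apply: le_lt_trans (hd p k (ltW p1) mk) _.
  rewrite -(@fineK _ (T_norm K p k)) ?ge0_fin_numE ?T_norm_ge0//.
  by rewrite poweR_EFin -EFinM ltry.
exists k => //.
pose D f := (L f - pairing f k)%R.
have linD : linear_on U D.
  by move=> e f h Uf Uh; rewrite /D linL// (pairing_linear Tk)//; ring.
pose e0 := (c + fine (T_norm K p k) + 1)%R.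
have e00 : (0 < e0)%R by rewrite ltr_wpDl// addr_ge0// fine_ge0// T_norm_ge0.
have De f : U f -> `|D f|%:E <= e0%:E * V f.
  move=> Uf; apply: (@le_trans _ _ (`|L f| + `|pairing f k|)%:E).
    by rewrite lee_fin ler_normB.
  have := Lc f Uf; have := pairing_le Uf Tk.
  rewrite (Vfin Uf) (Tfin Tk) -!EFinM !lee_fin => h1 h2.
  rewrite /e0 !mulrDl (mulrC (fine (T_norm _ _ _))) mul1r -addrA lerD// ler_wpDr//.
  by rewrite fine_ge0// V_norm_ge0.
have Dclosed f : U f -> (forall e : R, (0 < e)%R -> exists2 h, U h /\ D h = 0%R &
    V (f \- h)%R < e%:E) -> D f = 0%R.
  move=> Uf h; apply/eqP; rewrite -normr_eq0 eq_le normr_ge0 andbT.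
  apply/ler_addgt0Pr => e ep; rewrite add0r.
  have [|g [Ug Dg] Vg] := h (e / e0)%R; first by rewrite divr_gt0.
  rewrite -[D f]subr0 -Dg -(linear_onB U0 UZ linD Uf Ug) -lee_fin.
  apply: (le_trans (De _ (UB Uf Ug))).
  apply: (@le_trans _ _ (e0%:E * (e / e0)%:E)).
    by apply: lee_wpmul2l; [rewrite lee_fin ltW|exact: ltW].
  by rewrite -EFinM lee_fin mulrC divfK// gt_eqF.
have Dtrunc f N : measurable_fun hs f -> U (f \_ (doubly_sub f w N)) /\
    D (f \_ (doubly_sub f w N)) = 0%R.
  move=> mf; pose S := doubly_sub f w N.
  pose phi : mhalf R n -> R := ((fun z => f z / w z)%R \_ S).
  have bp : bounded_mfun phi.
    by apply: (bphi _ N N%:R) => //; [exact: mS|exact: Shs|move=> z [[_ ?] [_ ?]]].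
  have [Up ip Lp] := rep phi bp.
  have E : f \_ S = (fun z => phi z * w z)%R.
    apply/funext => z; rewrite /phi !patchE; case: ifPn => [/set_mem/Shs hz|_].
      by rewrite divfK// gt_eqF// w0.
    by rewrite mul0r.
  by rewrite /S in E; rewrite E; split => //; rewrite /D Lp subrr.
have DCc f : Cc f -> D f = 0%R.
  move=> Cf; have mf := Cc_measurable Cf; have [cf [Q [cQ QH fQ]]] := Cf.
  have [M M0 fM] := Cc_bounded Cf.
  have Uf : U f by apply: (U_space_bounded_compact hK p1 pq mf fM cQ QH fQ).
  apply: Dclosed => // e ep.
  have [d d0 hd] := V_norm_compact hK cQ QH.
  have fin : \int[mu]_(z in hs) (`|f z| `^ q)%:E < +oo.
    exact: (bounded_compact_pint q0 mf fM cQ QH fQ).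
  have ed : (0 < (e / 2 / d) `^ q)%R by rewrite powR_gt0// !divr_gt0.
  have [N hN] := integral_tail mhs (measurable_pow q mf)
    (fun z _ => powR_ge0 `|f z| q) fin (fun N => mS f N mf)
    (@doubly_sub_nd f w) (@doubly_sub_bigcup f w) ed.
  have [UN DN] := Dtrunc f N mf.
  exists (f \_ (doubly_sub f w N)); first by split.
  have mg : measurable_fun hs (f \- f \_ (doubly_sub f w N))%R.
    by apply: measurable_funB => //; exact: mU.
  apply: le_lt_trans (hd p q _ p1 pq mg _) _.
    by move=> z hz zQ; rewrite /= patchE fQ//; case: ifP; rewrite subrr.
  apply: (@le_lt_trans _ _ (d%:E * (e / 2 / d)%:E)); last first.
    by rewrite -EFinM lte_fin mulrC divfK ?gt_eqF// gtr_pMr// invf_lt1// ltr1n.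
  apply: lee_wpmul2l; first by rewrite lee_fin ltW.
  rewrite (Lp_norm_onE hs _ (lt0r_neq0 q0)).
  rewrite -[leRHS](@poweRK _ _ q) ?gt_eqF// ?lee_fin; last first.
    by rewrite !divr_ge0 ?(ltW ep) ?(ltW d0).
  apply: poweR_le; [by rewrite invr_ge0 ltW|exact: pint_ge0|].
  rewrite poweR_EFin; apply: le_trans (ltW hN); rewrite /pint.
  rewrite (@integral_supp _ _ _ mu (hs `\` doubly_sub f w N)); last 2 first.
  - by move=> z [].
  - move=> z hz zN; rewrite /= patchE mem_set ?subrr ?normr0 ?powR0 ?gt_eqF//.
    by apply: contrapT => zS; apply: zN.
  rewrite le_eqVlt; apply/orP; left; apply/eqP; apply: eq_integral => z /set_mem[hz zN].
  by rewrite /= patchE memNset// subr0.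
move=> f Uf; apply/eqP; rewrite -subr_eq0; apply/eqP.
apply: (Dclosed f Uf) => e ep.
have [_ /(_ e ep)[h Ch hfh]] := Uf; exists h => //; split; last exact: DCc.
have [M M0 hM] := Cc_bounded Ch; have [_ [Q [cQ QH hQ]]] := Ch.
exact: (U_space_bounded_compact hK p1 pq (Cc_measurable Ch) hM cQ QH hQ).
Qed.

Lemma U_is_dual (C : R) : (2 ^+ n <= C)%R ->
  is_dual U V T (T_norm K p) (@eq_ae R n) (@integral_pairable R n) pairing C.
Proof.
move=> hC.
have C1 : (1 <= C)%R by rewrite (le_trans _ hC)// exprn_ege1// ler1n.
have C0 : (0 < C)%R by rewrite (lt_le_trans _ C1).
split.
- by move=> f g; exact: pairing_integrable.
- move=> g Tg; split; [exact: pairing_linear|exact: pairing_bounded|].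
  have h1 := dual_norm_le_T_norm Tg; have h2 := T_norm_le_dual_norm Tg.
  have d0 : 0 <= dual_norm U V (pairing ^~ g).
    apply: (dual_norm_ge0 U0 (pairing_linear Tg)).
    have := VZ 0%R U0; rewrite normr0 mul0e (_ : _ \*o _ = cst 0)%R => [->//|].
    by apply/funext => z /=; rewrite mul0r.
  split.
  + rewrite muleC -lee_pdivlMr ?invr_gt0// invrK; apply: (le_trans h2).
    by rewrite muleC; apply: lee_wpmul2l => //; rewrite lee_fin.
  + apply: (le_trans h1); rewrite -[leLHS]mul1e; apply: lee_wpmul2r; first exact: T_norm_ge0.
    by rewrite lee_fin.
- exact: U_representation.
- by move=> g1 g2; exact: pairing_eq.
Qed.

End U_dual.

(** * Hahn-Banach and atomic expansions *)

Section hahn_banach.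
Context (R : realType) (V : lmodType R).
Variables (E : set V) (q : V -> R).
Hypothesis E0 : E 0.
Hypothesis ElinP : forall c u v, E u -> E v -> E (c *: u + v).
Hypothesis qD : forall u v, E u -> E v -> q (u + v) <= q u + q v.
Hypothesis qZ : forall c u, E u -> q (c *: u) = `|c| * q u.
Variable g : V.
Hypothesis Eg : E g.

Let EZ c u : E u -> E (c *: u).
Proof. by move=> Eu; have := ElinP c Eu E0; rewrite addr0. Qed.
Let ED u v : E u -> E v -> E (u + v).
Proof. by move=> Eu Ev; have := ElinP 1 Eu Ev; rewrite scale1r. Qed.
Let EB u v : E u -> E v -> E (u - v).
Proof. by move=> Eu Ev; rewrite -scaleN1r; apply: ED => //; exact: EZ. Qed.

Let q0 : q 0 = 0.
Proof. by have := qZ 0 E0; rewrite scale0r normr0 mul0r. Qed.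

Let qN u : E u -> q (- u) = q u.
Proof. by move=> Eu; rewrite -scaleN1r qZ// normrN1 mul1r. Qed.

Let q_ge0 u : E u -> 0 <= q u.
Proof.
move=> Eu; have := qD Eu (EZ (-1) Eu).
by rewrite scaleN1r subrr q0 qN// -mulr2n pmulrn_lge0.
Qed.

(** Linear functionals on subspaces of [E] dominated by [q], as graphs, so that a
    chain has its union as upper bound. The last clause makes the functional norm
    [g] without excluding the empty graph, the union of the empty chain. *)
Definition dominated_graph (G : set (V * R)) :=
  [/\ forall c a b, G a -> G b -> G (c *: a.1 + b.1, c * a.2 + b.2),
      forall a, G a -> E a.1 /\ a.2 <= q a.1 & G !=set0 -> G (g, q g)].

Let dominated_graph_bigcup (F : set (set (V * R))) :
  F `<=` dominated_graph -> total_on F subset ->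
  dominated_graph (\bigcup_(G in F) G).
Proof.
move=> FP tot; split.
- move=> c a b [G FG Ga] [G' FG' G'b].
  have [GG'|G'G] := tot _ _ FG FG'.
    by exists G' => //; have [l _ _] := FP _ FG'; apply: l => //; exact: GG'.
  by exists G => //; have [l _ _] := FP _ FG; apply: l => //; exact: G'G.
- by move=> a [G FG Ga]; have [_ h _] := FP _ FG; exact: h.
- move=> [a [G FG Ga]]; exists G => //; have [_ _ h] := FP _ FG.
  by apply: h; exists a.
Qed.

Let dominated_line : dominated_graph [set a | exists t, a = (t *: g, t * q g)].
Proof.
split.
- move=> c _ _ [s ->] [t ->]; exists (c * s + t) => /=.
  by rewrite scalerDl scalerA mulrDl mulrA.
- move=> _ [t ->]; split; first exact: EZ.
  by rewrite qZ// ler_wpM2r ?q_ge0// ler_norm.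
- by move=> _; exists 1; rewrite scale1r mul1r.
Qed.

(** At a new vector, the lower bounds for the value stay below the upper bounds by
    the triangle inequality; a maximal graph is therefore total on [E]. *)
Theorem hahn_banach_seminorm : exists L : V -> R,
  [/\ forall c u v, E u -> E v -> L (c *: u + v) = c * L u + L v,
      forall u, E u -> `|L u| <= q u & L g = q g].
Proof.
have [G [[Glin Gq Gg] Gmax]] := Zorn_bigcup dominated_graph_bigcup.
have Gg' : G (g, q g).
  apply: Gg; apply/set0P/negP => /eqP G0.
  apply: (Gmax _ _ dominated_line); rewrite G0; split; first exact: sub0set.
  by move=> /(_ (g, q g)); apply; exists 1; rewrite scale1r mul1r.
have G00 : G (0, 0).
  by have := Glin (-1) _ _ Gg' Gg'; rewrite scaleN1r mulN1r !addNr.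
have GZ c u r : G (u, r) -> G (c *: u, c * r).
  by move=> Gu; have := Glin c _ _ Gu G00; rewrite !addr0.
have GD u r v s : G (u, r) -> G (v, s) -> G (u + v, r + s).
  by move=> Gu Gv; have := Glin 1 _ _ Gu Gv; rewrite /= scale1r mul1r.
have Gfun u r s : G (u, r) -> G (u, s) -> r = s.
  move=> Gr Gs; have le x y : G (u, x) -> G (u, y) -> x <= y.
    move=> Gx Gy; have /Gq[_ /=] := GD _ _ _ _ Gx (GZ (-1) _ _ Gy).
    by rewrite scaleN1r subrr q0 mulN1r subr_le0.
  by apply/eqP; rewrite eq_le !le.
have dom v : E v -> exists r, G (v, r).
  move=> Ev; apply: contrapT => /forallNP nv.
  pose S := [set a.2 - q (a.1 - v) | a in G].
  have SS a b : G a -> G b -> a.2 - q (a.1 - v) <= q (b.1 + v) - b.2.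
    case: a b => [u r] [u' r'] Ga Gb; have [Eu _] := Gq _ Ga; have [Eu' _] := Gq _ Gb.
    have /Gq[_ /=] := GD _ _ _ _ Ga Gb; rewrite /= in Eu Eu' *.
    rewrite lerBrDr addrAC lerBlDr => /le_trans; apply.
    rewrite (_ : u + u' = (u' + v) + (u - v)); last by rewrite addrACA subrr addr0 addrC.
    by apply: qD; [exact: ED|exact: EB].
  have hsS : has_sup S.
    split; first by exists (0 - q (0 - v)), (0, 0).
    by exists (q (0 + v) - 0) => _ [a Ga <-]; exact: (SS a (0, 0)).
  pose al := sup S.
  have al1 a : G a -> a.2 - q (a.1 - v) <= al.
    by move=> Ga; apply: sup_upper_bound => //; exists a.
  have al2 a : G a -> al <= q (a.1 + v) - a.2.
    by move=> Ga; apply: ge_sup; [case: hsS|move=> _ [b Gb <-]; exact: SS].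
  pose G' := [set a | exists u r t, G (u, r) /\ a = (u + t *: v, r + t * al)].
  apply: (Gmax G'); first split.
  - by move=> [u r] Gu; exists u, r, 0; rewrite scale0r mul0r !addr0.
  - move=> /(_ (v, al)) h; apply: (nv al); apply: h.
    by exists 0, 0, 1; rewrite scale1r mul1r !add0r.
  split.
  - move=> c _ _ [u [r [t [Gu ->]]]] [u' [r' [t' [Gu' ->]]]] /=.
    exists (c *: u + u'), (c * r + r'), (c * t + t'); split; first exact: (Glin c _ _ Gu Gu').
    congr (_, _); last by ring.
    by rewrite scalerDr scalerA scalerDl addrACA.
  - move=> _ [u [r [t [Gu ->]]]] /=; have [/= Eu ru] := Gq _ Gu.
    split; first by apply: ED => //; exact: EZ.
    have [t0|t0|->] := ltgtP t 0; last by rewrite scale0r mul0r !addr0.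
    + pose s := - t; have s0 : 0 < s by rewrite oppr_gt0.
      have := al1 _ (GZ s^-1 _ _ Gu); rewrite /= -(ler_pM2l s0) mulrBr mulVKf ?gt_eqF//.
      rewrite -[s in s * q _]gtr0_norm// -qZ; last by apply: EB => //; exact: EZ.
      rewrite scalerBr scalerA mulfV ?gt_eqF// scale1r /s scaleNr opprK mulNr.
      by rewrite lerBlDr addrC -lerBlDr opprK.
    + have := al2 _ (GZ t^-1 _ _ Gu); rewrite /= -(ler_pM2l t0) mulrBr mulVKf ?gt_eqF//.
      rewrite -[t in t * q _]gtr0_norm// -qZ; last by apply: ED => //; exact: EZ.
      by rewrite scalerDr scalerA mulfV ?gt_eqF// scale1r lerBrDr addrC.
  - move=> _; exists g, (q g), 0; split => //.
    by rewrite scale0r mul0r !addr0.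
have /choice[L hL] : forall v, exists r, E v -> G (v, r).
  move=> v; have [Ev|nEv] := pselect (E v); last by exists 0.
  by have [r] := dom v Ev; exists r.
have Lle u : E u -> L u <= q u by move=> Eu; have [] := Gq _ (hL _ Eu).
exists L; split.
- move=> c u v Eu Ev; apply: (Gfun (c *: u + v)); first by apply: hL; exact: ElinP.
  exact: (Glin c _ _ (hL _ Eu) (hL _ Ev)).
- move=> u Eu; rewrite ler_norml Lle// andbT.
  have := Gq _ (GZ (-1) _ _ (hL _ Eu)) => -[_ /=].
  by rewrite scaleN1r qN// mulN1r lerNl.
- by apply: (Gfun g) => //; exact: hL.
Qed.

End hahn_banach.

Section atomic_expansion.
Context (R : realType) (V : lmodType R).
Variables (E : set V) (N : V -> R).
Hypothesis E0 : E 0.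
Hypothesis ElinP : forall c u v, E u -> E v -> E (c *: u + v).
Hypothesis ND : forall u v, E u -> E v -> N (u + v) <= N u + N v.
Hypothesis NZ : forall c u, E u -> N (c *: u) = `|c| * N u.
Variables (A : set V) (a0 : V) (c : R).
Hypothesis c0 : 0 < c.
Hypothesis Aa0 : A a0.
Hypothesis AE : A `<=` E.
Hypothesis AN : forall a, A a -> N a <= 1.
Hypothesis dual_le : forall L : V -> R,
  (forall c u v, E u -> E v -> L (c *: u + v) = c * L u + L v) ->
  (exists M, forall u, E u -> `|L u| <= M * N u) ->
  (forall a, A a -> `|L a| <= 1) -> forall u, E u -> `|L u| <= c * N u.

Let EZ b u : E u -> E (b *: u).
Proof. by move=> Eu; have := ElinP b Eu E0; rewrite addr0. Qed.
Let ED u v : E u -> E v -> E (u + v).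
Proof. by move=> Eu Ev; have := ElinP 1 Eu Ev; rewrite scale1r. Qed.
Let EB u v : E u -> E v -> E (u - v).
Proof. by move=> Eu Ev; rewrite -scaleN1r; apply: ED => //; exact: EZ. Qed.
Let N0 : N 0 = 0.
Proof. by have := NZ 0 E0; rewrite scale0r normr0 mul0r. Qed.
Let NN u : E u -> N (- u) = N u.
Proof. by move=> Eu; rewrite -scaleN1r NZ// normrN1 mul1r. Qed.
Let N_ge0 u : E u -> 0 <= N u.
Proof.
move=> Eu; have := ND Eu (EZ (-1) Eu).
by rewrite scaleN1r subrr N0 NN// -mulr2n pmulrn_lge0.
Qed.

Definition comb (s : seq (R * V)) : V := \sum_(x <- s) x.1 *: x.2.
Definition coef (s : seq (R * V)) : R := \sum_(x <- s) `|x.1|.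
Definition atoms (s : seq (R * V)) := forall x, List.In x s -> A x.2.

Lemma comb_cat s t : comb (s ++ t) = comb s + comb t.
Proof. by rewrite /comb big_cat. Qed.
Lemma coef_cat s t : coef (s ++ t) = coef s + coef t.
Proof. by rewrite /coef big_cat. Qed.
Lemma coef_ge0 s : 0 <= coef s.
Proof. by rewrite /coef sumr_ge0. Qed.
Lemma atoms_cat s t : atoms s -> atoms t -> atoms (s ++ t).
Proof. by move=> As At x /List.in_app_iff [] ?; [exact: As|exact: At]. Qed.

Lemma comb_E s : atoms s -> E (comb s).
Proof.
elim: s => [|x s ih] As; first by rewrite /comb big_nil.
rewrite /comb big_cons; apply: ED.
  by apply: EZ; apply: AE; apply: As; left.
by apply: ih => y ys; apply: As; right.
Qed.

Lemma N_comb s : atoms s -> N (comb s) <= coef s.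
Proof.
elim: s => [|x s ih] As; first by rewrite /comb /coef !big_nil N0.
have Ax : A x.2 by apply: As; left.
have As' : atoms s by move=> y ys; apply: As; right.
rewrite /comb /coef !big_cons (le_trans (ND (EZ _ (AE Ax)) (comb_E As')))//.
apply: lerD; last exact: ih.
by rewrite NZ ?ler_piMr//; [exact: AN|exact: AE].
Qed.

Definition scale_list b (s : seq (R * V)) := [seq (b * x.1, x.2) | x <- s].

Lemma comb_scale b s : comb (scale_list b s) = b *: comb s.
Proof.
rewrite /comb big_map scaler_sumr; apply: eq_bigr => x _ /=.
by rewrite scalerA.
Qed.
Lemma coef_scale b s : coef (scale_list b s) = `|b| * coef s.
Proof.
rewrite /coef big_map mulr_sumr; apply: eq_bigr => x _ /=.
by rewrite normrM.
Qed.
Lemma atoms_scale b s : atoms s -> atoms (scale_list b s).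
Proof.
move=> As x /List.in_map_iff[y [<- ys]]; exact: (As y ys).
Qed.

(** Cost of an approximate expansion of [u], the error being charged [M] times its
    norm: the largest seminorm below [M N] that is at most 1 on atoms. *)
Definition atomic_gauge (M : R) (u : V) : R :=
  inf [set coef s + M * N (u - comb s) | s in atoms].

Section gauge.
Variable M : R.
Hypothesis M0 : 0 <= M.

Let cost u s := coef s + M * N (u - comb s).

Let cost_ge0 u s : E u -> atoms s -> 0 <= cost u s.
Proof.
move=> Eu As; rewrite addr_ge0 ?coef_ge0// mulr_ge0// N_ge0//.
by apply: EB => //; exact: comb_E.
Qed.

Lemma gauge_le u s : E u -> atoms s -> atomic_gauge M u <= coef s + M * N (u - comb s).
Proof.
move=> Eu As; apply: ge_inf; last by exists s.
by exists 0 => _ [t At <-]; exact: cost_ge0.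
Qed.

Lemma gauge_has_inf u : E u -> has_inf [set coef s + M * N (u - comb s) | s in atoms].
Proof.
move=> Eu; split; first by exists (cost u [::]), [::].
by exists 0 => _ [t At <-]; exact: cost_ge0.
Qed.

Lemma gauge_ge0 u : E u -> 0 <= atomic_gauge M u.
Proof.
move=> Eu; apply: lb_le_inf; first by case: (gauge_has_inf Eu).
by move=> _ [t At <-]; exact: cost_ge0.
Qed.

Lemma gauge_lt u e : E u -> 0 < e -> exists2 s, atoms s &
  coef s + M * N (u - comb s) < atomic_gauge M u + e.
Proof.
move=> Eu e0; have [_ [s As <-] h] := inf_adherent e0 (gauge_has_inf Eu).
by exists s.
Qed.

Lemma gaugeD u v : E u -> E v -> atomic_gauge M (u + v) <= atomic_gauge M u + atomic_gauge M v.
Proof.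
move=> Eu Ev; apply/ler_addgt0Pr => e e0.
have e2 : 0 < e / 2 by rewrite divr_gt0.
have [s As hs] := gauge_lt Eu e2; have [t At ht] := gauge_lt Ev e2.
apply: le_trans (gauge_le (ED Eu Ev) (atoms_cat As At)) _.
rewrite (splitr e) addrACA; apply: le_trans (ltW (ltrD hs ht)).
rewrite coef_cat comb_cat addrACA lerD2l -mulrDr ler_wpM2l//.
rewrite opprD addrACA; apply: ND; apply: EB => //; exact: comb_E.
Qed.

Let gaugeZ_le b u : E u -> atomic_gauge M (b *: u) <= `|b| * atomic_gauge M u.
Proof.
move=> Eu; apply/ler_addgt0Pr => e e0.
have b1 : 0 < `|b| + 1 by rewrite ltr_wpDl.
have [s As hs] := gauge_lt Eu (divr_gt0 e0 b1).
apply: le_trans (gauge_le (EZ b Eu) (atoms_scale (b := b) As)) _.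
rewrite coef_scale comb_scale -scalerBr NZ; last by apply: EB => //; exact: comb_E.
rewrite mulrCA -mulrDr; apply: (le_trans (ler_wpM2l (normr_ge0 b) (ltW hs))).
rewrite mulrDr lerD2l mulrCA ler_piMr ?(ltW e0)// ler_pdivrMr// mul1r lerDl//.
Qed.

Lemma gaugeZ b u : E u -> atomic_gauge M (b *: u) = `|b| * atomic_gauge M u.
Proof.
move=> Eu; apply/eqP; rewrite eq_le gaugeZ_le//=.
have [->|b0] := eqVneq b 0.
  by rewrite normr0 mul0r gauge_ge0//; exact: EZ.
have := gaugeZ_le b^-1 (EZ b Eu); rewrite scalerA mulVf// scale1r normfV.
by rewrite ler_pdivlMl ?normr_gt0.
Qed.

Lemma gauge_atom a : A a -> atomic_gauge M a <= 1.
Proof.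
move=> Aa; have Aas : atoms [:: (1, a)] by move=> x [<-|[]].
apply: le_trans (gauge_le (AE Aa) Aas) _.
by rewrite /coef /comb !big_seq1 /= scale1r subrr N0 mulr0 addr0 normr1.
Qed.

Lemma gauge_norm u : E u -> atomic_gauge M u <= M * N u.
Proof.
move=> Eu; apply: le_trans (gauge_le Eu (s := [::]) _) _ => //.
by rewrite /coef /comb !big_nil subr0 add0r.
Qed.

(** A functional that norms [u] for the gauge is bounded, because the gauge is at
    most [M N], and at most 1 on atoms. *)
Lemma gauge_le_dual u : E u -> atomic_gauge M u <= c * N u.
Proof.
move=> Eu; have [L [linL Lq Lu]] := hahn_banach_seminorm E0 ElinP gaugeD gaugeZ Eu.
rewrite -Lu; apply: le_trans (ler_norm _) _; apply: dual_le => //.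
  by exists M => v Ev; apply: le_trans (Lq _ Ev) _; exact: gauge_norm.
by move=> a Aa; apply: le_trans (Lq _ (AE Aa)) _; exact: gauge_atom.
Qed.

End gauge.

(** For [M = 5 c] an almost optimal expansion leaves an error of at most a quarter
    of the norm, and what it leaves of the budget [2 c N u] pays for the expansion
    of the error. *)
Lemma atomic_step u : E u -> exists2 s, atoms s &
  N (u - comb s) <= N u / 4 /\ coef s + 2 * c * N (u - comb s) <= 2 * c * N u.
Proof.
move=> Eu; have [Nu|Nu] := eqVneq (N u) 0.
  exists [::] => //; rewrite /comb /coef !big_nil subr0 Nu mul0r.
  by split => //; rewrite !mulr0 addr0.
have {}Nu : 0 < N u by rewrite lt_neqAle eq_sym Nu N_ge0.
have M0 : 0 <= 5 * c by rewrite mulr_ge0// ltW.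
have e0 : 0 < c * N u / 4 by rewrite !mulr_gt0 ?invr_gt0.
have [s As hs] := gauge_lt M0 Eu e0; exists s => //.
have := gauge_le_dual M0 Eu; have := coef_ge0 s.
have : 0 <= N (u - comb s) by apply: N_ge0; apply: EB => //; exact: comb_E.
have := c0; move: (atomic_gauge _ _) hs => ga hs cp Nge cs gle.
have h : 5 * c * N (u - comb s) <= 5 * c * (N u / 4) by lra.
have h' : N (u - comb s) <= N u / 4 by move: h; rewrite ler_pM2l// mulr_gt0.
split => //.
have : 0 <= c * N (u - comb s) by rewrite mulr_ge0// ltW.
have : 0 < c * N u by rewrite mulr_gt0.
lra.
Qed.

(** Concatenate the steps. The coefficients used so far plus [2 c] times the norm of
    the remainder never increase, so that sums that stop inside a step are
    controlled too. *)
Theorem atomic_expansion u : E u -> exists (lam : nat -> R) (a : nat -> V),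
  [/\ forall i, A (a i),
      forall k, \sum_(i < k) `|lam i| <= 2 * c * N u &
      forall e, 0 < e -> exists K, forall k, (K <= k)%N ->
        N (u - \sum_(i < k) lam i *: a i) <= e].
Proof.
move=> Eu.
pose pot s := coef s + 2 * c * N (u - comb s).
have /choice[step hstep] : forall s, exists t, atoms s ->
    [/\ atoms t, (0 < size t)%N, N (u - comb (s ++ t)) <= N (u - comb s) / 4 &
      pot (s ++ t) <= pot s].
  move=> s; have [As|nAs] := pselect (atoms s); last by exists [::].
  have [t At [h1 h2]] := atomic_step (EB Eu (comb_E As)).
  (* the null term makes the list grow even when [t] is empty *)
  exists ((0, a0) :: t) => _.
  have E1 : comb (s ++ (0, a0) :: t) = comb s + comb t.
    by rewrite comb_cat /comb big_cons /= scale0r add0r.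
  have E2 : coef (s ++ (0, a0) :: t) = coef s + coef t.
    by rewrite coef_cat /coef big_cons /= normr0 add0r.
  split => //.
  - by move=> x [<-//|]; exact: At.
  - by rewrite E1 opprD addrA.
  - have E3 : u - (comb s + comb t) = u - comb s - comb t by rewrite opprD addrA.
    by rewrite /pot E1 E2 E3 -addrA lerD2l.
pose P := fix P j := if j is j'.+1 then P j' ++ step (P j') else [::].
have AP j : atoms (P j).
  by elim: j => // j ih /=; apply: atoms_cat => //; have [] := hstep _ ih.
have sP j : (j <= size (P j))%N.
  elim: j => // j ih /=; rewrite size_cat; have [_ + _ _] := hstep _ (AP j).
  by move=> h; rewrite -addn1 leq_add.
have preP j k : (j <= k)%N -> exists t, P k = P j ++ t.
  move=> /subnKC <-; elim: (k - j)%N => [|d [t ih]]; first by exists [::]; rewrite addn0 cats0.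
  by rewrite addnS /= ih; exists (t ++ step (P j ++ t)); rewrite catA.
have potP j k : (j <= k)%N -> pot (P k) <= pot (P j).
  move=> /subnKC <-; elim: (k - j)%N => [|d ih]; first by rewrite addn0.
  rewrite addnS; apply: le_trans ih; by have [] := hstep _ (AP (j + d)%N).
pose d0 : R * V := (0, a0).
pose x i := nth d0 (P i.+1) i.
have xE i k : (i < size (P k))%N -> x i = nth d0 (P k) i.
  move=> ik; rewrite /x; have [ki|ki] := leqP k i.+1.
    by have [t ->] := preP _ _ ki; rewrite nth_cat ik.
  have [t ->] := preP _ _ (ltnW ki); rewrite nth_cat.
  by rewrite (leq_trans _ (sP i.+1)).
have takeE j k : (j <= size (P k))%N -> [seq x i | i <- iota 0 j] = take j (P k).
  move=> jk; apply: (@eq_from_nth _ d0).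
    by rewrite size_map size_iota size_takel.
  move=> i; rewrite size_map size_iota => ij.
  rewrite (nth_map 0%N) ?size_iota// nth_iota// add0n nth_take//.
  by apply: xE; exact: leq_trans jk.
pose S k := [seq x i | i <- iota 0 k].
have AS k : atoms (S k).
  rewrite /S (takeE k k) ?sP// => y yt; apply: (AP k).
  by rewrite -(cat_take_drop k (P k)); apply/List.in_app_iff; left.
have SP j : S (size (P j)) = P j by rewrite /S (takeE _ j)// take_size.
have combS k : comb (S k) = \sum_(i < k) (x i).1 *: (x i).2.
  by rewrite /comb big_map -[k in iota 0 k]subn0 -/(index_iota 0 k) big_mkord.
have coefS k : coef (S k) = \sum_(i < k) `|(x i).1|.
  by rewrite /coef big_map -[k in iota 0 k]subn0 -/(index_iota 0 k) big_mkord.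
have Scat j k : (j <= k)%N -> S k = S j ++ [seq x i | i <- iota j (k - j)].
  by move=> jk; rewrite /S -map_cat -{1}(subnKC jk) iotaD add0n.
have coefS_le k j : coef (S k) <= pot (P j).
  pose m := maxn k j.
  have [km jm] : (k <= m)%N /\ (j <= m)%N by rewrite leq_maxl leq_maxr.
  apply: (@le_trans _ _ (coef (S (size (P m))))).
    have kP : (k <= size (P m))%N by exact: leq_trans km (sP m).
    by rewrite (Scat _ _ kP) coef_cat lerDl coef_ge0.
  rewrite SP; apply: le_trans (potP _ _ jm).
  rewrite /pot lerDl mulr_ge0 ?mulr_ge0 ?(ltW c0)//.
  by apply: N_ge0; apply: EB => //; exact: comb_E.
have NP j : N (u - comb (P j)) <= N u * 4^-1 ^+ j.
  elim: j => [|j ih]; first by rewrite /comb big_nil subr0 mulr1.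
  have [_ _ h _] := hstep _ (AP j); apply: (le_trans h).
  by rewrite exprSr mulrA ler_wpM2r// invr_ge0.
exists (fun i => (x i).1), (fun i => (x i).2); split.
- move=> i; apply: (AS i.+1); rewrite /S -addn1 iotaD map_cat /=.
  by apply/List.in_app_iff; right; left.
- move=> k; rewrite -coefS; apply: le_trans (coefS_le k 0%N) _.
  by rewrite /pot /= /coef /comb !big_nil subr0 add0r.
move=> e e0.
have C0 : 0 < 1 + 2 * c by rewrite ltr_pwDl// mulr_ge0// ltW.
have [j hj] : exists j, (1 + 2 * c) * (N u * 4^-1 ^+ j) <= e.
  have /cvgrPdist_le/(_ e e0) : ((1 + 2 * c) * N u * 4^-1 ^+ j) @[j --> \oo] --> 0.
    rewrite -(mulr0 ((1 + 2 * c) * N u)); apply: cvgMr; apply: cvg_expr.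
    by rewrite ger0_norm ?invr_ge0// invf_lt1// ltr1n.
  move=> [j _ /(_ j (leqnn _))/=]; rewrite sub0r normrN => h; exists j.
  by rewrite mulrA (le_trans (ler_norm _)).
exists (size (P j)) => k jk; rewrite -combS (Scat _ _ jk) comb_cat SP.
set t := map x _.
have At : atoms t.
  by move=> y yt; apply: (AS k); rewrite (Scat _ _ jk); apply/List.in_app_iff; right.
rewrite opprD addrA; apply: le_trans (ND (EB Eu (comb_E (AP j))) _) _.
  by rewrite -scaleN1r; apply: EZ; exact: comb_E.
rewrite NN; last exact: comb_E.
apply: le_trans hj; rewrite mulrDl mul1r; apply: lerD => //.
apply: le_trans (N_comb At) _.
have := coefS_le k j; rewrite (Scat _ _ jk) coef_cat SP /pot lerD2l => h.
by apply: (le_trans h); rewrite ler_wpM2l// mulr_ge0// ltW.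
Qed.

End atomic_expansion.

Section atomic_expansion_of_functions.
Context (R : realType) (X : Type).
Variables (E : set (X -> R)) (N : (X -> R) -> \bar R) (null : (X -> R) -> Prop).
Hypothesis banE : banach_space E N null.
Variables (A : set (X -> R)) (a0 : X -> R) (c : R).
Hypothesis c0 : 0 < c.
Hypothesis Aa0 : A a0.
Hypothesis AE : A `<=` E.
Hypothesis AN : forall a, A a -> (N a <= 1)%E.
Hypothesis dual_le : forall L, linear_on E L -> bounded_on E N L ->
  (forall a, A a -> `|L a| <= 1) -> forall f, E f -> (`|L f|%:E <= c%:E * N f)%E.
Local Open Scope ereal_scope.

Let E0 : E (cst 0%R). Proof. by case: banE => -[]. Qed.
Let ED f h : E f -> E h -> E (f \+ h)%R. Proof. by case: banE => -[_ + _] _ _; exact. Qed.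
Let EZ b f : E f -> E (b \*o f)%R. Proof. by case: banE => -[_ _ +] _ _; exact. Qed.
Let Nfin f : E f -> 0 <= N f < +oo. Proof. by case: banE => _ [+ _ _ _] _; exact. Qed.
Let ND f h : E f -> E h -> N (f \+ h)%R <= N f + N h.
Proof. by case: banE => _ [_ _ + _] _; exact. Qed.
Let NZ b f : E f -> N (b \*o f)%R = `|b|%:E * N f.
Proof. by case: banE => _ [_ _ _ +] _; exact. Qed.
Let NE f : E f -> N f = (fine (N f))%:E.
Proof. by move=> Ef; have /andP[? ?] := Nfin Ef; rewrite fineK// ge0_fin_numE. Qed.
Let Nge0 f : E f -> 0 <= N f. Proof. by move=> Ef; case/andP: (Nfin Ef). Qed.

Lemma function_expansion_le (lam : R^nat) (a : nat -> X -> R) f : E f ->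
  (forall i, A (a i)) ->
  N (f \- (fun x => \sum_(i < k) lam i * a i x)%R)%R @[k --> \oo] --> 0 ->
  N f <= abs_coef_sum lam.
Proof.
move=> Ef Aa cv; pose S k x := (\sum_(i < k) lam i * a i x)%R.
have ES k : E (S k).
  apply: (linear_space_sum E0 ED _ (F := fun (i : 'I_k) x => (lam i * a i x)%R)) => i.
  by apply: EZ; exact: AE.
have NS k : N (S k) <= abs_coef_sum lam.
  apply: (@le_trans _ _ (\sum_(0 <= i < k) `|lam i|%:E)); last first.
    by apply: nneseries_lim_ge => i _ _; rewrite lee_fin.
  elim: k {ES} => [|k ih].
    rewrite big_geq// (_ : S 0%N = 0%R \*o cst 0%R)%R; last first.
      by apply/funext => x; rewrite /S big_ord0 /= mul0r.
    by rewrite NZ// normr0 mul0e.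
  rewrite big_nat_recr//= (_ : S k.+1 = S k \+ (lam k \*o a k))%R; last first.
    by apply/funext => x; rewrite /S big_ord_recr.
  have ES : E (S k).
    apply: (linear_space_sum E0 ED _ (F := fun (i : 'I_k) x => (lam i * a i x)%R)) => i.
    by apply: EZ; exact: AE.
  have Ek : E (lam k \*o a k)%R by apply: EZ; exact: AE.
  apply: (le_trans (ND ES Ek)); apply: leeD => //.
  by rewrite NZ; [rewrite -[leRHS]mule1; apply: lee_wpmul2l; rewrite ?lee_fin ?AN|exact: AE].
have EB k : E (f \- S k)%R by exact: (linear_space_sub ED EZ).
have lam0 : 0 <= abs_coef_sum lam by apply: nneseries_ge0 => i _ _; rewrite lee_fin.
have [->|lfin] := eqVneq (abs_coef_sum lam) +oo; first exact: leey.
have lE : abs_coef_sum lam = (fine (abs_coef_sum lam))%:E.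
  by rewrite fineK// ge0_fin_numE// ltey.
rewrite lE; apply/lee_addgt0Pr => e e0.
have [k hk] := (cvge0P (fun k => Nge0 (EB k))).1 cv e e0.
rewrite -lE addeC [X in N X](_ : f = (f \- S k) \+ S k)%R; last first.
  by apply/funext => x /=; rewrite subrK.
apply: (le_trans (ND (EB k) (ES k))); apply: leeD => //.
exact/ltW/(hk k (leqnn k)).
Qed.

(** [atomic_expansion] in a space of functions normed in the extended reals. *)
Theorem function_expansion f : E f -> exists (lam : R^nat) (a : nat -> X -> R),
  [/\ forall i, A (a i), abs_coef_sum lam <= (2 * c)%:E * N f &
    N (f \- (fun x => \sum_(i < k) lam i * a i x)%R)%R @[k --> \oo] --> 0].
Proof.
move=> Ef.
have El (b : R) u v : E u -> E v -> E (b *: u + v)%R.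
  by move=> Eu Ev; exact: ED (EZ b Eu) Ev.
have Nl (u v : X -> R) : E u -> E v -> (fine (N (u + v)) <= fine (N u) + fine (N v))%R.
  move=> Eu Ev; rewrite -lee_fin EFinD -!NE//; first exact: ND.
  exact: ED.
have Nh (b : R) (u : X -> R) : E u -> (fine (N (b *: u)) = `|b| * fine (N u))%R.
  move=> Eu; apply: EFin_inj; rewrite EFinM -!NE//; first exact: NZ.
  exact: EZ.
have NA b : A b -> (fine (N b) <= 1)%R.
  by move=> Ab; rewrite -lee_fin -NE; [exact: AN|exact: AE].
have [|lam [a [Aa slam cv]]] := @atomic_expansion R (X -> R) E (fine \o N) E0 El Nl Nh
  A a0 c c0 Aa0 AE NA _ f Ef.
  move=> L linL [M LM] LA u Eu; rewrite -lee_fin EFinM /= -NE//.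
  apply: dual_le => //; exists M => v Ev.
  by rewrite (NE Ev) -EFinM lee_fin; exact: LM.
exists lam, a; split => //.
- apply: lime_le; first by apply: is_cvg_nneseries => i _ _; rewrite lee_fin.
  apply: nearW => k; rewrite (NE Ef) -EFinM sumEFin lee_fin big_mkord.
  exact: slam.
- have ES k : E (fun x => \sum_(i < k) lam i * a i x)%R.
    apply: (linear_space_sum E0 ED _ (F := fun (i : 'I_k) x => (lam i * a i x)%R)) => i.
    by apply: EZ; exact: AE.
  have EB k := linear_space_sub ED EZ Ef (ES k).
  apply/(cvge0P (fun k => Nge0 (EB k))) => e e0.
  have [|k0 hk0] := cv (e / 2)%R; first by rewrite divr_gt0.
  exists k0 => k kk0; rewrite (NE (EB k)) lte_fin.
  have := hk0 k kk0; rewrite /=.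
  rewrite (_ : (f - _)%R = f \- (fun x => \sum_(i < k) lam i * a i x))%R; last first.
    apply/funext => x; rewrite -[LHS]/(f x - (\sum_(i < k) lam i *: a i) x)%R.
    by rewrite fct_sumE.
  move=> /le_lt_trans; apply.
  by rewrite ltr_pdivrMr// ltr_pMr// ltr1n.
Qed.

End atomic_expansion_of_functions.

(** * Atomic decomposition in U *)

Section U_atomic.
Context (R : realType) (n : nat) (K : set 'rV[R]_n).
Hypothesis hK : symmetric_convex_body K.
Variables p q : R.
Hypothesis p1 : 1 < p.
Hypothesis pq : p^-1 + q^-1 = 1.
Local Open Scope ereal_scope.
Local Notation hs := (@half_space R n : set (mhalf R n)).
Local Notation mu := (dxdt R n).
Local Notation V := (V_norm K p).
Local Notation U := (U_space K p q).
Local Notation T := (T_space K p).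
Implicit Types (f h b : half R n -> R) (lam : R^nat) (a : (half R n -> R)^nat)
  (g : ('rV[R]_n -> R)^nat).

Let mhs : measurable hs := @measurable_half_space R n.
Let q1 : (1 < q)%R. Proof. by have [] := conjugate_exponents p1 pq. Qed.
Let q0 : (0 < q)%R. Proof. exact: lt_trans q1. Qed.

Definition U_atom : set (half R n -> R) :=
  [set f | exists (a : half R n -> R) (g : 'rV[R]_n -> R), [/\ unit_ball_Lp q a, unit_L1 g & f = atom K a g]].

Lemma U_atom_U : U_atom `<=` U.
Proof.
move=> _ [a [g [[ma a1] ug ->]]]; apply: U_space_weight => //.
  by rewrite (le_lt_trans a1)// ltry.
exact: unit_L1_weight.
Qed.

Lemma V_norm_atom f : U_atom f -> V f <= 1.
Proof.
move=> [a [g [[ma a1] ug ->]]]; apply: le_trans a1.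
by apply: V_norm_weight => //; exact: unit_L1_weight.
Qed.

Lemma U_atom0 : U_atom (atom K (cst 0%R) (avg K 0%R 1%R)).
Proof.
exists (cst 0%R), (avg K 0%R 1%R); split => //; last exact: unit_L1_avg.
split; first exact: measurable_cst.
rewrite (Lp_norm_onE hs _ (lt0r_neq0 q0)) /pint.
rewrite integral0_eq ?poweR0r ?invr_eq0 ?gt_eqF//.
by move=> z _; rewrite normr0 powR0// gt_eqF.
Qed.

(** The functional is integration against some [k], whose norm in T^p is bounded by
    testing it on atoms. *)
Lemma U_dual_atoms L : linear_on U L -> bounded_on U V L ->
  (forall f, U_atom f -> `|L f| <= 1)%R ->
  forall f, U f -> `|L f|%:E <= (2 ^+ n)%:E * V f.
Proof.
move=> linL bL LA f Uf.
have [k Tk Lk] := U_representation hK p1 pq linL bL.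
have mk : measurable_fun hs k by case: Tk => -[].
have Tle : T_norm K p k <= (2 ^+ n * 1)%:E.
  apply: T_area_le_T_norm => x.
  apply: (T_area_le hK p1 pq mk ler01 (S := sublevel k)).
  - by move=> N; exact: measurable_sublevel.
  - exact: sublevel_nd.
  - exact: sublevel_bigcup.
  - by move=> N z [].
  - by move=> N z [].
  move=> b g N M mb bM b0 ug; rewrite mul1e.
  have th := unit_L1_weight hK ug.
  have bfin : pint mu q hs b < +oo.
    apply: (bounded_compact_pint q0 mb bM (@exh_compact R n N) (@exh_half R n N)).
    by move=> z hz zN; apply: b0 => // -[].
  have LE : Lp_norm_on q hs b = (fine (Lp_norm_on q hs b))%:E.
    rewrite fineK// ge0_fin_numE ?Lnorm_ge0// (Lp_norm_onE hs b (lt0r_neq0 q0)).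
    rewrite -(@fineK _ (pint _ _ _ _)) ?poweR_EFin ?ltry//.
    by rewrite ge0_fin_numE// pint_ge0.
  have bfin' : Lp_norm_on q hs b < +oo by rewrite LE ltry.
  have Ub : U (atom K b g) by exact: U_space_weight.
  rewrite -[(\int[mu]_(z in hs) _)%R]/(integral_pairing (atom K b g) k) -Lk// LE lee_fin.
  set be := fine _; have be0 : (0 <= be)%R by apply: fine_ge0; exact: Lnorm_ge0.
  apply/ler_addgt0Pr => e e0; have bee : (0 < be + e)%R by rewrite ltr_wpDl.
  rewrite -[leRHS]mulr1 -ler_pdivrMl// -[X in (X^-1)%R](gtr0_norm bee) -normfV -normrM.
  have [U0 UZ] : U (cst 0%R) /\ forall c h, U h -> U (c \*o h)%R.
    by split; [exact: U_space0|exact: U_spaceZ].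
  rewrite -(linear_onZ U0 linL)//; apply: LA.
  exists ((be + e)^-1 \*o b)%R, g; split => //; last first.
    by apply/funext => z; rewrite /atom /= mulrA.
  split; first exact: measurable_funM.
  rewrite Lp_norm_onZ// gtr0_norm ?invr_gt0// LE -EFinM lee_fin -/be.
  by rewrite ler_pdivrMl// mulr1 lerDl ltW.
rewrite Lk//; have hp := pairing_le hK p1 Uf Tk.
apply: (le_trans hp).
rewrite muleC; apply: lee_wpmul2r; first exact: V_norm_ge0.
by rewrite mulr1 in Tle.
Qed.

Lemma U_decomposition (C : R) f : (2 * 2 ^+ n <= C)%R -> U f ->
  exists lam a g, atomic_decomposition K V (unit_ball_Lp q) f lam a g /\
    equivalent_up_to C (V f) (abs_coef_sum lam).
Proof.
move=> hC Uf.
have Vf0 : 0 <= V f by exact: V_norm_ge0.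
have C1 : (1 <= C)%R.
  by rewrite (le_trans _ hC)// -exprS exprn_ege1// ler1n.
have ban := U_banach hK p1 pq.
have p2 : (0 < 2 ^+ n :> R)%R by rewrite exprn_gt0.
have [lam [u [Au slam cv]]] := function_expansion ban p2 U_atom0 U_atom_U V_norm_atom
  U_dual_atoms Uf.
have /choice[a ha] : forall i, exists a : half R n -> R, exists g : 'rV[R]_n -> R,
    [/\ unit_ball_Lp q a, unit_L1 g & u i = atom K a g] by exact: Au.
have /choice[g hg] := ha.
have uE i : u i = atom K (a i) (g i) by have [] := hg i.
exists lam, a, g; split.
  split.
  - by move=> i; have [] := hg i.
  - by move=> i; have [] := hg i.
  - apply: le_lt_trans slam _; case: Uf => -[_ Vf] _.
    by rewrite -(@fineK _ (V f)) ?ge0_fin_numE// -EFinM ltry.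
  - apply: cvg_trans cv; apply: near_eq_cvg; apply: nearW => k.
    congr (V _); apply/funext => z; congr (_ - _)%R.
    by rewrite /atomic_sum; apply: eq_bigr => i _; rewrite uE.
split.
  have h := function_expansion_le ban U_atom_U V_norm_atom Uf Au cv.
  apply: le_trans h; rewrite -[leRHS]mul1e; apply: lee_wpmul2r => //.
  by rewrite lee_fin invf_le1// (lt_le_trans _ C1).
apply: (le_trans slam); apply: lee_wpmul2r => //; by rewrite lee_fin.
Qed.

Lemma atomic_sum_U lam a g k : (forall i, unit_ball_Lp q (a i)) ->
  (forall i, unit_L1 (g i)) -> U (atomic_sum K lam a g k).
Proof.
move=> ha hg; have U0 : U (cst 0%R) by exact: U_space0.
apply: (linear_space_sum U0 _ _ (F := fun (i : 'I_k) z => (lam i * atom K (a i) (g i) z)%R)).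
  by move=> f h; exact: U_spaceD.
move=> i; have Ua : U (atom K (a i) (g i)) by apply: U_atom_U; exists (a i), (g i).
by have := U_spaceZ p1 pq (lam i) Ua.
Qed.

Lemma decomposition_U f lam a g : Lp_loc q f ->
  atomic_decomposition K V (unit_ball_Lp q) f lam a g -> U f.
Proof.
move=> lf [ha hg _ cv]; apply: (U_space_closed lf) => e e0.
have V0 k : 0 <= V (f \- atomic_sum K lam a g k)%R by exact: V_norm_ge0.
have [k hk] := (cvge0P V0).1 cv e e0.
by exists (atomic_sum K lam a g k); [exact: atomic_sum_U|exact: hk].
Qed.

(** The norm of V dominates that of L^q. *)
Lemma decomposition_cvg f lam a g : Lp_loc q f ->
  atomic_decomposition K V (unit_ball_Lp q) f lam a g ->
  cvg_Lp_loc q (atomic_sum K lam a g) f.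
Proof.
move=> [mf lf] [ha hg _ cv] Q cQ QH.
have mS k : measurable_fun hs (atomic_sum K lam a g k).
  by apply: (@U_measurable _ _ K p q); exact: atomic_sum_U.
have V0 k : 0 <= V (f \- atomic_sum K lam a g k)%R by exact: V_norm_ge0.
apply/cvge0P => [k|e e0]; first exact: Lnorm_ge0.
have [k0 hk0] := (cvge0P V0).1 cv e e0.
exists k0 => k kk0; apply: le_lt_trans (hk0 k kk0).
have mfk : measurable_fun hs (f \- atomic_sum K lam a g k)%R by exact: measurable_funB.
apply: le_trans (Lp_le_V_norm hK p1 pq mfk).
rewrite !Lp_norm_onE ?gt_eqF//; apply: poweR_le; [by rewrite invr_ge0 ltW|exact: pint_ge0|].
by apply: le_pint => //; exact: compact_measurable_half.
Qed.

End U_atomic.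

(** * The space S^1_0 *)

Section half_continuity.
Context (R : realType) (n : nat).
Local Notation hs := (@half_space R n).
Implicit Types (f g : half R n -> R).

Lemma half_continuousP f : {within hs, continuous f} <->
  forall z, half_space z -> {for z, continuous f}.
Proof.
rewrite continuous_open_subspace; last exact: half_space_open.
by split => h z; [move=> hz; apply: h; rewrite inE|rewrite inE; exact: h].
Qed.

Lemma half_continuousD f g : {within hs, continuous f} -> {within hs, continuous g} ->
  {within hs, continuous (f \+ g)}.
Proof.
move=> /half_continuousP cf /half_continuousP cg; apply/half_continuousP => z hz.
exact: cvgD (cf z hz) (cg z hz).
Qed.

Lemma half_continuousM f g : {within hs, continuous f} -> {within hs, continuous g} ->
  {within hs, continuous (f \* g)}.
Proof.
move=> /half_continuousP cf /half_continuousP cg; apply/half_continuousP => z hz.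
exact: cvgM (cf z hz) (cg z hz).
Qed.

Lemma half_continuousZ c f : {within hs, continuous f} -> {within hs, continuous (c \*o f)}.
Proof.
move=> /half_continuousP cf; apply/half_continuousP => z hz.
exact: cvgM (@cvg_cst _ c _ _ _) (cf z hz).
Qed.

Lemma half_continuous_norm f : {within hs, continuous f} ->
  {within hs, continuous (fun z => `|f z|)}.
Proof.
move=> /half_continuousP cf; apply/half_continuousP => z hz.
exact: cvg_norm (cf z hz).
Qed.

Lemma Cc_continuous f : Cc f -> {within hs, continuous f}. Proof. by case. Qed.

Lemma CcM f g : {within hs, continuous f} -> Cc g -> Cc (fun z => f z * g z).
Proof.
move=> cf [cg [Q [cQ QH g0]]]; split; first exact: half_continuousM.
by exists Q; split => // z hz zQ; rewrite g0// mulr0.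
Qed.

Lemma Cc_dominated f g : {within hs, continuous f} -> Cc g ->
  (forall z, half_space z -> `|f z| <= `|g z|) -> Cc f.
Proof.
move=> cf [cg [Q [cQ QH g0]]] fg; split => //.
exists Q; split => // z hz zQ; apply/eqP; rewrite -normr_eq0 eq_le normr_ge0 andbT.
by rewrite (le_trans (fg z hz))// g0// normr0.
Qed.

Lemma Cc0 : Cc (cst 0 : half R n -> R).
Proof.
split; first by apply/half_continuousP => z hz; exact: cvg_cst.
by exists set0; split => //; exact: compact0.
Qed.

Lemma CcB f g : Cc f -> Cc g -> Cc (f \- g).
Proof. by move=> cf cg; apply: (linear_space_sub (@CcD R n) (@CcZ R n)). Qed.

Lemma Cc_norm f : Cc f -> Cc (fun z => `|f z|).
Proof.
move=> cf; apply: (Cc_dominated _ cf); first exact/half_continuous_norm/Cc_continuous.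
by move=> z _; rewrite normr_id.
Qed.

Lemma Cc_min f g : Cc f -> Cc g -> Cc (fun z => Num.min (f z) (g z)).
Proof.
move=> cf cg; rewrite (_ : (fun _ => _) =
    2^-1 \*o ((f \+ g) \- (fun z => `|(f \- g) z|))); last first.
  by apply/funext => z; rewrite minr_absE /= mulrC.
apply: CcZ; apply: CcB; first exact: CcD.
exact/Cc_norm/CcB.
Qed.

Lemma Cc_max f g : Cc f -> Cc g -> Cc (fun z => Num.max (f z) (g z)).
Proof.
move=> cf cg; rewrite (_ : (fun _ => _) =
    2^-1 \*o ((f \+ g) \+ (fun z => `|(f \- g) z|))); last first.
  by apply/funext => z; rewrite maxr_absE /= mulrC.
apply: CcZ; apply: CcD; first exact: CcD.
exact/Cc_norm/CcB.
Qed.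

Lemma Cc_of_cutoff k : Cc (@cutoff R n k).
Proof.
have := @Cc_cutoff R n k (cst 1) (@cst_continuous _ _ _).
by rewrite (_ : (fun _ => _) = cutoff k)//; apply/funext => z; rewrite mul1r.
Qed.

End half_continuity.

Section radon_integrable.
Context (R : realType) (n : nat).
Local Open Scope ereal_scope.
Local Notation hs := (@half_space R n : set (mhalf R n)).
Implicit Types (f g : half R n -> R).
Variable m : {measure set (mhalf R n) -> \bar R}.
Hypothesis m_fin : forall Q : set (half R n), compact Q -> Q `<=` @half_space R n -> m Q < +oo.

Let mhs : measurable hs := @measurable_half_space R n.

Lemma bounded_compact_integrable g (M : R) (Q : set (half R n)) :
  measurable_fun hs g -> (forall z, half_space z -> (`|g z| <= M)%R) ->
  compact Q -> Q `<=` @half_space R n ->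
  (forall z, half_space z -> ~ Q z -> g z = 0%R) -> m.-integrable hs (EFin \o g).
Proof.
move=> mg gM cQ QH g0; apply/integrableP; split; first exact/measurable_EFinP.
have mQ : measurable (Q : set (mhalf R n)) by exact: compact_measurable_half.
rewrite (@integral_supp _ _ _ m Q) //; last first.
  by move=> z hz zQ; rewrite /= g0// normr0.
apply: (@le_lt_trans _ _ (\int[m]_(z in Q) (`|M|)%:E)).
  apply: ge0_le_integral => //.
  - apply/measurable_EFinP; apply: measurableT_comp => //.
    exact: measurable_funS mg.
  - by move=> z Qz; rewrite lee_fin (le_trans (gM _ (QH _ Qz)))// ler_norm.
by rewrite integral_cst// lte_mul_pinfty ?lee_fin// m_fin.
Qed.

Lemma Cc_integrable f : Cc f -> m.-integrable hs (EFin \o f).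
Proof.
move=> Cf; have [M M0 fM] := Cc_bounded Cf; have [_ [Q [cQ QH f0]]] := Cf.
exact: (bounded_compact_integrable (Cc_measurable Cf) fM cQ QH f0).
Qed.

End radon_integrable.

Section S1_norm.
Context (R : realType) (n : nat) (K : set 'rV[R]_n).
Hypothesis hK : symmetric_convex_body K.
Local Open Scope ereal_scope.
Local Notation hs := (@half_space R n : set (mhalf R n)).
Local Notation S1 := (S1_norm K).
Implicit Types (f g h : half R n -> R).

Lemma S1_norm_le f (m : \bar R) :
  (forall C : {fset half R n}, disjoint_balls K C -> (\sum_(z <- C) `|f z|)%:E <= m) -> S1 f <= m.
Proof. by move=> h; apply: ge_ereal_sup => _ [C dC <-]; exact: h. Qed.

Lemma le_S1_norm f (C : {fset half R n}) : disjoint_balls K C ->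
  (\sum_(z <- C) `|f z|)%:E <= S1 f.
Proof. by move=> dC; apply: ereal_sup_ubound; exists C. Qed.

Lemma S1_norm_ge0 f : 0 <= S1 f.
Proof.
apply: le_trans (@le_S1_norm f fset0 _); first by rewrite big_seq_fset0.
by split; [move=> z /=; rewrite in_fset0|move=> z z'; rewrite /= in_fset0].
Qed.

Lemma norm_le_S1 f z : half_space z -> `|f z|%:E <= S1 f.
Proof.
move=> hz; apply: le_trans (@le_S1_norm f [fset z]%fset _).
  by rewrite big_seq_fset1.
split; first by move=> z' /=; rewrite in_fset1 => /eqP ->.
by move=> i j /=; rewrite !in_fset1 => /eqP -> /eqP ->.
Qed.

Lemma S1_norm_mono f h : (forall z, half_space z -> `|f z| <= `|h z|)%R -> S1 f <= S1 h.
Proof.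
move=> fh; apply: S1_norm_le => C dC; apply: le_trans (le_S1_norm h dC).
rewrite lee_fin big_seq [leRHS]big_seq; apply: ler_sum => z zC; apply: fh.
by case: dC => + _; exact.
Qed.

Lemma S1_normD f h : S1 (f \+ h)%R <= S1 f + S1 h.
Proof.
apply: S1_norm_le => C dC.
apply: le_trans (leeD (le_S1_norm f dC) (le_S1_norm h dC)).
rewrite -EFinD lee_fin -big_split; apply: ler_sum => z _; exact: ler_normD.
Qed.

Let S1_normZ_le (c : R) f : S1 (c \*o f)%R <= `|c|%:E * S1 f.
Proof.
apply: S1_norm_le => C dC.
rewrite (eq_bigr (fun z => `|c| * `|f z|)%R); last by move=> z _; rewrite /= normrM.
by rewrite -mulr_sumr EFinM; apply: lee_wpmul2l => //; exact: le_S1_norm.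
Qed.

Lemma S1_normZ (c : R) f : S1 (c \*o f)%R = `|c|%:E * S1 f.
Proof.
apply/eqP; rewrite eq_le S1_normZ_le/=; have [->|c0] := eqVneq c 0%R.
  by rewrite normr0 mul0e S1_norm_ge0.
have n0 : (0 < `|c|)%R by rewrite normr_gt0.
rewrite muleC -lee_pdivlMr//; have := S1_normZ_le c^-1 (c \*o f)%R.
rewrite normfV muleC; congr (S1 _ <= _); apply/funext => z /=.
by rewrite mulrA mulVf ?mul1r.
Qed.

Lemma S1_normB f h : S1 (f \- h)%R = S1 (h \- f)%R.
Proof.
by apply/eqP; rewrite eq_le !S1_norm_mono// => z _; rewrite /= distrC.
Qed.

Lemma S1_norm_eq0 f : S1 f = 0 <-> null_everywhere f.
Proof.
split => [f0 z hz|f0].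
  by apply/eqP; rewrite -normr_le0 -lee_fin; apply: le_trans (norm_le_S1 f hz) _; rewrite f0.
apply/eqP; rewrite eq_le S1_norm_ge0 andbT; apply: S1_norm_le => C [CH _].
by rewrite big_seq big1// => z zC; rewrite f0 ?normr0//; exact: CH.
Qed.

(** Disjoint balls carry disjoint parts of an integrable function: this is why
    a tent weight has norm at most one. *)
Lemma S1_norm_weight f h (M : R) : tent_weight K h -> (0 <= M)%R ->
  (forall z, half_space z -> `|f z| <= M * `|h z|)%R -> S1 f <= M%:E.
Proof.
move=> [mh [g [mg g0 g1 hg]]] M0 fh; apply: S1_norm_le => C [CH tC].
pose F (z : half R n) : set 'rV[R]_n := Kball K z.1 z.2.
have mF z : measurable (F z) by exact: measurable_Kball.
apply: (@le_trans _ _ (\sum_(z <- C) M%:E * ball_integral K g z)).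
  rewrite -sumEFin big_seq [leRHS]big_seq; apply: lee_sum => z zC; have hz := CH z zC.
  apply: (@le_trans _ _ (M * `|h z|)%:E); first by rewrite lee_fin fh.
  by rewrite EFinM; apply: lee_wpmul2l => //; exact: hg.
rewrite -ge0_sume_distrr; last by move=> z _; exact: ball_integral_ge0.
rewrite -[leRHS]mule1; apply: lee_wpmul2l => //; apply: le_trans g1.
rewrite -(@ge0_integral_bigsetU _ _ _ _ _ F g C mF (fset_uniq C) tC).
- apply: ge0_subset_integral => //; first exact: bigsetU_measurable.
- exact: measurable_funTS.
- by move=> x _; exact: g0.
Qed.

Lemma S1_norm_compact (Q : set (half R n)) : compact Q -> Q `<=` @half_space R n ->
  exists2 c : R, (0 < c)%R & forall f (M : R), (0 <= M)%R ->
    (forall z, half_space z -> `|f z| <= M)%R ->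
    (forall z, half_space z -> ~ Q z -> f z = 0%R) -> S1 f <= (c * M)%:E.
Proof.
move=> cQ QH; have [c c0 tw] := compact_weight hK cQ QH.
exists (c^-1)%R => [|f M M0 fM f0]; first by rewrite invr_gt0.
apply: (S1_norm_weight tw); first by rewrite mulr_ge0// invr_ge0 ltW.
move=> z hz; rewrite normrM (gtr0_norm c0) mulrA [(c^-1 * M)%R]mulrC divfK ?gt_eqF//.
have [zQ|zQ] := pselect (Q z); first by rewrite indicE mem_set// normr1 mulr1 fM.
by rewrite f0// normr0 mulr_ge0.
Qed.

Local Notation S10 := (S10_space K).

Lemma Cc_S1_space f : Cc f -> S1_space K f.
Proof.
move=> Cf; split; first exact: Cc_continuous.
have [M M0 fM] := Cc_bounded Cf; have [_ [Q [cQ QH f0]]] := Cf.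
have [c c0 hc] := S1_norm_compact cQ QH.
by apply: le_lt_trans (hc f M (ltW M0) fM f0) _; rewrite ltry.
Qed.

Lemma Cc_S10 f : Cc f -> S10 f.
Proof.
move=> Cf; split; first exact: Cc_S1_space.
move=> e e0; exists f => //; rewrite (_ : S1 _ = 0)//.
by apply/S1_norm_eq0 => z _; rewrite /= subrr.
Qed.

Lemma S10_continuous f : S10 f -> {within hs, continuous f}.
Proof. by case=> -[]. Qed.

Lemma S10_fin f : S10 f -> S1 f < +oo. Proof. by case=> -[]. Qed.

Lemma S10_dense f (e : R) : S10 f -> (0 < e)%R -> exists2 h, Cc h & S1 (f \- h)%R < e%:E.
Proof. by case=> _; exact. Qed.

Lemma S10D f h : S10 f -> S10 h -> S10 (f \+ h)%R.
Proof.
move=> Sf Sh; split.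
  split; first by apply: half_continuousD; exact: S10_continuous.
  by apply: le_lt_trans (S1_normD _ _) _; rewrite lte_add_pinfty ?S10_fin.
move=> e e0; have e2 : (0 < e / 2)%R by rewrite divr_gt0.
have [f' Cf' hf'] := S10_dense Sf e2; have [h' Ch' hh'] := S10_dense Sh e2.
exists (f' \+ h')%R; first exact: CcD.
rewrite (_ : (_ \- _)%R = (f \- f') \+ (h \- h'))%R; last first.
  by apply/funext => z /=; rewrite opprD addrACA.
by apply: le_lt_trans (S1_normD _ _) _; rewrite [e]splitr EFinD; exact: lteD.
Qed.

Lemma S10Z (c : R) f : S10 f -> S10 (c \*o f)%R.
Proof.
move=> Sf; split.
  split; first by apply: half_continuousZ; exact: S10_continuous.
  rewrite S1_normZ; have := S10_fin Sf; have := S1_norm_ge0 f.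
  by case: (S1 f) => // r _ _; rewrite -EFinM ltry.
move=> e e0; have c1 : (0 < `|c| + 1)%R by rewrite ltr_wpDl.
have [h Ch hh] := S10_dense Sf (divr_gt0 e0 c1).
exists (c \*o h)%R; first exact: CcZ.
rewrite (_ : (_ \- _)%R = c \*o (f \- h))%R; last first.
  by apply/funext => z /=; rewrite mulrBr.
rewrite S1_normZ; apply: (@le_lt_trans _ _ (`|c|%:E * (e / (`|c| + 1))%:E)).
  by apply: lee_wpmul2l => //; exact: ltW.
rewrite -EFinM lte_fin mulrCA gtr_pMr// ltr_pdivrMr// mul1r.
by rewrite ltrDl.
Qed.

Lemma S10_0 : S10 (cst 0%R). Proof. exact/Cc_S10/Cc0. Qed.

Lemma S10B f h : S10 f -> S10 h -> S10 (f \- h)%R.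
Proof. by move=> Sf Sh; apply: (linear_space_sub S10D S10Z). Qed.

(** The norm dominates the supremum, so that the limits are uniform and continuity
    persists. *)
Lemma S10_complete (u : nat -> half R n -> R) : (forall k, S10 (u k)) ->
  (forall e : R, (0 < e)%R -> exists k0, forall j k, (k0 <= j)%N -> (k0 <= k)%N ->
    S1 (u j \- u k)%R < e%:E) ->
  exists2 f, S10 f & S1 (u k \- f)%R @[k --> \oo] --> 0.
Proof.
move=> Su cu.
have cauchy e : (0 < e)%R -> exists k0, forall j k, (k0 <= j)%N -> (k0 <= k)%N ->
    forall z, half_space z -> (`|u j z - u k z| < e)%R.
  move=> e0; have [k0 h] := cu e e0; exists k0 => j k jk kk z hz; rewrite -lte_fin.
  by apply: le_lt_trans (h j k jk kk); exact: (norm_le_S1 (u j \- u k)%R hz).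
pose f z : R := limn (fun k => u k z).
have cvu z : half_space z -> (fun k => u k z) @ \oo --> f z.
  move=> hz; suff : cvgn (fun k => u k z) by [].
  apply/cauchy_cvgP/cauchy_exP => e e0; have [k0 h] := cauchy e e0.
  exists (u k0 z); exists k0 => // k /= kk; rewrite -ball_normE/=; exact: h.
have S1lim e k0 : (0 < e)%R -> (forall j k, (k0 <= j)%N -> (k0 <= k)%N ->
    S1 (u j \- u k)%R < e%:E) -> forall j, (k0 <= j)%N -> S1 (u j \- f)%R <= e%:E.
  move=> e0 h j jk; apply: S1_norm_le => C dC; rewrite lee_fin.
  have cv : (\sum_(z <- C) `|u j z - u k z|)%R @[k --> \oo] -->
      (\sum_(z <- C) `|(u j \- f) z|)%R.
    have [CH _] := dC; move: (enum_fset C) (CH : forall z, z \in enum_fset C -> half_space z).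
    elim=> [_|w s ih sH].
      by rewrite big_nil; under eq_fun do rewrite big_nil; exact: cvg_cst.
    rewrite big_cons; under eq_fun do rewrite big_cons.
    apply: cvgD; last by apply: ih => z zs; apply: sH; rewrite in_cons zs orbT.
    apply: cvg_norm; apply: cvgB; first exact: cvg_cst.
    by apply: cvu; apply: sH; rewrite mem_head.
  rewrite -(cvg_lim _ cv)//; apply: limr_le; first exact: cvgP cv.
  exists k0 => // k /= kk; rewrite -lee_fin.
  by apply: le_trans (ltW (h j k jk kk)); exact: (le_S1_norm (u j \- u k)%R dC).
have cf : {within hs, continuous f}.
  apply/half_continuousP => z hz; apply/cvgrPdist_lt => e e0.
  have e3 : (0 < e / 3)%R by rewrite divr_gt0.
  have [k0 h] := cu _ e3.
  have near k : half_space k -> (`|u k0 k - f k| <= e / 3)%R.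
    move=> hk; rewrite -lee_fin.
    apply: le_trans (S1lim _ _ e3 h k0 (leqnn _)); exact: (norm_le_S1 (u k0 \- f)%R hk).
  have /half_continuousP/(_ z hz)/cvgrPdist_lt/(_ _ e3) cu0 := S10_continuous (Su k0).
  near=> w.
  have hw : half_space w by near: w; exact: (half_space_open hz).
  have uw : (`|u k0 z - u k0 w| < e / 3)%R by near: w.
  rewrite (_ : f z - f w = (f z - u k0 z) + (u k0 z - u k0 w) + (u k0 w - f w))%R; last by ring.
  have -> : e = (e / 3 + e / 3 + e / 3)%R by field.
  apply: le_lt_trans (ler_normD _ _) _; apply: ltr_leD; last exact: near.
  apply: le_lt_trans (ler_normD _ _) _; apply: ler_ltD => //.
  by rewrite distrC; exact: near.
have Sf : S10 f.
  split.
    split => //; have [k0 h] := cu 1%R ltr01.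
    rewrite (_ : f = u k0 \+ (f \- u k0))%R; last by apply/funext => z /=; rewrite subrKC.
    apply: le_lt_trans (S1_normD _ _) _; apply: lte_add_pinfty; first exact: S10_fin.
    rewrite S1_normB; by apply: le_lt_trans (S1lim _ _ ltr01 h k0 (leqnn _)) _; rewrite ltry.
  move=> e e0; have e3 : (0 < e / 2)%R by rewrite divr_gt0.
  have [k0 h] := cu _ e3; have [g Cg hg] := S10_dense (Su k0) e3; exists g => //.
  rewrite (_ : (f \- g) = (f \- u k0) \+ (u k0 \- g))%R; last first.
    by apply/funext => z /=; rewrite subrKA.
  apply: le_lt_trans (S1_normD _ _) _; rewrite [e]splitr EFinD.
  rewrite S1_normB; apply: (@le_lt_trans _ _ ((e / 2)%:E + S1 (u k0 \- g)%R)).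
    by apply: leeD2r; exact: (S1lim _ _ e3 h k0 (leqnn _)).
  by rewrite lteD2lE.
exists f => //; apply/cvge0P => [k|e e0]; first exact: S1_norm_ge0.
have e2 : (0 < e / 2)%R by rewrite divr_gt0.
have [k0 h] := cu _ e2; exists k0 => k kk.
apply: le_lt_trans (S1lim _ _ e2 h k kk) _.
by rewrite lte_fin gtr_pMr// invf_lt1// ltr1n.
Unshelve. all: by end_near. Qed.

Lemma S10_banach : banach_space S10 S1 (@null_everywhere R n).
Proof.
split.
- by split; [exact: S10_0|exact: S10D|exact: S10Z].
- split.
  + by move=> f Sf; rewrite S1_norm_ge0 S10_fin.
  + by move=> f _; exact: S1_norm_eq0.
  + by move=> f h _ _; exact: S1_normD.
  + by move=> c f _; exact: S1_normZ.
- exact: S10_complete.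
Qed.

End S1_norm.

(** * The key inequality for S^1 *)

Section local_ratio.
Context (R : realType) (T : eqType).
Variables (adj le : rel T) (w : T -> R) (D : R).
Hypothesis adjxx : forall x, adj x x.
Hypothesis lexx : forall x, le x x.
Hypothesis w0 : forall x, 0 <= w x.

(** Subtracting the value at the first vertex from all its neighbours costs at most
    [D] times that value on the weighted side, and the first vertex can be added to
    the chosen ones unless one of its neighbours was chosen. *)
Lemma local_ratio (s : seq T) (f : T -> R) : pairwise le s ->
  (forall x, x \in s -> \sum_(y <- s | le x y && adj x y) w y <= D) ->
  exists C, [/\ subseq C s, pairwise (fun x y => ~~ adj x y) C &
    \sum_(y <- s) w y * f y <= D * \sum_(y <- C) f y].
Proof.
elim: s f => [|x s ih] f; first by exists [::]; rewrite !big_nil mulr0.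
rewrite pairwise_cons => /andP[lex pws] hD.
have hDs y : y \in s -> \sum_(z <- s | le y z && adj y z) w z <= D.
  move=> ys; have ysx : y \in x :: s by rewrite in_cons ys orbT.
  apply: le_trans (hD y ysx); rewrite big_cons; case: ifP => // _.
  by rewrite lerDr.
have [fx|fx] := leP (f x) 0.
  have [C [sC pC hC]] := ih f pws hDs; exists C; split => //.
    by apply: subseq_trans sC _; exact: subseq_cons.
  by rewrite big_cons; apply: le_trans hC; rewrite gerDr mulr_ge0_le0.
pose f' y := f y - (if adj x y then f x else 0).
have f'_le y : f' y <= f y by rewrite gerBl; case: ifP => // _; exact: ltW.
have [C [sC pC hC]] := ih f' pws hDs.
have key : \sum_(y <- x :: s) w y * f y <= D * (\sum_(y <- C) f' y + f x).
  have -> : \sum_(y <- x :: s) w y * f y = \sum_(y <- x :: s) w y * f' y +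
      f x * \sum_(y <- x :: s | le x y && adj x y) w y.
    rewrite mulr_sumr [X in _ + X]big_mkcond -big_split /= big_seq [RHS]big_seq.
    apply: eq_bigr => y; rewrite in_cons => ys.
    have -> : le x y by case/orP: ys => [/eqP ->//|ys]; exact: (allP lex).
    by rewrite /f' /=; case: ifP => _; ring.
  have hx := hD x (mem_head _ _).
  rewrite big_cons {1}/f' adjxx subrr mulr0 add0r mulrDr; apply: lerD => //.
  by rewrite mulrC ler_wpM2r// ltW.
have [hasC|nhas] := boolP (has (adj x) C).
  exists C; split => //; first by apply: subseq_trans sC _; exact: subseq_cons.
  apply: le_trans key _; apply: ler_wpM2l.
    by apply: le_trans (hD x (mem_head _ _)); apply: sumr_ge0.
  elim: C hasC {sC pC hC} => // y C ihC; rewrite !big_cons /= => /orP[xy|hasC].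
    rewrite addrAC lerD//; first by rewrite /f' xy subrK.
    by apply: ler_sum => z _; exact: f'_le.
  by rewrite -addrA lerD//; exact: ihC.
exists (x :: C); split => /=.
- by rewrite eqxx.
- by rewrite pC andbT -all_predC in nhas *.
- apply: le_trans key _; rewrite big_cons addrC; apply: ler_wpM2l.
    by apply: le_trans (hD x (mem_head _ _)); apply: sumr_ge0.
  by rewrite lerD2l; apply: ler_sum => z _; exact: f'_le.
Qed.

End local_ratio.

Lemma compact_finite_subcover (X : topologicalType) (Q : set X) (W : X -> set X) :
  compact Q -> (forall x, Q x -> nbhs x (W x)) ->
  exists2 s : seq X, forall x, x \in s -> Q x &
    forall x, Q x -> exists2 y, y \in s & W y x.
Proof.
move=> /compact_near_coveringP cQ QW.
pose F := filter_from setT (fun s0 : seq X => [set s : seq X | {subset s0 <= s}]).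
have FF : Filter F.
  apply: filter_from_filter; first by exists [::].
  move=> s t _ _; exists (s ++ t) => // u stu; split => y ys; apply: stu;
  by rewrite mem_cat ys ?orbT.
have [|s0 _ hs0] := cQ (seq X) F (fun s x => exists2 y, y \in s & (Q y /\ W y x)) FF.
  move=> x Qx; exists (W x, [set s : seq X | {subset [:: x] <= s}]).
    by split; [exact: QW|exists [:: x]].
  move=> [x' s] [/= Wx' xs]; exists x; first by apply: xs; rewrite mem_head.
  by split.
exists [seq y <- s0 | `[< Q y >]].
  by move=> y; rewrite mem_filter => /andP[/asboolP].
move=> x Qx; have [//|y ys [Qy Wy]] := hs0 s0 _ x Qx.
by exists y => //; rewrite mem_filter ys andbT; exact/asboolP.
Qed.

Section key_inequality.
Context (R : realType) (n : nat) (K : set 'rV[R]_n).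
Hypothesis hK : symmetric_convex_body K.
Local Open Scope ereal_scope.
Local Notation hs := (@half_space R n : set (mhalf R n)).
Local Notation S1 := (S1_norm K).
Variable nu : {measure set (mhalf R n) -> \bar R}.
Hypothesis sf : sigma_finite setT nu.
Hypothesis nu_fin : forall Q : set (half R n), compact Q -> Q `<=` @half_space R n -> nu Q < +oo.
Variable m : R.
Hypothesis m0 : (0 <= m)%R.
Hypothesis nu_cone : {ae dx R n, forall x, nu (cone K x) <= m%:E}.

Let mhs : measurable hs := @measurable_half_space R n.

Lemma avg_mass_le x r : (0 < r)%R ->
  \int[nu]_(z in hs) ball_integral K (EFin \o avg K x r) z <= m%:E.
Proof.
move=> r0.
have mg : measurable_fun setT (EFin \o avg K x r).
  by apply/measurable_EFinP; exact: measurable_avg.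
have g0 y : 0 <= (EFin \o avg K x r) y by rewrite lee_fin avg_ge0.
have g1 : \int[dx R n]_y (EFin \o avg K x r) y <= 1 by rewrite integral_avg.
have m1 : measurable_fun hs (cst 1 : mhalf R n -> \bar R) by exact: measurable_cst.
have c1 : {ae dx R n, forall y, \int[nu]_(z in cone K y) (cst 1 : mhalf R n -> \bar R) z <= m%:E}.
  have [N [mN N0 sub]] := nu_cone; exists N; split => // y hy; apply: sub => /= h; apply: hy.
  have mC : measurable (cone K y : set (mhalf R n)) by exact: measurable_cone.
  by have := integral_cst nu mC 1%E; rewrite mul1e /= => ->.
have := tent_le_ess_sup hK sf m1 (fun z _ => lee01) mg g0 g1 _ c1.
rewrite lee_fin m0 => /(_ isT).
by under eq_integral do rewrite /= mul1e.
Qed.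

(** The support is cut into small pieces on which [f] is nearly constant, each
    attached to a ball [z_ i], and the pieces are sorted by radius. If a ball meets
    [z_ i], whose radius is [t], and is not smaller, then every ball of its piece
    shares a ball of radius [t / 4] with the ball of radius [4 t] around the center
    of [z_ i]; so such pieces have total mass at most [16 ^+ n * m], the degree
    bound of [local_ratio]. *)
Lemma key_inequality_Cc f : Cc f ->
  \int[nu]_(z in hs) `|f z|%:E <= (16 ^+ n * m)%:E * S1 f.
Proof.
move=> Cf; have [cf [Q [cQ QH f0]]] := Cf.
have mQ : measurable (Q : set (mhalf R n)) by exact: compact_measurable_half.
have S1fin : S1 f < +oo by apply: S10_fin; exact: Cc_S10.
have S1E : S1 f = (fine (S1 f))%:E by rewrite fineK// ge0_fin_numE ?S1_norm_ge0.
have nuQ : nu Q = (fine (nu Q))%:E by rewrite fineK// ge0_fin_numE// nu_fin.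
have mf := Cc_measurable Cf.
have maf : measurable_fun hs (fun z => `|f z|%:E).
  by apply/measurable_EFinP; apply: measurableT_comp.
have -> : \int[nu]_(z in hs) `|f z|%:E = \int[nu]_(z in Q) `|f z|%:E.
  by apply: integral_supp => // z hz zQ; rewrite f0// normr0.
have q0 : (0 <= fine (nu Q))%R by exact: fine_ge0.
suff main e : (0 < e)%R ->
    \int[nu]_(z in Q) `|f z|%:E <= (16 ^+ n * m)%:E * S1 f + (e * fine (nu Q))%:E.
  rewrite S1E -EFinM; apply/lee_addgt0Pr => e e0.
  have q1 : (0 < fine (nu Q) + 1)%R by rewrite ltr_wpDl.
  apply: (le_trans (main _ (divr_gt0 e0 q1))).
  rewrite [in leLHS]S1E -EFinM; apply: leeD => //; rewrite lee_fin.
  by rewrite mulrAC ler_pdivrMr// ler_wpM2l ?(ltW e0)// lerDl.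
move=> e0.
have [[r t0] [_ t00] hQ] := compact_half_bounds hK cQ QH; rewrite /= in t00 hQ.
pose d := (t0 / 4)%R; have d0 : (0 < d)%R by rewrite divr_gt0.
pose W (z : half R n) : set (half R n) := [set z' |
  [/\ (`|f z - f z'| < e)%R, (Knorm K (z'.1 - z.1) < d)%R & (`|z.2 - z'.2| < d)%R]].
have Wnbhs0 z : Q z -> (W z)^° z.
  move=> zQ; have hz := QH _ zQ.
  have /half_continuousP/(_ z hz)/cvgrPdist_lt/(_ _ e0) cfz := cf.
  have c2 : (@snd 'rV[R]_n R) z' @[z' --> z] --> z.2 by exact: cvg_snd.
  have cK : Knorm K (z'.1 - z.1) @[z' --> z] --> 0%R.
    rewrite -[0%R](Knorm0 hK) -(subrr z.1).
    apply: (@cvg_comp _ _ _ (fun z' : half R n => z'.1 - z.1)%R (Knorm K) _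
      (nbhs (z.1 - z.1)%R)); last exact: Knorm_continuous.
    by apply: cvgB; [exact: cvg_fst|exact: cvg_cst].
  move/cvgrPdist_lt/(_ _ d0) in c2; move/cvgrPdist_lt/(_ _ d0) in cK.
  near=> z'; split; [by near: z'| |by near: z'].
  have : (`|0 - Knorm K (z'.1 - z.1)| < d)%R by near: z'.
  by rewrite sub0r normrN; apply: le_lt_trans; exact: ler_norm.
have Wnbhs z : Q z -> nbhs z (W z)^°.
  by move=> /Wnbhs0 h; apply: open_nbhs_nbhs; split => //; exact: open_interior.
have [D' D'Q Qcov] := compact_finite_subcover cQ Wnbhs.
pose le2 (a b : half R n) := (a.2 <= b.2)%R.
pose s := sort le2 D'.
pose N := size s.
pose z_ i := nth (0%R, 1%R) s i : half R n.
have zQ i : (i < N)%N -> Q (z_ i).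
  move=> iN; apply: D'Q.
  by have := mem_nth (0%R, 1%R) iN; rewrite mem_sort.
pose F i : set (mhalf R n) := Q `&` (W (z_ i))^°.
pose G := seqDU F.
have mF i : measurable (F i).
  by apply: measurableI => //; apply: open_measurable_half; exact: open_interior.
have mG i : measurable (G i).
  by apply: measurableD => //; apply: bigsetU_measurable.
have GF i : G i `<=` F i by move=> z [].
have FW i z : F i z -> W (z_ i) z by move=> [_]; exact: interior_subset.
have tG : trivIset setT G by exact: trivIset_seqDU.
have GQ : \big[setU/set0]_(i <- iota 0 N) G i = Q.
  apply/seteqP; split => z.
    by rewrite -bigcup_seq => -[i _ /GF[]].
  move=> /[dup] zq /Qcov[y yD Wy]; rewrite -bigcup_seq.
  have yN : (index y s < N)%N by rewrite index_mem mem_sort.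
  have ex : exists i, (i < N)%N && `[< F i z >].
    exists (index y s); rewrite yN; apply/asboolP; split => //.
    by rewrite /z_ nth_index// mem_sort.
  have [i /andP[iN /asboolP Fi] imin] := ex_minnP ex.
  exists i; first by rewrite /= mem_iota.
  split => //; rewrite -bigcup_mkord => -[j /= ji Fj].
  by have := imin j; rewrite (ltn_trans ji iN) /= => /(_ (asboolT Fj)); rewrite leqNgt ji.
have Gfin i : nu (G i) = (fine (nu (G i)))%:E.
  rewrite fineK// ge0_fin_numE//; apply: le_lt_trans (nu_fin cQ QH).
  by apply: le_measure; rewrite ?inE// => z /GF[].
pose w i := fine (nu (G i)).
have w0 i : (0 <= w i)%R by exact: fine_ge0.
pose adj i j := `[< (Kball K (z_ i).1 (z_ i).2 `&` Kball K (z_ j).1 (z_ j).2) !=set0 >]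
  || (i == j).
pose le i j := le2 (z_ i) (z_ j).
have pw : pairwise le (iota 0 N).
  apply/(pairwiseP 0%N) => i j; rewrite !inE size_iota => iN jN ij.
  rewrite !nth_iota// !add0n /le /z_.
  have trl : transitive le2 by move=> a b c'; exact: le_trans.
  have rl : reflexive le2 by move=> a; exact: lexx.
  have sl : sorted le2 s by apply: sort_sorted => a b; exact: le_total.
  by apply: (sorted_leq_nth trl rl _ sl) => //; exact: ltnW.
have hadj i : i \in iota 0 N ->
    (\sum_(j <- iota 0 N | le i j && adj i j) w j <= 16 ^+ n * m)%R.
  rewrite mem_iota /= add0n => iN; have [_ ti] := hQ _ (zQ i iN).
  pose x0 := (z_ i).1; pose t := (z_ i).2.
  have tp : (0 < t)%R by exact: lt_le_trans ti.
  have t4 : (0 < 4 * t)%R by rewrite mulr_gt0.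
  pose H := ball_integral K (EFin \o avg K x0 (4 * t)%R).
  have mH : measurable_fun setT H.
    apply: measurable_ball_integral => //.
      by apply/measurable_EFinP; exact: measurable_avg.
    by move=> y; rewrite lee_fin avg_ge0.
  have H0 z : 0 <= H z by apply: ball_integral_ge0 => y; rewrite lee_fin avg_ge0.
  have lowH j z : le i j && adj i j -> G j z -> ((16 ^- n)%R)%:E <= H z.
    move=> /andP[tij aij] /GF/FW[_ h1 h2]; rewrite /H [z in ball_integral _ _ z]surjective_pairing.
    have -> : (16 ^- n)%R = ((t / 4 / (4 * t)) ^+ n)%R :> R.
      by rewrite -exprVn; congr (_ ^+ _)%R; field; rewrite gt_eqF.
    have := ltr_normlW h2; have := tij; rewrite /le /le2 -/t => tij' h2'.
    have dt : (d <= t / 4)%R by rewrite /d ler_pM2r.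
    apply: (avg_lower hK); [by rewrite divr_gt0|lra|lra|].
    have h3 : (Knorm K ((z_ j).1 - x0) <= t + (z_ j).2)%R.
      case/orP: aij => [/asboolP[y [/= y1 y2]]|/eqP <-]; last first.
        by rewrite subrr Knorm0// addr_ge0// ltW.
      rewrite -(subrKA y) addrC; apply: le_trans (Knorm_triangle hK _ _) _.
      by apply: lerD => //; rewrite KnormB.
    have h4 : (Knorm K (z.1 - x0) <= Knorm K (z.1 - (z_ j).1) + Knorm K ((z_ j).1 - x0))%R.
      by rewrite -(subrKA (z_ j).1); exact: Knorm_triangle.
    lra.
  pose L := [seq j <- iota 0 N | le i j && adj i j].
  have p16 : (0 < 16 ^+ n :> R)%R by rewrite exprn_gt0.
  rewrite -lee_fin -big_filter -/L -sumEFin.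
  apply: (@le_trans _ _ (\sum_(j <- L) (16 ^+ n)%:E * \int[nu]_(z in G j) H z)).
    rewrite big_seq [leRHS]big_seq; apply: lee_sum => j.
    rewrite mem_filter => /andP[lj _].
    have -> : (w j)%:E = (16 ^+ n)%:E * ((16 ^- n)%:E * (w j)%:E).
      by rewrite -!EFinM mulrA mulfV ?gt_eqF// mul1r.
    apply: lee_wpmul2l; first by rewrite lee_fin ltW.
    rewrite /w -Gfin -integral_cst//; apply: ge0_le_integral => //.
    - by move=> z _; rewrite lee_fin invr_ge0 ltW.
    - exact: measurable_funTS.
    - by move=> z zG; exact: (lowH j).
  rewrite -ge0_sume_distrr; last by move=> j _; apply: integral_ge0 => z _; exact: H0.
  rewrite EFinM; apply: lee_wpmul2l; first by rewrite lee_fin ltW.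
  have tL : trivIset [set` L] G by apply: sub_trivIset tG.
  have uL : uniq L by rewrite filter_uniq// iota_uniq.
  rewrite -(ge0_integral_bigsetU nu mG uL tL); last 2 first.
  - exact: measurable_funTS.
  - by move=> z _; exact: H0.
  apply: le_trans (avg_mass_le x0 t4); apply: ge0_subset_integral => //.
  - exact: bigsetU_measurable.
  - exact: measurable_funTS.
  - move=> z; rewrite -bigcup_seq => -[j _ /GF[zq _]]; exact: QH.
have lexx' i : le i i by exact: lexx.
have adjxx' i : adj i i by rewrite /adj eqxx orbT.
have [C [sC pC hC]] := local_ratio adjxx' lexx' w0 (fun i => `|f (z_ i)|%R) pw hadj.
have CN i : i \in C -> (i < N)%N.
  by move=> /(mem_subseq sC); rewrite mem_iota.
have uC : uniq C by apply: subseq_uniq sC _; exact: iota_uniq.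
have nadj i j : i \in C -> j \in C -> i != j ->
    Kball K (z_ i).1 (z_ i).2 `&` Kball K (z_ j).1 (z_ j).2 = set0.
  move=> iC jC ij.
  have main a b : a \in C -> b \in C -> (index a C < index b C)%N ->
      Kball K (z_ a).1 (z_ a).2 `&` Kball K (z_ b).1 (z_ b).2 = set0.
    move=> aC bC ab.
    have := (pairwiseP 0%N pC) (index a C) (index b C).
    rewrite !inE !index_mem => /(_ aC bC ab); rewrite !nth_index// /adj negb_or => /andP[/asboolPn h _].
    by apply/eqP; apply: contrapT => /negP/set0P.
  have [ab|ab|ab] := ltngtP (index i C) (index j C); first exact: main.
    by rewrite setIC; exact: main.
  by move: ij; rewrite -(nth_index 0%N iC) ab nth_index// eqxx.
have z_inj : {in C &, injective z_}.
  move=> i j iC jC zz; apply/eqP; apply: contrapT => /negP ij.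
  have [_ ti] := hQ _ (zQ i (CN i iC)).
  have := nadj i j iC jC ij; rewrite -zz setIid => e1.
  have ti0 : (0 <= (z_ i).2)%R := le_trans (ltW t00) ti.
  by have := Kball_center hK (z_ i).1 ti0; rewrite e1.
pose C' : {fset half R n} := [fset z in map z_ C]%fset.
have C'E z : (z \in C') = (z \in map z_ C) by rewrite /C' !inE.
have dC' : disjoint_balls K C'.
  split.
    by move=> z /=; rewrite C'E => /mapP[i iC ->]; apply: QH; exact: zQ (CN i iC).
  move=> z z' /=; rewrite !C'E => /mapP[i iC ->] /mapP[j jC ->] ne.
  have [->//|ij] := eqVneq i j.
  by case: ne => y; rewrite (nadj i j iC jC ij).
have sumC : (\sum_(i <- C) `|f (z_ i)| = \sum_(z <- C') `|f z|)%R.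
  rewrite -(big_map z_ xpredT (fun z => `|f z|)%R); apply: perm_big.
  by apply: uniq_perm; [rewrite map_inj_in_uniq|exact: fset_uniq|move=> z; rewrite C'E].
have nuQsum : nu Q = \sum_(i <- iota 0 N) nu (G i).
  transitivity (\int[nu]_(z in Q) cst 1 z); first by rewrite integral_cst// mul1e.
  rewrite -GQ (ge0_integral_bigsetU nu mG (iota_uniq _ _))//; last exact: sub_trivIset tG.
  by apply: eq_bigr => i _; rewrite integral_cst// mul1e.
rewrite -{1}GQ (ge0_integral_bigsetU nu mG (iota_uniq _ _)); last 3 first.
- exact: sub_trivIset tG.
- by rewrite GQ; exact: measurable_funS maf.
- by move=> z _; rewrite lee_fin.
apply: (@le_trans _ _ (\sum_(i <- iota 0 N) (w i * `|f (z_ i)| + e * w i)%:E)).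
  apply: lee_sum => i _.
  have -> : (w i * `|f (z_ i)| + e * w i)%:E = (`|f (z_ i)| + e)%:E * nu (G i).
    by rewrite Gfin -EFinM mulrDl mulrC.
  rewrite -integral_cst//; apply: ge0_le_integral => //.
  - by apply: measurable_funS maf => // z /GF[zq _]; exact: QH.
  - move=> z /GF/FW[h _ _]; rewrite lee_fin -[f z](subrKC (f (z_ i))).
    by rewrite (le_trans (ler_normD _ _))// lerD// distrC ltW.
rewrite sumEFin big_split /= -mulr_sumr EFinD; apply: leeD; last first.
  rewrite lee_fin ler_wpM2l ?(ltW e0)// -lee_fin -nuQ nuQsum -sumEFin.
  by apply: lee_sum => i _; rewrite Gfin.
rewrite S1E -EFinM lee_fin; apply: (le_trans hC); apply: ler_wpM2l.
  by rewrite mulr_ge0// exprn_ge0.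
by rewrite sumC -lee_fin -S1E; exact: le_S1_norm.
Unshelve. all: by end_near. Qed.

(** Cutting off does not increase the norm, so that the integral over the half-space
    is a limit of integrals of compactly supported functions. *)
Lemma key_inequality f : S1_space K f ->
  \int[nu]_(z in hs) `|f z|%:E <= (16 ^+ n * m)%:E * S1 f.
Proof.
move=> [cf Sf].
have mf : measurable_fun hs f by apply: continuous_measurable_half => //; exact: half_space_open.
have maf : measurable_fun hs (fun z => `|f z|%:E).
  by apply/measurable_EFinP; apply: measurableT_comp.
have cv : \int[nu]_(z in exh k) `|f z|%:E @[k --> \oo] --> \int[nu]_(z in hs) `|f z|%:E.
  rewrite -{1}(exh_bigcup R n); apply: ge0_nondecreasing_set_cvg_integral => //.
  - by move=> i j ij; apply/subsetPset; exact: exh_nd.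
  - by move=> k; exact: measurable_exh.
  - by move=> k; apply: measurable_funS maf => //; exact: exh_half.
rewrite -(cvg_lim _ cv)//; apply: lime_le; first exact: cvgP cv.
apply: nearW => k.
have Cfk : Cc (fun z => f z * cutoff k z)%R by apply: CcM => //; exact: Cc_of_cutoff.
apply: (@le_trans _ _ (\int[nu]_(z in hs) `|f z * cutoff k z|%:E)).
  apply: (@le_trans _ _ (\int[nu]_(z in exh k) `|f z * cutoff k z|%:E)).
    by rewrite le_eqVlt; apply/orP; left; apply/eqP; apply: eq_integral => z /set_mem zk;
      rewrite cutoff1// mulr1.
  apply: ge0_subset_integral => //; [exact: measurable_exh| |exact: exh_half].
  by apply/measurable_EFinP; apply: measurableT_comp => //; exact: Cc_measurable.
apply: (le_trans (key_inequality_Cc Cfk)); apply: lee_wpmul2l.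
  by rewrite lee_fin mulr_ge0// exprn_ge0.
apply: S1_norm_mono => z hz; rewrite normrM ler_piMr//.
by have /andP[c0 c1] := cutoff_itv k z; rewrite ger0_norm.
Qed.

End key_inequality.

(** * Representation of positive functionals *)

Section inner_approximation.
Context (R : realType) (n : nat).
Local Notation hs := (@half_space R n).
Implicit Types (U : set (half R n)) (z w : half R n).

(** Distance to the complement, truncated at 1 so that it is finite when the
    complement is empty. *)
Definition gap U z : R := inf ([set `|z - w| | w in ~` U] `|` [set 1]).

Let gap_has_inf U z : has_inf ([set `|z - w| | w in ~` U] `|` [set 1]).
Proof.
split; first by exists 1; right.
by exists 0 => _ [[w _ <-]|->]//; exact: ler01.
Qed.

Lemma gap_ge0 U z : 0 <= gap U z.
Proof.
apply: lb_le_inf; first by case: (gap_has_inf U z).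
by move=> _ [[w _ <-]|->]//; exact: ler01.
Qed.

Lemma gap_out U z : ~ U z -> gap U z = 0.
Proof.
move=> Uz; apply/eqP; rewrite eq_le gap_ge0 andbT -(normr0 (half R n)) -(subrr z).
by apply: ge_inf; [case: (gap_has_inf U z)|left; exists z].
Qed.

Lemma gap_gt0 U z : open U -> U z -> 0 < gap U z.
Proof.
move=> oU Uz; have /nbhs_ballP[e /= e0 eU] := open_nbhs_nbhs (conj oU Uz).
apply: (@lt_le_trans _ _ (Num.min e 1)); first by rewrite lt_min e0 ltr01.
apply: lb_le_inf; first by case: (gap_has_inf U z).
move=> _ [[w Uw <-]|->]; last by rewrite ge_min lexx orbT.
rewrite ge_min; apply/orP; left; rewrite leNgt; apply/negP => h.
by apply: Uw; apply: eU; rewrite -ball_normE.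
Qed.

Lemma gap_lipschitz U z w : `|gap U z - gap U w| <= `|z - w|.
Proof.
have le a b : gap U a <= gap U b + `|a - b|.
  rewrite -lerBlDr; apply: lb_le_inf; first by case: (gap_has_inf U b).
  move=> _ [[v Uv <-]|->]; rewrite lerBlDr.
    apply: (@le_trans _ _ `|a - v|).
      by apply: ge_inf; [case: (gap_has_inf U a)|left; exists v].
    by rewrite -(subrKA b) addrC; exact: ler_normD.
  apply: (@le_trans _ _ 1); last by rewrite lerDl.
  by apply: ge_inf; [case: (gap_has_inf U a)|right].
by rewrite ler_distl lerBlDr le /= [leRHS]addrC distrC addrC le.
Qed.

Lemma continuous_gap U : continuous (gap U).
Proof.
move=> z; apply/cvgrPdist_lt => e e0; near=> w.
apply: le_lt_trans (gap_lipschitz U z w) _.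
by near: w; apply: cvgr_dist_lt.
Unshelve. all: by end_near. Qed.

(** Compactly supported functions that increase to the indicator of [U] when [U] is
    open. *)
Definition inner U (k : nat) z : R := clamp (k%:R * gap U z) * cutoff k z.

Lemma Cc_inner U k : Cc (inner U k).
Proof.
apply: CcM; last exact: Cc_of_cutoff.
apply: continuous_subspaceT; apply: continuous_clamp => z.
by apply: cvgM; [exact: cvg_cst|exact: continuous_gap].
Qed.

Lemma inner_itv U k z : 0 <= inner U k z <= 1.
Proof.
have /andP[a0 a1] := clamp_itv (k%:R * gap U z); have /andP[b0 b1] := cutoff_itv k z.
by rewrite mulr_ge0//= -[leRHS]mulr1 ler_pM.
Qed.

Lemma inner_out U k z : ~ U z -> inner U k z = 0.
Proof. by move=> Uz; rewrite /inner gap_out// mulr0 clamp_le0// mul0r. Qed.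

Lemma inner_nd U z : half_space z -> {homo (fun k => inner U k z) : j k / (j <= k)%N >-> j <= k}.
Proof.
move=> hz j k jk; rewrite /inner; apply: ler_pM.
- by case/andP: (clamp_itv (j%:R * gap U z)).
- by case/andP: (cutoff_itv j z).
- have h : j%:R * gap U z <= k%:R * gap U z by rewrite ler_wpM2r ?gap_ge0// ler_nat.
  rewrite /clamp le_min ge_min lexx /= ge_min; apply/orP; right.
  by rewrite ge_max !le_max lexx h orbT.
- move: jk; rewrite leq_eqVlt => /predU1P[->//|jk].
  have [zk|zk] := pselect (exh j.+1 z); last first.
    by rewrite cutoff0//; case/andP: (cutoff_itv k z).
  by rewrite [leRHS]cutoff1; [case/andP: (cutoff_itv j z)|exact: exh_nd zk].
Qed.

Lemma inner1 U z : open U -> U z -> half_space z -> exists k, inner U k z = 1.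
Proof.
move=> oU Uz hz; have g0 := gap_gt0 oU Uz.
have : (\bigcup_k @exh R n k) z by rewrite exh_bigcup.
move=> [i _ iz]; pose k := maxn i (Num.bound (gap U z)^-1); exists k.
rewrite /inner cutoff1 ?mulr1; last by apply: exh_nd iz; exact: leq_maxl.
apply: clamp_ge1; rewrite -ler_pdivrMr// div1r ltW//.
apply: (@lt_le_trans _ _ (Num.bound (gap U z)^-1)%:R).
  by apply: archi_boundP; rewrite invr_ge0 ltW.
by rewrite ler_nat leq_maxr.
Qed.

End inner_approximation.

Section positive_functional.
Context (R : realType) (n : nat).
Local Notation hs := (@half_space R n).
Implicit Types (f g : half R n -> R) (U : set (half R n)).

Definition Ccp : set (half R n -> R) :=
  [set f | Cc f /\ forall z, half_space z -> 0 <= f z].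

Lemma Ccp0 : Ccp (cst 0). Proof. by split => //; exact: Cc0. Qed.

Lemma CcpD f g : Ccp f -> Ccp g -> Ccp (f \+ g).
Proof.
by move=> [cf f0] [cg g0]; split; [exact: CcD|move=> z hz; rewrite addr_ge0 ?f0 ?g0].
Qed.

Lemma CcpZ c f : 0 <= c -> Ccp f -> Ccp (c \*o f).
Proof.
by move=> c0 [cf f0]; split; [exact: CcZ|move=> z hz; rewrite mulr_ge0 ?f0].
Qed.

Lemma Ccp_min f g : Ccp f -> Ccp g -> Ccp (fun z => Num.min (f z) (g z)).
Proof.
by move=> [cf f0] [cg g0]; split; [exact: Cc_min|move=> z hz; rewrite le_min f0 ?g0].
Qed.

Lemma Ccp_sub f g : Ccp f -> Ccp g -> (forall z, half_space z -> f z <= g z) -> Ccp (g \- f).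
Proof.
by move=> [cf f0] [cg g0] fg; split; [exact: CcB|move=> z hz; rewrite subr_ge0 fg].
Qed.

Lemma Ccp_inner U k : Ccp (inner U k).
Proof. by split; [exact: Cc_inner|move=> z _; case/andP: (inner_itv U k z)]. Qed.

Lemma Ccp_cutoff k : Ccp (@cutoff R n k).
Proof. by split; [exact: Cc_of_cutoff|move=> z _; case/andP: (cutoff_itv k z)]. Qed.

Lemma Ccp_excess f (d : R) : 0 <= d -> Ccp f -> Ccp (fun z => Num.max (f z - d) 0).
Proof.
move=> d0 [cf f0]; split; last by move=> z _; rewrite le_max lexx orbT.
apply: (Cc_dominated _ cf).
  have /half_continuousP cf' := Cc_continuous cf.
  apply/half_continuousP => z hz.
  rewrite (_ : (fun z => _) = fun z => 2^-1 * ((f z - d) + `|f z - d|)); last first.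
    by apply/funext => w; rewrite maxr_absE addr0 subr0 mulrC.
  have h : (fun z => f z - d) @ z --> f z - d by apply: cvgB; [exact: cf'|exact: cvg_cst].
  by apply: cvgM; [exact: cvg_cst|apply: cvgD => //; exact: cvg_norm].
move=> z hz; rewrite !ger0_norm ?f0// ?le_max ?lexx ?orbT//.
by rewrite ge_max f0// andbT gerBl.
Qed.

Variable K : set 'rV[R]_n.
Hypothesis hK : symmetric_convex_body K.
Variable I : (half R n -> R) -> R.
Hypothesis I_ge0 : forall f, Ccp f -> 0 <= I f.
Hypothesis ID : forall f g, Ccp f -> Ccp g -> I (f \+ g) = I f + I g.
Hypothesis IZ : forall c f, 0 <= c -> Ccp f -> I (c \*o f) = c * I f.

Lemma positive_le f g : Ccp f -> Ccp g -> (forall z, half_space z -> f z <= g z) -> I f <= I g.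
Proof.
move=> Cf Cg fg; have Cgf := Ccp_sub Cf Cg fg.
rewrite (_ : g = f \+ (g \- f)); last by apply/funext => z /=; rewrite subrKC.
by rewrite ID// lerDl I_ge0.
Qed.

Lemma positive0 : I (cst 0) = 0.
Proof.
have := IZ (lexx 0) Ccp0; rewrite mul0r => {2}<-; congr I.
by apply/funext => z /=; rewrite mul0r.
Qed.

Lemma Ccp_sum (J : Type) (s : seq J) (F : J -> half R n -> R) :
  (forall j, Ccp (F j)) -> Ccp (fun z => \sum_(j <- s) F j z).
Proof. by move=> CF; apply: (linear_space_sum Ccp0 CcpD). Qed.

Lemma positive_sum (J : Type) (s : seq J) (F : J -> half R n -> R) :
  (forall j, Ccp (F j)) -> I (fun z => \sum_(j <- s) F j z) = \sum_(j <- s) I (F j).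
Proof.
move=> CF; elim: s => [|i s ih].
  rewrite big_nil (_ : (fun _ => _) = cst 0) ?positive0//.
  by apply/funext => x; rewrite big_nil.
rewrite (_ : (fun _ => _) = F i \+ (fun x => \sum_(i <- s) F i x)); last first.
  by apply/funext => x; rewrite big_cons.
by rewrite ID// ?ih ?big_cons//; exact: Ccp_sum.
Qed.

(** On the compact support of [f] the constant [d] is below [d] times a cutoff. *)
Lemma positive_excess f (e : R) : Ccp f -> 0 < e ->
  exists2 d : R, 0 < d & I f <= I (fun z => Num.max (f z - d) 0) + e.
Proof.
move=> Cf e0; have [[cf [Q [cQ QH fQ]]] fp] := Cf.
have [i Qi] := compact_sub_exh hK cQ QH.
have I1 : 0 < I (cutoff i) + 1 by rewrite ltr_wpDl// I_ge0//; exact: Ccp_cutoff.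
pose d := e / (I (cutoff i) + 1); have d0 : 0 < d by rewrite divr_gt0.
exists d => //; have Cd : Ccp (d \*o cutoff i) by apply: CcpZ; [exact: ltW|exact: Ccp_cutoff].
have Ce : Ccp (fun z => Num.max (f z - d) 0) by apply: Ccp_excess => //; exact: ltW.
have : I f <= I ((fun z => Num.max (f z - d) 0) \+ d \*o cutoff i).
  apply: positive_le => //; first exact: CcpD.
  move=> z hz /=; have [Qz|Qz] := pselect (Q z).
    by rewrite cutoff1 ?mulr1; [rewrite -lerBlDr le_max lexx|exact: Qi].
  have /andP[c0 _] := cutoff_itv i z.
  by rewrite fQ// addr_ge0 ?le_max ?lexx ?orbT// mulr_ge0// ltW.
move=> /le_trans; apply; rewrite ID// IZ ?(ltW d0)//; last exact: Ccp_cutoff.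
rewrite lerD2l /d mulrAC ler_pdivrMr// ler_wpM2l ?(ltW e0)// lerDl.
exact: ler01.
Qed.

(** Dini: on the compact support of [f], finitely many of the functions exceed
    [f - d], hence a single one by monotonicity. *)
Lemma positive_dini f (g : nat -> half R n -> R) (e : R) : Ccp f ->
  (forall k, Ccp (g k)) ->
  (forall z, half_space z -> {homo (fun k => g k z) : j k / (j <= k)%N >-> j <= k}) ->
  (forall z, half_space z -> exists k, f z <= g k z) -> 0 < e ->
  exists k, I f <= I (g k) + e.
Proof.
move=> Cf Cg ndg fg e0; have [[cf [Q [cQ QH f0]]] fp] := Cf.
have [d d0 hd] := positive_excess Cf e0.
have /choice[k hk] : forall z, exists k, half_space z -> f z <= g k z.
  move=> z; have [hz|hz] := pselect (half_space z); last by exists 0%N.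
  by have [k] := fg z hz; exists k.
pose W z := [set w | half_space w /\ f w < g (k z) w + d].
have QW z : Q z -> nbhs z (W z).
  move=> Qz; have hz := QH z Qz.
  have /half_continuousP/(_ z hz) cfz := cf.
  have /half_continuousP/(_ z hz) cgz := Cc_continuous (Cg (k z)).1.
  have cfg : (fun w => g (k z) w - f w) @ z --> g (k z) z - f z by exact: cvgB.
  have : - d < g (k z) z - f z.
    by rewrite (@lt_le_trans _ _ 0)// ?oppr_lt0// subr_ge0 hk.
  move=> h; have near_gt : \forall w \near z, - d < g (k z) w - f w by exact: cvgr_gt cfg _ h.
  near=> w; split; first by near: w; exact: (half_space_open hz).
  have : - d < g (k z) w - f w by near: w.
  by rewrite ltrBrDr addrC -ltrBrDr opprK.
have [s sQ scov] := compact_finite_subcover cQ QW.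
pose m := \max_(z <- s) k z; exists m; apply: (le_trans hd); rewrite lerD2r.
apply: positive_le => //; first by apply: Ccp_excess => //; exact: ltW.
move=> z hz; have [_ gp] := Cg m; rewrite ge_max gp// andbT.
have [Qz|Qz] := pselect (Q z); last by rewrite f0// sub0r (le_trans _ (gp z hz))// oppr_le0 ltW.
have [y ys [_ Wy]] := scov z Qz; rewrite lerBlDr; apply: (le_trans (ltW Wy)).
by rewrite lerD2r; apply: ndg => //; rewrite /m; apply: leq_bigmax_seq.
Unshelve. all: by end_near. Qed.

Local Open Scope ereal_scope.

Definition below U : set (half R n -> R) := [set f | [/\ Ccp f,
  forall z, half_space z -> (f z <= 1)%R & forall z, half_space z -> ~ U z -> f z = 0%R]].

Definition open_mass U : \bar R := ereal_sup [set (I f)%:E | f in below U].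

Definition riesz_outer (A : set (half R n)) : \bar R :=
  ereal_inf [set open_mass U | U in [set U | open U /\ A `&` hs `<=` U]].

Lemma below0 U : below U (cst 0%R).
Proof. by split; [exact: Ccp0|move=> z _; exact: ler01|by []]. Qed.

Lemma le_open_mass U f : below U f -> (I f)%:E <= open_mass U.
Proof. by move=> bf; apply: ereal_sup_ubound; exists f. Qed.

Lemma open_mass_ge0 U : 0 <= open_mass U.
Proof. by apply: le_trans (le_open_mass (below0 U)); rewrite positive0. Qed.

Lemma open_mass_mono U V : U `&` hs `<=` V -> open_mass U <= open_mass V.
Proof.
move=> UV; apply: ge_ereal_sup => _ [f [Cf f1 f0] <-]; apply: le_open_mass.
by split => // z hz Vz; apply: f0 => // Uz; apply: Vz; exact: UV.
Qed.

(** By Dini, a function below the indicator of the union is nearly bounded by a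
    finite sum of functions below the indicators of the sets. *)
Lemma open_mass_bigcup (U : nat -> set (half R n)) : (forall i, open (U i)) ->
  open_mass (\bigcup_i U i) <= \sum_(i <oo) open_mass (U i).
Proof.
move=> oU; apply: ge_ereal_sup => _ [f [Cf f1 f0] <-].
apply/lee_addgt0Pr => e e0.
pose g k z := Num.min (f z) (\sum_(i < k) inner (U i) k z)%R.
have Csum k : Ccp (fun z => \sum_(i < k) inner (U i) k z)%R.
  by apply: (@Ccp_sum _ _ (fun (i : 'I_k) z => inner (U i) k z)) => i; exact: Ccp_inner.
have Cg k : Ccp (g k) by exact: Ccp_min.
have inge0 (V : set (half R n)) k z : (0 <= inner V k z)%R by case/andP: (inner_itv V k z).
have ndg z : half_space z -> {homo (fun k => g k z) : j k / (j <= k)%N >-> (j <= k)%R}.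
  move=> hz j k jk; rewrite /g le_min ge_min lexx /= ge_min; apply/orP; right.
  rewrite (big_ord_widen _ (fun i => inner (U i) j z) jk) big_mkcond /=.
  apply: ler_sum => i _; case: ifP => _; last exact: inge0.
  exact: inner_nd.
have fg z : half_space z -> exists k, (f z <= g k z)%R.
  move=> hz; have [[i _ Uiz]|nU] := pselect ((\bigcup_i U i) z).
    have [k hk] := inner1 (oU i) Uiz hz; pose l := maxn i.+1 k; exists l.
    rewrite /g le_min lexx /=; apply: (le_trans (f1 z hz)).
    have il : (i < l)%N by rewrite leq_maxl.
    rewrite (bigD1 (Ordinal il)) //=; apply: ler_wpDr; first exact: sumr_ge0.
    by rewrite -hk; apply: inner_nd => //; rewrite leq_maxr.
  exists 0%N; rewrite f0// /g big_ord0 le_min lexx andbT; case: Cf => _; exact.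
have [k hk] := positive_dini Cf Cg ndg fg e0.
apply: (@le_trans _ _ (I (g k) + e)%:E); first by rewrite lee_fin.
rewrite EFinD; apply: leeD => //.
pose h (i : nat) z := Num.min (f z) (inner (U i) k z).
have Ch i : Ccp (h i) by apply: Ccp_min => //; exact: Ccp_inner.
have bh i : below (U i) (h i).
  split => // z hz; first by rewrite ge_min f1.
  by move=> Uz; rewrite /h inner_out// min_r//; case: Cf => _; exact.
apply: (@le_trans _ _ (\sum_(0 <= i < k) open_mass (U i))); last first.
  by apply: nneseries_lim_ge => i _ _; exact: open_mass_ge0.
apply: (@le_trans _ _ (I (fun z => \sum_(i < k) h i z)%R)%:E).
  rewrite lee_fin; apply: positive_le => //; first by apply: (@Ccp_sum _ _ (fun (i : 'I_k) => h i)).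
  move=> z hz; have fz0 : (0 <= f z)%R by case: Cf => _; exact.
  suff [] : (0 <= \sum_(i < k) inner (U i) k z)%R /\
    (Num.min (f z) (\sum_(i < k) inner (U i) k z) <= \sum_(i < k) h i z)%R by [].
  elim/big_ind2 : _ => [|x1 x2 y1 y2 [x0 h1] [y0 h2]|i _].
  - by rewrite min_r.
  - split; first exact: addr_ge0.
    apply: le_trans (lerD h1 h2).
    have [a1|a1] := leP (f z) x2; have [a2|a2] := leP (f z) y2;
    rewrite ge_min; apply/orP; try (left; lra); right; lra.
  - by split.
rewrite (@positive_sum _ _ (fun (i : 'I_k) => h i))// -sumEFin big_mkord.
by apply: lee_sum => i _; exact: le_open_mass.
Qed.

Lemma le_riesz_outer A U : open U -> A `&` hs `<=` U -> riesz_outer A <= open_mass U.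
Proof. by move=> oU AU; apply: ereal_inf_lbound; exists U. Qed.

Lemma riesz_outer_open U : open U -> riesz_outer U = open_mass U.
Proof.
move=> oU; apply/eqP; rewrite eq_le; apply/andP; split.
  by apply: le_riesz_outer => // z [].
by apply: le_ereal_inf_tmp => _ [V [oV UV] <-]; exact: open_mass_mono.
Qed.

Let riesz_outer_ge0 A : 0 <= riesz_outer A.
Proof. by apply: le_ereal_inf_tmp => _ [V _ <-]; exact: open_mass_ge0. Qed.

Let riesz_outer0 : riesz_outer set0 = 0.
Proof.
apply/eqP; rewrite eq_le riesz_outer_ge0 andbT riesz_outer_open; last exact: open0.
apply: ge_ereal_sup => _ [f [Cf _ f0] <-]; rewrite lee_fin -positive0.
by apply: positive_le => //; [exact: Ccp0|move=> z hz; rewrite f0].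
Qed.

Let riesz_outer_mono : {homo riesz_outer : A B / A `<=` B >-> A <= B}.
Proof.
move=> A B AB; apply: ereal_inf_le_tmp => _ [U [oU BU] <-]; exists U => //.
by split => // z [/AB Bz hz]; apply: BU.
Qed.

Let riesz_outer_sub : sigma_subadditive riesz_outer.
Proof.
move=> A; apply/lee_addgt0Pr => e e0.
apply: le_trans (@epsilon_trick _ (fun i => riesz_outer (A i)) e xpredT
  (fun i => riesz_outer_ge0 (A i)) (ltW e0)).
have /choice[U hU] : forall i, exists U, [/\ open U, A i `&` hs `<=` U &
    open_mass U <= riesz_outer (A i) + (e / (2 ^ i.+1)%:R)%:E].
  move=> i; have ei : (0 < e / (2 ^ i.+1)%:R)%R by rewrite divr_gt0// ltr0n expn_gt0.
  have [fin|] := boolP (riesz_outer (A i) \is a fin_num).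
    have [_ [U [oU AU] <-] h] := lb_ereal_inf_adherent ei fin.
    by exists U; split => //; exact: ltW.
  rewrite ge0_fin_numE// -leNgt leye_eq => /eqP ->.
  by exists setT; split => //; [exact: openT|rewrite addye// leey].
have oU i : open (U i) by have [] := hU i.
apply: (@le_trans _ _ (open_mass (\bigcup_i U i))).
  apply: le_riesz_outer; first exact: bigcup_open.
  by move=> z [[i _ Aiz] hz]; exists i => //; have [_ + _] := hU i; apply.
apply: le_trans (open_mass_bigcup oU) _; apply: lee_nneseries => i *.
  exact: open_mass_ge0.
by have [] := hU i.
Qed.

HB.instance Definition _ := isOuterMeasure.Build R (half R n) riesz_outer
  riesz_outer0 riesz_outer_ge0 riesz_outer_mono riesz_outer_sub.

(** Lowering a nearly optimal function [f] below [E `&` U] by a small height [d]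
    makes room for the functions below [E `&` [set z | f z < d]], an open set that
    contains the rest of [E]. *)
Lemma riesz_caratheodory_open U : open U -> caratheodory_measurable riesz_outer U.
Proof.
move=> oU; apply: le_caratheodory_measurable => X.
apply: le_ereal_inf_tmp => _ [E [oE XE] <-].
have [->|Efin] := eqVneq (open_mass E) +oo; first exact: leey.
have Er : open_mass E \is a fin_num by rewrite ge0_fin_numE ?open_mass_ge0// ltey.
have XUE : riesz_outer (X `&` U) <= open_mass (E `&` U).
  apply: le_riesz_outer; first exact: openI.
  by move=> z [[Xz Uz] hz]; split => //; exact: XE.
apply: (le_trans (leeD2r _ XUE)).
have XE' : riesz_outer (X `&` ~` U) <= open_mass E.
  by apply: le_riesz_outer => // z [[Xz _] hz]; exact: XE.
have bfin : riesz_outer (X `&` ~` U) \is a fin_num.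
  by rewrite ge0_fin_numE// (le_lt_trans XE')// ltey.
rewrite -leeBrDr//; apply: ge_ereal_sup => _ [f [Cf f1 f0] <-]; rewrite leeBrDr//.
apply/lee_addgt0Pr => e e0.
(* cutting [f] at a small height makes room for functions living off [U] *)
have [d d0 hd] := positive_excess Cf e0.
pose fd z := Num.max (f z - d)%R 0%R.
have Cfd : Ccp fd by apply: Ccp_excess => //; exact: ltW.
pose V := E `&` (hs `&` [set z | (f z < d)%R]).
have oV : open V.
  apply: openI => //; have /half_continuousP cf := Cc_continuous Cf.1.
  rewrite openE => z [hz fz]; apply: filterI; first exact: (half_space_open hz).
  exact: (cvgr_lt _ (cf z hz)).
have XV : riesz_outer (X `&` ~` U) <= open_mass V.
  apply: le_riesz_outer => // z [[Xz Uz] hz]; split; first exact: XE.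
  by split => //=; rewrite f0// => -[].
have VE : (I fd)%:E + open_mass V <= open_mass E.
  rewrite addeC -leeBrDr//; apply: ge_ereal_sup => _ [g [Cg g1 g0] <-].
  rewrite leeBrDr// -EFinD addrC -ID//; apply: le_open_mass; split.
  - exact: CcpD.
  - move=> z hz /=; have [Vz|Vz] := pselect (V z).
      by rewrite /fd max_r ?add0r ?g1//; case: Vz => _ [_ /= h]; rewrite subr_le0 ltW.
    rewrite g0// addr0 /fd ge_max ler01 andbT.
    by rewrite (le_trans _ (f1 z hz))// gerBl ltW.
  - move=> z hz Ez /=; rewrite g0//; last by case.
    rewrite addr0 /fd f0//; last by case.
    by rewrite sub0r max_r// oppr_le0 ltW.
apply: (@le_trans _ _ ((I fd)%:E + e%:E + riesz_outer (X `&` ~` U))).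
  by apply: leeD2r; rewrite -EFinD lee_fin.
rewrite addeAC; apply: leeD2r; apply: le_trans VE; exact: leeD2l.
Qed.

Lemma riesz_caratheodory (A : set (mhalf R n)) : measurable A ->
  caratheodory_measurable riesz_outer A.
Proof.
move: A; apply: measurable_half_ind.
- split.
  + exact: caratheodory_measurable_set0.
  + by move=> A mA; rewrite setTD; exact: caratheodory_measurable_setC.
  + by move=> A mA; exact: caratheodory_measurable_bigcup.
- move=> i c; apply: riesz_caratheodory_open.
  apply: (open_comp (f := fun z : half R n => z.1 ord0 i) (D := [set x : R | (c < x)%R])).
    move=> z _; apply: (@cvg_comp _ _ _ fst (fun x : 'rV[R]_n => x ord0 i) _ (nbhs z.1)).
      exact: cvg_fst.
    exact: coord_continuous.
  exact: open_gt.
- move=> c; apply: riesz_caratheodory_open.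
  apply: (open_comp (f := snd) (D := [set x : R | (c < x)%R])); last exact: open_gt.
  by move=> z _; exact: cvg_snd.
Qed.

Definition riesz_mass (A : set (mhalf R n)) : \bar R := riesz_outer A.

Let riesz_mass0 : riesz_mass set0 = 0. Proof. exact: riesz_outer0. Qed.
Let riesz_mass_ge0 A : 0 <= riesz_mass A. Proof. exact: riesz_outer_ge0. Qed.

Let riesz_mass_sigma_additive : semi_sigma_additive riesz_mass.
Proof.
move=> F mF tF mUF.
have cF i : caratheodory_measurable riesz_outer (F i) by exact: riesz_caratheodory.
have h := caratheodory_lime_le cF tF (\bigcup_i F i).
have E : riesz_mass (\bigcup_i F i) = \sum_(i <oo) riesz_mass (F i).
  apply/eqP; rewrite eq_le; apply/andP; split; first exact: riesz_outer_sub.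
  rewrite setICr outer_measure0 adde0 in h; apply: le_trans h.
  apply: lee_nneseries => i *; first exact: riesz_outer_ge0.
  by rewrite setIC (setIidl (bigcup_sup (i := i) _)).
rewrite E; apply: is_cvg_nneseries => i _ _; exact: riesz_outer_ge0.
Qed.

HB.instance Definition _ := isMeasure.Build _ _ _ riesz_mass riesz_mass0
  riesz_mass_ge0 riesz_mass_sigma_additive.

Definition riesz_measure : {measure set (mhalf R n) -> \bar R} := riesz_mass.

Lemma riesz_mass_half : riesz_mass (~` hs) = 0.
Proof.
apply/eqP; rewrite eq_le riesz_mass_ge0 andbT -riesz_outer0.
by apply: ereal_inf_le_tmp => _ [U [oU _] <-]; exists U => //; split => // z [].
Qed.

Lemma riesz_mass_exh i : riesz_mass (exh i : set (mhalf R n)) < +oo.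
Proof.
pose U := [set z : half R n | (2^-1 < cutoff i z)%R].
have oU : open U.
  by apply: (open_comp (D := [set x : R | (2^-1 < x)%R])); [move=> z _; exact: continuous_cutoff|exact: open_gt].
have : riesz_mass (exh i : set (mhalf R n)) <= open_mass U.
  apply: le_riesz_outer => // z [/cutoff1 zi _]; rewrite /U /= zi.
  by rewrite invf_lt1// ltr1n.
move=> /le_lt_trans; apply; apply: (@le_lt_trans _ _ (2 * I (cutoff i))%:E); last exact: ltry.
apply: ge_ereal_sup => _ [f [Cf f1 f0] <-]; rewrite lee_fin -IZ//; last exact: Ccp_cutoff.
apply: positive_le => //; first by apply: CcpZ => //; exact: Ccp_cutoff.
move=> z hz /=; have [Uz|Uz] := pselect (U z).
  by rewrite (le_trans (f1 z hz))// -ler_pdivrMl// mulr1 ltW.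
by rewrite f0// mulr_ge0//; case/andP: (cutoff_itv i z).
Qed.

Lemma riesz_mass_compact (Q : set (half R n)) : compact Q -> Q `<=` hs -> riesz_mass Q < +oo.
Proof.
move=> cQ QH; have [i Qi] := compact_sub_exh hK cQ QH.
by apply: le_lt_trans (riesz_mass_exh i); exact: riesz_outer_mono.
Qed.

Local Notation mhs := (@half_space R n : set (mhalf R n)).

Let Ccp_integrable f : Ccp f -> riesz_mass.-integrable mhs (EFin \o f).
Proof. by move=> [Cf _]; exact: (Cc_integrable riesz_mass_compact). Qed.

Let J f : R := (\int[riesz_mass]_(z in mhs) f z)%R.

Let JD f g : Ccp f -> Ccp g -> J (f \+ g)%R = (J f + J g)%R.
Proof.
move=> Cf Cg; rewrite /J -RintegralD//; first exact: measurable_half_space.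
  exact: Ccp_integrable.
exact: Ccp_integrable.
Qed.

Lemma Ccp_layer f (h : R) j : (0 < h)%R -> Ccp f ->
  Ccp (fun z => Num.min (f z) (j%:R * h))%R.
Proof.
move=> h0 Cf; have jh : (0 <= j%:R * h)%R by rewrite mulr_ge0// ltW.
rewrite (_ : (fun z => _) = f \- (fun z => Num.max (f z - j%:R * h) 0))%R; last first.
  apply/funext => z /=; have [] := leP (f z) (j%:R * h)%R;
  by have [] := leP (f z - j%:R * h)%R 0%R; lra.
apply: Ccp_sub => //; first exact: Ccp_excess.
by move=> z hz; rewrite ge_max gerBl jh /=; case: Cf => _; exact.
Qed.

(** Both functionals are squeezed between the same bounds on slices of height [h]: a
    slice lies between [h] times the indicators of two consecutive level sets, and
    these bounds telescope. *)
Theorem riesz_integral f : Ccp f -> I f = J f.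
Proof.
move=> Cf; have [[cf [Q [cQ QH fQ]]] fp] := Cf.
have [M M0 fM] := Cc_bounded Cf.1.
have mQ : measurable (Q : set (mhalf R n)) by exact: compact_measurable_half.
pose A (t : R) : set (mhalf R n) := hs `&` [set z | (t < f z)%R].
have oA t : open (A t : set (half R n)).
  move/half_continuousP : cf => cf; rewrite openE => z [hz fz].
  by apply: filterI; [exact: (half_space_open hz)|exact: (cvgr_gt _ (cf z hz))].
have mA t : measurable (A t) by exact: open_measurable_half.
have AQ t : (0 <= t)%R -> A t `<=` Q.
  move=> t0 z [hz /= tz]; apply: contrapT => Qz; move: tz; rewrite fQ//.
  by rewrite ltNge t0.
pose a t := fine (riesz_mass (A t)).
have aE t : (0 <= t)%R -> riesz_mass (A t) = (a t)%:E.
  move=> t0; rewrite fineK// ge0_fin_numE ?riesz_mass_ge0//.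
  by apply: le_lt_trans (riesz_mass_compact cQ QH); apply: riesz_outer_mono; exact: AQ.
have a0 t : (0 <= a t)%R by apply: fine_ge0; exact: riesz_mass_ge0.
suff main (h : R) : (0 < h)%R -> (`|I f - J f| <= h * a 0)%R.
  apply/eqP; rewrite -subr_eq0 -normr_eq0 eq_le normr_ge0 andbT.
  apply/ler_addgt0Pr => e e0; rewrite add0r.
  have a1 : (0 < a 0 + 1)%R by rewrite ltr_wpDl.
  apply: le_trans (main _ (divr_gt0 e0 a1)) _.
  by rewrite mulrAC ler_pdivrMr// ler_wpM2l ?(ltW e0)// lerDl.
move=> h0; pose c j z := Num.min (f z) (j%:R * h)%R.
have Cj j : Ccp (c j) by exact: Ccp_layer.
pose s j z := (c j.+1 z - c j z)%R.
have c_nd j z : (c j z <= c j.+1 z)%R.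
  rewrite /c le_min ge_min lexx /= ge_min; apply/orP; right.
  by rewrite ler_wpM2r ?(ltW h0)// ler_nat.
have Cs j : Ccp (s j) by apply: Ccp_sub.
have s_le j z : (s j z <= h)%R.
  rewrite /s /c; have : (j.+1%:R * h = j%:R * h + h)%R by rewrite -natr1 mulrDl mul1r.
  move=> ->; have [] := leP (f z) (j%:R * h)%R; have [] := leP (f z) (j%:R * h + h)%R; lra.
have s_out j z : half_space z -> ~ A (j%:R * h)%R z -> s j z = 0%R.
  move=> hz nA; have fz : (f z <= j%:R * h)%R.
    by rewrite leNgt; apply/negP => fz; apply: nA.
  rewrite /s /c !min_l ?subrr//; apply: (le_trans fz).
  by rewrite ler_wpM2r ?(ltW h0)// ler_nat.
have s_in j z : A (j.+1%:R * h)%R z -> s j z = h.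
  move=> [hz /= fz]; have : (j.+1%:R * h = j%:R * h + h)%R by rewrite -natr1 mulrDl mul1r.
  by rewrite /s /c => E; rewrite !min_r; [rewrite E; ring|lra|exact: ltW].
have jh j : (0 <= j%:R * h)%R by rewrite mulr_ge0// ltW.
have I_up j : (I (s j) <= h * a (j%:R * h))%R.
  rewrite -lee_fin EFinM -aE// muleC -lee_pdivrMr// -EFinM mulrC -IZ ?invr_ge0 ?(ltW h0)//.
  rewrite [riesz_mass _]riesz_outer_open//; apply: le_open_mass; split.
  - by apply: CcpZ => //; rewrite invr_ge0 ltW.
  - by move=> z hz /=; rewrite ler_pdivrMl// mulr1.
  - by move=> z hz zA /=; rewrite s_out// mulr0.
have I_low j : (h * a (j.+1%:R * h) <= I (s j))%R.
  rewrite -lee_fin EFinM -aE// muleC -lee_pdivlMr//.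
  rewrite [riesz_mass _]riesz_outer_open//; apply: ge_ereal_sup => _ [g [Cg g1 g0] <-].
  rewrite -EFinM lee_fin ler_pdivlMr// mulrC -IZ ?(ltW h0)//.
  apply: positive_le => //; first by apply: CcpZ => //; exact: ltW.
  move=> z hz /=; have [Az|nA] := pselect (A (j.+1%:R * h)%R z).
    by rewrite s_in// ler_piMr ?(ltW h0)// g1.
  by rewrite g0// mulr0; case: (Cs j) => _; exact.
have intA t : (0 <= t)%R -> \int[riesz_mass]_(z in mhs) (h * \1_(A t) z)%:E = (h * a t)%:E.
  move=> t0; under eq_integral do rewrite EFinM.
  have mH : measurable mhs by exact: measurable_half_space.
  rewrite ge0_integralZl ?lee_fin ?(ltW h0)//; last first.
    by apply/measurable_EFinP; exact: measurable_indic.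
  rewrite integral_indic//.
  rewrite [A t `&` _]setIidl => [|z []//]; rewrite EFinM; congr (_ * _); exact: aE.
have JE g : Ccp g -> (J g)%:E = \int[riesz_mass]_(z in mhs) (g z)%:E.
  move=> Cg; rewrite /J fineK//; apply: integrable_fin_num; last exact: Ccp_integrable.
  exact: measurable_half_space.
have J_up j : (J (s j) <= h * a (j%:R * h))%R.
  rewrite -lee_fin JE// -intA//; apply: ge0_le_integral.
  - exact: measurable_half_space.
  - by move=> z hz; rewrite lee_fin; case: (Cs j) => _; exact.
  - by apply/measurable_EFinP; exact: Cc_measurable (Cs j).1.
  - by apply/measurable_EFinP; apply: measurable_funM => //; exact: measurable_indic.
  - move=> z hz; rewrite lee_fin; have [Az|nA] := pselect (A (j%:R * h)%R z).
      by rewrite indicE mem_set// mulr1.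
    by rewrite s_out// indicE memNset// mulr0.
have J_low j : (h * a (j.+1%:R * h) <= J (s j))%R.
  rewrite -lee_fin JE// -intA//; apply: ge0_le_integral.
  - exact: measurable_half_space.
  - by move=> z hz; rewrite lee_fin mulr_ge0// ltW.
  - by apply/measurable_EFinP; apply: measurable_funM => //; exact: measurable_indic.
  - by apply/measurable_EFinP; exact: Cc_measurable (Cs j).1.
  - move=> z hz; rewrite lee_fin; have [Az|nA] := pselect (A (j.+1%:R * h)%R z).
      by rewrite indicE mem_set// mulr1 s_in.
    by rewrite indicE memNset// mulr0; case: (Cs j) => _; exact.
have step j : (`|I (c j) - J (c j)| <= h * (a 0 - a (j%:R * h)))%R.
  elim: j => [|j ih].
    have E : c 0%N = fun z => Num.min (f z) 0%R by apply/funext => z; rewrite /c mul0r.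
    have I0 : I (c 0%N) = 0%R.
      apply/eqP; rewrite eq_le I_ge0// andbT -positive0; apply: positive_le => //.
        exact: Ccp0.
      by move=> z hz; rewrite E ge_min lexx orbT.
    have J0 : J (c 0%N) = 0%R.
      rewrite /J /Rintegral integral0_eq// => z hz.
      by rewrite E min_r//; exact: fp.
    by rewrite I0 J0 subrr normr0 mul0r subrr mulr0.
  have E : c j.+1 = (c j \+ s j)%R by apply/funext => z /=; rewrite /s subrKC.
  rewrite {1 2}E ID// JD//.
  have := I_up j; have := I_low j; have := J_up j; have := J_low j; move: ih.
  rewrite !ler_norml => /andP[i1 i2] j1 j2 j3 j4.
  by apply/andP; split; lra.
have [N hN] : exists N : nat, (M <= N%:R * h)%R.
  exists (Num.bound (M / h)); rewrite -ler_pdivrMr// ltW//.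
  by apply: archi_boundP; rewrite divr_ge0// ltW.
have IN : I (c N) = I f /\ J (c N) = J f.
  have E z : half_space z -> c N z = f z.
    move=> hz; rewrite /c min_l//; apply: le_trans hN.
    by apply: le_trans (fM z hz); exact: ler_norm.
  split; last by apply: eq_Rintegral => z /set_mem; exact: E.
  by apply/eqP; rewrite eq_le; apply/andP; split; apply: positive_le => // z hz; rewrite E.
have := step N; rewrite IN.1 IN.2 => /le_trans; apply.
by rewrite ler_wpM2l ?(ltW h0)// gerBl.
Qed.

End positive_functional.

Theorem riesz_positive (R : realType) (n : nat) (K : set 'rV[R]_n)
    (I : (half R n -> R) -> R) :
  symmetric_convex_body K ->
  (forall f, Ccp f -> 0 <= I f) ->
  (forall f g, Ccp f -> Ccp g -> I (f \+ g) = I f + I g) ->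
  (forall c f, 0 <= c -> Ccp f -> I (c \*o f) = c * I f) ->
  exists m : {measure set (mhalf R n) -> \bar R}, [/\ m (~` @half_space R n) = 0%E,
    forall Q, compact Q -> Q `<=` @half_space R n -> (m Q < +oo)%E &
    forall f, Ccp f -> I f = \int[m]_(z in @half_space R n) f z].
Proof.
move=> hK I0 ID IZ.
exists (riesz_measure hK I0 ID IZ); split.
- exact: riesz_mass_half.
- by move=> Q cQ QH; exact: (riesz_mass_compact hK I0 ID IZ cQ QH).
- by move=> f Cf; exact: riesz_integral.
Qed.

(** * Signed measures tested on atoms *)

Section ball_intersection.
Context (R : realType) (n : nat) (K : set 'rV[R]_n).
Hypothesis hK : symmetric_convex_body K.
Local Notation hs := (@half_space R n).
Local Open Scope ereal_scope.

(** Balls with nearby centres and radii are squeezed between two concentric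
    balls of nearly equal volume. *)
Lemma continuous_avg_weight x r : (0 < r)%R ->
  {within hs, continuous (fun z => \int[dx R n]_(y in Kball K z.1 z.2) avg K x r y)%R}.
Proof.
move=> r0; have [_ v0] := unit_volE hK; set v := unit_vol K in v0.
pose c := ((r ^+ n * v)^-1)%R; have c0 : (0 <= c)%R.
  by rewrite invr_ge0 mulr_ge0 ?exprn_ge0 ?ltW.
have mB := measurable_Kball hK.
pose B0 := Kball K x r.
have mI y s : measurable (B0 `&` Kball K y s) by apply: measurableI; exact: mB.
have Bfin y s : (0 < s)%R -> dx R n (B0 `&` Kball K y s) < +oo.
  move=> s0; apply: (@le_lt_trans _ _ (dx R n (Kball K y s))).
    by apply: le_measure; rewrite ?inE// => w [].
  by rewrite dx_Kball// ltry.
pose phi (y : 'rV[R]_n) (s : R) := fine (dx R n (B0 `&` Kball K y s)).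
have phiE y s : (0 < s)%R -> dx R n (B0 `&` Kball K y s) = (phi y s)%:E.
  by move=> s0; rewrite fineK// ge0_fin_numE// Bfin.
have phi_mono y s y' s' : (0 < s)%R -> (0 < s')%R ->
    Kball K y s `<=` Kball K y' s' -> (phi y s <= phi y' s')%R.
  move=> s0 s'0 sub; rewrite -lee_fin -!phiE//; apply: le_measure; rewrite ?inE//.
  by move=> w [w1 /sub].
have annulus y s t : (0 < s)%R -> (s <= t)%R ->
    (phi y t - phi y s <= v * (t ^+ n - s ^+ n))%R.
  move=> s0 st; have t0 : (0 < t)%R by exact: lt_le_trans st.
  have sub : Kball K y s `<=` Kball K y t by move=> w /= /le_trans; apply.
  have mD : measurable (Kball K y t `\` Kball K y s) by exact: measurableD.
  have e1 : dx R n (Kball K y t `\` Kball K y s) = (v * (t ^+ n - s ^+ n))%:E.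
    have tfin : dx R n (Kball K y t) < +oo by rewrite dx_Kball// ltry.
    rewrite (measureD (mB y t) (mB y s) tfin).
    rewrite (setIidr sub) [X in X - _](dx_Kball hK y t0) [X in _ - X](dx_Kball hK y s0).
    by rewrite -EFinB -/v; congr EFin; ring.
  rewrite -lee_fin -e1 EFinB -!phiE// leeBlDr ?ge0_fin_numE ?Bfin//.
  rewrite addeC; apply: le_trans (measureU2 _ _ _) => //.
    apply: le_measure; rewrite ?inE//; first by apply: measurableU.
  move=> w [w1 w2]; have [ws|ws] := pselect (Kball K y s w); first by left.
  by right.
have E z : hs z -> (\int[dx R n]_(y in Kball K z.1 z.2) avg K x r y = c * phi z.1 z.2)%R.
  move=> hz; rewrite /Rintegral -[LHS]/(fine (ball_integral K (EFin \o avg K x r) z)).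
  by rewrite ball_integral_avg// phiE.
apply/half_continuousP => z hz; rewrite /half_space /= in hz.
have key w : hs w -> (Knorm K (z.1 - w.1) + `|z.2 - w.2| < z.2)%R ->
    (`|phi z.1 z.2 - phi w.1 w.2| <=
      v * ((z.2 + (Knorm K (z.1 - w.1) + `|z.2 - w.2|)) ^+ n -
           (z.2 - (Knorm K (z.1 - w.1) + `|z.2 - w.2|)) ^+ n))%R.
  move=> hw; set d := (Knorm K (z.1 - w.1) + `|z.2 - w.2|)%R => dz; rewrite /half_space /= in hw.
  have d0 : (0 <= d)%R by rewrite addr_ge0// Knorm_ge0.
  have zd : (0 < z.2 - d)%R by rewrite subr_gt0.
  have zd' : (0 < z.2 + d)%R by rewrite ltr_wpDr.
  have := annulus z.1 (z.2 - d)%R (z.2 + d)%R zd _; move=> /(_ _)h1.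
  have {}h1 : (phi z.1 (z.2 + d) - phi z.1 (z.2 - d) <= v * ((z.2 + d) ^+ n - (z.2 - d) ^+ n))%R.
    by apply: h1; lra.
  have n1 : (z.2 - w.2 <= `|z.2 - w.2|)%R by exact: ler_norm.
  have n2 : (w.2 - z.2 <= `|z.2 - w.2|)%R by rewrite distrC; exact: ler_norm.
  have k0 : (0 <= Knorm K (z.1 - w.1))%R by exact: Knorm_ge0.
  have p1 : (phi z.1 (z.2 - d) <= phi z.1 z.2)%R.
    by apply: phi_mono => // y /= /le_trans; apply; lra.
  have p2 : (phi z.1 z.2 <= phi z.1 (z.2 + d))%R.
    by apply: phi_mono => // y /= /le_trans; apply; lra.
  have p3 : (phi z.1 (z.2 - d) <= phi w.1 w.2)%R.
    by apply: phi_mono => //; apply: (Kball_sub hK); rewrite /d; lra.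
  have p4 : (phi w.1 w.2 <= phi z.1 (z.2 + d))%R.
    by apply: phi_mono => //; apply: (Kball_sub hK); rewrite KnormB// /d; lra.
  by apply: le_trans h1; rewrite ler_norml; apply/andP; split; lra.
pose G (s : R) := (v * ((z.2 + s) ^+ n - (z.2 - s) ^+ n))%R.
have cG : G s @[s --> (0%R : R)] --> G 0%R.
  have cX (k : nat) (u : R -> R) (l : R) : u s @[s --> (0%R : R)] --> l ->
      (u s ^+ k)%R @[s --> (0%R : R)] --> (l ^+ k)%R.
    move=> cu; elim: k => [|k ih]; first by under eq_fun do rewrite expr0; exact: cvg_cst.
    by rewrite exprS; under eq_fun do rewrite exprS; exact: cvgM.
  apply: cvgM; first exact: cvg_cst.
  by apply: cvgB; apply: cX; [apply: cvgD|apply: cvgB] => //; exact: cvg_cst.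
have G0 : G 0%R = 0%R by rewrite /G addr0 subr0 subrr mulr0.
have cd : (Knorm K (z.1 - w.1) + `|z.2 - w.2|)%R @[w --> z] --> (0 : R)%R.
  rewrite -[X in _ --> X](_ : Knorm K (z.1 - z.1) + `|z.2 - z.2| = 0)%R; last first.
    by rewrite !subrr Knorm0// normr0 addr0.
  apply: cvgD.
    apply: (@cvg_comp _ _ _ (fun w : half R n => z.1 - w.1)%R (Knorm K) _
      (nbhs (z.1 - z.1)%R)); last exact: Knorm_continuous.
    by apply: cvgB; [exact: cvg_cst|exact: cvg_fst].
  by apply: cvg_norm; apply: cvgB; [exact: cvg_cst|exact: cvg_snd].
have cGd : G (Knorm K (z.1 - w.1) + `|z.2 - w.2|)%R @[w --> z] --> (0 : R)%R.
  by rewrite -G0; exact: (cvg_comp _ _ cd cG).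
apply/cvgrPdist_lt => e e0.
have c1 : (0 < c + 1)%R by rewrite ltr_wpDl.
have nearG : \forall w \near z, (G (Knorm K (z.1 - w.1) + `|z.2 - w.2|) < e / (c + 1))%R.
  by apply: cvgr_lt cGd _ _; rewrite divr_gt0.
near=> w.
have hw : hs w by near: w; exact: (half_space_open hz).
rewrite !E// -mulrBr normrM (ger0_norm c0).
have dz : (Knorm K (z.1 - w.1) + `|z.2 - w.2| < z.2)%R by near: w; exact: cvgr_lt cd _ hz.
have hG : (G (Knorm K (z.1 - w.1) + `|z.2 - w.2|) < e / (c + 1))%R by near: w.
apply: (@le_lt_trans _ _ (c * (e / (c + 1)))%R).
  by apply: ler_wpM2l => //; apply: (le_trans (key w hw dz)); exact: ltW.
by rewrite mulrCA gtr_pMr// ltr_pdivrMr// mul1r ltrDl.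
Unshelve. all: by end_near. Qed.

(** Normalized indicators are the only densities needed here; they make atoms
    continuous. *)
Definition S1_atom : set (half R n -> R) := [set f | exists a x r,
  [/\ unit_ball_Cc a, (0 < r)%R & f = atom K a (avg K x r)]].

Lemma S1_atom_Cc f : S1_atom f -> Cc f.
Proof.
move=> [a [x [r [[Ca _] r0 ->]]]].
rewrite (_ : atom _ _ _ = (fun z => (\int[dx R n]_(y in Kball K z.1 z.2) avg K x r y)%R * a z)%R); last first.
  by apply/funext => z; rewrite /atom mulrC.
by apply: CcM => //; exact: continuous_avg_weight.
Qed.

Lemma S1_norm_atom f : S1_atom f -> S1_norm K f <= 1.
Proof.
move=> [a [x [r [[Ca a1] r0 ->]]]].
apply: (S1_norm_weight hK (unit_L1_weight hK (unit_L1_avg x hK r0)) ler01).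
by move=> z hz; rewrite mul1r /atom normrM ler_piMl// a1.
Qed.

Lemma S1_atom0 : S1_atom (atom K (cst 0%R) (avg K 0%R 1%R)).
Proof.
exists (cst 0%R), 0%R, 1%R; split => //; split; first exact: Cc0.
by move=> z _; rewrite normr0.
Qed.

End ball_intersection.

Section radon_measures.
Context (R : realType) (n : nat) (K : set 'rV[R]_n).
Hypothesis hK : symmetric_convex_body K.
Local Open Scope ereal_scope.
Local Notation hs := (@half_space R n : set (mhalf R n)).
Implicit Types (f g h : half R n -> R).

Let mhs : measurable hs := @measurable_half_space R n.

Lemma radon_sigma_finite (m : {measure set (mhalf R n) -> \bar R}) : m (~` hs) = 0 ->
  (forall Q : set (half R n), compact Q -> Q `<=` @half_space R n -> m Q < +oo) ->
  sigma_finite setT m.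
Proof.
move=> m_half m_fin.
exists (fun k => exh k `|` ~` hs).
  apply/seteqP; split => // z _; have [hz|hz] := pselect (hs z); last by exists 0%N => //; right.
  have : (\bigcup_k @exh R n k) z by rewrite exh_bigcup.
  by move=> [k _ zk]; exists k => //; left.
move=> k; have mE : measurable (exh k : set (mhalf R n)) by exact: measurable_exh.
have mC : measurable (~` hs) by exact: measurableC.
split; first exact: measurableU.
have m0 : m (~` hs) < +oo by rewrite m_half.
apply: le_lt_trans (measureU2 _ mE mC) _; apply: lte_add_pinfty; last exact: m0.
by apply: m_fin; [exact: exh_compact|exact: exh_half].
Qed.

Lemma Rintegral_close (m : {measure set (mhalf R n) -> \bar R}) f g (e : R) :
  m.-integrable hs (EFin \o f) -> m.-integrable hs (EFin \o g) ->
  \int[m]_(z in hs) `|f z - g z|%:E <= e%:E ->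
  (`|\int[m]_(z in hs) f z - \int[m]_(z in hs) g z| <= e)%R.
Proof.
move=> If Ig h; rewrite -RintegralB//.
have Ifg : m.-integrable hs (EFin \o (f \- g)%R).
  by have := integrableB mhs If Ig; apply: eq_integrable.
rewrite -lee_fin EFin_normr_Rintegral//; apply: le_trans h.
by apply: le_abse_integral => //; case/integrableP: Ifg.
Qed.

(** The cutoff is 1 where [f] is supported, and multiplying by [H] does not increase
    distances, so that only the distance of [phi] to [f] on a compact set matters. *)
Lemma test_close (m : {measure set (mhalf R n) -> \bar R}) (k : nat)
    (f phi H : half R n -> R) (e : R) :
  (forall Q : set (half R n), compact Q -> Q `<=` @half_space R n -> m Q < +oo) ->
  measurable_fun hs f -> (forall z, `|f z| <= 1)%R -> (forall z, ~ exh k z -> f z = 0%R) ->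
  continuous phi -> (forall z, `|phi z| <= 1)%R ->
  measurable_fun hs H -> (forall z, half_space z -> 0 <= H z <= 1)%R ->
  \int[m]_(z in (exh k.+1 : set (mhalf R n))) `|f z - phi z|%:E <= e%:E ->
  (`|\int[m]_(z in hs) (f z * H z) - \int[m]_(z in hs) (phi z * cutoff k z * H z)| <= e)%R.
Proof.
move=> mfin mf f1 f0 cphi phi1 mH H01 he.
pose Q := exh k.+1 : set (mhalf R n).
have mQ : measurable Q by exact: measurable_exh.
have QH : Q `<=` hs by exact: exh_half.
have Cphi : Cc (fun z => phi z * cutoff k z)%R by exact: Cc_cutoff.
have mphi : measurable_fun hs phi.
  apply: continuous_measurable_half; first exact: half_space_open.
  exact: continuous_subspaceT.
have mC : measurable_fun hs (fun z => phi z * cutoff k z)%R by exact: Cc_measurable.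
have nH z : half_space z -> (`|H z| <= 1)%R.
  by move=> /H01 /andP[h0 h1]; rewrite ger0_norm.
have ncut (z : half R n) : (`|cutoff k z| <= 1)%R by have /andP[c0 c1] := cutoff_itv k z; rewrite ger0_norm.
apply: Rintegral_close.
- apply: (bounded_compact_integrable mfin (M := 1) _ _ (@exh_compact R n k) (@exh_half R n k)).
  + exact: measurable_funM.
  + by move=> z hz; rewrite normrM -[leRHS]mulr1 ler_pM// nH.
  + by move=> z hz zk; rewrite f0// mul0r.
- apply: (bounded_compact_integrable mfin (M := 1) _ _ (@exh_compact R n k.+1) (@exh_half R n k.+1)).
  + exact: measurable_funM.
  + move=> z hz; rewrite normrM -[leRHS]mulr1 ler_pM ?nH//.
    by rewrite normrM -[leRHS]mulr1 ler_pM.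
  + by move=> z hz zk; rewrite cutoff0// mulr0 mul0r.
apply: le_trans he.
rewrite (@integral_supp _ _ _ m Q hs _ QH); last first.
  move=> z hz zQ; rewrite f0 ?cutoff0// => [|zk]; first by rewrite mulr0 mul0r subrr normr0.
  by apply: zQ; exact: exh_nd zk.
have mfQ : measurable_fun Q f by exact: measurable_funS mf.
have mpQ : measurable_fun Q phi by exact: measurable_funS mphi.
have mHQ : measurable_fun Q H by exact: measurable_funS mH.
have mCQ : measurable_fun Q (fun z => phi z * cutoff k z)%R by exact: measurable_funS mC.
apply: ge0_le_integral => //.
- apply/measurable_EFinP; apply: measurableT_comp => //.
  by apply: measurable_funB; exact: measurable_funM.
- apply/measurable_EFinP; apply: measurableT_comp => //.
  exact: measurable_funB.
- move=> z zQ; have hz := QH _ zQ; rewrite lee_fin -mulrBl normrM.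
  have -> : (f z - phi z * cutoff k z = (f z - phi z) * cutoff k z)%R.
    have [zk|zk] := pselect (exh k z); first by rewrite cutoff1// !mulr1.
    by rewrite f0// !sub0r mulNr.
  rewrite normrM -[leRHS]mulr1 -[leRHS]mulr1 ler_pM ?mulr_ge0 ?nH//.
  by rewrite ler_wpM2l.
Qed.

Lemma Rintegral_indic_half (m : {measure set (mhalf R n) -> \bar R}) A : measurable A -> A `<=` hs ->
  (\int[m]_(z in hs) \1_A z)%R = fine (m A).
Proof. by move=> mA AH; rewrite /Rintegral integral_indic// setIidl. Qed.

(** On a compact part of the half-space, an indicator is approximated by continuous
    functions in L^1 of the sum of the two measures, hence for both at once. *)
Lemma Cc_measure_unique (m1 m2 : {measure set (mhalf R n) -> \bar R}) :
  m1 (~` hs) = 0 -> m2 (~` hs) = 0 ->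
  (forall Q : set (half R n), compact Q -> Q `<=` @half_space R n -> m1 Q < +oo) ->
  (forall Q : set (half R n), compact Q -> Q `<=` @half_space R n -> m2 Q < +oo) ->
  (forall f, Cc f -> \int[m1]_(z in hs) f z = \int[m2]_(z in hs) f z)%R ->
  forall A, measurable A -> m1 A = m2 A.
Proof.
move=> h1 h2 f1 f2 eqI.
have main k (A : set (mhalf R n)) : measurable A -> A `<=` exh k -> m1 A = m2 A.
  move=> mA Ak.
  pose Q := exh k.+1 : set (mhalf R n).
  have mQ : measurable Q by exact: measurable_exh.
  have cQ : compact (Q : set (half R n)) := @exh_compact R n k.+1.
  have QH : Q `<=` @half_space R n by exact: exh_half.
  have finQ : measure_add m1 m2 Q < +oo.
    by rewrite measure_addE lte_add_pinfty ?f1 ?f2.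
  have AH : A `<=` hs by move=> z /Ak; exact: exh_half.
  have fin (m : {measure set (mhalf R n) -> \bar R}) :
      (forall Q : set (half R n), compact Q -> Q `<=` @half_space R n -> m Q < +oo) ->
      m A = (fine (m A))%:E.
    move=> mf; rewrite fineK// ge0_fin_numE//.
    apply: le_lt_trans (mf _ (@exh_compact R n k) (@exh_half R n k)).
    by apply: le_measure; rewrite ?inE//; exact: measurable_exh.
  have ind1 z : (`|\1_A z| <= 1 :> R)%R.
    by rewrite indicE; case: (_ \in _); rewrite ?normr1 ?normr0.
  have ind0 z : ~ exh k z -> \1_A z = 0%R :> R.
    by move=> zk; rewrite indicE memNset// => /Ak.
  rewrite (fin m1 f1) (fin m2 f2); congr EFin; apply/eqP; rewrite -subr_eq0 -normr_eq0.
  rewrite eq_le normr_ge0 andbT; apply/ler_addgt0Pr => e e0; rewrite add0r.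
  have e2 : (0 < e / 2)%R by rewrite divr_gt0.
  have [phi [cphi phi01 hphi]] := approx_indic mQ finQ mA e2.
  have phi1 z : (`|phi z| <= 1)%R by have /andP[p0 p1] := phi01 z; rewrite ger0_norm.
  have mdiff : measurable_fun Q (fun z => `|\1_A z - phi z|%:E).
    apply/measurable_EFinP; apply: measurableT_comp => //; apply: measurable_funB => //.
    apply: (measurable_funS mhs QH); apply: continuous_measurable_half.
      exact: half_space_open.
    exact: continuous_subspaceT.
  have sumI : \int[m1]_(z in Q) `|\1_A z - phi z|%:E + \int[m2]_(z in Q) `|\1_A z - phi z|%:E <= (e / 2)%:E.
    by rewrite -ge0_integral_measure_add.
  have I10 : 0 <= \int[m1]_(z in Q) `|\1_A z - phi z|%:E by apply: integral_ge0.
  have I20 : 0 <= \int[m2]_(z in Q) `|\1_A z - phi z|%:E by apply: integral_ge0.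
  have close (m : {measure set (mhalf R n) -> \bar R}) :
      (forall Q : set (half R n), compact Q -> Q `<=` @half_space R n -> m Q < +oo) ->
      \int[m]_(z in Q) `|\1_A z - phi z|%:E <= (e / 2)%:E ->
      (`|fine (m A) - \int[m]_(z in hs) (phi z * cutoff k z)| <= e / 2)%R.
    move=> mf hm; rewrite -Rintegral_indic_half//.
    have h01 z : half_space z -> (0 <= (cst 1%R : half R n -> R) z <= 1)%R.
      by move=> _; rewrite /= lexx ler01.
    have E1 : (\int[m]_(z in hs) (\1_A z * (cst 1%R : half R n -> R) z) = \int[m]_(z in hs) \1_A z)%R.
      by apply: eq_Rintegral => z _; rewrite /= mulr1.
    have E2 : (\int[m]_(z in hs) (phi z * cutoff k z * (cst 1%R : half R n -> R) z) =
        \int[m]_(z in hs) (phi z * cutoff k z))%R.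
      by apply: eq_Rintegral => z _; rewrite /= mulr1.
    rewrite -E1 -E2; apply: test_close mf _ ind1 ind0 cphi phi1 _ h01 hm.
      exact: measurable_indic.
    exact: measurable_cst.
  have c1 := close m1 f1 (le_trans (leeDl _ I20) sumI).
  have c2 := close m2 f2 (le_trans (leeDr _ I10) sumI).
  rewrite -eqI in c2; last exact: Cc_cutoff.
  rewrite [e in leRHS]splitr; move: c1 c2; set x := Rintegral _ _ _.
  move=> c1; rewrite distrC => c2; rewrite -(subrKA x).
  by apply: le_trans (ler_normD _ _) _; exact: lerD.
move=> A mA.
have mhC : measurable (~` hs) by exact: measurableC.
have split (m : {measure set (mhalf R n) -> \bar R}) : m (~` hs) = 0 -> m A = m (A `&` hs).
  move=> m0; apply/eqP; rewrite eq_le; apply/andP; split; last first.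
    by apply: le_measure; rewrite ?inE//; exact: measurableI.
  have AE : A `<=` (A `&` hs) `|` (~` hs).
    by move=> z Az; have [hz|hz] := pselect (hs z); [left|right].
  apply: (le_trans (le_measure m _ _ AE)); rewrite ?inE//.
    by apply: measurableU => //; exact: measurableI.
  apply: (le_trans (measureU2 _ _ mhC)); first exact: measurableI.
  have m0' : m (~` hs) <= 0 by rewrite m0.
  by rewrite -[leRHS]adde0; apply: leeD2l.
rewrite (split m1)// (split m2)//.
have cv (m : {measure set (mhalf R n) -> \bar R}) :
    m (A `&` exh k) @[k --> \oo] --> m (A `&` hs).
  rewrite -{1}(exh_bigcup R n) setI_bigcupr; apply: nondecreasing_cvg_mu => //.
  - by move=> k; apply: measurableI => //; exact: measurable_exh.
  - by apply: bigcup_measurable => k _; apply: measurableI => //; exact: measurable_exh.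
  - move=> i j ij; apply/subsetPset; apply: setIS; exact: exh_nd.
rewrite -(cvg_lim _ (cv m1))// -(cvg_lim _ (cv m2))//; congr (lim _).
suff -> : (fun k => m1 (A `&` exh k)) = (fun k => m2 (A `&` exh k)) by [].
apply/funext => k; apply: (main k); last by move=> z [].
by apply: measurableI => //; exact: measurable_exh.
Qed.

(** The total variation is recovered by testing against atoms: the sign of the
    measure is approximated by continuous functions, and an average weight is
    bounded below on a truncated cone. *)
Lemma cone_mass_le (mp mn : {measure set (mhalf R n) -> \bar R}) (P : set (mhalf R n)) (c : R) :
  (forall Q : set (half R n), compact Q -> Q `<=` @half_space R n -> mp Q < +oo) ->
  (forall Q : set (half R n), compact Q -> Q `<=` @half_space R n -> mn Q < +oo) ->
  measurable P -> mp (~` P) = 0 -> mn P = 0 -> (0 <= c)%R ->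
  (forall f, S1_atom K f -> \int[mp]_(z in hs) f z - \int[mn]_(z in hs) f z <= c)%R ->
  forall x, mp (cone K x) + mn (cone K x) <= (2 ^+ n * c)%:E.
Proof.
move=> pfin nfin mP p0 n0 c0 test x.
pose nu := measure_add mp mn.
have mcone : measurable (cone K x : set (mhalf R n)) by exact: measurable_cone.
suff main (r : R) : (0 < r)%R ->
    \int[nu]_(z in cone K x `&` [set z | (r <= z.2)%R]) (cst 1 : mhalf R n -> \bar R) z <= (2 ^+ n * c)%:E.
  have mc1 : measurable_fun hs (cst 1 : mhalf R n -> \bar R) by exact: measurable_cst.
  have := cone_truncation hK mc1 (fun _ _ => lee01) main.
  by rewrite integral_cst// mul1e -measure_addE.
move=> r0.
pose g := avg K x r.
have mg : measurable_fun setT (EFin \o g) by apply/measurable_EFinP; exact: measurable_avg.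
have g0 y : 0 <= (EFin \o g) y by rewrite lee_fin; exact: avg_ge0.
have g1 : \int[dx R n]_y (EFin \o g) y <= 1 by rewrite integral_avg.
pose H z := fine (ball_integral K (EFin \o g) z).
have fin z := ball_integral_fin hK z mg g0 g1.
have H01 z : (0 <= H z <= 1)%R by have [] := fin z.
have mHT : measurable_fun (setT : set (mhalf R n)) H.
  apply: measurableT_comp; first exact: fine_measurable.
  exact: measurable_ball_integral.
have mH : measurable_fun hs H by exact: measurable_funTS.
have meH : measurable_fun hs (EFin \o H) by exact/measurable_EFinP.
have trunc k : \int[nu]_(z in (exh k : set (mhalf R n))) (H z)%:E <= c%:E.
  pose E := exh k : set (mhalf R n).
  have mE : measurable E by exact: measurable_exh.
  have EH : E `<=` hs by exact: exh_half.
  pose Q := exh k.+1 : set (mhalf R n).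
  have mQ : measurable Q by exact: measurable_exh.
  have QH : Q `<=` hs by exact: exh_half.
  have finQ : nu Q < +oo.
    have cQ : compact (Q : set (half R n)) by exact: exh_compact.
    by rewrite /nu measure_addE lte_add_pinfty ?pfin ?nfin.
  pose f z : R := ((\1_P z - \1_(~` P) z) * \1_E z)%R.
  have fP z : P z -> f z = \1_E z.
    by move=> Pz; rewrite /f !indicE in_setC mem_set// subr0 mul1r.
  have fN z : ~ P z -> f z = (- \1_E z)%R.
    by move=> Pz; rewrite /f !indicE in_setC memNset// sub0r mulN1r.
  have mf : measurable_fun setT (f : mhalf R n -> R).
    apply: measurable_funM; last exact: measurable_indic.
    by apply: measurable_funB; apply: measurable_indic => //; exact: measurableC.
  have f1 z : (`|f z| <= 1)%R.
    have i1 : (`|\1_E z| <= 1 :> R)%R.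
      by rewrite indicE; case: (_ \in _); rewrite ?normr1 ?normr0.
    by have [/fP ->//|/fN ->] := pselect (P z); rewrite normrN.
  have f0 z : ~ exh k z -> f z = 0%R.
    by move=> zk; rewrite /f [X in (_ * X)%R]indicE memNset ?mulr0.
  apply/lee_addgt0Pr => e e0.
  have e2 : (0 < e / 2)%R by rewrite divr_gt0.
  have [phi [cphi phi1 hphi]] := approx_bounded mQ finQ mf ltr01 f1 e2.
  have mdiff : measurable_fun Q (fun z => `|f z - phi z|%:E).
    apply/measurable_EFinP; apply: measurableT_comp => //; apply: measurable_funB.
      exact: measurable_funTS.
    apply: (measurable_funS mhs QH); apply: continuous_measurable_half.
      exact: half_space_open.
    exact: continuous_subspaceT.
  have sumI : \int[mp]_(z in Q) `|f z - phi z|%:E + \int[mn]_(z in Q) `|f z - phi z|%:E <= (e / 2)%:E.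
    by rewrite -ge0_integral_measure_add.
  have I10 : 0 <= \int[mp]_(z in Q) `|f z - phi z|%:E by apply: integral_ge0.
  have I20 : 0 <= \int[mn]_(z in Q) `|f z - phi z|%:E by apply: integral_ge0.
  have mfh : measurable_fun hs f by exact: measurable_funTS.
  have c1 := test_close pfin mfh f1 f0 cphi phi1 mH (fun z _ => H01 z) (le_trans (leeDl _ I20) sumI).
  have c2 := test_close nfin mfh f1 f0 cphi phi1 mH (fun z _ => H01 z) (le_trans (leeDr _ I10) sumI).
  have Sa : S1_atom K (fun z => phi z * cutoff k z * H z)%R.
    exists (fun z => phi z * cutoff k z)%R, x, r; split => //; split; first exact: Cc_cutoff.
    move=> z _; have /andP[a0 a1] := cutoff_itv k z.
    by rewrite normrM -[leRHS]mulr1 ler_pM// ger0_norm.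
  have le1 := test _ Sa.
  pose G z := (\1_E z * H z)%R.
  have mG : measurable_fun hs G by apply: measurable_funM => //; exact: measurable_indic.
  have mfH : measurable_fun hs (fun z => f z * H z)%R by exact: measurable_funM.
  have GE (m : {measure set (mhalf R n) -> \bar R}) :
      \int[m]_(z in hs) (G z)%:E = \int[m]_(z in E) (H z)%:E.
    rewrite (@integral_supp _ _ _ m E hs _ EH)//; last first.
      by move=> z hz zE; rewrite /G indicE memNset// mul0r.
    by apply: eq_integral => z zE; rewrite /G indicE zE mul1r.
  have intG (m : {measure set (mhalf R n) -> \bar R}) :
      (forall Q : set (half R n), compact Q -> Q `<=` @half_space R n -> m Q < +oo) ->
      m.-integrable hs (EFin \o G).
    move=> mfin; apply: (bounded_compact_integrable mfin (M := 1) mG _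
      (@exh_compact R n k) (@exh_half R n k)).
      move=> z hz; have /andP[a0 a1] := H01 z.
      rewrite /G normrM -[leRHS]mulr1 ler_pM// ?(ger0_norm a0)//.
      by rewrite indicE; case: (_ \in _); rewrite ?normr1 ?normr0.
    by move=> z hz zk; rewrite /G indicE memNset// mul0r.
  have Ep : (\int[mp]_(z in hs) (f z * H z) = \int[mp]_(z in hs) G z)%R.
    congr fine; apply: ae_eq_integral => //; [exact/measurable_EFinP|exact/measurable_EFinP|].
    exists (~` P); split => //; first exact: measurableC.
    by move=> z /= h Pz; apply: h => hz; rewrite /G fP.
  have En : (\int[mn]_(z in hs) (f z * H z) = - \int[mn]_(z in hs) G z)%R.
    rewrite -mulN1r -RintegralZl//; last exact: intG.
    congr fine; apply: ae_eq_integral => //.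
    - exact/measurable_EFinP.
    - by apply/measurable_EFinP; exact: measurable_funM.
    exists P; split => //.
    move=> z /= h; apply: contrapT => Pz; apply: h => hz.
    by rewrite /G fN// mulN1r mulNr.
  rewrite ge0_integral_measure_add//; last 2 first.
  - by move=> z _; rewrite lee_fin; case/andP: (H01 z).
  - exact: measurable_funS meH.
  rewrite -!GE -(@fineK _ (\int[mp]_(z in hs) (G z)%:E)); last first.
    by apply: integrable_fin_num => //; exact: intG.
  rewrite -(@fineK _ (\int[mn]_(z in hs) (G z)%:E)); last first.
    by apply: integrable_fin_num => //; exact: intG.
  rewrite -!EFinD lee_fin; move: c1 c2 le1; rewrite Ep En.
  rewrite -[fine (integral mp _ _)]/(\int[mp]_(z in hs) G z)%R.
  rewrite -[fine (integral mn _ _)]/(\int[mn]_(z in hs) G z)%R.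
  rewrite !ler_norml => /andP[_ c1] /andP[c2 _] le1.
  by move: c1 c2 le1; lra.
have Hle : \int[nu]_(z in hs) (H z)%:E <= c%:E.
  have cv : \int[nu]_(z in (exh k : set (mhalf R n))) (H z)%:E @[k --> \oo] -->
      \int[nu]_(z in hs) (H z)%:E.
    rewrite -{1}(exh_bigcup R n); apply: ge0_nondecreasing_set_cvg_integral => //.
    - by move=> i j ij; apply/subsetPset; exact: exh_nd.
    - by move=> k; exact: measurable_exh.
    - by move=> k; apply: measurable_funS meH => //; exact: exh_half.
    - by move=> k z _; rewrite lee_fin; case/andP: (H01 z).
  rewrite -(cvg_lim _ cv)//; apply: lime_le; first exact: cvgP cv.
  by apply: nearW => k; exact: trunc.
pose C : set (mhalf R n) := cone K x `&` [set z | (r <= z.2)%R].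
have mC : measurable C by exact: measurable_cone_slab.
have CH : C `<=` hs by move=> z [/cone_half].
have p2 : (0 < 2^-1 ^+ n :> R)%R by rewrite exprn_gt0// invr_gt0.
rewrite EFinM -lee_pdivrMl ?exprn_gt0// -exprVn; apply: le_trans Hle.
rewrite integral_cst// mul1e -integral_cst//.
apply: (@le_trans _ _ (\int[nu]_(z in C) (H z)%:E)).
  apply: ge0_le_integral => //.
  - by move=> z _; rewrite lee_fin ltW.
  - exact: measurable_funS meH.
  - move=> z [zc rz]; have [HE _] := fin z; rewrite /H -HE.
    exact: avg_lower_cone.
apply: ge0_subset_integral => //.
by move=> z _; rewrite lee_fin; case/andP: (H01 z).
Qed.

End radon_measures.

(** * Jordan decomposition of functionals on S^1_0 *)

Section positive_part.
Context (R : realType) (n : nat) (K : set 'rV[R]_n).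
Hypothesis hK : symmetric_convex_body K.
Local Notation hs := (@half_space R n : set (mhalf R n)).
Local Notation S10 := (S10_space K).
Local Notation S1 := (S1_norm K).
Implicit Types (f g h : half R n -> R).
Variables (L : (half R n -> R) -> R) (c : R).
Hypothesis linL : linear_on S10 L.
Hypothesis c0 : 0 <= c.
Hypothesis Lc : forall f, S10 f -> (`|L f|%:E <= c%:E * S1 f)%E.

Let mhs : measurable hs := @measurable_half_space R n.
Let S0 : S10 (cst 0). Proof. exact: S10_0. Qed.
Let SZ (b : R) f : S10 f -> S10 (b \*o f). Proof. exact: S10Z. Qed.
Let CS f : Cc f -> S10 f. Proof. exact: Cc_S10. Qed.
Let L0 : L (cst 0) = 0. Proof. have := @linear_on0 R (half R n) S10 S0 L linL. by []. Qed.

(** The positive part of [L] in the order dual of the compactly supported functions. *)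
Definition pos_part f : R := sup [set L h | h in
  [set h | Ccp h /\ forall z, half_space z -> h z <= f z]].

Let pos_part_sup f : Ccp f -> has_sup [set L h | h in
  [set h | Ccp h /\ forall z, half_space z -> h z <= f z]].
Proof.
move=> [Cf f0]; split; first by exists (L (cst 0)), (cst 0) => //; split => //; exact: Ccp0.
exists (c * fine (S1 f)) => _ [h [[Ch h0] hf] <-].
have Sfin : S1 f = (fine (S1 f))%:E.
  by rewrite fineK// ge0_fin_numE ?S1_norm_ge0//; exact: S10_fin (CS Cf).
rewrite (le_trans (ler_norm _))// -lee_fin EFinM -Sfin.
apply: (le_trans (Lc (CS Ch))); apply: lee_wpmul2l; first by rewrite lee_fin.
by apply: S1_norm_mono => z hz; rewrite !ger0_norm ?f0 ?h0 ?hf.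
Qed.

Lemma le_pos_part f h : Ccp f -> Ccp h -> (forall z, half_space z -> h z <= f z) ->
  L h <= pos_part f.
Proof. by move=> Cf Ch hf; apply: sup_upper_bound; [exact: pos_part_sup|exists h]. Qed.

Lemma pos_part_le f (b : R) : Ccp f ->
  (forall h, Ccp h -> (forall z, half_space z -> h z <= f z) -> L h <= b) -> pos_part f <= b.
Proof.
move=> Cf hb; apply: ge_sup; first by case: (pos_part_sup Cf).
by move=> _ [h [Ch hf] <-]; exact: hb.
Qed.

Lemma pos_part_ge0 f : Ccp f -> 0 <= pos_part f.
Proof. by move=> Cf; rewrite -L0; apply: le_pos_part => //; [exact: Ccp0|case: Cf]. Qed.

(** Riesz decomposition: a function below [f + g] is the sum of its minimum with [f]
    and of a function below [g]. *)
Lemma pos_partD f g : Ccp f -> Ccp g -> pos_part (f \+ g) = pos_part f + pos_part g.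
Proof.
move=> Cf Cg; have Cfg := CcpD Cf Cg; apply/eqP; rewrite eq_le; apply/andP; split.
  apply: pos_part_le => // h Ch hfg.
  pose h1 z := Num.min (h z) (f z); have Ch1 : Ccp h1 by exact: Ccp_min.
  have h1h z : half_space z -> h1 z <= h z by rewrite ge_min lexx.
  have Ch2 : Ccp (h \- h1) by exact: Ccp_sub.
  have -> : L h = L h1 + L (h \- h1).
    rewrite -(linear_onD linL); [|exact: CS Ch1.1|exact: CS Ch2.1].
    by congr L; apply/funext => z /=; rewrite subrKC.
  apply: lerD; apply: le_pos_part => // z hz; first by rewrite ge_min lexx orbT.
  rewrite /h1 /=; have := hfg z hz; rewrite /=; have : 0 <= g z by case: Cg => _; exact.
  by have [] := leP (h z) (f z); lra.
rewrite -lerBrDr; apply: pos_part_le => // h1 Ch1 h1f; rewrite lerBrDr -lerBrDl.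
apply: pos_part_le => // h2 Ch2 h2g; rewrite lerBrDl.
rewrite -(linear_onD linL); [|exact: CS Ch1.1|exact: CS Ch2.1].
apply: le_pos_part => //; first exact: CcpD.
by move=> z hz /=; rewrite lerD ?h1f ?h2g.
Qed.

Let L_null h : Cc h -> (forall z, half_space z -> h z = 0) -> L h = 0.
Proof.
move=> Ch h0; have := Lc (CS Ch); rewrite (S1_norm_eq0 K h).2// mule0 lee_fin.
by rewrite normr_le0 => /eqP.
Qed.

Lemma pos_partZ b f : 0 <= b -> Ccp f -> pos_part (b \*o f) = b * pos_part f.
Proof.
move=> b0 Cf; have Cbf := CcpZ b0 Cf.
have le (a : R) g : 0 < a -> Ccp g -> pos_part (a \*o g) <= a * pos_part g.
  move=> a0 Cg; have Cag := CcpZ (ltW a0) Cg; apply: pos_part_le => // h Ch hag.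
  have a'0 : 0 <= a^-1 by rewrite invr_ge0 ltW.
  rewrite -ler_pdivrMl// -(linear_onZ S0 linL); last exact: CS Ch.1.
  apply: le_pos_part => //; first exact: CcpZ.
  by move=> z hz /=; rewrite ler_pdivrMl//; exact: hag.
have [->|bn0] := eqVneq b 0.
  have C0f := CcpZ (lexx 0) Cf.
  rewrite mul0r; apply/eqP; rewrite eq_le pos_part_ge0// andbT.
  apply: pos_part_le => // h [Ch h0] hf; rewrite L_null// => z hz.
  by apply/eqP; rewrite eq_le h0// andbT; have := hf z hz; rewrite /= mul0r.
have {}b0 : 0 < b by rewrite lt_neqAle eq_sym bn0.
apply/eqP; rewrite eq_le le//= -ler_pdivlMl//.
rewrite {1}(_ : f = b^-1 \*o (b \*o f)); first by apply: le; rewrite ?invr_gt0.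
by apply/funext => z /=; rewrite mulrA mulVf ?mul1r// gt_eqF.
Qed.

(** The positive and negative parts of [L] are represented by two measures. They are
    mutually singular: on the [j]-th compact set some function [h j] carries all of
    the positive part and nothing of the negative part, up to [2 ^- j], and
    Borel-Cantelli produces a carrier. *)
Lemma signed_representation : exists mu : signed_radon R n, forall f, Cc f ->
  L f = radon_pairing f mu.
Proof.
have n0 f : Ccp f -> 0 <= pos_part f - L f.
  by move=> Cf; rewrite subr_ge0; exact: le_pos_part.
have nD f g : Ccp f -> Ccp g ->
    pos_part (f \+ g) - L (f \+ g) = (pos_part f - L f) + (pos_part g - L g).
  move=> Cf Cg; rewrite pos_partD// (linear_onD linL); [by ring|exact: CS Cf.1|exact: CS Cg.1].
have nZ b f : 0 <= b -> Ccp f -> pos_part (b \*o f) - L (b \*o f) = b * (pos_part f - L f).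
  by move=> b0 Cf; rewrite pos_partZ// (linear_onZ S0 linL) ?mulrBr//; exact: CS Cf.1.
have [mp [ph pfin pI]] := riesz_positive hK pos_part_ge0 pos_partD pos_partZ.
have [mn [nh nfin nI]] := riesz_positive hK n0 nD nZ.
pose r (j : nat) : R := 2^-1 ^+ j.
have r0 j : 0 < r j by rewrite exprn_gt0// invr_gt0.
have /choice[h hh] : forall j, exists h, [/\ Ccp h,
    forall z, half_space z -> h z <= @cutoff R n j z &
    pos_part (@cutoff R n j) - r j < L h].
  move=> j; have [_ [h [Ch hc] <-] lt] := sup_adherent (r0 j) (pos_part_sup (@Ccp_cutoff R n j)).
  by exists h.
have Ch j : Ccp (h j) by have [] := hh j.
have hc j z : half_space z -> h j z <= cutoff j z by have [_ + _] := hh j; exact.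
have Lh j : pos_part (@cutoff R n j) - r j < L (h j) by have [] := hh j.
have Cd j : Ccp (@cutoff R n j \- h j) by apply: Ccp_sub => //; [exact: Ccp_cutoff|exact: hc].
(* [h j] carries almost all of the positive part of [L] on the [j]-th compact *)
have In j : \int[mn]_(z in hs) h j z <= r j.
  rewrite -nI//; have : pos_part (h j) <= pos_part (@cutoff R n j).
    have := pos_part_ge0 (Cd j); have := pos_partD (Ch j) (Cd j).
    rewrite (_ : _ \+ _ = cutoff j); last by apply/funext => z /=; rewrite subrKC.
    by move=> ->; rewrite lerDl.
  by have := Lh j; lra.
have Ip j : \int[mp]_(z in hs) (cutoff j z - h j z) <= r j.
  rewrite -(pI _ (Cd j)).
  have : L (h j) <= pos_part (h j) by exact: le_pos_part.
  have := pos_partD (Ch j) (Cd j).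
  rewrite (_ : _ \+ _ = cutoff j); last by apply/funext => z /=; rewrite subrKC.
  by move=> E; have := Lh j; rewrite E; lra.
have markov (m : {measure set (mhalf R n) -> \bar R}) f (A : set (mhalf R n)) (e : R) :
    (forall Q : set (half R n), compact Q -> Q `<=` @half_space R n -> (m Q < +oo)%E) ->
    Ccp f -> measurable A -> A `<=` hs -> (forall z, A z -> 2^-1 <= f z) ->
    \int[m]_(z in hs) f z <= e -> (m A <= (2 * e)%:E)%E.
  move=> mfin Cf mA AH Af fe.
  have intf := Cc_integrable mfin Cf.1.
  have meA : measurable_fun hs (fun z => (\1_A z)%:E : \bar R).
    by apply/measurable_EFinP; exact: measurable_indic.
  have f0 z : half_space z -> 0 <= f z by case: Cf => _; exact.
  have mf : measurable_fun hs (EFin \o f) by case/integrableP: intf.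
  have -> : m A = (\int[m]_(z in hs) (\1_A z)%:E)%E by rewrite integral_indic// setIidl.
  apply: (@le_trans _ _ (\int[m]_(z in hs) (2%:E * (f z)%:E))%E).
    apply: ge0_le_integral => //.
    - by apply: emeasurable_funM => //; exact: measurable_cst.
    - move=> z hz; rewrite -EFinM lee_fin; have [Az|Az] := pselect (A z).
        by rewrite indicE mem_set//= -ler_pdivrMl// mulr1 Af.
      by rewrite indicE memNset//= mulr_ge0// f0.
  rewrite ge0_integralZl//.
  rewrite EFinM; apply: lee_wpmul2l => //.
  rewrite -[leLHS]fineK//; exact: integrable_fin_num.
pose A j : set (mhalf R n) := hs `&` [set z | 2^-1 < h j z].
have mA j : measurable (A j).
  have mh : measurable_fun hs (h j) := Cc_measurable (Ch j).1.
  have := mh mhs `]2^-1, +oo[%classic (measurable_itv _).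
  rewrite (_ : _ `&` _ = A j)//; apply/seteqP.
  by split => z [hz]; rewrite /A /= in_itv/= andbT.
pose B j : set (mhalf R n) := (exh j : set (mhalf R n)) `\` A j.
have mB j : measurable (B j) by apply: measurableD => //; exact: measurable_exh.
have mnA j : (mn (A j) <= (2 * r j)%:E)%E.
  apply: (markov mn (h j)) => //; first by move=> z [].
  by move=> z [_ /ltW].
have mpB j : (mp (B j) <= (2 * r j)%:E)%E.
  apply: (markov mp (@cutoff R n j \- h j)) => //; [by move=> z [/exh_half]| |exact: Ip].
  move=> z [zj nA]; have hz := exh_half zj.
  have : h j z <= 2^-1 by rewrite leNgt; apply/negP => h2; apply: nA.
  by rewrite /= cutoff1//; lra.
have sumr : (\sum_(j <oo) (2 * r j)%:E < +oo)%E.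
  under eq_eseriesr do rewrite EFinM.
  rewrite nneseriesZl//; last by move=> j _; rewrite lee_fin ltW.
  have := half_series_le R 0; under eq_eseriesr do rewrite addn0.
  by move=> le; rewrite lte_mul_pinfty// (le_lt_trans le)// ltry.
have small (m : {measure set (mhalf R n) -> \bar R}) (F : nat -> set (mhalf R n)) :
    (forall j, measurable (F j)) -> (forall j, (m (F j) <= (2 * r j)%:E)%E) ->
    m (lim_sup_set F) = 0%E.
  move=> mF mle; apply: lim_sup_set_cvg0 => //; apply: le_lt_trans sumr.
  exact: lee_nneseries.
pose P := lim_sup_set A.
have mlim (F : nat -> set (mhalf R n)) : (forall j, measurable (F j)) -> measurable (lim_sup_set F).
  by move=> mF; apply: bigcap_measurable => // k _; apply: bigcup_measurable.
have mP : measurable P by exact: mlim.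
have mnP : mn P = 0%E by exact: small.
have mpP : mp (~` P) = 0%E.
  apply/eqP; rewrite eq_le measure_ge0 andbT.
  have sub : ~` P `<=` (~` hs) `|` lim_sup_set B.
    move=> z nP; have [hz|hz] := pselect (hs z); [right|by left].
    have : (\bigcup_k @exh R n k) z by rewrite exh_bigcup.
    move=> [i _ zi]; have [k hk] : exists k, forall j, (k <= j)%N -> ~ A j z.
      apply: contrapT => /forallNP all; apply: nP => k _.
      by have /existsNP[j /not_implyP[kj /contrapT Aj]] := all k; exists j.
    move=> l _; exists (maxn l (maxn i k)); first by rewrite /= leq_maxl.
    split; first by apply: exh_nd zi; rewrite leq_max leq_maxl orbT.
    by apply: hk; rewrite leq_max leq_maxr orbT.
  have mhC : measurable (~` hs) by exact: measurableC.
  have mPC : measurable (~` P) by exact: measurableC.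
  apply: (le_trans (le_measure mp _ _ sub)); rewrite ?inE//.
    by apply: measurableU => //; exact: mlim.
  apply: (le_trans (measureU2 _ mhC (mlim _ mB))).
  have e1 : (mp (~` hs) <= 0)%E by rewrite ph.
  have e2 : (mp (lim_sup_set B) <= 0)%E by rewrite small.
  by rewrite -[leRHS]adde0; exact: leeD.
have sing : exists P : set (mhalf R n), [/\ measurable P, mp (~` P) = 0%E & mn P = 0%E].
  by exists P.
exists (SignedRadon ph nh pfin nfin sing) => f Cf; rewrite /radon_pairing /=.
pose fp z := Num.max (f z) 0; pose fn z := Num.max (- f z) 0.
have Cfp : Ccp fp.
  split; first by apply: Cc_max => //; exact: Cc0.
  by move=> z _; rewrite le_max lexx orbT.
have Cfn : Ccp fn.
  split; last by move=> z _; rewrite le_max lexx orbT.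
  apply: Cc_max; last exact: Cc0.
  rewrite (_ : (fun _ => _) = (-1) \*o f); first exact: CcZ.
  by apply/funext => z /=; rewrite mulN1r.
have fE : f = fp \- fn.
  by apply/funext => z; rewrite /fp /fn /=; have [] := leP (f z) 0; have [] := leP (- f z) 0; lra.
have int (m : {measure set (mhalf R n) -> \bar R}) :
    (forall Q : set (half R n), compact Q -> Q `<=` @half_space R n -> (m Q < +oo)%E) ->
    \int[m]_(z in hs) f z = \int[m]_(z in hs) fp z - \int[m]_(z in hs) fn z.
  move=> mfin; rewrite {1}fE RintegralB//; first exact: Cc_integrable Cfp.1.
  exact: Cc_integrable Cfn.1.
rewrite (int mp)// (int mn)// -!pI// -!nI// {1}fE.
rewrite (linear_onB S0 SZ linL (CS Cfp.1) (CS Cfn.1)).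
by ring.
Qed.

End positive_part.

(** * The dual of S^1_0 and its atoms *)

Section S10_dual.
Context (R : realType) (n : nat) (K : set 'rV[R]_n).
Hypothesis hK : symmetric_convex_body K.
Local Notation hs := (@half_space R n : set (mhalf R n)).
Local Notation S10 := (S10_space K).
Local Notation S1 := (S1_norm K).
Implicit Types (f g h : half R n -> R) (mu : signed_radon R n).

Let mhs : measurable hs := @measurable_half_space R n.
Let S0 : S10 (cst 0). Proof. exact: S10_0. Qed.
Let SZ (b : R) f : S10 f -> S10 (b \*o f). Proof. exact: S10Z. Qed.
Let CS f : Cc f -> S10 f. Proof. exact: Cc_S10. Qed.
Let Sfin f : S10 f -> (0 <= S1 f < +oo)%E.
Proof. by move=> Sf; rewrite S1_norm_ge0// S10_fin. Qed.
Let SEfin f : S10 f -> S1 f = (fine (S1 f))%:E.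
Proof. by move=> Sf; rewrite fineK// ge0_fin_numE ?S1_norm_ge0// S10_fin. Qed.
Let NZ (b : R) f : S10 f -> S1 (b \*o f) = (`|b|%:E * S1 f)%E.
Proof. by case: (S10_banach hK) => _ [_ _ _ +] _; exact. Qed.
Let N0 : (S1 (cst 0%R) <= 1)%E.
Proof. by rewrite (S1_norm_eq0 K _).2. Qed.

Let nu mu : {measure set (mhalf R n) -> \bar R} := measure_add (radon_pos mu) (radon_neg mu).
Let nuE mu A : nu mu A = (radon_pos mu A + radon_neg mu A)%E.
Proof. exact: measure_addE. Qed.

Let nu_fin mu (Q : set (half R n)) : compact Q -> Q `<=` @half_space R n ->
  (nu mu Q < +oo)%E.
Proof. by move=> cQ QH; rewrite nuE lte_add_pinfty ?radon_pos_fin ?radon_neg_fin. Qed.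

Let nu_sf mu : sigma_finite setT (nu mu).
Proof.
apply: radon_sigma_finite; last exact: nu_fin.
by have := nuE mu (~` hs); rewrite radon_pos_half_space radon_neg_half_space adde0.
Qed.

Let T1_ge0 mu : (0 <= T1_norm K mu)%E.
Proof.
apply: ess_sup_gee; last by apply: nearW => x; rewrite adde_ge0.
apply: (@lt_le_trans _ _ (dx R n (@cube R n 1))).
  by rewrite dx_cube// lte_fin exprn_gt0// mulr_gt0.
by apply: le_measure; rewrite ?inE//; exact: measurable_cube.
Qed.

Let T1E mu : T1_space K mu -> T1_norm K mu = (fine (T1_norm K mu))%:E.
Proof. by move=> Tmu; rewrite fineK// ge0_fin_numE. Qed.

Let nu_cone mu : T1_space K mu ->
  {ae dx R n, forall x, (nu mu (cone K x) <= (fine (T1_norm K mu))%:E)%E}.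
Proof.
move=> Tmu; rewrite -T1E//.
have := ess_sup_ge (dx R n) (fun x => Defs.total_variation mu (cone K x)); apply: filterS => x.
by rewrite nuE.
Qed.

Lemma radon_key f mu : S10 f -> T1_space K mu ->
  (\int[nu mu]_(z in hs) `|f z|%:E <=
    (16 ^+ n * fine (T1_norm K mu))%:E * S1 f)%E.
Proof.
move=> [Sf _] Tmu; have T0 : 0 <= fine (T1_norm K mu) by rewrite fine_ge0.
exact: (key_inequality hK (nu_sf mu) (@nu_fin mu) T0 (nu_cone Tmu) Sf).
Qed.

Let mS f : S10 f -> measurable_fun hs f.
Proof.
move=> Sf; apply: continuous_measurable_half; first exact: half_space_open.
exact: S10_continuous Sf.
Qed.

Let int_abs f mu : S10 f ->
  (\int[nu mu]_(z in hs) `|f z|%:E =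
   \int[radon_pos mu]_(z in hs) `|f z|%:E + \int[radon_neg mu]_(z in hs) `|f z|%:E)%E.
Proof.
move=> Sf; apply: ge0_integral_measure_add => //.
by apply/measurable_EFinP; apply: measurableT_comp => //; exact: mS.
Qed.

Lemma S10_radon_integrable f mu : S10 f -> T1_space K mu -> radon_integrable f mu.
Proof.
move=> Sf Tmu; have := radon_key Sf Tmu; rewrite int_abs// (SEfin Sf) -EFinM => le.
have lty := le_lt_trans le (ltry _).
have p0 : (0 <= \int[radon_pos mu]_(z in hs) `|f z|%:E)%E by exact: integral_ge0.
have q0 : (0 <= \int[radon_neg mu]_(z in hs) `|f z|%:E)%E by exact: integral_ge0.
have mf := mS Sf.
by split; apply/integrableP; split; try exact/measurable_EFinP;
  apply: le_lt_trans lty; [exact: leeDl|exact: leeDr].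
Qed.

Lemma radon_pairing_le f mu : S10 f -> T1_space K mu ->
  (`|radon_pairing f mu|%:E <= (16 ^+ n * fine (T1_norm K mu))%:E * S1 f)%E.
Proof.
move=> Sf Tmu; have [ip iq] := S10_radon_integrable Sf Tmu.
apply: le_trans (radon_key Sf Tmu); rewrite int_abs//.
have le (m : {measure set (mhalf R n) -> \bar R}) : m.-integrable hs (EFin \o f) ->
    (`|\int[m]_(z in hs) f z|%:E <= \int[m]_(z in hs) `|f z|%:E)%E.
  move=> im; have mf := mS Sf.
  rewrite -abse_EFin /Rintegral fineK; last exact: integrable_fin_num.
  by apply: le_abse_integral => //; exact/measurable_EFinP.
apply: (@le_trans _ _ (`|\int[radon_pos mu]_(z in hs) f z|%:E +
  `|\int[radon_neg mu]_(z in hs) f z|%:E)%E); last by apply: leeD; exact: le.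
by rewrite -EFinD lee_fin ler_normB.
Qed.

Lemma radon_pairing_linear mu : T1_space K mu -> linear_on S10 ((@radon_pairing R n) ^~ mu).
Proof.
move=> Tmu b f h Sf Sh; have [pf nf] := S10_radon_integrable Sf Tmu.
have [ph nh] := S10_radon_integrable Sh Tmu.
have lin (m : {measure set (mhalf R n) -> \bar R}) : m.-integrable hs (EFin \o f) ->
    m.-integrable hs (EFin \o h) ->
    \int[m]_(z in hs) ((b \*o f) \+ h) z = b * \int[m]_(z in hs) f z + \int[m]_(z in hs) h z.
  move=> mf mh; rewrite -RintegralZl// -RintegralD//.
  rewrite (_ : EFin \o _ = (fun z => b%:E * (EFin \o f) z)%E); last by apply/funext.
  exact: integrableZl.
by rewrite /radon_pairing !lin//; ring.
Qed.

Lemma radon_pairing_bounded mu : T1_space K mu ->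
  bounded_on S10 S1 ((@radon_pairing R n) ^~ mu).
Proof.
by move=> Tmu; exists (16 ^+ n * fine (T1_norm K mu)) => f Sf; exact: radon_pairing_le.
Qed.

Lemma T1_norm_le_test mu (c : R) : 0 <= c ->
  (forall f, S1_atom K f -> radon_pairing f mu <= c) -> (T1_norm K mu <= (2 ^+ n * c)%:E)%E.
Proof.
move=> c0 test; have [P [mP p0 q0]] := radon_singular mu.
apply/ess_supP; apply: nearW => x.
exact: (cone_mass_le hK (@radon_pos_fin _ _ mu) (@radon_neg_fin _ _ mu) mP p0 q0 c0 test).
Qed.

Lemma T1_norm_le_dual_norm mu : T1_space K mu ->
  (T1_norm K mu <= (2 ^+ n)%:E * dual_norm S10 S1 ((@radon_pairing R n) ^~ mu))%E.
Proof.
move=> Tmu; have linP := radon_pairing_linear Tmu; have bP := radon_pairing_bounded Tmu.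
set D := dual_norm _ _ _.
have D0 : (0 <= D)%E := dual_norm_ge0 S0 linP N0.
have DE : D = (fine D)%:E.
  by rewrite fineK// ge0_fin_numE//; exact: dual_norm_lty Sfin bP.
rewrite DE -EFinM; apply: T1_norm_le_test; first by rewrite fine_ge0.
move=> f Af; have Sf := CS (S1_atom_Cc hK Af).
apply: (le_trans (ler_norm _)); rewrite -lee_fin -DE.
apply: (le_trans (le_dual_norm S0 SZ linP Sfin NZ bP Sf)).
by rewrite -[leRHS]mule1; apply: lee_wpmul2l => //; exact: S1_norm_atom.
Qed.

Lemma dual_norm_le_T1_norm mu : T1_space K mu ->
  (dual_norm S10 S1 ((@radon_pairing R n) ^~ mu) <= (16 ^+ n)%:E * T1_norm K mu)%E.
Proof.
move=> Tmu; apply: ge_ereal_sup => _ [f [Sf f1] <-].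
apply: (le_trans (radon_pairing_le Sf Tmu)); rewrite EFinM -T1E// -[leRHS]mule1.
by apply: lee_wpmul2l => //; rewrite mule_ge0// lee_fin exprn_ge0.
Qed.

(** A functional on [S10] is determined by its values on compactly supported functions,
    where it is integration against a signed measure; testing that measure on atoms bounds
    its mass on every cone. *)
Lemma S10_representation L : linear_on S10 L -> bounded_on S10 S1 L ->
  exists2 mu, T1_space K mu & forall f, S10 f -> L f = radon_pairing f mu.
Proof.
move=> linL [c' Lc'].
pose c := Num.max c' 0.
have c0 : 0 <= c by rewrite le_max lexx orbT.
have Lc f : S10 f -> (`|L f|%:E <= c%:E * S1 f)%E.
  move=> Sf; apply: (le_trans (Lc' f Sf)); apply: lee_wpmul2r; first by rewrite S1_norm_ge0.
  by rewrite lee_fin le_max lexx.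
have [mu Lmu] := signed_representation hK linL c0 Lc.
have Tmu : T1_space K mu.
  apply: (@le_lt_trans _ _ (2 ^+ n * c)%:E); last by rewrite ltry.
  apply: T1_norm_le_test => // f Af; have Cf := S1_atom_Cc hK Af.
  rewrite -Lmu//; apply: (le_trans (ler_norm _)); rewrite -lee_fin.
  apply: (le_trans (Lc f (CS Cf))); rewrite -[leRHS]mule1.
  by apply: lee_wpmul2l; [rewrite lee_fin|exact: S1_norm_atom].
exists mu => // f Sf; have linP := radon_pairing_linear Tmu.
pose b := 16 ^+ n * fine (T1_norm K mu).
have b0 : 0 <= b by rewrite mulr_ge0 ?exprn_ge0// fine_ge0.
have cb0 : 0 < c + b + 1 by rewrite ltr_wpDl// addr_ge0.
apply/eqP; rewrite -subr_eq0 -normr_le0; apply/ler_addgt0Pr => e e0; rewrite add0r.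
have [h Ch fh] := S10_dense Sf (divr_gt0 e0 cb0).
have Sh := CS Ch.
have Sfh : S10 (f \- h) by exact: S10B.
have -> : L f - radon_pairing f mu = L (f \- h) - radon_pairing (f \- h) mu.
  have -> : radon_pairing (f \- h) mu = radon_pairing f mu - radon_pairing h mu.
    exact (linear_onB S0 SZ linP Sf Sh).
  by rewrite (linear_onB S0 SZ linL Sf Sh) (Lmu h Ch); ring.
apply: (le_trans (ler_normB _ _)).
have := Lc _ Sfh; have := radon_pairing_le Sfh Tmu.
move: fh; rewrite (SEfin Sfh) lte_fin ltr_pdivlMr// -!EFinM !lee_fin -/b.
have : 0 <= fine (S1 (f \- h)) by rewrite fine_ge0// S1_norm_ge0.
set s := fine _; nra.
Qed.

(** Two Jordan decompositions with the same difference: the sums [pos1 + neg2] and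
    [pos2 + neg1] agree, and the carriers of the positive parts separate them. *)
Lemma radon_pairing_inj mu1 mu2 :
  (forall f, Cc f -> radon_pairing f mu1 = radon_pairing f mu2) -> radon_eq mu1 mu2.
Proof.
move=> pairE.
have eqm (A : set (mhalf R n)) : measurable A ->
    (radon_pos mu1 A + radon_neg mu2 A = radon_pos mu2 A + radon_neg mu1 A)%E.
  pose m12 (mu mu' : signed_radon R n) : {measure set (mhalf R n) -> \bar R} :=
    measure_add (radon_pos mu) (radon_neg mu').
  have mE mu mu' B : m12 mu mu' B = (radon_pos mu B + radon_neg mu' B)%E.
    exact: measure_addE.
  have m0 mu mu' : m12 mu mu' (~` hs) = 0%E.
    by have := mE mu mu' (~` hs); rewrite radon_pos_half_space radon_neg_half_space adde0.
  have mfin mu mu' (Q : set (half R n)) : compact Q -> Q `<=` @half_space R n ->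
      (m12 mu mu' Q < +oo)%E.
    by move=> cQ QH; rewrite mE lte_add_pinfty ?radon_pos_fin ?radon_neg_fin.
  move=> mA; rewrite -(mE mu1 mu2) -(mE mu2 mu1).
  apply: (Cc_measure_unique (m0 _ _) (m0 _ _) (@mfin _ _) (@mfin _ _) _ mA).
  move=> f Cf; have := pairE f Cf; rewrite /radon_pairing.
  have ip mu := Cc_integrable (@radon_pos_fin _ _ mu) Cf.
  have iq mu := Cc_integrable (@radon_neg_fin _ _ mu) Cf.
  have add mu mu' : \int[m12 mu mu']_(z in hs) f z =
      \int[radon_pos mu]_(z in hs) f z + \int[radon_neg mu']_(z in hs) f z.
    by rewrite /Rintegral integral_measure_add// fineD//; exact: integrable_fin_num.
  rewrite !add; lra.
have [P1 [mP1 p1 q1]] := radon_singular mu1.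
have [P2 [mP2 p2 q2]] := radon_singular mu2.
move=> A mA.
have null (m : {measure set (mhalf R n) -> \bar R}) (N B : set (mhalf R n)) :
    measurable N -> measurable B -> B `<=` N -> m N = 0%E -> m B = 0%E.
  move=> mN mB BN mN0; apply/eqP; rewrite eq_le measure_ge0 andbT.
  apply: (le_trans (le_measure m _ _ BN)); rewrite ?inE//.
  have le0 : (m N <= 0)%E by rewrite mN0.
  exact: le0.
pose D b1 b2 : set (mhalf R n) :=
  (A `&` (if b1 then P1 else ~` P1)) `&` (if b2 then P2 else ~` P2).
have mD b1 b2 : measurable (D b1 b2).
  apply: measurableI; last by case: b2 => //; exact: measurableC.
  by apply: measurableI => //; case: b1 => //; exact: measurableC.
have split (m : {measure set (mhalf R n) -> \bar R}) :
    m A = (m (D true true) + m (D true false) + (m (D false true) + m (D false false)))%E.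
  have half_ (B P : set (mhalf R n)) : measurable B -> measurable P ->
      m B = (m (B `&` P) + m (B `&` ~` P))%E.
    move=> mB mP; rewrite -measureU.
    - by rewrite -setIUr setUv setIT.
    - exact: measurableI.
    - by apply: measurableI => //; exact: measurableC.
    - by rewrite setIACA setICr setI0.
  rewrite (half_ A P1)// (half_ (A `&` P1) P2)//; last exact: measurableI.
  by rewrite (half_ (A `&` ~` P1) P2)//; apply: measurableI => //; exact: measurableC.
have mC1 : measurable (~` P1) by exact: measurableC.
have mC2 : measurable (~` P2) by exact: measurableC.
have pos1 b : radon_pos mu1 (D false b) = 0%E.
  by apply: (null _ (~` P1)) => //; move=> z [[]].
have neg1 b : radon_neg mu1 (D true b) = 0%E.
  by apply: (null _ P1) => //; move=> z [[]].
have pos2 b : radon_pos mu2 (D b false) = 0%E.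
  by apply: (null _ (~` P2)) => //; move=> z [].
have neg2 b : radon_neg mu2 (D b true) = 0%E.
  by apply: (null _ P2) => //; move=> z [].
have e b1 b2 := eqm _ (mD b1 b2).
have ett := e true true; have etf := e true false.
have eft := e false true; have eff := e false false.
rewrite neg1 neg2 !adde0 in ett.
rewrite neg1 pos2 adde0 in etf.
rewrite pos1 neg2 adde0 in eft.
rewrite pos1 pos2 !add0e in eff.
have [tf1 tf2] : radon_pos mu1 (D true false) = 0%E /\ radon_neg mu2 (D true false) = 0%E.
  by move/eqP: etf; rewrite padde_eq0 ?measure_ge0// => /andP[/eqP-> /eqP->].
have [ft1 ft2] : radon_pos mu2 (D false true) = 0%E /\ radon_neg mu1 (D false true) = 0%E.
  by move/esym/eqP: eft; rewrite padde_eq0 ?measure_ge0// => /andP[/eqP-> /eqP->].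
rewrite !split !pos1 !pos2 !neg1 !neg2 ett eff tf1 tf2 ft1 ft2.
by rewrite !adde0 !add0e.
Qed.

Lemma radon_pairing_eq f mu1 mu2 : S10 f -> T1_space K mu1 -> T1_space K mu2 ->
  radon_eq mu1 mu2 -> radon_pairing f mu1 = radon_pairing f mu2.
Proof.
move=> Sf T1 T2 e; rewrite /radon_pairing /Rintegral; congr (fine _ - fine _).
- by apply: eq_measure_integral => A mA _; have [] := e A mA.
- by apply: eq_measure_integral => A mA _; have [] := e A mA.
Qed.

Lemma S10_is_dual (C : R) : 16 ^+ n <= C ->
  is_dual S10 S1 (T1_space K) (T1_norm K) (@radon_eq R n) (@radon_integrable R n)
    (@radon_pairing R n) C.
Proof.
move=> hC; split.
- by move=> f mu; exact: S10_radon_integrable.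
- move=> mu Tmu; split; [exact: radon_pairing_linear|exact: radon_pairing_bounded|].
  have C2 : 2 ^+ n <= C by rewrite (le_trans _ hC)// lerXn2r ?nnegrE// ler_nat.
  have C0 : 0 < C by rewrite (lt_le_trans _ C2)// exprn_gt0.
  split.
    rewrite lee_pdivrMl//; apply: (le_trans (T1_norm_le_dual_norm Tmu)).
    apply: lee_wpmul2r; last by rewrite lee_fin.
    exact (dual_norm_ge0 S0 (radon_pairing_linear Tmu) N0).
  by apply: (le_trans (dual_norm_le_T1_norm Tmu)); apply: lee_wpmul2r => //; rewrite lee_fin.
- exact: S10_representation.
- move=> mu1 mu2 T1 T2; split.
    by move=> e; apply: radon_pairing_inj => f Cf; exact/e/CS.
  by move=> e f Sf; exact: radon_pairing_eq.
Qed.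

Lemma S10_dual_atoms L : linear_on S10 L -> bounded_on S10 S1 L ->
  (forall a, S1_atom K a -> `|L a| <= 1) ->
  forall f, S10 f -> (`|L f|%:E <= (32 ^+ n)%:E * S1 f)%E.
Proof.
move=> linL bL L1 f Sf; have [mu Tmu LE] := S10_representation linL bL.
have le : (T1_norm K mu <= (2 ^+ n * 1)%:E)%E.
  apply: T1_norm_le_test => // a Aa; have Sa := CS (S1_atom_Cc hK Aa).
  by rewrite -LE// (le_trans (ler_norm _))// L1.
rewrite LE//; apply: (le_trans (radon_pairing_le Sf Tmu)).
apply: lee_wpmul2r; first by rewrite S1_norm_ge0.
rewrite T1E// mulr1 lee_fin in le; rewrite lee_fin.
apply: (@le_trans _ _ (16 ^+ n * 2 ^+ n)); first by rewrite ler_wpM2l// exprn_ge0.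
by rewrite -exprMn -natrM.
Qed.

Lemma S10_decomposition (C : R) f : 2 * 32 ^+ n <= C -> S10 f ->
  exists lam a (g : ('rV[R]_n -> R)^nat), atomic_decomposition K S1 (@unit_ball_Cc R n) f lam a g /\
    equivalent_up_to C (S1 f) (abs_coef_sum lam).
Proof.
move=> hC Sf.
have S1f0 : (0 <= S1 f)%E by rewrite S1_norm_ge0.
have p32 : 1 <= 32 ^+ n :> R by rewrite exprn_ege1// ler1n.
have C1 : 1 <= C by apply: le_trans hC; lra.
have ban := S10_banach hK.
have p2 : 0 < 32 ^+ n :> R by rewrite exprn_gt0.
have AS : S1_atom K `<=` S10 by move=> a Aa; exact/CS/(S1_atom_Cc hK).
have [lam [u [Au slam cv]]] := function_expansion ban p2 (S1_atom0 K) AS (S1_norm_atom hK)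
  S10_dual_atoms Sf.
have /choice[a ha] : forall i, exists a : half R n -> R, exists x, exists r,
    [/\ unit_ball_Cc a, 0 < r & u i = atom K a (avg K x r)] by exact: Au.
have /choice[x hx] := ha.
have /choice[r hr] := hx.
have uE i : u i = atom K (a i) (avg K (x i) (r i)) by have [] := hr i.
exists lam, a, (fun i => avg K (x i) (r i)); split.
  split.
  - by move=> i; have [] := hr i.
  - by move=> i; have [_ ri _] := hr i; exact: unit_L1_avg.
  - apply: le_lt_trans slam _.
    by rewrite (SEfin Sf) -EFinM ltry.
  - apply: cvg_trans cv; apply: near_eq_cvg; apply: nearW => k.
    congr (S1 _); apply/funext => z; congr (_ - _).
    by rewrite /atomic_sum; apply: eq_bigr => i _; rewrite uE.
split.
  have h := function_expansion_le ban AS (S1_norm_atom hK) Sf Au cv.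
  apply: le_trans h; rewrite -[leRHS]mul1e; apply: lee_wpmul2r => //.
  by rewrite lee_fin invf_le1// (lt_le_trans _ C1).
by apply: (le_trans slam); apply: lee_wpmul2r => //; rewrite lee_fin.
Qed.

End S10_dual.

(** * Duality and atomic decomposition *)

Theorem theorem2p5 (R : realType) (n : nat) (n_gt0 : (0 < n)%N) :
  exists2 C : R, 0 < C &
  forall K : set 'rV[R]_n, symmetric_convex_body K ->
  [/\ forall p p' : R, 1 < p -> p^-1 + p'^-1 = 1 ->
        banach_space (U_space K p p') (V_norm K p) (@null_ae R n) /\
        is_dual (U_space K p p') (V_norm K p) (T_space K p) (T_norm K p)
          (@eq_ae R n) (@integral_pairable R n) (@integral_pairing R n) C,
      forall p p' : R, 1 < p -> p^-1 + p'^-1 = 1 ->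
        let decomposition f lam a g :=
          atomic_decomposition K (V_norm K p) (unit_ball_Lp p') f lam a g in
        [/\ forall f, Lp_loc p' f ->
              U_space K p p' f <-> exists lam a g, decomposition f lam a g,
            forall f, U_space K p p' f -> exists lam a g,
              decomposition f lam a g /\
              equivalent_up_to C (V_norm K p f) (abs_coef_sum lam)
          & forall f lam a g, Lp_loc p' f -> decomposition f lam a g ->
              cvg_Lp_loc p' (atomic_sum K lam a g) f]
    & [/\ banach_space (S10_space K) (S1_norm K)
            (@null_everywhere R n),
          is_dual (S10_space K) (S1_norm K) (T1_space K) (T1_norm K)
            (@radon_eq R n) (@radon_integrable R n) (@radon_pairing R n) C
        & forall f, S10_space K f -> exists lam a g,
            atomic_decomposition K (S1_norm K) (@unit_ball_Cc R n) f lam a g /\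
            equivalent_up_to C (S1_norm K f) (abs_coef_sum lam)]].
Proof.
have p32 : 0 < 32 ^+ n :> R by rewrite exprn_gt0.
have leX (m : nat) : (m <= 32)%N -> m%:R ^+ n <= 32 ^+ n :> R.
  by move=> m32; rewrite lerXn2r ?nnegrE// ler_nat.
have h2 : 2 ^+ n <= 32 ^+ n :> R by exact: leX.
have h16 : 16 ^+ n <= 32 ^+ n :> R by exact: leX.
(* twice the norm of the pairing, [16 ^+ n], times the loss in testing on atoms, [2 ^+ n] *)
exists (2 * 32 ^+ n) => [|K hK]; first by rewrite mulr_gt0.
split.
- move=> p p' p1 pq; split; first exact: U_banach.
  by apply: U_is_dual => //; lra.
- move=> p p' p1 pq; split.
  + move=> f Lf; split; last by move=> [lam [a [g dec]]]; exact: decomposition_U dec.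
    move=> Uf; have hC : 2 * 2 ^+ n <= 2 * 2 ^+ n :> R by [].
    have [lam [a [g [dec _]]]] := U_decomposition hK p1 pq hC Uf.
    by exists lam, a, g.
  + by move=> f; apply: U_decomposition => //; lra.
  + by move=> f lam a g Lf dec; exact: decomposition_cvg dec.
- split; first exact: S10_banach.
  + by apply: S10_is_dual => //; lra.
  + by move=> f; exact: S10_decomposition.
Qed.
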